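(* Let $A(2)$ be the set of all sequences $\{a_1,a_2,a_3,\ldots\}$ of positive real numbers such that (i) there are constants $c>0$ and $0<\mu<1$ with $|\log(a_n/a_m)|\le c\,\mu^{i}$ whenever $n,m\ge 1$ and $2^i$ divides $n-m$; (ii) for every $n\ge 1$, $$a_{2n+1}=\frac{a_n}{a_{2n}}\left(1+\frac1{a_{2n-1}}\right)-1 .$$ The set $A(2)$ is canonically isomorphic (via the canonical correspondences listed in the context) to each of the following sets: A) the set of all affine structures on the leaves of the dyadic solenoid $\tilde S(2)$ that are transversely Hölder continuous and invariant under the solenoid map $\tilde E(2):\tilde S(2)\to\tilde S(2)$; B) the set of all $C^r$ structures, $r>1$ (i.e. $C^{1+\text{Hölder}}$ structures), on the circle $S$ that are invariant by the doubling map $E(2):S\to S$, $E(2)(z)=z^2$; C) the set of all positive Hölder continuous functions $s:C\to\mathbb{R}^+$ on the Cantor set $C$ of $2$-adic integers satisfying, for all $x\in C$, $$s(2x+1)=\frac{s(x)}{s(2x)}\left(1+\frac{1}{s(2x-1)}\right)-1;$$ D) the set of all affine classes of $2$-adic quasiperiodic tilings of the real line that are fixed points of the $2$-amalgamation operator; E) the set of all affine classes of $2$-adic quasiperiodic fixed grids of the real line.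
   Context: Circle and solenoid. $S=\{z\in\mathbb{C}:|z|=1\}$, $E=E(2):S\to S$, $E(z)=z^2$. The solenoid $\tilde S=\tilde S(2)$ is the set of all sequences ${\bf x}=(\ldots,x_2,x_1,x_0)$ in $S$ with $E(x_n)=x_{n-1}$ for $n\ge1$, with the product topology; $\tilde E=\tilde E(2)$ is $\tilde E({\bf x})=(\ldots,x_1,x_0,E(x_0))$. For ${\bf x}\in\tilde S$ and $t\in\mathbb{R}$ write ${\bf x}+t$ for the point with $n$-th coordinate $x_n e^{2\pi i t/2^n}$. Leaves are the path components of $\tilde S$; the leaf of ${\bf x}$ is $\{{\bf x}+t:t\in\mathbb{R}\}$ and $t\mapsto{\bf x}+t$ is a bijective parametrization of it. Affine structures on leaves. An affine structure on a leaf $\mathcal L$ is a map $\phi:\mathcal L\to\mathbb{R}$ that is injective and continuous in the leaf parameter $t$, modulo postcomposition with affine maps of $\mathbb{R}$. A choice of affine structure on every leaf gives ratios $r({\bf x},{\bf y},{\bf z})=|\phi({\bf y})-\phi({\bf z})|/|\phi({\bf x})-\phi({\bf y})|$ for distinct points ${\bf x},{\bf y},{\bf z}$ on a common leaf. It is invariant by $\tilde E$ if $r(\tilde E{\bf x},\tilde E{\bf y},\tilde E{\bf z})=r({\bf x},{\bf y},{\bf z})$ always. It is transversely Hölder continuous if for every $T>0$ there are $c>0$ and $0<\mu<1$ such that for all $n\ge0$, all ${\bf x},{\bf x}'\in\tilde S$ with $x_n=x'_n$, and all distinct $t_1,t_2,t_3\in[-T,T]$, $|\log r({\bf x}+t_1,{\bf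 x}+t_2,{\bf x}+t_3)-\log r({\bf x}'+t_1,{\bf x}'+t_2,{\bf x}'+t_3)|\le c\mu^n$. Structures on the circle. A chart is a homeomorphism $u:J\to u(J)\subset\mathbb{R}$ from a proper compact arc $J\subset S$ onto a compact interval. A $C^{1+\text{Hölder}}$ structure $U$ on $S$ is a maximal collection of charts, with the interiors of their domains covering $S$, such that all overlap maps $v\circ u^{-1}$ are $C^{1+\epsilon}$ diffeomorphisms (differentiable with nonvanishing $\epsilon$-Hölder derivative) for some $\epsilon>0$. $U$ is invariant by $E$ if for every finite cover $U'\subset U$ of $S$ by charts: (1) there is $\epsilon>0$ such that for all $u:I\to\mathbb{R}$, $v:J\to\mathbb{R}$ in $U'$ and all intervals $K\subset I$ with $E(K)\subset J$, the maps $v\circ E\circ u^{-1}|u(K)$ are $C^{1+\epsilon}$ with $C^{1+\epsilon}$ norms bounded away from zero and infinity; (2) for every $u:I\to\mathbb{R}$ in $U'$ and every isometry $u_{iso}:I\to\mathbb{R}$ for arc length on $S$, $u_{iso}\circ u^{-1}$ is quasisymmetric. A homeomorphism $h$ between compact intervals is quasisymmetric if for every $d\ge1$ there is $k_d\ge1$ with $\left|\log\frac{h(x+\delta_2)-h(x)}{h(x)-h(x-\delta_1)}\frac{\delta_1}{\delta_2}\right|\le\log k_d$ for all $x-\delta_1,x,x+\delta_2$ in the domain with $\delta_1,\delta_2>0$, $d^{-1}\le\delta_2/\delta_1\le d$. 2-adic integers. $C=\{0,1\}^{\mathbb{Z}_{\ge0}}$ is the set of $2$-adic integers $\sum_{i\ge0}a_i2^i$;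 Hölder continuity of $s$ on $C$ is with respect to the usual $2$-adic metric (equivalently $|s(a)-s(b)|\le c\mu^n$ for some $c>0$, $0<\mu<1$ whenever $a,b$ have the same first $n$ digits). For $a=\sum a_i2^i\in C$ let $\tilde\omega(a)\in\tilde S$ be the point with $n$-th coordinate $\exp\big(2\pi i(\sum_{m<n}a_m2^m)/2^n\big)$. Tilings. A tiling of $\mathbb{R}$ is a collection $\{I_\beta:\beta\in\mathbb{Z}\}$ of closed intervals with pairwise disjoint interiors and union $\mathbb{R}$, such that $I_\beta\cap I_{\beta+1}$ is exactly a common endpoint and, for some $B\ge1$, $B^{-1}\le|I_{\beta+1}|/|I_\beta|\le B$ for all $\beta$. Two tilings $\{I_\beta\},\{J_\beta\}$ are in the same affine class if some affine $h:\mathbb{R}\to\mathbb{R}$ has $h(I_\beta)=J_\beta$ for all $\beta$. The tiling sequence is $\underline r=(r_m)_{m\in\mathbb{Z}}$, $r_m=|I_{m+1}|/|I_m|$; it determines the affine class. It is $2$-adic quasiperiodic if there are $c>0$, $0<\mu<1$ with $|r_j-r_k|\le c\mu^i$ whenever $2^i$ divides $j-k$. The $2$-amalgamation operator $A_2$ sends $\underline r$ to $\underline s$ with $s_i=r_{2i-1}r_{2i}\frac{1+r_{2i+1}}{1+r_{2i-1}}$ (ratios of lengths of unions $I_{2i-1}\cup I_{2i}$). A tiling is a fixed point if $A_2(\underline r)=\underline r$. Grids. A $2$-grid of $\mathbb{R}$ is a family $\{I^n_\beta:n\ge1,\beta\in\mathbb{Z}\}$ such that each level $n$ is a tiling (with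 $B$ independent of $n$), and $I^n_\beta=I^{n+1}_{2\beta-1}\cup I^{n+1}_{2\beta}$. Two such grids are in the same affine class if an affine $h$ sends $I^n_\beta$ to $J^n_\beta$ for all $n,\beta$. Let $\underline r^n$ be the tiling sequence of level $n$. The grid is a $2$-adic quasiperiodic fixed grid if $\underline r^n=\underline r^1$ for all $n$ and $\underline r^1$ is $2$-adic quasiperiodic. Canonical correspondences. From C) to $A(2)$: $a_n=s(n)$, $n\ge1$. From A) to C): $s(a)=r(\tilde\omega(a-1),\tilde\omega(a),\tilde\omega(a+1))$. From C) to D): the tiling with tiling sequence $r_m=s(m)$, $m\in\mathbb{Z}\subset C$. From D) to E): the grid all of whose levels have the tiling sequence of the given tiling. From B) to A): the affine structures with ratios $r_U({\bf x},{\bf y},{\bf z})=\lim_{n\to\infty}\frac{|u_n(y_n)-u_n(z_n)|}{|u_n(x_n)-u_n(y_n)|}$, where $U'\subset U$ is a finite cover and $u_n\in U'$ has domain containing the (shrinking) arc through $x_n,y_n,z_n$ that is the $n$-th coordinate projection of the leaf segment through ${\bf x},{\bf y},{\bf z}$. *)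

(* Defs.v *)
From Stdlib Require Export Reals ZArith List ClassicalEpsilon.
From Stdlib Require Import Lra Lia.
From Coquelicot Require Export Coquelicot.
Export ListNotations.
Local Open Scope R_scope.

(* [Rel] is the graph (on representatives) of a bijection from the quotient of
   {x | P x} by [eqX] onto the quotient of {y | Q y} by [eqY]: it is defined
   everywhere, well defined on classes and injective (the two directions of
   the equivalence), and onto. *)
Definition canonical_bijection {X Y : Type}
    (P : X -> Prop) (eqX : X -> X -> Prop)
    (Q : Y -> Prop) (eqY : Y -> Y -> Prop)
    (Rel : X -> Y -> Prop) : Prop :=
  (forall x, P x -> exists y, Q y /\ Rel x y) /\
  (forall x x' y y', P x -> P x' -> Q y -> Q y' -> Rel x y -> Rel x' y' ->
     (eqX x x' <-> eqY y y')) /\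
  (forall y, Q y -> exists x, P x /\ Rel x y).

Definition ext_eq {X : Type} (f g : X -> R) : Prop := forall x, f x = g x.

(* Sequences a_1, a_2, ... are indexed by [positive]. *)
Definition inA2 (a : positive -> R) : Prop :=
  (forall n, 0 < a n) /\
  (exists c mu, 0 < c /\ 0 < mu < 1 /\
     forall (i : nat) (n m : positive),
       (2 ^ Z.of_nat i | Z.pos n - Z.pos m)%Z ->
       Rabs (ln (a n / a m)) <= c * mu ^ i) /\
  (forall n : positive,
     a (2 * n + 1)%positive
     = a n / a (2 * n)%positive * (1 + 1 / a (2 * n - 1)%positive) - 1).

(* a : dyadic is the 2-adic integer \sum_i a_i 2^i. *)
Definition dyadic := nat -> bool.

Fixpoint trunc (a : dyadic) (n : nat) : Z :=
  match n with
  | O => 0%Z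
  | S k => (trunc a k + Z.b2z (a k) * 2 ^ Z.of_nat k)%Z
  end.

(* The 2-adic integer p * a + q, for integers p and q: its residue modulo
   2^(n+1), hence its n-th digit, is that of p * (a mod 2^(n+1)) + q. *)
Definition dyadic_affine (p q : Z) (a : dyadic) : dyadic :=
  fun n => Z.testbit (p * trunc a (S n) + q) (Z.of_nat n).

(* [Z.testbit] uses two's complement, which is the 2-adic expansion, also for
   negative integers. *)
Definition dyadic_of_Z (m : Z) : dyadic := fun n => Z.testbit m (Z.of_nat n).

Definition dyadic_holder (s : dyadic -> R) : Prop :=
  exists c mu, 0 < c /\ 0 < mu < 1 /\
    forall (n : nat) (a b : dyadic),
      (forall m, (m < n)%nat -> a m = b m) ->
      Rabs (s a - s b) <= c * mu ^ n.

Definition dyadic_solution (s : dyadic -> R) : Prop :=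
  (forall x, 0 < s x) /\
  dyadic_holder s /\
  (forall x,
     s (dyadic_affine 2 1 x)
     = s x / s (dyadic_affine 2 0 x)
         * (1 + 1 / s (dyadic_affine 2 (-1) x)) - 1).

Definition circle (z : C) : Prop := Cmod z = 1.

Definition doubling (z : C) : C := (z ^ 2)%C.

(* exp (2 pi i t): angles are measured in turns. *)
Definition cis (t : R) : C := (cos (2 * PI * t), sin (2 * PI * t)).

Record solenoid := Solenoid {
  coord :> nat -> C;
  coord_circle : forall n, circle (coord n);
  coord_doubling : forall n, doubling (coord (S n)) = coord n }.

Lemma circle_cis t : circle (cis t).
Proof.
unfold circle, Cmod, cis; simpl fst; simpl snd.
replace (_ + _) with 1; [apply sqrt_1|].
generalize (sin2_cos2 (2 * PI * t)); unfold Rsqr; lra.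
Qed.

Lemma circle_mult z w : circle z -> circle w -> circle (z * w)%C.
Proof. unfold circle; intros Hz Hw; rewrite Cmod_mult, Hz, Hw; ring. Qed.

Lemma doubling_mult z w : doubling (z * w)%C = (doubling z * doubling w)%C.
Proof. unfold doubling; ring. Qed.

Lemma circle_doubling z : circle z -> circle (doubling z).
Proof.
intros Hz; replace (doubling z) with (z * z)%C by (unfold doubling; ring).
now apply circle_mult.
Qed.

Lemma doubling_cis t : doubling (cis t) = cis (2 * t).
Proof.
unfold doubling, cis.
replace (2 * PI * (2 * t)) with (2 * (2 * PI * t)) by ring.
rewrite cos_2a, sin_2a; simpl; unfold Cmult; simpl; f_equal; ring.
Qed.

Lemma cis_add_bool t (b : bool) : cis (t + IZR (Z.b2z b)) = cis t.
Proof.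
destruct b; simpl; [|now rewrite Rplus_0_r].
unfold cis; replace (2 * PI * (t + 1)) with (2 * PI * t + 2 * PI) by ring.
rewrite cos_plus, sin_plus, cos_2PI, sin_2PI.
f_equal; ring.
Qed.

Lemma flow_doubling (x : solenoid) t n :
  doubling (x (S n) * cis (t / 2 ^ S n))%C = (x n * cis (t / 2 ^ n))%C.
Proof.
rewrite doubling_mult, coord_doubling, doubling_cis.
do 2 f_equal; simpl; field; apply pow_nonzero; lra.
Qed.

(* x + t *)
Definition flow (x : solenoid) (t : R) : solenoid :=
  {| coord := fun n => (x n * cis (t / 2 ^ n))%C;
     coord_circle := fun n =>
       circle_mult _ _ (coord_circle x n) (circle_cis (t / 2 ^ n));
     coord_doubling := flow_doubling x t |}.

Definition tilde_coord (x : solenoid) (n : nat) : C :=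
  match n with O => doubling (x O) | S k => x k end.

Lemma tilde_circle x n : circle (tilde_coord x n).
Proof. destruct n; [apply circle_doubling|]; apply coord_circle. Qed.

Lemma tilde_doubling x n : doubling (tilde_coord x (S n)) = tilde_coord x n.
Proof. destruct n; [reflexivity|]; apply coord_doubling. Qed.

Definition tilde_E (x : solenoid) : solenoid :=
  Solenoid (tilde_coord x) (tilde_circle x) (tilde_doubling x).

Lemma omega_doubling (a : dyadic) n :
  doubling (cis (IZR (trunc a (S n)) / 2 ^ S n))
  = cis (IZR (trunc a n) / 2 ^ n).
Proof.
rewrite doubling_cis, <- (cis_add_bool (IZR (trunc a n) / 2 ^ n) (a n)).
f_equal; simpl trunc; rewrite plus_IZR, mult_IZR, <- pow_IZR.
simpl; field; apply pow_nonzero; lra.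
Qed.

Definition tilde_omega (a : dyadic) : solenoid :=
  Solenoid (fun n => cis (IZR (trunc a n) / 2 ^ n))
           (fun n => circle_cis _) (omega_doubling a).

(* x and y are in the same path component of the solenoid; continuity into the
   product topology is continuity of each coordinate. *)
Definition same_leaf (x y : solenoid) : Prop :=
  exists gamma : R -> solenoid,
    (forall n, continuous_on (fun s => 0 <= s <= 1) (fun s => gamma s n)) /\
    gamma 0 = x /\ gamma 1 = y.

(* One function on the solenoid gathers the maps phi of all the leaves; no
   regularity is imposed from one leaf to another. *)
Definition leaf_structure (phi : solenoid -> R) : Prop :=
  (forall x t, continuous (fun s => phi (flow x s)) t) /\
  (forall x y, same_leaf x y -> phi x = phi y -> x = y).

Definition leaf_structure_eq (phi psi : solenoid -> R) : Prop :=
  forall x, exists a b, a <> 0 /\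
    forall y, same_leaf x y -> psi y = a * phi y + b.

Definition ratio (phi : solenoid -> R) (x y z : solenoid) : R :=
  Rabs (phi y - phi z) / Rabs (phi x - phi y).

Definition tilde_E_invariant (phi : solenoid -> R) : Prop :=
  forall x y z, same_leaf x y -> same_leaf x z ->
    x <> y -> y <> z -> x <> z ->
    ratio phi (tilde_E x) (tilde_E y) (tilde_E z) = ratio phi x y z.

Definition transversely_holder (phi : solenoid -> R) : Prop :=
  forall T, 0 < T -> exists c mu, 0 < c /\ 0 < mu < 1 /\
    forall (n : nat) (x x' : solenoid), x n = x' n ->
    forall t1 t2 t3, -T <= t1 <= T -> -T <= t2 <= T -> -T <= t3 <= T ->
      t1 <> t2 -> t2 <> t3 -> t1 <> t3 ->
      Rabs (ln (ratio phi (flow x t1) (flow x t2) (flow x t3))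
            - ln (ratio phi (flow x' t1) (flow x' t2) (flow x' t3)))
      <= c * mu ^ n.

Definition invariant_leaf_structure (phi : solenoid -> R) : Prop :=
  leaf_structure phi /\ transversely_holder phi /\ tilde_E_invariant phi.

(* [is_arc J a l]: J is the compact arc from cis a to cis (a + l), a proper
   nondegenerate arc when 0 < l < 1. *)
Definition is_arc (J : C -> Prop) (a l : R) : Prop :=
  0 < l < 1 /\
  forall z, J z <-> exists t, a <= t <= a + l /\ z = cis t.

(* The values of [chart_map] outside [dom] are irrelevant: all notions below
   depend only on its restriction to [dom], so a maximal collection contains
   with a chart all the records representing it. *)
Record chart := Chart { dom : C -> Prop; chart_map :> C -> R }.

Definition chart_inv (u : chart) (t : R) : C :=
  epsilon (inhabits (RtoC 0)) (fun z => dom u z /\ u z = t).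

Definition is_chart (u : chart) : Prop :=
  (exists a l, is_arc (dom u) a l) /\
  exists p q, p < q /\
    continuous_on (dom u) u /\
    continuous_on (fun t => p <= t <= q) (chart_inv u) /\
    (forall z, dom u z -> p <= u z <= q /\ chart_inv u (u z) = z) /\
    (forall t, p <= t <= q -> dom u (chart_inv u t) /\ u (chart_inv u t) = t).

Definition image {X Y : Type} (f : X -> Y) (A : X -> Prop) : Y -> Prop :=
  fun y => exists x, A x /\ f x = y.

(* g is a derivative of f relative to K (one-sided at end points; no condition
   at isolated points of K). *)
Definition derivative_on (K : R -> Prop) (f g : R -> R) : Prop :=
  forall x, K x ->
    filterlim (fun y => (f y - f x) / (y - x))
              (within K (locally' x)) (locally (g x)).

Definition holder_on (K : R -> Prop) (g : R -> R) (eps c : R) : Prop :=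
  forall x y, K x -> K y -> x <> y ->
    Rabs (g x - g y) <= c * Rpower (Rabs (x - y)) eps.

(* C^{1+eps} diffeomorphism onto its image, for an injective f. *)
Definition C1_holder_diffeo (K : R -> Prop) (f : R -> R) (eps : R) : Prop :=
  exists g c, derivative_on K f g /\
    (forall x, K x -> g x <> 0) /\ holder_on K g eps c.

(* C^{1+eps} with bound b: the derivative is bounded by b, away from zero by
   1/b, and eps-Hoelder with constant b (f itself takes values in a compact
   interval whenever this is used). *)
Definition C1_holder_bounded (K : R -> Prop) (f : R -> R) (eps b : R) : Prop :=
  exists g, derivative_on K f g /\
    (forall x, K x -> / b <= Rabs (g x) <= b) /\ holder_on K g eps b.

Definition compatible (u v : chart) : Prop :=
  exists eps, 0 < eps /\
    C1_holder_diffeo (image u (fun z => dom u z /\ dom v z))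
                     (fun t => v (chart_inv u t)) eps.

(* The exponent in [compatible] depends on the overlap map: with a common
   exponent for the whole collection no collection would be maximal. *)
Definition atlas (U : chart -> Prop) : Prop :=
  (forall u, U u -> is_chart u) /\
  (forall z, circle z ->
     exists u, U u /\ dom u z /\ within circle (locally z) (dom u)) /\
  (forall u v, U u -> U v -> compatible u v).

Definition C1_holder_structure (U : chart -> Prop) : Prop :=
  atlas U /\
  forall V, atlas V -> (forall u, U u -> V u) -> forall u, V u -> U u.

Definition structure_eq (U V : chart -> Prop) : Prop := forall u, U u <-> V u.

Definition finite_cover (U : chart -> Prop) (U' : list chart) : Prop :=
  (forall u, In u U' -> U u) /\
  (forall z, circle z -> exists u, In u U' /\ dom u z).

Definition is_interval (P : R -> Prop) : Prop :=
  forall s t r, P s -> P t -> s <= r <= t -> P r.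

Definition circle_interval (K : C -> Prop) : Prop :=
  exists P, is_interval P /\ forall z, K z <-> exists t, P t /\ z = cis t.

(* w restricted to the arc I preserves the arc length between points of I,
   measured along I. *)
Definition arc_isometry (I : C -> Prop) (w : C -> R) : Prop :=
  exists a l, is_arc I a l /\
    forall s t, a <= s <= a + l -> a <= t <= a + l ->
      Rabs (w (cis s) - w (cis t)) = 2 * PI * Rabs (s - t).

Definition quasisymmetric (D : R -> Prop) (h : R -> R) : Prop :=
  forall d, 1 <= d -> exists k, 1 <= k /\
    forall x d1 d2, 0 < d1 -> 0 < d2 ->
      D (x - d1) -> D x -> D (x + d2) ->
      / d <= d2 / d1 <= d ->
      Rabs (ln ((h (x + d2) - h x) / (h x - h (x - d1)) * (d1 / d2))) <= ln k.

Definition doubling_invariant (U : chart -> Prop) : Prop :=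
  forall U', finite_cover U U' ->
    (exists eps b, 0 < eps /\ 1 <= b /\
       forall u v, In u U' -> In v U' ->
       forall K, circle_interval K ->
         (forall z, K z -> dom u z) ->
         (forall z, K z -> dom v (doubling z)) ->
         C1_holder_bounded (image u K)
           (fun t => v (doubling (chart_inv u t))) eps b) /\
    (forall u w, In u U' -> arc_isometry (dom u) w ->
       quasisymmetric (image u (dom u)) (fun t => w (chart_inv u t))).

Definition invariant_circle_structure (U : chart -> Prop) : Prop :=
  C1_holder_structure U /\ doubling_invariant U.

(* I : tiles assigns to beta the closed interval [fst (I beta), snd (I beta)]. *)
Definition tiles := Z -> R * R.

Definition in_tile (J : R * R) (x : R) : Prop := fst J <= x <= snd J.

Definition tile_length (J : R * R) : R := snd J - fst J.

Definition is_endpoint (J : R * R) (p : R) : Prop := p = fst J \/ p = snd J.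

(* Tiles may be numbered from left to right or from right to left. *)
Definition tiling_with (B : R) (I : tiles) : Prop :=
  (forall b, fst (I b) < snd (I b)) /\
  (forall b b', b <> b' -> forall x,
     ~ (fst (I b) < x < snd (I b) /\ fst (I b') < x < snd (I b'))) /\
  (forall x, exists b, in_tile (I b) x) /\
  (forall b, exists p, is_endpoint (I b) p /\ is_endpoint (I (b + 1)%Z) p /\
     forall x, in_tile (I b) x /\ in_tile (I (b + 1)%Z) x <-> x = p) /\
  (forall b, / B <= tile_length (I (b + 1)%Z) / tile_length (I b) <= B).

Definition is_tiling (I : tiles) : Prop := exists B, 1 <= B /\ tiling_with B I.

Definition tile_image (a b : R) (I J : R * R) : Prop :=
  forall y, in_tile J y <-> exists x, in_tile I x /\ y = a * x + b.

Definition tiling_eq (I J : tiles) : Prop :=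
  exists a b, a <> 0 /\ forall beta, tile_image a b (I beta) (J beta).

Definition tiling_sequence (I : tiles) (m : Z) : R :=
  tile_length (I (m + 1)%Z) / tile_length (I m).

Definition amalgamation (r : Z -> R) (i : Z) : R :=
  r (2 * i - 1)%Z * r (2 * i)%Z
    * ((1 + r (2 * i + 1)%Z) / (1 + r (2 * i - 1)%Z)).

Definition quasiperiodic (r : Z -> R) : Prop :=
  exists c mu, 0 < c /\ 0 < mu < 1 /\
    forall (i : nat) (j k : Z), (2 ^ Z.of_nat i | j - k)%Z ->
      Rabs (r j - r k) <= c * mu ^ i.

Definition fixed_tiling (I : tiles) : Prop :=
  is_tiling I /\ quasiperiodic (tiling_sequence I) /\
  ext_eq (amalgamation (tiling_sequence I)) (tiling_sequence I).

(* Levels n >= 1 are indexed by [positive]. *)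
Definition is_grid (G : positive -> tiles) : Prop :=
  (exists B, 1 <= B /\ forall n, tiling_with B (G n)) /\
  (forall n beta x,
     in_tile (G n beta) x <->
     in_tile (G (n + 1)%positive (2 * beta - 1)%Z) x \/
     in_tile (G (n + 1)%positive (2 * beta)%Z) x).

Definition grid_eq (G H : positive -> tiles) : Prop :=
  exists a b, a <> 0 /\ forall n beta, tile_image a b (G n beta) (H n beta).

Definition fixed_grid (G : positive -> tiles) : Prop :=
  is_grid G /\
  (forall n, ext_eq (tiling_sequence (G n)) (tiling_sequence (G 1%positive))) /\
  quasiperiodic (tiling_sequence (G 1%positive)).

Definition function_to_sequence (s : dyadic -> R) (a : positive -> R) : Prop :=
  forall n, a n = s (dyadic_of_Z (Z.pos n)).

Definition leaf_to_function (phi : solenoid -> R) (s : dyadic -> R) : Prop :=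
  forall a, s a = ratio phi (tilde_omega (dyadic_affine 1 (-1) a))
                            (tilde_omega a)
                            (tilde_omega (dyadic_affine 1 1 a)).

(* The ratios of phi are the limits r_U, whatever the finite cover and the
   choice of the charts u_n; the hypothesis on u_n can hold only for large n,
   when the projected leaf segment has become short. *)
Definition circle_to_leaf (U : chart -> Prop) (phi : solenoid -> R) : Prop :=
  forall (x : solenoid) (t1 t2 t3 : R), t1 <> t2 -> t2 <> t3 -> t1 <> t3 ->
  forall (U' : list chart) (u : nat -> chart), finite_cover U U' ->
    (forall n, In (u n) U') ->
    eventually (fun n =>
      forall t, Rmin t1 (Rmin t2 t3) <= t <= Rmax t1 (Rmax t2 t3) ->
        dom (u n) (flow x t n)) ->
    is_lim_seq
      (fun n => Rabs (u n (flow x t2 n) - u n (flow x t3 n))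
                / Rabs (u n (flow x t1 n) - u n (flow x t2 n)))
      (ratio phi (flow x t1) (flow x t2) (flow x t3)).

Definition function_to_tiling (s : dyadic -> R) (I : tiles) : Prop :=
  forall m, tiling_sequence I m = s (dyadic_of_Z m).

Definition tiling_to_grid (I : tiles) (G : positive -> tiles) : Prop :=
  forall n, ext_eq (tiling_sequence (G n)) (tiling_sequence I).

(* Main.v *)
Require Import Defs.
From Stdlib Require Import Lra Lia FunctionalExtensionality ProofIrrelevance PropExtensionality Classical.
Local Open Scope R_scope.

(** All the sets are compared with the solutions s of the functional equation on
    the 2-adic integers.  The link is one function of a real variable for each
    leaf.

    Fix a solution s and a 2-adic integer a.  The points k / 2^m of the leaf of
    a cut it into tiles.  The functional equation says that the ratios of
    lengths s (2^(m+1) a + k), prescribed at level m + 1, become the ratios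
    s (2^m a + k) of level m when tiles are joined in pairs.  So there is an
    increasing function with these ratios at all levels at once; it is
    continuous since the ratios are bounded, and unique up to affine maps
    ([adapted_exists], [tile_law_unique]).  It is an affine chart of the leaf.

    Since s is Hölder, going from a tile to its halves at level m, on two leaves
    whose base points share n digits, gives factors that differ by
    O(mu^(n+m)).  These errors have a sum O(mu^n), which is the transverse
    Hölder condition ([adapted_close]); rescaled by the solenoid map, it says
    that the charts of any two leaves agree at small scales up to a power of
    the scale ([adapted_local]).

    The chart f of the leaf of 0, which the solenoid map preserves, gives the
    tiling of s: its unit tiles, and the grid: its dyadic tiles.  The charts
    of all leaves together give the invariant affine structure of s; in the
    other direction the ratios at integer points of an affine structure give a
    solution, the equation being the comparison of unit tiles with their
    halves ([tile_law_equation]).  Sequences in A(2) and tilings are solutions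
    on dense sets of integers, which extend by continuity
    ([extend_solution]).

    The circle structure of s consists of the charts whose ratios of increments
    agree with those of f up to a power of the scale ([charts_along]).  Such
    charts have Hölder derivatives relative to each other
    ([tangent_of_dist3], [C1_of_slopes]), the doubling map is affine in f, and
    f is quasisymmetric because tiles next to each other are comparable.
    Conversely let U be an invariant structure.  Quasisymmetry makes lengths
    in its charts decay geometrically along inverse branches of the doubling
    map, so the distortions of the successive steps form a geometric series
    ([one_step], [leaf_estimate]).  The ratios converge to those of an affine
    structure, and at coordinate 0 they already agree with the limit up to a
    power of the scale: U is contained in the structure of charts along f
    ([structure_along]), hence equal to it by maximality. *)

(** * Real analysis on intervals *)

Lemma floor_ex x : exists k : Z, IZR k <= x < IZR k + 1.
Proof.
exists (up x - 1)%Z; rewrite minus_IZR.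
destruct (archimed x); lra.
Qed.

Lemma IZR_lt_1_eq (j k : Z) : Rabs (IZR j - IZR k) < 1 -> j = k.
Proof.
intros H; rewrite <- minus_IZR in H; apply Rabs_def2 in H; destruct H as [H1 H2].
apply lt_IZR in H1; apply (lt_IZR (-1)) in H2; lia.
Qed.

(** Every compactness argument below is an instance: a relation on the pairs
    x <= y that holds near each point and can be concatenated holds on all
    of [a, b]. *)
Lemma interval_induction (Q : R -> R -> Prop) a b : a <= b ->
  (forall x y z, a <= x <= y -> y <= z <= b -> Q x y -> Q y z -> Q x z) ->
  (forall x, a <= x <= b -> exists d, 0 < d /\
     forall u v, a <= u <= x -> x <= v <= b -> x - d < u -> v < x + d -> Q u v) ->
  Q a b.
Proof.
intros Hab Htr Hloc.
set (S := fun y => a <= y <= b /\ Q a y).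
assert (Ha : S a).
{ split; [lra|]; destruct (Hloc a) as [d [Hd H]]; [lra|]; apply H; lra. }
destruct (completeness S) as [m [Hub Hlub]].
{ exists b; intros y [Hy _]; lra. }
{ now exists a. }
assert (Ham : a <= m <= b).
{ split; [now apply Hub|]; apply Hlub; intros y [Hy _]; lra. }
destruct (Hloc m Ham) as [d [Hd H]].
assert (Hy : exists y, S y /\ m - d < y).
{ apply NNPP; intros Hn; assert (m <= m - d); [|lra].
  apply Hlub; intros y Hy; apply Rnot_lt_le; intros Hlt; apply Hn; now exists y. }
destruct Hy as [y [Hy Hmy]]; assert (y <= m) by now apply Hub.
set (v := Rmin b (m + d / 2)).
assert (Hv : m <= v <= b /\ v < m + d /\ (v = b \/ v = m + d / 2)).
{ unfold v; apply Rmin_case_strong; intros; lra. }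
assert (Sv : S v).
{ split; [lra|]; destruct Hy as [Hy1 Hy2].
  apply (Htr a y v); try lra; [exact Hy2|]; apply H; lra. }
destruct Hv as [Hv1 [Hv2 [Hv3|Hv3]]]; [now rewrite <- Hv3; apply Sv|].
assert (v <= m) by now apply Hub.
lra.
Qed.

Lemma half_pow_pos n : 0 < (/ 2) ^ n.
Proof. apply pow_lt; lra. Qed.

Lemma half_pow_inv n : (/ 2) ^ n = / 2 ^ n.
Proof. apply pow_inv. Qed.

Lemma pow_decr r n m : 0 < r < 1 -> (n <= m)%nat -> r ^ m <= r ^ n.
Proof.
intros Hr Hnm; replace m with (n + (m - n))%nat by lia; rewrite pow_add.
assert (0 < r ^ n) by (apply pow_lt; lra).
assert (r ^ (m - n) <= 1).
{ rewrite <- (pow1 (m - n)); apply pow_incr; lra. }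
nra.
Qed.

Lemma pow_le_1 r n : 0 < r < 1 -> 0 < r ^ n <= 1.
Proof.
intros Hr; split; [apply pow_lt; lra|].
now apply (pow_decr r 0 n); [|lia].
Qed.

Lemma pow_small r e : 0 < r < 1 -> 0 < e -> exists n, r ^ n < e.
Proof.
intros Hr He; destruct (pow_lt_1_zero r) with (y := e) as [N HN]; auto.
{ rewrite Rabs_pos_eq; lra. }
exists N; apply Rle_lt_trans with (2 := HN N (le_n _)); apply Rle_abs.
Qed.

Lemma dyadic_scale r : 0 < r <= 1 -> exists n, (/ 2) ^ S n < r <= (/ 2) ^ n.
Proof.
intros Hr.
assert (H : forall n, (/ 2) ^ n < r -> exists m, (/ 2) ^ S m < r <= (/ 2) ^ m).
{ induction n as [|n IH]; intros Hn; [simpl in Hn; lra|].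
  destruct (Rlt_le_dec ((/ 2) ^ n) r) as [H|H]; [now apply IH|now exists n]. }
destruct (pow_small (/ 2) r) as [n Hn]; [lra..|]; now apply (H n).
Qed.

Lemma geometric_telescope (e : nat -> R) K mu n0 : 0 < mu < 1 -> 0 <= K ->
  (forall n, (n0 <= n)%nat -> Rabs (e (S n) - e n) <= K * mu ^ n) ->
  forall n k, (n0 <= n)%nat -> Rabs (e (n + k)%nat - e n) <= K / (1 - mu) * mu ^ n.
Proof.
intros Hmu HK H.
assert (A : forall k n, (n0 <= n)%nat ->
  Rabs (e (n + k)%nat - e n) <= K / (1 - mu) * (mu ^ n - mu ^ (n + k))).
{ induction k as [|k IH]; intros n Hn.
  { rewrite Nat.add_0_r, !Rminus_diag, Rabs_R0; lra. }
  replace (n + S k)%nat with (S (n + k)) by lia.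
  replace (e (S (n + k)) - e n)
    with ((e (S (n + k)) - e (n + k)%nat) + (e (n + k)%nat - e n)) by ring.
  eapply Rle_trans; [apply Rabs_triang|].
  eapply Rle_trans; [apply Rplus_le_compat; [apply H; lia|now apply IH]|].
  apply Req_le; simpl; field; lra. }
intros n k Hn; eapply Rle_trans; [now apply A|].
apply Rmult_le_compat_l.
{ apply Rmult_le_pos; [lra|]; left; apply Rinv_0_lt_compat; lra. }
assert (0 < mu ^ (n + k)) by (apply pow_lt; lra); lra.
Qed.

Lemma is_lim_seq_eps u (l : R) :
  is_lim_seq u l <->
  (forall e, 0 < e -> exists N, forall n, (N <= n)%nat -> Rabs (u n - l) < e).
Proof.
rewrite <- is_lim_seq_spec; simpl; split; intros H e.
- intros He; destruct (H (mkposreal e He)) as [N HN]; now exists N.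
- destruct (H e (cond_pos e)) as [N HN]; now exists N.
Qed.

Lemma is_lim_seq_dist_le u (l c d : R) : is_lim_seq u l ->
  (exists N, forall n, (N <= n)%nat -> Rabs (u n - c) <= d) -> Rabs (l - c) <= d.
Proof.
intros Hu [N HN]; apply Rnot_lt_le; intros Hlt.
destruct (proj1 (is_lim_seq_eps u l) Hu (Rabs (l - c) - d)) as [M HM]; [lra|].
specialize (HN (N + M)%nat ltac:(lia)); specialize (HM (N + M)%nat ltac:(lia)).
assert (Rabs (l - c) <= Rabs (u (N + M)%nat - l) + Rabs (u (N + M)%nat - c)); [|lra].
replace (l - c) with (- (u (N + M)%nat - l) + (u (N + M)%nat - c)) by ring.
eapply Rle_trans; [apply Rabs_triang|]; rewrite Rabs_Ropp; lra.
Qed.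

Lemma is_lim_seq_geometric u (l K mu : R) N : 0 < mu < 1 ->
  (forall n, (N <= n)%nat -> Rabs (u n - l) <= K * mu ^ n) -> is_lim_seq u l.
Proof.
intros Hmu H; apply is_lim_seq_eps; intros e He.
destruct (pow_small mu (e / (Rabs K + 1))) as [M HM]; auto.
{ apply Rdiv_lt_0_compat; [lra|]; generalize (Rabs_pos K); lra. }
exists (N + M)%nat; intros n Hn; eapply Rle_lt_trans; [apply H; lia|].
assert (0 < mu ^ n <= mu ^ M) by (split; [apply pow_lt; lra|apply pow_decr; [lra|lia]]).
generalize (Rabs_pos K) (Rle_abs K); intros.
apply Rle_lt_trans with (mu ^ M * (Rabs K + 1)); [nra|].
apply (Rmult_lt_compat_r (Rabs K + 1)) in HM; [|lra].
now replace (e / (Rabs K + 1) * (Rabs K + 1)) with e in HM by (field; lra).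
Qed.

Lemma cauchy_geometric (e : nat -> R) K mu n0 : 0 < mu < 1 -> 0 <= K ->
  (forall n, (n0 <= n)%nat -> Rabs (e (S n) - e n) <= K * mu ^ n) ->
  exists l : R, is_lim_seq e l /\
    forall n, (n0 <= n)%nat -> Rabs (l - e n) <= K / (1 - mu) * mu ^ n.
Proof.
intros Hmu HK H; assert (T := geometric_telescope e K mu n0 Hmu HK H).
assert (HK' : 0 <= K / (1 - mu)).
{ apply Rmult_le_pos; [lra|]; left; apply Rinv_0_lt_compat; lra. }
assert (C : ex_finite_lim_seq e).
{ apply ex_lim_seq_cauchy_corr; intros eps.
  set (K' := K / (1 - mu)) in *.
  destruct (pow_small mu (eps / (2 * (K' + 1)))) as [M HM]; auto.
  { apply Rdiv_lt_0_compat; [apply cond_pos|lra]. }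
  exists (n0 + M)%nat.
  assert (A : forall n, (n0 + M <= n)%nat -> Rabs (e n - e (n0 + M)%nat) < eps / 2).
  { intros n Hn; replace n with (n0 + M + (n - (n0 + M)))%nat at 1 by lia.
    eapply Rle_lt_trans; [apply T; lia|].
    assert (0 < mu ^ (n0 + M) <= mu ^ M) by (split; [apply pow_lt; lra|apply pow_decr; [lra|lia]]).
    apply Rle_lt_trans with (mu ^ M * (K' + 1)); [nra|].
    apply (Rmult_lt_compat_r (K' + 1)) in HM; [|lra].
    now replace (eps / (2 * (K' + 1)) * (K' + 1)) with (eps / 2) in HM by (field; lra). }
  intros n m Hn Hm; apply A in Hn; apply A in Hm.
  replace (e n - e m) with ((e n - e (n0 + M)%nat) - (e m - e (n0 + M)%nat)) by ring.
  unfold Rminus at 1; eapply Rle_lt_trans; [apply Rabs_triang|]; rewrite Rabs_Ropp; lra. }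
destruct C as [l Hl]; exists l; split; [exact Hl|]; intros n Hn.
apply is_lim_seq_dist_le with (1 := Hl); exists n; intros m Hm.
replace m with (n + (m - n))%nat by lia; now apply T.
Qed.

(** ** Continuous and monotone functions on a segment *)

Definition seg_cont (F : R -> R) p q := forall x, p <= x <= q -> forall e, 0 < e ->
  exists d, 0 < d /\ forall y, p <= y <= q -> Rabs (y - x) < d -> Rabs (F y - F x) < e.

Lemma seg_cont_sub F p q p' q' : p <= p' -> q' <= q -> seg_cont F p q -> seg_cont F p' q'.
Proof.
intros Hp Hq H x Hx e He; destruct (H x ltac:(lra) e He) as [d [Hd H']].
exists d; split; [exact Hd|]; intros; apply H'; lra.
Qed.

Definition clamp p q t := Rmax p (Rmin q t).

Lemma clamp_in p q t : p <= q -> p <= clamp p q t <= q.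
Proof. intros H; unfold clamp, Rmax, Rmin; repeat destruct Rle_dec; lra. Qed.

Lemma clamp_id p q t : p <= t <= q -> clamp p q t = t.
Proof. intros H; unfold clamp, Rmax, Rmin; repeat destruct Rle_dec; lra. Qed.

Lemma clamp_contract p q s t : Rabs (clamp p q s - clamp p q t) <= Rabs (s - t).
Proof.
unfold clamp, Rmax, Rmin, Rabs; repeat destruct Rle_dec; repeat destruct Rcase_abs; lra.
Qed.

(** Extending a function by constants turns relative continuity on a segment
    into continuity on the line. *)
Lemma clamp_continuity F p q : p <= q -> seg_cont F p q ->
  continuity (fun t => F (clamp p q t)).
Proof.
intros Hpq H x e He.
destruct (H _ (clamp_in p q x Hpq) e He) as [d [Hd H']].
exists d; split; [exact Hd|]; intros y [_ Hy]; simpl in *; unfold Rdist in *.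
apply H'; [now apply clamp_in|].
eapply Rle_lt_trans; [apply clamp_contract|exact Hy].
Qed.

Lemma seg_cont_ivt F p q y : p <= q -> seg_cont F p q ->
  Rmin (F p) (F q) <= y <= Rmax (F p) (F q) -> exists x, p <= x <= q /\ F x = y.
Proof.
intros Hpq H Hy.
destruct (IVT_gen (fun t => F (clamp p q t)) p q y) as [x [Hx1 Hx2]].
{ now apply clamp_continuity. }
{ rewrite !clamp_id; lra. }
exists (clamp p q x); split; [now apply clamp_in|exact Hx2].
Qed.

Definition increasing_on (F : R -> R) p q := forall x y, p <= x -> x < y -> y <= q -> F x < F y.

Definition monotone_on F p q := increasing_on F p q \/ increasing_on (fun t => - F t) p q.

Lemma monotone_inj F p q x y : monotone_on F p q -> p <= x <= q -> p <= y <= q ->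
  F x = F y -> x = y.
Proof.
intros HF Hx Hy E; destruct (Rtotal_order x y) as [H|[H|H]]; auto;
  destruct HF as [HF|HF]; [generalize (HF x y)|generalize (HF x y)|
  generalize (HF y x)|generalize (HF y x)]; simpl; intros HH; lra.
Qed.

Lemma monotone_dist_pos F p q x y : monotone_on F p q -> p <= x <= q -> p <= y <= q ->
  x <> y -> 0 < Rabs (F x - F y).
Proof.
intros HF Hx Hy Hne; apply Rabs_pos_lt; intros E; apply Hne.
apply (monotone_inj F p q); auto; lra.
Qed.

(** Increments of a monotone function add up in absolute value; this spares
    all distinctions between increasing and decreasing functions. *)
Lemma monotone_dist_add F p q x y z : monotone_on F p q ->
  p <= x -> x <= y -> y <= z -> z <= q ->
  Rabs (F z - F x) = Rabs (F y - F x) + Rabs (F z - F y).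
Proof.
intros HF Hx Hxy Hyz Hz.
assert (A : forall G, increasing_on G p q ->
  Rabs (G z - G x) = Rabs (G y - G x) + Rabs (G z - G y)).
{ intros G HG.
  assert (G x <= G y) by (destruct Hxy as [H|H]; [left; apply HG; lra|rewrite H; lra]).
  assert (G y <= G z) by (destruct Hyz as [H0|H0]; [left; apply HG; lra|rewrite H0; lra]).
  rewrite !Rabs_pos_eq; lra. }
destruct HF as [H|H]; [now apply A|]; apply A in H.
replace (- F z - - F x) with (- (F z - F x)) in H by ring.
replace (- F y - - F x) with (- (F y - F x)) in H by ring.
replace (- F z - - F y) with (- (F z - F y)) in H by ring.
now rewrite !Rabs_Ropp in H.
Qed.

Lemma monotone_dist_incl F p q x x' y' y : monotone_on F p q ->
  p <= x -> x <= x' -> x' <= y' -> y' <= y -> y <= q ->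
  Rabs (F y' - F x') <= Rabs (F y - F x).
Proof.
intros HF H1 H2 H3 H4 H5.
rewrite (monotone_dist_add F p q x x' y); try lra; auto.
rewrite (monotone_dist_add F p q x' y' y); try lra; auto.
generalize (Rabs_pos (F x' - F x)) (Rabs_pos (F y - F y')); lra.
Qed.

Lemma monotone_range F p q t : monotone_on F p q -> p <= t <= q ->
  Rmin (F p) (F q) <= F t <= Rmax (F p) (F q).
Proof.
assert (A : forall G, increasing_on G p q -> p <= t <= q -> G p <= G t <= G q).
{ intros G HG Ht; split; [destruct (Req_dec p t) as [->|]|destruct (Req_dec t q) as [->|]];
    try lra; left; apply HG; lra. }
intros [HF|HF] Ht; specialize (A _ HF Ht); simpl in A; unfold Rmin, Rmax; destruct Rle_dec; lra.
Qed.

(** A value between those at two other points, or outside of them, would be taken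
    twice, by the intermediate value theorem. *)
Lemma injective_monotone F p q : p <= q -> seg_cont F p q ->
  (forall x y, p <= x <= q -> p <= y <= q -> F x = F y -> x = y) ->
  monotone_on F p q.
Proof.
intros Hpq HC HI.
assert (Step : forall G, seg_cont G p q ->
  (forall x y, p <= x <= q -> p <= y <= q -> G x = G y -> x = y) ->
  forall x y z, p <= x -> x < y -> y < z -> z <= q -> G x < G z -> G x < G y < G z).
{ intros G GC GI x y z Hx Hxy Hyz Hz Hlt; split; apply Rnot_le_lt; intros Hle.
  - destruct (seg_cont_ivt G y z (G x)) as [t [Ht E]]; [lra| |
    rewrite Rmin_left, Rmax_right by lra; lra|].
    { apply seg_cont_sub with p q; auto; lra. }
    apply GI in E; lra.
  - destruct (seg_cont_ivt G x y (G z)) as [t [Ht E]]; [lra| |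
    rewrite Rmin_left, Rmax_right by lra; lra|].
    { apply seg_cont_sub with p q; auto; lra. }
    apply GI in E; lra. }
assert (Main : forall G, seg_cont G p q ->
  (forall x y, p <= x <= q -> p <= y <= q -> G x = G y -> x = y) ->
  G p < G q -> increasing_on G p q).
{ intros G GC GI Hlt x y Hx Hxy Hy.
  assert (HG := Step G GC GI).
  assert (A : G p <= G x /\ (x < q -> G x < G q)).
  { destruct (Req_dec x p) as [->|Hn]; [lra|]; destruct (HG p x q); try lra. }
  destruct (Req_dec y q) as [->|Hn]; [apply A; lra|].
  destruct (Req_dec x p) as [->|Hn']; [destruct (HG p y q); lra|].
  destruct (HG x y q); try lra. }
destruct (Rtotal_order (F p) (F q)) as [H|[H|H]].
- left; now apply Main.
- assert (p = q) by (apply HI; auto; lra); subst; left; intros x y; lra.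
- right; apply Main; [| |lra].
  + intros x Hx e He; destruct (HC x Hx e He) as [d [Hd H']]; exists d; split; auto.
    intros y Hy Hxy; replace (- F y - - F x) with (- (F y - F x)) by ring.
    rewrite Rabs_Ropp; now apply H'.
  + intros x y Hx Hy E; apply HI; auto; lra.
Qed.

(** ** Ratios of consecutive increments *)

(** The ratio r(x, y, z) of three points of a leaf, for the function [F] of the leaf
    parameter. *)
Definition R3 (F : R -> R) t1 t2 t3 := Rabs (F t2 - F t3) / Rabs (F t1 - F t2).

Definition dist3 F G t1 t2 t3 := Rabs (ln (R3 F t1 t2 t3) - ln (R3 G t1 t2 t3)).

Lemma dist3_trans F G H t1 t2 t3 :
  dist3 F H t1 t2 t3 <= dist3 F G t1 t2 t3 + dist3 G H t1 t2 t3.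
Proof.
unfold dist3; eapply Rle_trans; [|apply Rabs_triang]; apply Req_le; f_equal; ring.
Qed.

Lemma R3_affine F A B t1 t2 t3 : A <> 0 ->
  R3 (fun t => A * F t + B) t1 t2 t3 = R3 F t1 t2 t3.
Proof.
intros HA; unfold R3.
replace (A * F t2 + B - (A * F t3 + B)) with (A * (F t2 - F t3)) by ring.
replace (A * F t1 + B - (A * F t2 + B)) with (A * (F t1 - F t2)) by ring.
rewrite !Rabs_mult; apply Rabs_no_R0 in HA.
destruct (Req_dec (Rabs (F t1 - F t2)) 0) as [E|E].
- rewrite E, Rmult_0_r; unfold Rdiv; rewrite Rinv_0; ring.
- field; auto.
Qed.

Lemma ln_R3 F t1 t2 t3 : F t1 <> F t2 -> F t2 <> F t3 ->
  ln (R3 F t1 t2 t3) = ln (Rabs (F t2 - F t3)) - ln (Rabs (F t1 - F t2)).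
Proof. intros H1 H2; apply ln_div; apply Rabs_pos_lt; lra. Qed.

Lemma R3_pos F t1 t2 t3 : F t1 <> F t2 -> F t2 <> F t3 -> 0 < R3 F t1 t2 t3.
Proof. intros H1 H2; apply Rdiv_lt_0_compat; apply Rabs_pos_lt; lra. Qed.

Lemma ln_lipschitz m x y : 0 < m -> m <= x -> m <= y ->
  Rabs (ln x - ln y) <= Rabs (x - y) / m.
Proof.
intros Hm; assert (A : forall x y, m <= y -> y <= x -> Rabs (ln x - ln y) <= Rabs (x - y) / m).
{ intros a b Hb Hab; assert (ln b <= ln a) by (apply ln_le; lra).
  rewrite !Rabs_pos_eq by lra.
  rewrite <- ln_div by lra.
  replace (a / b) with (1 + (a - b) / b) by (field; lra).
  apply Rle_trans with ((a - b) / b).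
  - assert (0 <= (a - b) / b) by (apply Rmult_le_pos; [lra|left; apply Rinv_0_lt_compat; lra]).
    rewrite <- (ln_exp ((a - b) / b)) at 2; apply ln_le; [lra|].
    apply exp_ineq1_le.
  - apply Rmult_le_compat_l; [lra|]; apply Rinv_le_contravar; lra. }
intros Hx Hy; destruct (Rle_dec y x) as [H|H]; [now apply A|].
rewrite Rabs_minus_sym, (Rabs_minus_sym x); apply A; lra.
Qed.

Lemma exp_mono x y : x <= y -> exp x <= exp y.
Proof. intros [H|H]; [left; now apply exp_increasing|rewrite H; lra]. Qed.

Lemma exp_lipschitz M x y : x <= M -> y <= M -> Rabs (exp x - exp y) <= exp M * Rabs (x - y).
Proof.
assert (A : forall x y, x <= M -> y <= x -> Rabs (exp x - exp y) <= exp M * Rabs (x - y)).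
{ intros a b Ha Hab; assert (exp b <= exp a) by now apply exp_mono.
  rewrite !Rabs_pos_eq by lra.
  assert (exp a <= exp M) by now apply exp_mono.
  assert (1 + (b - a) <= exp (b - a)) by apply exp_ineq1_le.
  assert (E : exp b = exp a * exp (b - a)) by (rewrite <- exp_plus; f_equal; ring).
  generalize (exp_pos a); nra. }
intros Hx Hy; destruct (Rle_dec y x) as [H|H]; [now apply A|].
rewrite Rabs_minus_sym, (Rabs_minus_sym x); apply A; lra.
Qed.

Lemma Rpower_lt_1 r e : 0 < r < 1 -> 0 < e -> 0 < Rpower r e < 1.
Proof.
intros Hr He; split; [apply exp_pos|]; unfold Rpower; rewrite <- exp_0; apply exp_increasing.
assert (ln r < 0) by (rewrite <- ln_1; apply ln_increasing; lra); nra.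
Qed.

(** * Dyadic integers and solutions of the functional equation *)

Lemma pow2_pos n : (0 < 2 ^ Z.of_nat n)%Z.
Proof. apply Z.pow_pos_nonneg; lia. Qed.

Lemma pow2_S n : (2 ^ Z.of_nat (S n) = 2 * 2 ^ Z.of_nat n)%Z.
Proof. rewrite Nat2Z.inj_succ, Z.pow_succ_r; lia. Qed.

Lemma trunc_S a n : trunc a (S n) = (trunc a n + Z.b2z (a n) * 2 ^ Z.of_nat n)%Z.
Proof. reflexivity. Qed.

Lemma trunc_range a n : (0 <= trunc a n < 2 ^ Z.of_nat n)%Z.
Proof.
induction n as [|n IH]; [simpl; lia|].
rewrite trunc_S, pow2_S; destruct (a n); simpl Z.b2z; lia.
Qed.

Lemma trunc_testbits d z n :
  (forall i, (i < n)%nat -> d i = Z.testbit z (Z.of_nat i)) ->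
  trunc d n = (z mod 2 ^ Z.of_nat n)%Z.
Proof.
induction n as [|n IH]; intros H; [simpl; now rewrite Z.mod_1_r|].
rewrite trunc_S, IH, H by (auto with arith); rewrite pow2_S.
rewrite Z.testbit_spec' by lia.
rewrite (Z.mul_comm 2), Z.rem_mul_r; generalize (pow2_pos n); lia.
Qed.

Lemma trunc_of_Z m n : trunc (dyadic_of_Z m) n = (m mod 2 ^ Z.of_nat n)%Z.
Proof. now apply trunc_testbits. Qed.

Lemma mod_pow2_le z n m : (n <= m)%nat ->
  ((z mod 2 ^ Z.of_nat m) mod 2 ^ Z.of_nat n = z mod 2 ^ Z.of_nat n)%Z.
Proof.
intros H; rewrite <- Znumtheory.Zmod_div_mod; auto using pow2_pos.
exists (2 ^ (Z.of_nat m - Z.of_nat n))%Z; rewrite <- Z.pow_add_r; f_equal; lia.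
Qed.

Lemma testbit_congr x y i : (x mod 2 ^ Z.of_nat (S i) = y mod 2 ^ Z.of_nat (S i))%Z ->
  Z.testbit x (Z.of_nat i) = Z.testbit y (Z.of_nat i).
Proof.
intros H; rewrite <- (Z.mod_pow2_bits_low x (Z.of_nat (S i))) by lia.
rewrite H; apply Z.mod_pow2_bits_low; lia.
Qed.

Lemma trunc_mod a n m : (n <= m)%nat -> (trunc a m mod 2 ^ Z.of_nat n = trunc a n)%Z.
Proof.
intros H; induction m as [|m IH].
{ replace n with 0%nat by lia; simpl; now rewrite Z.mod_1_r. }
destruct (Nat.eq_dec n (S m)) as [->|Hn].
{ apply Z.mod_small, trunc_range. }
rewrite <- IH by lia; rewrite trunc_S.
replace (2 ^ Z.of_nat m)%Z with (2 ^ (Z.of_nat m - Z.of_nat n) * 2 ^ Z.of_nat n)%Z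
  by (rewrite <- Z.pow_add_r by lia; f_equal; lia).
rewrite Z.mul_assoc, Z_mod_plus_full; reflexivity.
Qed.

Lemma trunc_affine p q a n :
  trunc (dyadic_affine p q a) n = ((p * trunc a n + q) mod 2 ^ Z.of_nat n)%Z.
Proof.
apply trunc_testbits; intros i Hi; apply testbit_congr.
rewrite Zplus_mod, Zmult_mod.
rewrite <- (trunc_mod a (S i) n) at 1 by lia; rewrite Zmod_mod.
now rewrite <- Zmult_mod, <- Zplus_mod.
Qed.

Lemma trunc_inj a b : (forall n, trunc a n = trunc b n) -> a = b.
Proof.
intros H; apply functional_extensionality; intros n.
assert (E := H (S n)); rewrite !trunc_S, H in E; generalize (pow2_pos n).
destruct (a n), (b n); simpl Z.b2z in E; auto; lia.
Qed.

Lemma agree_trunc a b n : (forall m, (m < n)%nat -> a m = b m) <-> trunc a n = trunc b n.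
Proof.
induction n as [|n IH]; [simpl; split; auto; intros; lia|].
rewrite !trunc_S; split; intros H.
- rewrite H by lia; rewrite (proj1 IH); auto with arith.
- generalize (trunc_range a n) (trunc_range b n) (pow2_pos n); intros Ra Rb P2.
  assert (a n = b n) by (destruct (a n), (b n); simpl Z.b2z in *; auto; lia).
  intros i Hi; destruct (Nat.eq_dec i n) as [->|]; auto.
  apply IH; [|lia]; destruct (a n), (b n); simpl Z.b2z in *; lia.
Qed.

Lemma affine_comp p q p' q' a :
  dyadic_affine p q (dyadic_affine p' q' a) = dyadic_affine (p * p') (p * q' + q) a.
Proof.
apply trunc_inj; intros n; rewrite !trunc_affine.
rewrite Zplus_mod, Zmult_mod, Zmod_mod, <- Zmult_mod, <- Zplus_mod; f_equal; ring.
Qed.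

Lemma affine_id a : dyadic_affine 1 0 a = a.
Proof.
apply trunc_inj; intros n; rewrite trunc_affine.
rewrite Z.mod_small; generalize (trunc_range a n); lia.
Qed.

Lemma affine_of_Z p q m : dyadic_affine p q (dyadic_of_Z m) = dyadic_of_Z (p * m + q).
Proof.
apply trunc_inj; intros n; rewrite trunc_affine, !trunc_of_Z.
now rewrite Zplus_mod, Zmult_mod, Zmod_mod, <- Zmult_mod, <- Zplus_mod.
Qed.

(** Multiplication by 2^m makes 2-adic integers m digits closer. *)
Lemma agree_affine a b n m k : trunc a n = trunc b n ->
  trunc (dyadic_affine (2 ^ Z.of_nat m) k a) (m + n)
  = trunc (dyadic_affine (2 ^ Z.of_nat m) k b) (m + n).
Proof.
intros H; rewrite !trunc_affine.
assert (A : forall c, ((2 ^ Z.of_nat m * trunc c (m + n) + k) mod 2 ^ Z.of_nat (m + n)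
  = (2 ^ Z.of_nat m * trunc c n + k) mod 2 ^ Z.of_nat (m + n))%Z).
{ intros c; rewrite <- (trunc_mod c n (m + n)) by lia.
  rewrite Zplus_mod, (Zplus_mod (_ * (_ mod _))); do 2 f_equal.
  rewrite Nat2Z.inj_add, Z.pow_add_r by lia.
  rewrite Zmult_mod_distr_l, Zmult_mod_distr_l, Zmod_mod; reflexivity. }
now rewrite !A, H.
Qed.

Lemma holder_trunc s : dyadic_holder s -> exists c mu, 0 < c /\ 0 < mu < 1 /\
  forall n a b, trunc a n = trunc b n -> Rabs (s a - s b) <= c * mu ^ n.
Proof.
intros [c [mu [Hc [Hmu H]]]]; exists c, mu; repeat split; try lra.
intros n a b E; apply H; now apply agree_trunc.
Qed.

Lemma of_Z_close x n m : (m mod 2 ^ Z.of_nat n = trunc x n)%Z ->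
  trunc (dyadic_of_Z m) n = trunc x n.
Proof. intros H; now rewrite trunc_of_Z. Qed.

(** Adding 2^n to the truncation keeps the first n digits and makes it positive. *)
Definition approx (x : dyadic) n : positive := Z.to_pos (trunc x n + 2 ^ Z.of_nat n).

Lemma approx_eq x n : Z.pos (approx x n) = (trunc x n + 2 ^ Z.of_nat n)%Z.
Proof. apply Z2Pos.id; generalize (trunc_range x n) (pow2_pos n); lia. Qed.

Lemma approx_mod x n : (Z.pos (approx x n) mod 2 ^ Z.of_nat n = trunc x n)%Z.
Proof.
rewrite approx_eq, <- (Z.mul_1_l (2 ^ Z.of_nat n)) at 1.
rewrite Z_mod_plus_full; apply Z.mod_small, trunc_range.
Qed.

(** The positive integers are dense. *)
Lemma holder_eq s s' : dyadic_holder s -> dyadic_holder s' ->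
  (forall n : positive, s (dyadic_of_Z (Z.pos n)) = s' (dyadic_of_Z (Z.pos n))) ->
  ext_eq s s'.
Proof.
intros Hs Hs' E x.
apply holder_trunc in Hs; apply holder_trunc in Hs'.
destruct Hs as [c [mu [Hc [Hmu H]]]], Hs' as [c' [mu' [Hc' [Hmu' H']]]].
assert (L : is_lim_seq (fun n => s (dyadic_of_Z (Z.pos (approx x n)))) (s x)).
{ apply is_lim_seq_geometric with c mu 0%nat; auto; intros n _.
  apply H, of_Z_close, approx_mod. }
assert (L' : is_lim_seq (fun n => s (dyadic_of_Z (Z.pos (approx x n)))) (s' x)).
{ apply is_lim_seq_geometric with c' mu' 0%nat; auto; intros n _.
  rewrite E; apply H', of_Z_close, approx_mod. }
apply is_lim_seq_unique in L; apply is_lim_seq_unique in L'.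
rewrite L in L'; now injection L'.
Qed.

(** Without denominators, both sides are continuous in the four values, so that the
    equation passes to limits. *)
Lemma equation_clear a b c d : 0 < b -> 0 < c ->
  d = a / b * (1 + 1 / c) - 1 <-> (d + 1) * b * c = a * (c + 1).
Proof.
intros Hb Hc; split.
- intros ->; field; lra.
- intros H; apply (Rmult_eq_reg_r (b * c)); [|nra].
  apply Rplus_eq_reg_r with (b * c).
  replace (d * (b * c) + b * c) with ((d + 1) * b * c) by ring; rewrite H; field; lra.
Qed.

Lemma congr_of_divide n j k : (2 ^ Z.of_nat n | j - k)%Z ->
  (j mod 2 ^ Z.of_nat n = k mod 2 ^ Z.of_nat n)%Z.
Proof.
intros [t Ht]; replace j with (k + t * 2 ^ Z.of_nat n)%Z by lia.
apply Z_mod_plus_full.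
Qed.

Lemma divide_of_congr n j k : (j mod 2 ^ Z.of_nat n = k mod 2 ^ Z.of_nat n)%Z ->
  (2 ^ Z.of_nat n | j - k)%Z.
Proof.
intros H; apply Z.mod_divide; [generalize (pow2_pos n); lia|].
rewrite Zminus_mod, H, Z.sub_diag; apply Zmod_0_l.
Qed.

(** The values along the truncations of a 2-adic integer form a Cauchy sequence, and
    the functional equation passes to the limit.  The lower bound keeps the
    limit positive. *)
Lemma extend_solution (r : positive -> R) d c mu : 0 < d -> 0 < c -> 0 < mu < 1 ->
  (forall n, d <= r n) ->
  (forall i n m, (2 ^ Z.of_nat i | Z.pos n - Z.pos m)%Z -> Rabs (r n - r m) <= c * mu ^ i) ->
  (forall n, r (2 * n + 1)%positive
     = r n / r (2 * n)%positive * (1 + 1 / r (2 * n - 1)%positive) - 1) ->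
  exists s, dyadic_solution s /\ forall n, r n = s (dyadic_of_Z (Z.pos n)).
Proof.
intros Hd Hc Hmu Hr Hq HE.
assert (HK : 0 <= c / (1 - mu)).
{ apply Rmult_le_pos; [lra|]; left; apply Rinv_0_lt_compat; lra. }
assert (A : forall x, exists l : R,
  forall n, Rabs (l - r (approx x n)) <= c / (1 - mu) * mu ^ n).
{ intros x; destruct (cauchy_geometric (fun n => r (approx x n)) c mu 0) as [l [_ Hl]]; auto; try lra.
  - intros n _; apply Hq; rewrite !approx_eq, pow2_S, trunc_S.
    exists (1 + Z.b2z (x n))%Z; ring.
  - exists l; intros n; apply Hl; lia. }
apply (ClassicalEpsilon.choice (fun x l => _)) in A; destruct A as [s Hs].
set (K := c / (1 - mu) + c).
assert (Hclose : forall x n m, (Z.pos m mod 2 ^ Z.of_nat n = trunc x n)%Z ->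
  Rabs (r m - s x) <= K * mu ^ n).
{ intros x n m E; replace (r m - s x) with ((r m - r (approx x n)) - (s x - r (approx x n))) by ring.
  unfold Rminus at 1; eapply Rle_trans; [apply Rabs_triang|]; rewrite Rabs_Ropp; unfold K.
  assert (Rabs (r m - r (approx x n)) <= c * mu ^ n).
  { apply Hq, divide_of_congr; now rewrite approx_mod. }
  specialize (Hs x n); lra. }
assert (Hlim : forall x p q f, (0 < p)%Z ->
  (forall n, Z.pos (f n) = (p * Z.pos (approx x n) + q)%Z) ->
  is_lim_seq (fun n => r (f n)) (s (dyadic_affine p q x))).
{ intros x p q f Hp Hf; apply is_lim_seq_geometric with K mu 0%nat; auto; intros n _.
  apply Hclose; rewrite Hf, trunc_affine, <- (approx_mod x n).
  now rewrite (Zplus_mod (_ * (_ mod _))), Zmult_mod_idemp_r, <- Zplus_mod. }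
assert (Hpos : forall x, d <= s x).
{ intros x; assert (L := Hlim x 1%Z 0%Z (approx x) ltac:(lia) ltac:(intros; lia)).
  rewrite affine_id in L.
  apply (is_lim_seq_le (fun _ => d) (fun n => r (approx x n)) d (s x)); auto using is_lim_seq_const. }
exists s; split; [split; [|split]|].
- intros x; specialize (Hpos x); lra.
- exists (2 * K), mu; split; [unfold K; lra|]; split; [auto|].
  intros n a b E; apply agree_trunc in E.
  replace (s a - s b) with ((r (approx a n) - s b) - (r (approx a n) - s a)) by ring.
  unfold Rminus at 1; eapply Rle_trans; [apply Rabs_triang|]; rewrite Rabs_Ropp.
  assert (H1 := Hclose a n (approx a n) (approx_mod a n)).
  assert (H2 := Hclose b n (approx a n)); rewrite approx_mod in H2; specialize (H2 E); lra.
- intros x.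
  assert (P := Hpos (dyadic_affine 2 0 x)); assert (P' := Hpos (dyadic_affine 2 (-1) x)).
  apply equation_clear; try lra.
  assert (L1 := Hlim x 2%Z 1%Z (fun n => (2 * approx x n + 1)%positive) ltac:(lia) ltac:(intros; cbv beta; lia)).
  assert (L2 := Hlim x 2%Z 0%Z (fun n => (2 * approx x n)%positive) ltac:(lia) ltac:(intros; cbv beta; lia)).
  assert (L3 := Hlim x 2%Z (-1)%Z (fun n => (2 * approx x n - 1)%positive) ltac:(lia) ltac:(intros; cbv beta; lia)).
  assert (L0 := Hlim x 1%Z 0%Z (approx x) ltac:(lia) ltac:(intros; cbv beta; lia)); rewrite affine_id in L0.
  assert (LL := is_lim_seq_mult' _ _ _ _ (is_lim_seq_mult' _ _ _ _
     (is_lim_seq_plus' _ _ _ _ L1 (is_lim_seq_const 1)) L2) L3).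
  assert (LR := is_lim_seq_mult' _ _ _ _ L0 (is_lim_seq_plus' _ _ _ _ L3 (is_lim_seq_const 1))).
  apply (is_lim_seq_ext _ (fun n => r (approx x n) * (r (2 * approx x n - 1)%positive + 1))) in LL.
  + apply is_lim_seq_unique in LL; apply is_lim_seq_unique in LR.
    rewrite LL in LR; now injection LR.
  + intros n; apply equation_clear; auto.
    * specialize (Hr (2 * approx x n)%positive); lra.
    * specialize (Hr (2 * approx x n - 1)%positive); lra.
- intros n; apply Rminus_diag_uniq.
  assert (L : is_lim_seq (fun _ : nat => r n) (s (dyadic_of_Z (Z.pos n)))).
  { apply is_lim_seq_geometric with K mu 0%nat; auto; intros k _.
    apply Hclose; now rewrite trunc_of_Z. }
  apply is_lim_seq_unique in L; rewrite Lim_seq_const in L; injection L; lra.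
Qed.

(** Compactness of the Cantor set, by walking down the tree of cylinders on
    which the function is not bounded away from zero. *)
Lemma holder_lower_bound s : (forall x, 0 < s x) -> dyadic_holder s ->
  exists d, 0 < d /\ forall x, d <= s x.
Proof.
intros Hp Hh; apply holder_trunc in Hh; destruct Hh as [c [mu [Hc [Hmu H]]]].
apply NNPP; intros Hn.
set (bad := fun z n => forall d, 0 < d -> exists b, trunc b n = z /\ s b < d).
assert (B0 : bad 0%Z 0%nat).
{ intros d Hd; apply NNPP; intros Hn'; apply Hn; exists d; split; auto.
  intros x; apply Rnot_lt_le; intros Hlt; apply Hn'; now exists x. }
assert (BS : forall z n, bad z n -> ~ bad (z + 2 ^ Z.of_nat n)%Z (S n) -> bad z (S n)).
{ intros z n Hb Hnb d Hd; unfold bad in Hnb; apply not_all_ex_not in Hnb.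
  destruct Hnb as [d' Hd']; apply imply_to_and in Hd'; destruct Hd' as [Hd' Hd''].
  destruct (Hb (Rmin d d')) as [b [Eb Sb]]; [now apply Rmin_pos|].
  exists b; split; [|now apply Rlt_le_trans with (1 := Sb), Rmin_l].
  rewrite trunc_S, Eb; destruct (b n) eqn:Ebn; simpl Z.b2z; [|lia].
  exfalso; apply Hd''; exists b; split; [|now apply Rlt_le_trans with (1 := Sb), Rmin_r].
  rewrite trunc_S, Eb, Ebn; simpl Z.b2z; lia. }
set (dec := fun z n => if excluded_middle_informative (bad (z + 2 ^ Z.of_nat n)%Z (S n))
                       then true else false).
set (z := fix z n := match n with
  | O => 0%Z | S k => (z k + Z.b2z (dec (z k) k) * 2 ^ Z.of_nat k)%Z end).
assert (Hz : forall n, trunc (fun k => dec (z k) k) n = z n).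
{ induction n as [|n IH]; [reflexivity|]; rewrite trunc_S, IH; reflexivity. }
assert (Hb : forall n, bad (z n) n).
{ induction n as [|n IH]; [exact B0|]; simpl; unfold dec.
  destruct excluded_middle_informative as [Hb|Hb]; simpl Z.b2z.
  - now rewrite Z.mul_1_l.
  - rewrite Z.mul_0_l, Z.add_0_r; now apply BS. }
set (x := fun k => dec (z k) k) in *.
destruct (pow_small mu (s x / 2 / c)) as [n Hnn]; auto.
{ specialize (Hp x); apply Rdiv_lt_0_compat; lra. }
destruct (Hb n (s x / 2)) as [b [Eb Sb]]; [specialize (Hp x); lra|].
assert (Hxb : Rabs (s x - s b) <= c * mu ^ n) by (apply H; now rewrite Eb, Hz).
apply (Rmult_lt_compat_l c) in Hnn; auto.
replace (c * (s x / 2 / c)) with (s x / 2) in Hnn by (field; lra).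
generalize (Rle_abs (s x - s b)); lra.
Qed.

Lemma solution_bounds s : dyadic_solution s -> exists B c mu, 1 < B /\ 0 < c /\ 0 < mu < 1 /\
  (forall x, / B <= s x <= B) /\
  (forall n a b, trunc a n = trunc b n ->
     Rabs (s a - s b) <= c * mu ^ n /\ Rabs (ln (s a) - ln (s b)) <= c * mu ^ n).
Proof.
intros [Hp [Hh _]]; destruct (holder_lower_bound s Hp Hh) as [d [Hd Hlow]].
apply holder_trunc in Hh; destruct Hh as [c [mu [Hc [Hmu H]]]].
set (s0 := s (fun _ => true)).
assert (Hup : forall x, s x <= s0 + c).
{ intros x; assert (E := H 0%nat x (fun _ => true) eq_refl); simpl in E.
  generalize (Rle_abs (s x - s (fun _ : nat => true))); unfold s0; lra. }
assert (0 < s0) by apply Hp.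
assert (0 < / d) by now apply Rinv_0_lt_compat.
exists (1 + s0 + c + / d), (c + c / d), mu; repeat split; try lra.
- apply Rplus_lt_0_compat; [lra|]; apply Rdiv_lt_0_compat; lra.
- apply Rle_trans with d; [|apply Hlow].
  rewrite <- (Rinv_inv d) at 2; apply Rinv_le_contravar; lra.
- specialize (Hup x); lra.
- eapply Rle_trans; [apply H; eassumption|].
  apply Rmult_le_compat_r; [left; apply pow_lt; lra|].
  assert (0 < c / d) by (apply Rdiv_lt_0_compat; lra); lra.
- eapply Rle_trans; [apply (ln_lipschitz d); auto|].
  apply Rle_trans with (c * mu ^ n / d).
  + apply Rmult_le_compat_r; [lra|]; now apply H.
  + replace (c * mu ^ n / d) with (c / d * mu ^ n) by (field; lra).
    apply Rmult_le_compat_r; [left; apply pow_lt; lra|lra].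
Qed.

(** * Functions on the 2-adic integers and sequences *)

(** Restriction to the positive integers is injective by density.  For a sequence of
    A(2), condition (i) with i = 0 bounds the values away from zero and
    infinity; this is what the extension needs. *)
Lemma functions_sequences :
  canonical_bijection dyadic_solution ext_eq inA2 ext_eq function_to_sequence.
Proof.
split; [|split].
- intros s Hs; exists (fun n => s (dyadic_of_Z (Z.pos n))); split; [|intros n; reflexivity].
  destruct (solution_bounds s Hs) as [B [c [mu [HB [Hc [Hmu [Hb H]]]]]]].
  destruct Hs as [Hp [_ HE]].
  split; [intros; apply Hp|split].
  + exists c, mu; repeat split; try lra; intros i n m Hd.
    rewrite ln_div by apply Hp; apply H.
    rewrite !trunc_of_Z; now apply congr_of_divide.
  + intros n; assert (E := HE (dyadic_of_Z (Z.pos n))); rewrite !affine_of_Z in E.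
    replace (Z.pos (2 * n + 1)) with (2 * Z.pos n + 1)%Z by lia.
    replace (Z.pos (2 * n)) with (2 * Z.pos n + 0)%Z by lia.
    replace (Z.pos (2 * n - 1)) with (2 * Z.pos n + -1)%Z by lia.
    exact E.
- intros s s' a a' [_ [Hs _]] [_ [Hs' _]] _ _ R R'; split; intros E.
  + intros n; rewrite (R n), (R' n); apply E.
  + apply holder_eq; auto; intros n; rewrite <- (R n), <- (R' n); apply E.
- intros a [Hp [[c [mu [Hc [Hmu H]]]] HE]].
  set (M := ln (a 1%positive) + c).
  assert (Hb : forall n, Rabs (ln (a n) - ln (a 1%positive)) <= c).
  { intros n; rewrite <- ln_div by apply Hp.
    assert (H0 := H 0%nat n 1%positive); simpl in H0; rewrite Rmult_1_r in H0; apply H0.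
    apply Z.divide_1_l. }
  destruct (extend_solution a (exp (ln (a 1%positive) - c)) (exp M * c) mu) as [s [Hs E]]; auto.
  + apply exp_pos.
  + apply Rmult_lt_0_compat; auto using exp_pos.
  + intros n; specialize (Hb n); apply Rabs_le_between in Hb.
    rewrite <- (exp_ln (a n)) by apply Hp; apply exp_mono; lra.
  + intros i n m Hd; rewrite <- (exp_ln (a n)), <- (exp_ln (a m)) by apply Hp.
    eapply Rle_trans; [apply (exp_lipschitz M)|].
    * specialize (Hb n); apply Rabs_le_between in Hb; unfold M; lra.
    * specialize (Hb m); apply Rabs_le_between in Hb; unfold M; lra.
    * rewrite Rmult_assoc; apply Rmult_le_compat_l; [left; apply exp_pos|].
      rewrite <- ln_div by apply Hp; now apply H.
  + exists s; split; auto.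
Qed.

(** * Affine charts of the leaves, as functions on the line *)

Definition dy (m : nat) (k : Z) := IZR k * (/ 2) ^ m.

Definition tile (F : R -> R) m k := F (dy m (k + 1)) - F (dy m k).

(** The law of the ratios of adjacent tiles on the leaf of a.  Tiles of level m are
    scaled to unit tiles by the m-th iterate of the solenoid map, which moves
    a to 2^m a; unit tiles at the point a + k have ratio s (a + k). *)
Definition tile_law (s : dyadic -> R) (a : dyadic) (F : R -> R) :=
  forall m k, tile F m k = s (dyadic_affine (2 ^ Z.of_nat m) k a) * tile F m (k - 1).

(** [F] is an affine chart of the leaf of a, read in the leaf parameter. *)
Definition adapted (s : dyadic -> R) (a : dyadic) (F : R -> R) :=
  (forall x y, x < y -> F x < F y) /\ continuity F /\ tile_law s a F.

Lemma dy_double m k : dy (S m) (2 * k) = dy m k.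
Proof. unfold dy; rewrite mult_IZR; simpl; field. Qed.

Lemma dy_succ m k : dy m (k + 1) = dy m k + (/ 2) ^ m.
Proof. unfold dy; rewrite plus_IZR; ring. Qed.

Lemma dy_lt m j k : dy m j < dy m k <-> (j < k)%Z.
Proof.
unfold dy; generalize (half_pow_pos m); intros H; split; intros Hjk.
- apply lt_IZR; apply Rmult_lt_reg_r in Hjk; auto.
- apply Rmult_lt_compat_r; auto; now apply IZR_lt.
Qed.

Lemma dy_le m j k : dy m j <= dy m k <-> (j <= k)%Z.
Proof.
rewrite Z.le_ngt, <- (dy_lt m); split; intros H; [apply Rle_not_lt|apply Rnot_lt_le]; auto.
Qed.

Lemma dy_pow m i k : dy (i + m) (2 ^ Z.of_nat i * k) = dy m k.
Proof.
unfold dy; rewrite mult_IZR, <- pow_IZR, pow_add, half_pow_inv; simpl.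
field; apply pow_nonzero; lra.
Qed.

Lemma dy_floor m x : exists k, dy m k <= x < dy m (k + 1).
Proof.
destruct (floor_ex (x * 2 ^ m)) as [k Hk]; exists k.
rewrite dy_succ; unfold dy; rewrite half_pow_inv.
assert (H : 0 < / 2 ^ m) by (apply Rinv_0_lt_compat, pow_lt; lra).
assert (E : x = x * 2 ^ m * / 2 ^ m) by (field; apply pow_nonzero; lra).
split; rewrite E at 1; nra.
Qed.

Lemma dyadic_dense x y : x < y -> exists m k, x < dy m k /\ dy m (k + 1) < y.
Proof.
intros Hxy; destruct (pow_small (/ 2) ((y - x) / 3)) as [m Hm]; [lra..|].
destruct (dy_floor m x) as [k Hk]; exists m, (k + 1)%Z.
rewrite !dy_succ in *; lra.
Qed.

(** Continuity reduces inequalities to dyadic points. *)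
Lemma dyadic_monotone H p q : continuity H ->
  (forall m k, p <= dy m k -> dy m (k + 1) <= q -> H (dy m k) <= H (dy m (k + 1))) ->
  forall x y, p < x -> x <= y -> y < q -> H x <= H y.
Proof.
intros HC HT x y Hx Hxy Hy.
assert (A : forall m j i, (j <= i)%Z -> p <= dy m j -> dy m i <= q -> H (dy m j) <= H (dy m i)).
{ intros m j i Hji; pattern i; apply Zlt_lower_bound_ind with (z := j); auto.
  intros k IH Hk Hp Hq; destruct (Z.eq_dec k j) as [->|Hn]; [lra|].
  assert (dy m (k - 1) <= dy m k) by (apply dy_le; lia).
  apply Rle_trans with (H (dy m (k - 1))); [apply IH; auto; [lia|lra]|].
  replace k with (k - 1 + 1)%Z at 2 by ring; apply HT.
  - apply Rle_trans with (1 := Hp); apply dy_le; lia.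
  - now replace (k - 1 + 1)%Z with k by ring. }
destruct (ClassicalEpsilon.choice _ (fun m : nat => dy_floor m x)) as [fx Hfx].
destruct (ClassicalEpsilon.choice _ (fun m : nat => dy_floor m y)) as [fy Hfy].
assert (L : forall z f, (forall m, dy m (f m) <= z < dy m (f m + 1)) ->
  is_lim_seq (fun m => H (dy m (f m))) (H z)).
{ intros z f Hf; apply is_lim_seq_continuous; [apply HC|].
  apply is_lim_seq_geometric with 1 (/ 2) 0%nat; [lra|]; intros n _.
  specialize (Hf n); rewrite dy_succ in Hf; rewrite Rabs_minus_sym, Rabs_pos_eq; lra. }
apply (is_lim_seq_le_loc (fun m => H (dy m (fx m))) (fun m => H (dy m (fy m))) (H x) (H y));
  auto.
destruct (pow_small (/ 2) (x - p)) as [N HN]; [lra..|].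
exists N; intros m Hm.
assert ((/ 2) ^ m <= (/ 2) ^ N) by (apply pow_decr; [lra|auto]).
specialize (Hfx m); specialize (Hfy m); rewrite dy_succ in Hfx.
apply A; try lra.
apply Z.lt_succ_r; rewrite <- Z.add_1_r; apply (dy_lt m); lra.
Qed.

Lemma tile_pos F m k : (forall x y, x < y -> F x < F y) -> 0 < tile F m k.
Proof.
intros H; assert (F (dy m k) < F (dy m (k + 1))) by (apply H, dy_lt; lia).
unfold tile; lra.
Qed.

Lemma tile_split F m k : tile F m k = tile F (S m) (2 * k) + tile F (S m) (2 * k + 1).
Proof.
unfold tile; rewrite dy_double; replace (2 * k + 1 + 1)%Z with (2 * (k + 1))%Z by ring.
rewrite dy_double; ring.
Qed.

Lemma adapted_pos s a F m k : adapted s a F -> 0 < tile F m k.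
Proof. intros [H _]; now apply tile_pos. Qed.

Lemma tile_law_halves s a F m k : (forall x, 0 < s x) -> tile_law s a F ->
  let r := s (dyadic_affine (2 ^ Z.of_nat (S m)) (2 * k + 1) a) in
  tile F (S m) (2 * k) = tile F m k / (1 + r) /\
  tile F (S m) (2 * k + 1) = r * (tile F m k / (1 + r)).
Proof.
intros Hs H r; specialize (H (S m) (2 * k + 1)%Z); fold r in H.
replace (2 * k + 1 - 1)%Z with (2 * k)%Z in H by ring.
rewrite (tile_split F m k), H; assert (0 < r) by apply Hs.
split; field; lra.
Qed.

Lemma Z_two_sided (P : Z -> Prop) : P 0%Z -> (forall k, P k <-> P (k + 1)%Z) -> forall k, P k.
Proof.
intros H0 HS; apply Z.bi_induction; [intros x y ->; tauto|exact H0|].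
intros k; rewrite <- Z.add_1_r; apply HS.
Qed.

Lemma Z_recursion (h h' : Z -> R -> R) x0 : (forall k x, h k (h' k x) = x) ->
  exists f : Z -> R, f 0%Z = x0 /\ forall k, f (k + 1)%Z = h k (f k).
Proof.
intros Hh.
set (u := fix u n := match n with O => x0 | S i => h (Z.of_nat i) (u i) end).
set (d := fix d n := match n with O => x0 | S i => h' (- Z.of_nat (S i))%Z (d i) end).
exists (fun k => if Z.leb 0 k then u (Z.to_nat k) else d (Z.to_nat (- k))).
split; [reflexivity|]; intros k.
destruct (Z.leb_spec 0 k) as [Hk|Hk].
- replace (Z.leb 0 (k + 1)) with true by (symmetry; apply Z.leb_le; lia).
  replace (Z.to_nat (k + 1)) with (S (Z.to_nat k)) by lia.
  simpl; f_equal; lia.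
- destruct (Z.eq_dec k (-1)) as [->|Hn].
  + simpl; now rewrite Hh.
  + replace (Z.leb 0 (k + 1)) with false by (symmetry; apply Z.leb_gt; lia).
    replace (Z.to_nat (- k)) with (S (Z.to_nat (- (k + 1)))) by lia.
    simpl d; rewrite <- (Hh k (d (Z.to_nat (- (k + 1))))) at 1.
    do 2 f_equal; lia.
Qed.

Lemma geometric_unique (g w w' : Z -> R) : (forall k, g k <> 0) ->
  (forall k, w (k + 1)%Z = g k * w k) -> (forall k, w' (k + 1)%Z = g k * w' k) ->
  forall k, w' k * w 0%Z = w 0%Z * w' k /\ w' k * w 0%Z = w' 0%Z * w k.
Proof.
intros Hg H H' k; split; [ring|]; revert k; apply Z_two_sided; [ring|]; intros k.
rewrite H, H'; split; intros E.
- replace (g k * w' k * w 0%Z) with (g k * (w' k * w 0%Z)) by ring; rewrite E; ring.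
- apply (Rmult_eq_reg_l (g k)); auto.
  replace (g k * (w' k * w 0%Z)) with (g k * w' k * w 0%Z) by ring; rewrite E; ring.
Qed.

(** The values at dyadic points of an affine chart.  The functional equation says
    precisely that, for the ratios of level m + 1, the unions of two tiles
    have the ratios of level m. *)
Lemma dyadic_positions s a : dyadic_solution s -> exists P : nat -> Z -> R,
  P 0%nat 0%Z = 0 /\
  (forall m k, P (S m) (2 * k)%Z = P m k) /\
  (forall m k, P m k < P m (k + 1)%Z) /\
  (forall m k, P m (k + 1)%Z - P m k
    = s (dyadic_affine (2 ^ Z.of_nat m) k a) * (P m k - P m (k - 1)%Z)).
Proof.
intros [Hs [_ HE]].
set (g := fun m k => s (dyadic_affine (2 ^ Z.of_nat m) k a)).
assert (Hg : forall m k, 0 < g m k) by (intros; apply Hs).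
assert (GE : forall m k, (g (S m) (2 * k + 1)%Z + 1) * g (S m) (2 * k)%Z * g (S m) (2 * k - 1)%Z
   = g m k * (g (S m) (2 * k - 1)%Z + 1)).
{ intros m k; apply equation_clear; auto.
  specialize (HE (dyadic_affine (2 ^ Z.of_nat m) k a)); rewrite !affine_comp in HE.
  unfold g; rewrite pow2_S.
  now replace (2 * k)%Z with (2 * k + 0)%Z at 2 by ring. }
assert (HL : forall m, exists w : Z -> R, w 0%Z = 1 /\ forall k, w (k + 1)%Z = g m (k + 1)%Z * w k).
{ intros m; apply (Z_recursion (fun k x => g m (k + 1)%Z * x) (fun k x => x / g m (k + 1)%Z)).
  intros k x; specialize (Hg m (k + 1)%Z); field; lra. }
apply ClassicalEpsilon.choice in HL; destruct HL as [w Hw].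
assert (Hwp : forall m k, 0 < w m k).
{ intros m; apply Z_two_sided; [rewrite (proj1 (Hw m)); lra|]; intros k.
  rewrite (proj2 (Hw m)); specialize (Hg m (k + 1)%Z); split; intros H.
  - now apply Rmult_lt_0_compat.
  - apply (Rmult_lt_reg_l (g m (k + 1)%Z)); auto; lra. }
assert (HP : forall m, exists L : Z -> R, L 0%Z = 0 /\ forall k, L (k + 1)%Z = L k + w m k).
{ intros m; apply (Z_recursion (fun k x => x + w m k) (fun k x => x - w m k)).
  intros; ring. }
apply ClassicalEpsilon.choice in HP; destruct HP as [L HL].
set (kap := fun m => w (S m) 0%Z + w (S m) 1%Z).
assert (Hk : forall m, 0 < kap m).
{ intros m; generalize (Hwp (S m) 0%Z) (Hwp (S m) 1%Z); unfold kap; lra. }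
assert (Hamal : forall m k, w (S m) (2 * k)%Z + w (S m) (2 * k + 1)%Z = kap m * w m k).
{ intros m k.
  destruct (geometric_unique (fun k => g m (k + 1)%Z) (w m)
    (fun k => w (S m) (2 * k)%Z + w (S m) (2 * k + 1)%Z)) with (k := k) as [_ E].
  - intros; apply Rgt_not_eq, Hg.
  - apply Hw.
  - intros j; destruct (Hw (S m)) as [_ HwS].
    assert (E1 := HwS (2 * j)%Z).
    assert (E2 := HwS (2 * j + 1)%Z); assert (E3 := HwS (2 * (j + 1))%Z).
    replace (2 * j + 1 + 1)%Z with (2 * (j + 1))%Z in E2 by ring.
    assert (G := GE m (j + 1)%Z).
    replace (2 * (j + 1) - 1)%Z with (2 * j + 1)%Z in G by ring.
    rewrite E3, E2, E1.
    replace (g (S m) (2 * (j + 1))%Z * (g (S m) (2 * j + 1)%Z * w (S m) (2 * j)%Z) +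
      g (S m) (2 * (j + 1) + 1)%Z * (g (S m) (2 * (j + 1))%Z * (g (S m) (2 * j + 1)%Z * w (S m) (2 * j)%Z)))
      with ((g (S m) (2 * (j + 1) + 1)%Z + 1) * g (S m) (2 * (j + 1))%Z * g (S m) (2 * j + 1)%Z * w (S m) (2 * j)%Z)
      by ring.
    rewrite G; ring.
  - simpl in E; rewrite (proj1 (Hw m)) in E; unfold kap; rewrite Rmult_1_r in E; exact E. }
assert (HLL : forall m k, L (S m) (2 * k)%Z = kap m * L m k).
{ intros m; apply Z_two_sided; [simpl; rewrite !(proj1 (HL _)); ring|]; intros k.
  replace (2 * (k + 1))%Z with (2 * k + 1 + 1)%Z by ring.
  rewrite !(proj2 (HL _)); specialize (Hamal m k); split; intros E; lra. }
set (c := fix c m := match m with O => 1 | S i => c i / kap i end).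
assert (Hc : forall m, 0 < c m).
{ induction m as [|m IH]; simpl; [lra|]; apply Rdiv_lt_0_compat; auto. }
exists (fun m k => c m * L m k); split; [|split; [|split]].
- rewrite (proj1 (HL _)); ring.
- intros m k; rewrite HLL; simpl; field; apply Rgt_not_eq, Hk.
- intros m k; rewrite (proj2 (HL m)); specialize (Hc m); specialize (Hwp m k); nra.
- intros m k; rewrite (proj2 (HL m)).
  replace (L m k) with (L m (k - 1)%Z + w m (k - 1)%Z)
    by (rewrite <- (proj2 (HL m)); f_equal; ring).
  replace (w m k) with (g m k * w m (k - 1)%Z)
    by (generalize (proj2 (Hw m) (k - 1)%Z); replace (k - 1 + 1)%Z with k by ring; intros ->; ring).
  fold (g m k); ring.
Qed.

(** The chart is the supremum of the positions of the dyadic points to the left.  It is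
    continuous because a tile exceeds its halves by a factor bounded away
    from 1, so that the tiles around a point shrink to zero. *)
Lemma adapted_exists s a : dyadic_solution s -> exists F, adapted s a F /\ F 0 = 0.
Proof.
intros Hs; destruct (solution_bounds s Hs) as [B [_ [_ [HB [_ [_ [Hb _]]]]]]].
destruct (dyadic_positions s a Hs) as [P [P0 [PD [PI PR]]]].
assert (Pinc : forall m j k, (j <= k)%Z -> P m j <= P m k).
{ intros m j k Hjk; pattern k; apply Zlt_lower_bound_ind with (z := j); auto.
  intros i IH Hi; destruct (Z.eq_dec i j) as [->|Hn]; [lra|].
  apply Rle_trans with (P m (i - 1)%Z); [apply IH; lia|].
  left; replace i with (i - 1 + 1)%Z at 2 by ring; apply PI. }
assert (PP : forall i m k, P (i + m)%nat (2 ^ Z.of_nat i * k)%Z = P m k).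
{ induction i as [|i IH]; intros m k; [simpl; now destruct k|].
  rewrite pow2_S, <- Z.mul_assoc; simpl Nat.add; rewrite PD; apply IH. }
assert (Pord : forall m j m' k, dy m j <= dy m' k -> P m j <= P m' k).
{ intros m j m' k H; rewrite <- (PP m' m j), <- (PP m m' k), (Nat.add_comm m' m).
  apply Pinc, (dy_le (m + m')); rewrite dy_pow; rewrite (Nat.add_comm m m'), dy_pow; exact H. }
assert (HF : forall x, exists l, is_lub (fun y => exists m k, dy m k <= x /\ y = P m k) l).
{ intros x; destruct (completeness (fun y => exists m k, dy m k <= x /\ y = P m k)) as [l Hl].
  - destruct (dy_floor 0 x) as [k Hk]; exists (P 0%nat (k + 1)%Z); intros y [m [j [Hj ->]]].
    apply Pord; lra.
  - destruct (dy_floor 0 x) as [k Hk]; exists (P 0%nat k), 0%nat, k; split; [lra|auto].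
  - now exists l. }
apply ClassicalEpsilon.choice in HF; destruct HF as [F HF].
assert (Flow : forall x m k, dy m k <= x -> P m k <= F x).
{ intros x m k H; apply (proj1 (HF x)); now exists m, k. }
assert (Fup : forall x m k, x <= dy m k -> F x <= P m k).
{ intros x m k H; apply (proj2 (HF x)); intros y [m' [j [Hj ->]]]; apply Pord; lra. }
assert (Fdy : forall m k, F (dy m k) = P m k).
{ intros m k; apply Rle_antisym; [apply Fup|apply Flow]; lra. }
exists F; split; [split; [|split]|].
- intros x y Hxy; destruct (dyadic_dense x y Hxy) as [m [k [Hk Hk']]].
  apply Rle_lt_trans with (P m k); [apply Fup; lra|].
  apply Rlt_le_trans with (1 := PI m k); apply Flow; lra.
- intros x e He.
  set (rho := B / (1 + B)).
  assert (Hrho : 0 < rho < 1).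
  { unfold rho; split; [apply Rdiv_lt_0_compat; lra|].
    apply (Rmult_lt_reg_r (1 + B)); [lra|]; replace (B / (1 + B) * (1 + B)) with B by (field; lra); lra. }
  destruct (dy_floor 0 x) as [k0 Hk0].
  set (T := P 0%nat (k0 + 1)%Z - P 0%nat k0).
  assert (HT : 0 < T) by (generalize (PI 0%nat k0); unfold T; lra).
  assert (Hshrink : forall m, exists k, dy m k <= x < dy m (k + 1) /\
    P m (k + 1)%Z - P m k <= rho ^ m * T).
  { induction m as [|m [k [Hk IH]]]; [exists k0; split; auto; simpl; unfold T; lra|].
    assert (E := PR (S m) (2 * k + 1)%Z).
    set (r := s _) in E; assert (Hr : / B <= r <= B) by apply Hb.
    assert (HBi : 0 < / B) by (apply Rinv_0_lt_compat; lra).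
    replace (2 * k + 1 + 1)%Z with (2 * (k + 1))%Z in E by ring.
    replace (2 * k + 1 - 1)%Z with (2 * k)%Z in E by ring.
    rewrite !PD in E.
    set (y := P (S m) (2 * k + 1)%Z) in E.
    assert (Hy : P m k < y).
    { unfold y; rewrite <- PD; apply PI. }
    assert (A : y - P m k <= rho * (P m (k + 1)%Z - P m k)).
    { unfold rho; apply (Rmult_le_reg_r (1 + B)); [lra|].
      replace (B / (1 + B) * (P m (k + 1)%Z - P m k) * (1 + B))
        with (B * (P m (k + 1)%Z - P m k)) by (field; lra).
      assert (1 <= B * r); [|nra].
      apply (Rmult_le_reg_l (/ B)); auto; rewrite <- Rmult_assoc, Rinv_l by lra; lra. }
    assert (A' : P m (k + 1)%Z - y <= rho * (P m (k + 1)%Z - P m k)).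
    { unfold rho; apply (Rmult_le_reg_r (1 + B)); [lra|].
      replace (B / (1 + B) * (P m (k + 1)%Z - P m k) * (1 + B))
        with (B * (P m (k + 1)%Z - P m k)) by (field; lra).
      nra. }
    destruct (Rlt_le_dec x (dy (S m) (2 * k + 1))) as [Hx|Hx].
    - exists (2 * k)%Z; split; [rewrite dy_double; lra|].
      rewrite PD; fold y; simpl; nra.
    - exists (2 * k + 1)%Z; replace (2 * k + 1 + 1)%Z with (2 * (k + 1))%Z by ring.
      split; [rewrite dy_double; lra|]; rewrite PD; fold y; simpl; nra. }
  destruct (pow_small rho (e / ((1 + 2 * B) * T))) as [m Hm]; auto.
  { apply Rdiv_lt_0_compat; auto; apply Rmult_lt_0_compat; lra. }
  destruct (Hshrink m) as [k [Hk Hkk]].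
  exists ((/ 2) ^ m); split; [apply half_pow_pos|]; intros y [_ Hy]; simpl in *; unfold Rdist in *.
  apply Rabs_def2 in Hy.
  assert (H1 := PR m (k + 1)%Z); replace (k + 1 - 1)%Z with k in H1 by ring.
  assert (H0 := PR m k).
  set (r1 := s _) in H1; assert (Hr1 : / B <= r1 <= B) by apply Hb.
  set (r0 := s _) in H0; assert (Hr0 : / B <= r0 <= B) by apply Hb.
  assert (HBi : 0 < / B) by (apply Rinv_0_lt_compat; lra).
  assert (HBr : 1 <= B * r0).
  { apply (Rmult_le_reg_l (/ B)); auto; rewrite <- Rmult_assoc, Rinv_l by lra; lra. }
  assert (HI := PI m (k - 1)%Z); replace (k - 1 + 1)%Z with k in HI by ring.
  assert (HI' := PI m k).
  assert (U1 : P m (k + 1 + 1)%Z - P m (k + 1)%Z <= B * (P m (k + 1)%Z - P m k)) by nra.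
  assert (U0 : P m k - P m (k - 1)%Z <= B * (P m (k + 1)%Z - P m k)) by nra.
  rewrite dy_succ in Hk.
  assert (Eq1 := dy_succ m (k + 1)); assert (Eq0 := dy_succ m k).
  assert (Em := dy_succ m (k - 1)); replace (k - 1 + 1)%Z with k in Em by ring.
  assert (F x <= P m (k + 1)%Z) by (apply Fup; lra).
  assert (P m k <= F x) by (apply Flow; lra).
  assert (F y <= P m (k + 1 + 1)%Z) by (apply Fup; lra).
  assert (P m (k - 1)%Z <= F y) by (apply Flow; lra).
  apply (Rmult_lt_compat_r ((1 + 2 * B) * T)) in Hm; [|apply Rmult_lt_0_compat; lra].
  replace (e / ((1 + 2 * B) * T) * ((1 + 2 * B) * T)) with e in Hm
    by (field; split; lra).
  apply Rabs_def1; nra.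
- intros m k; unfold tile; replace (k - 1 + 1)%Z with k by ring; rewrite !Fdy; apply PR.
- replace 0 with (dy 0 0) at 1 by (unfold dy; ring); now rewrite Fdy.
Qed.

(** The tile law determines an increasing function up to an affine map: it
    determines all dyadic tiles from one unit tile, and the dyadic points
    are dense. *)
Lemma tile_law_unique s a F G : (forall x, 0 < s x) -> adapted s a F ->
  (forall x y, x < y -> G x < G y) -> tile_law s a G ->
  exists A B, 0 < A /\ forall x, G x = A * F x + B.
Proof.
intros Hs [HFI [HFC HF]] HGI HG.
assert (HT0 : 0 < tile F 0 0) by now apply tile_pos.
set (A := tile G 0 0 / tile F 0 0).
assert (HA : 0 < A) by (apply Rdiv_lt_0_compat; auto; now apply tile_pos).
assert (HT : forall m k, tile G m k = A * tile F m k).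
{ induction m as [|m IH].
  - apply Z_two_sided.
    + unfold A; field; lra.
    + intros k; specialize (HF 0%nat (k + 1)%Z); specialize (HG 0%nat (k + 1)%Z).
      replace (k + 1 - 1)%Z with k in * by ring; rewrite HF, HG.
      set (r := s _); assert (0 < r) by apply Hs; split; intros E.
      * rewrite E; ring.
      * apply (Rmult_eq_reg_l r); lra.
  - intros k; destruct (Z.Even_or_Odd k) as [[j ->]|[j ->]];
      destruct (tile_law_halves s a F m j Hs HF) as [F0 F1];
      destruct (tile_law_halves s a G m j Hs HG) as [G0 G1];
      set (r := s _) in *; assert (0 < r) by apply Hs.
    + rewrite F0, G0, IH; field; lra.
    + rewrite F1, G1, IH; field; lra. }
set (B := G 0 - A * F 0); exists A, B; split; auto.
assert (Hdy : forall m k, G (dy m k) = A * F (dy m k) + B).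
{ intros m; apply Z_two_sided.
  - replace (dy m 0) with 0 by (unfold dy; ring); unfold B; ring.
  - intros k; specialize (HT m k); unfold tile in HT; split; intros; lra. }
assert (HC : forall x e, 0 < e -> exists d, 0 < d /\ forall y, Rabs (y - x) < d -> A * Rabs (F y - F x) < e).
{ intros x e He; destruct (HFC x (e / A)) as [d [Hd H]]; [now apply Rdiv_lt_0_compat|].
  exists d; split; auto; intros y Hy; destruct (Req_dec x y) as [->|Hne].
  - rewrite Rminus_diag, Rabs_R0; lra.
  - apply (Rmult_lt_reg_l (/ A)); [now apply Rinv_0_lt_compat|].
    rewrite <- Rmult_assoc, Rinv_l, Rmult_1_l by lra; rewrite Rmult_comm.
    apply H; repeat split; auto. }
intros x; apply Rle_antisym; apply Rnot_lt_le; intros Hlt.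
- destruct (HC x (G x - (A * F x + B))) as [d [Hd H]]; [lra|].
  destruct (dyadic_dense x (x + d / 2)) as [m [k [K1 K2]]]; [lra|]; rewrite dy_succ in K2.
  assert (Pm := half_pow_pos m); assert (L := HGI _ _ K1); rewrite Hdy in L.
  assert (L' := H (dy m k) ltac:(apply Rabs_def1; lra)).
  generalize (Rle_abs (F (dy m k) - F x)); nra.
- destruct (HC x (A * F x + B - G x)) as [d [Hd H]]; [lra|].
  destruct (dyadic_dense (x - d / 2) x) as [m [k [K1 K2]]]; [lra|]; rewrite dy_succ in K2.
  assert (Pm := half_pow_pos m); assert (L := HGI (dy m k) x ltac:(lra)); rewrite Hdy in L.
  assert (L' := H (dy m k) ltac:(apply Rabs_def1; lra)).
  generalize (Rle_abs (- (F (dy m k) - F x))); rewrite Rabs_Ropp; nra.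
Qed.

Lemma adapted_unique s a F G : (forall x, 0 < s x) -> adapted s a F -> adapted s a G ->
  exists A B, 0 < A /\ forall x, G x = A * F x + B.
Proof. intros Hs HF [HG [_ HGt]]; now apply tile_law_unique with s a. Qed.

(** Translations along the leaf and the solenoid map act on charts. *)
Lemma adapted_rescale s a F n j : adapted s a F ->
  adapted s (dyadic_affine (2 ^ Z.of_nat n) j a) (fun t => F ((t + IZR j) * (/ 2) ^ n)).
Proof.
intros [HI [HC HR]]; split; [|split].
- intros x y Hxy; apply HI, Rmult_lt_compat_r; [apply half_pow_pos|lra].
- intros x; apply (continuity_pt_comp (fun t => (t + IZR j) * (/ 2) ^ n) F); [|apply HC].
  apply continuity_pt_mult; [|apply continuity_pt_const; now intros u v].
  apply continuity_pt_plus; [apply continuity_pt_id|apply continuity_pt_const; now intros u v].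
- intros m k; rewrite affine_comp.
  assert (E : forall i, (dy m i + IZR j) * (/ 2) ^ n = dy (m + n) (2 ^ Z.of_nat m * j + i)).
  { intros i; unfold dy; rewrite plus_IZR, mult_IZR, <- pow_IZR, pow_add, !half_pow_inv; simpl.
    field; split; apply pow_nonzero; lra. }
  unfold tile; rewrite !E.
  assert (R := HR (m + n)%nat (2 ^ Z.of_nat m * j + k)%Z); unfold tile in R.
  rewrite <- Z.pow_add_r, <- Nat2Z.inj_add by lia.
  replace (2 ^ Z.of_nat m * j + (k + 1))%Z with (2 ^ Z.of_nat m * j + k + 1)%Z by ring.
  replace (2 ^ Z.of_nat m * j + (k - 1))%Z with (2 ^ Z.of_nat m * j + k - 1)%Z by ring.
  replace (2 ^ Z.of_nat m * j + (k - 1 + 1))%Z with (2 ^ Z.of_nat m * j + k - 1 + 1)%Z by ring.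
  exact R.
Qed.

(** * Comparison of the charts of different leaves *)

Lemma adapted_monotone s a F p q : adapted s a F -> monotone_on F p q.
Proof. intros [H _]; left; intros x y _ Hxy _; now apply H. Qed.

Lemma adapted_neq s a F x y : adapted s a F -> x <> y -> F x <> F y.
Proof. intros [H _] Hxy; destruct (Rdichotomy x y Hxy) as [L|L]; apply H in L; lra. Qed.

Lemma ln_1p_lipschitz x y : 0 < x -> 0 < y -> Rabs (ln (1 + x) - ln (1 + y)) <= Rabs (x - y).
Proof.
intros Hx Hy; eapply Rle_trans; [apply (ln_lipschitz 1); lra|].
replace (1 + x - (1 + y)) with (x - y) by ring; lra.
Qed.

Lemma ln_le_exp x y D : 0 < x -> 0 < y -> Rabs (ln x - ln y) <= D -> x <= exp D * y.
Proof.
intros Hx Hy H; rewrite <- (exp_ln x), <- (exp_ln y) at 1 by auto.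
rewrite <- exp_plus; apply exp_mono; apply Rabs_le_between in H; lra.
Qed.

Lemma ln_exp_le x y D : 0 < x -> 0 < y -> x <= exp D * y -> y <= exp D * x -> Rabs (ln x - ln y) <= D.
Proof.
intros Hx Hy H H'.
apply ln_le in H; auto; rewrite ln_mult, ln_exp in H; auto using exp_pos.
apply ln_le in H'; auto; rewrite ln_mult, ln_exp in H'; auto using exp_pos.
apply Rabs_le_between; lra.
Qed.

(** The charts of two leaves whose base points share n digits differ by a
    factor that is constant up to O(mu^n).  Passing from a tile to its halves
    in level m + 1 multiplies lengths by functions of the value of s at points
    sharing n + m + 1 digits, so that the errors of all levels form a geometric
    series: the bound does not depend on the size of the tile. *)
Lemma adapted_close s : dyadic_solution s -> forall N : nat, exists C mu, 0 < C /\ 0 < mu < 1 /\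
  forall n a b F G, trunc a n = trunc b n -> adapted s a F -> adapted s b G ->
  exists c0, forall x y, - INR N < x -> x < y -> y < INR N ->
    Rabs (ln (F y - F x) - ln (G y - G x) - c0) <= C * mu ^ n.
Proof.
intros Hs N; destruct (solution_bounds s Hs) as [B [c [mu [HB [Hc [Hmu [Hb Hcl]]]]]]].
destruct Hs as [Hs _].
assert (Hi : 0 < / (1 - mu)) by (apply Rinv_0_lt_compat; lra).
exists ((INR N + 2 / (1 - mu)) * c), mu; split; [|split; [auto|]].
{ generalize (pos_INR N); intros; apply Rmult_lt_0_compat; unfold Rdiv; nra. }
intros n a b F G Hab HF HG.
assert (Hmn : 0 < mu ^ n) by (apply pow_lt; lra).
set (e := fun m k => ln (tile F m k) - ln (tile G m k)).
set (c0 := e 0%nat 0%Z).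
assert (tF : forall m k, 0 < tile F m k) by (intros; eapply adapted_pos; eauto).
assert (tG : forall m k, 0 < tile G m k) by (intros; eapply adapted_pos; eauto).
assert (Hcl' : forall m k, let x := dyadic_affine (2 ^ Z.of_nat m) k a in
  let y := dyadic_affine (2 ^ Z.of_nat m) k b in
  Rabs (s x - s y) <= c * mu ^ (m + n) /\ Rabs (ln (s x) - ln (s y)) <= c * mu ^ (m + n)).
{ intros m k; apply Hcl; now apply agree_affine. }
assert (E0 : forall k, Rabs (e 0%nat k - c0) <= Rabs (IZR k) * (c * mu ^ n)).
{ assert (St : forall k, Rabs (e 0%nat (k + 1)%Z - e 0%nat k) <= c * mu ^ n).
  { intros k; destruct HF as [_ [_ HF]], HG as [_ [_ HG]]; unfold e.
    rewrite (HF 0%nat (k + 1)%Z), (HG 0%nat (k + 1)%Z); replace (k + 1 - 1)%Z with k by ring.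
    rewrite !ln_mult by auto; destruct (Hcl' 0%nat (k + 1)%Z) as [_ H]; simpl Nat.add in H.
    match goal with |- Rabs ?X <= _ => match type of H with Rabs ?Y <= _ =>
      replace X with Y by ring end end; exact H. }
  assert (Up : forall i : nat, Rabs (e 0%nat (Z.of_nat i) - c0) <= INR i * (c * mu ^ n) /\
    Rabs (e 0%nat (- Z.of_nat i)%Z - c0) <= INR i * (c * mu ^ n)).
  { induction i as [|i [IH1 IH2]]; [simpl; unfold c0; rewrite !Rminus_diag, Rabs_R0; lra|].
    rewrite S_INR; split.
    - specialize (St (Z.of_nat i)); replace (Z.of_nat i + 1)%Z with (Z.of_nat (S i)) in St by lia.
      replace (e 0%nat (Z.of_nat (S i)) - c0)
        with ((e 0%nat (Z.of_nat (S i)) - e 0%nat (Z.of_nat i)) + (e 0%nat (Z.of_nat i) - c0)) by ring.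
      eapply Rle_trans; [apply Rabs_triang|]; lra.
    - specialize (St (- Z.of_nat (S i))%Z).
      replace (- Z.of_nat (S i) + 1)%Z with (- Z.of_nat i)%Z in St by lia.
      replace (e 0%nat (- Z.of_nat (S i))%Z - c0)
        with (- (e 0%nat (- Z.of_nat i)%Z - e 0%nat (- Z.of_nat (S i))%Z) + (e 0%nat (- Z.of_nat i)%Z - c0)) by ring.
      eapply Rle_trans; [apply Rabs_triang|]; rewrite Rabs_Ropp; lra. }
  intros k; assert (Hk : exists i : nat, k = Z.of_nat i \/ k = (- Z.of_nat i)%Z)
    by (exists (Z.to_nat (Z.abs k)); lia).
  destruct Hk as [i [->| ->]]; rewrite ?opp_IZR, ?Rabs_Ropp, <- INR_IZR_INZ, (Rabs_pos_eq (INR i))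
    by apply pos_INR; apply Up. }
assert (Hh : forall m k, Rabs (e (S m) (2 * k)%Z - e m k) <= c * mu ^ (S m + n) /\
  Rabs (e (S m) (2 * k + 1)%Z - e m k) <= 2 * (c * mu ^ (S m + n))).
{ intros m k; destruct (tile_law_halves s a F m k Hs (proj2 (proj2 HF))) as [F0 F1].
  destruct (tile_law_halves s b G m k Hs (proj2 (proj2 HG))) as [G0 G1].
  destruct (Hcl' (S m) (2 * k + 1)%Z) as [H1 H2]; unfold e; rewrite F0, F1, G0, G1.
  set (r := s _) in *; set (r' := s (dyadic_affine _ _ b)) in *.
  assert (0 < r) by apply Hs; assert (0 < r') by apply Hs.
  assert (H3 := ln_1p_lipschitz r r' ltac:(auto) ltac:(auto)).
  assert (P0 : 0 < tile F m k / (1 + r)) by (apply Rdiv_lt_0_compat; auto; lra).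
  assert (P0' : 0 < tile G m k / (1 + r')) by (apply Rdiv_lt_0_compat; auto; lra).
  assert (Q : Rabs (ln (tile F m k / (1 + r)) - ln (tile G m k / (1 + r')) - (ln (tile F m k) - ln (tile G m k)))
    <= c * mu ^ (S m + n)).
  { rewrite !ln_div by (auto; lra).
    replace (_ - _) with (- (ln (1 + r) - ln (1 + r'))) by ring; rewrite Rabs_Ropp; lra. }
  split; [exact Q|].
  rewrite !ln_mult by auto.
  match goal with |- Rabs ?X <= _ => match type of Q with Rabs ?Y <= _ =>
    replace X with ((ln r - ln r') + Y) by ring end end.
  eapply Rle_trans; [apply Rabs_triang|]; lra. }
assert (Em : forall m k, (- (Z.of_nat N * 2 ^ Z.of_nat m) <= k)%Z ->
  (k + 1 <= Z.of_nat N * 2 ^ Z.of_nat m)%Z ->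
  Rabs (e m k - c0) <= (INR N + 2 * ((1 - mu ^ m) / (1 - mu))) * c * mu ^ n).
{ induction m as [|m IH]; intros k Hk1 Hk2.
  - eapply Rle_trans; [apply E0|]; simpl.
    replace ((INR N + 2 * ((1 - 1) / (1 - mu))) * c * mu ^ n) with (INR N * (c * mu ^ n)) by (field; lra).
    apply Rmult_le_compat_r; [nra|].
    simpl in Hk1, Hk2; rewrite INR_IZR_INZ; apply Rabs_le; split; rewrite <- ?opp_IZR; apply IZR_le; lia.
  - rewrite pow2_S in *.
    assert (A : exists j, (k = 2 * j \/ k = 2 * j + 1)%Z /\ (- (Z.of_nat N * 2 ^ Z.of_nat m) <= j)%Z /\
      (j + 1 <= Z.of_nat N * 2 ^ Z.of_nat m)%Z).
    { destruct (Z.Even_or_Odd k) as [[j ->]|[j ->]]; exists j; repeat split; auto; lia. }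
    destruct A as [j [Hkj [Hj1 Hj2]]]; specialize (IH j Hj1 Hj2).
    assert (Q : Rabs (e (S m) k - e m j) <= 2 * (c * mu ^ (S m + n))).
    { destruct (Hh m j) as [H1 H2]; destruct Hkj as [->| ->]; auto.
      assert (0 < c * mu ^ (S m + n)) by (apply Rmult_lt_0_compat; auto; apply pow_lt; lra); lra. }
    replace (e (S m) k - c0) with ((e (S m) k - e m j) + (e m j - c0)) by ring.
    eapply Rle_trans; [apply Rabs_triang|]; eapply Rle_trans; [apply Rplus_le_compat; eassumption|].
    rewrite pow_add; simpl.
    assert (0 < mu ^ m) by (apply pow_lt; lra).
    match goal with |- ?X <= ?Y => assert (Y - X = 2 * c * mu ^ n * mu ^ m * (1 - mu)) by (field; lra) end.
    assert (0 < 2 * c * mu ^ n * mu ^ m * (1 - mu)) by (repeat apply Rmult_lt_0_compat; lra); lra. }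
set (D := (INR N + 2 / (1 - mu)) * c * mu ^ n).
assert (ED : forall m k, - INR N <= dy m k -> dy m (k + 1) <= INR N -> Rabs (e m k - c0) <= D).
{ intros m k H1 H2; eapply Rle_trans; [apply Em|].
  - apply (dy_le m); apply Rle_trans with (2 := H1); unfold dy.
    rewrite opp_IZR, mult_IZR, <- INR_IZR_INZ, <- pow_IZR, half_pow_inv; simpl.
    apply Req_le; field; apply pow_nonzero; lra.
  - apply (dy_le m); apply Rle_trans with (1 := H2); unfold dy.
    rewrite mult_IZR, <- INR_IZR_INZ, <- pow_IZR, half_pow_inv; simpl.
    apply Req_le; field; apply pow_nonzero; lra.
  - unfold D; do 2 (apply Rmult_le_compat_r; [lra|]); apply Rplus_le_compat_l.
    assert (0 < mu ^ m) by (apply pow_lt; lra); unfold Rdiv; nra. }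
exists c0; intros x y Hx Hxy Hy; fold D.
destruct HF as [HFI [HFC _]], HG as [HGI [HGC _]].
assert (FG : F y - F x <= exp (c0 + D) * (G y - G x)).
{ assert (M := dyadic_monotone (fun t => exp (c0 + D) * G t - F t) (- INR N) (INR N)); simpl in M.
  enough (exp (c0 + D) * G x - F x <= exp (c0 + D) * G y - F y) by lra.
  apply M; try lra.
  - apply continuity_minus; auto; now apply continuity_scal.
  - intros m k H1 H2; specialize (ED m k H1 H2).
    enough (tile F m k <= exp (c0 + D) * tile G m k) by (unfold tile in *; lra).
    rewrite <- (exp_ln (tile F m k)), <- (exp_ln (tile G m k)), <- exp_plus by auto.
    apply exp_mono; apply Rabs_le_between in ED; unfold e in ED; lra. }
assert (GF : exp (c0 - D) * (G y - G x) <= F y - F x).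
{ assert (M := dyadic_monotone (fun t => F t - exp (c0 - D) * G t) (- INR N) (INR N)); simpl in M.
  enough (F x - exp (c0 - D) * G x <= F y - exp (c0 - D) * G y) by lra.
  apply M; try lra.
  - apply continuity_minus; auto; now apply continuity_scal.
  - intros m k H1 H2; specialize (ED m k H1 H2).
    enough (exp (c0 - D) * tile G m k <= tile F m k) by (unfold tile in *; lra).
    rewrite <- (exp_ln (tile F m k)), <- (exp_ln (tile G m k)), <- exp_plus by auto.
    apply exp_mono; apply Rabs_le_between in ED; unfold e in ED; lra. }
specialize (HFI x y Hxy); specialize (HGI x y Hxy).
apply ln_le in FG; [|lra]; rewrite ln_mult, ln_exp in FG; [|apply exp_pos|lra].
apply ln_le in GF; [|apply Rmult_lt_0_compat; [apply exp_pos|lra]].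
rewrite ln_mult, ln_exp in GF; [|apply exp_pos|lra].
apply Rabs_le_between; lra.
Qed.

Lemma dist3_of_factor F G D c0 t1 t2 t3 :
  F t1 <> F t2 -> F t2 <> F t3 -> G t1 <> G t2 -> G t2 <> G t3 ->
  Rabs (ln (Rabs (F t1 - F t2)) - ln (Rabs (G t1 - G t2)) - c0) <= D ->
  Rabs (ln (Rabs (F t2 - F t3)) - ln (Rabs (G t2 - G t3)) - c0) <= D ->
  dist3 F G t1 t2 t3 <= 2 * D.
Proof.
intros HF1 HF2 HG1 HG2 H1 H2; unfold dist3; rewrite !ln_R3 by auto.
apply Rabs_le_between in H1; apply Rabs_le_between in H2; apply Rabs_le_between; lra.
Qed.

(** The common factor cancels in ratios; this is the transverse Hölder condition. *)
Lemma adapted_transverse s : dyadic_solution s -> forall N : nat, exists C mu, 0 < C /\ 0 < mu < 1 /\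
  forall n a b F G t1 t2 t3, trunc a n = trunc b n -> adapted s a F -> adapted s b G ->
  - INR N < t1 < INR N -> - INR N < t2 < INR N -> - INR N < t3 < INR N -> t1 <> t2 -> t2 <> t3 ->
  dist3 F G t1 t2 t3 <= C * mu ^ n.
Proof.
intros Hs N; destruct (adapted_close s Hs N) as [C [mu [HC [Hmu H]]]].
exists (2 * C), mu; split; [lra|split; [auto|]].
intros n a b F G t1 t2 t3 Hab HF HG H1 H2 H3 H12 H23.
destruct (H n a b F G Hab HF HG) as [c0 Hc].
assert (HA : forall x y, - INR N < x < INR N -> - INR N < y < INR N -> x <> y ->
  Rabs (ln (Rabs (F x - F y)) - ln (Rabs (G x - G y)) - c0) <= C * mu ^ n).
{ intros x y Hx Hy Hxy; destruct HF as [HFI _], HG as [HGI _].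
  destruct (Rdichotomy x y Hxy) as [L|L]; assert (LF := HFI _ _ L); assert (LG := HGI _ _ L).
  - rewrite (Rabs_minus_sym (F x)), (Rabs_minus_sym (G x)), (Rabs_pos_eq (F y - F x)),
      (Rabs_pos_eq (G y - G x)) by lra; apply Hc; lra.
  - rewrite (Rabs_pos_eq (F x - F y)), (Rabs_pos_eq (G x - G y)) by lra; apply Hc; lra. }
rewrite Rmult_assoc; apply dist3_of_factor with c0; auto; eapply adapted_neq; eauto.
Qed.

(** At small scales the charts of any two leaves agree: the n-th iterate of the
    solenoid map expands a segment of length 2^-n to unit length, and the
    images of the base points share n digits. *)
Lemma adapted_local s : dyadic_solution s -> exists C mu, 0 < C /\ 0 < mu < 1 /\
  forall n a b F G t1 t2 t3, adapted s a F -> adapted s b G ->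
  Rabs (t1 - t2) <= (/ 2) ^ n -> Rabs (t3 - t2) <= (/ 2) ^ n -> t1 <> t2 -> t2 <> t3 ->
  dist3 F G t1 t2 t3 <= C * mu ^ n.
Proof.
intros Hs; destruct (adapted_transverse s Hs 3) as [C [mu [HC [Hmu H]]]].
exists C, mu; split; [auto|split; [auto|]].
intros n a b F G t1 t2 t3 HF HG H1 H3 H12 H23.
destruct (floor_ex (t2 * 2 ^ n)) as [j Hj].
assert (Hn : 0 < 2 ^ n) by (apply pow_lt; lra).
assert (E : forall (F' : R -> R) t, (fun t => F' ((t + IZR j) * (/ 2) ^ n)) (t * 2 ^ n - IZR j) = F' t).
{ intros F' t; cbv beta; f_equal; rewrite half_pow_inv; field; lra. }
assert (HR : forall F' : R -> R, R3 F' t1 t2 t3 = R3 (fun t => F' ((t + IZR j) * (/ 2) ^ n))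
  (t1 * 2 ^ n - IZR j) (t2 * 2 ^ n - IZR j) (t3 * 2 ^ n - IZR j)).
{ intros F'; unfold R3; now rewrite !(E F'). }
unfold dist3; rewrite (HR F), (HR G).
rewrite half_pow_inv in H1, H3.
assert (A : forall t, Rabs (t - t2) <= / 2 ^ n -> -1 <= t * 2 ^ n - t2 * 2 ^ n <= 1).
{ intros t Ht; apply Rabs_le_between in Ht.
  assert (2 ^ n * / 2 ^ n = 1) by (field; lra); nra. }
apply A in H1; apply A in H3; replace (INR 3) with 3 in H by (simpl; ring).
apply H with (dyadic_affine (2 ^ Z.of_nat n) j a) (dyadic_affine (2 ^ Z.of_nat n) j b);
  try now apply adapted_rescale.
- replace n with (n + 0)%nat at 2 4 by lia; now apply agree_affine.
- lra.
- lra.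
- lra.
- intros Eq; apply H12; nra.
- intros Eq; apply H23; nra.
Qed.

Lemma tile_ratio_iter s a F B m k (i : nat) : (forall x, / B <= s x <= B) -> 1 < B -> adapted s a F ->
  tile F m (k + Z.of_nat i) <= B ^ i * tile F m k /\ tile F m k <= B ^ i * tile F m (k + Z.of_nat i).
Proof.
intros Hb HB HF; induction i as [|i [IH1 IH2]].
{ rewrite Z.add_0_r; simpl; lra. }
assert (E := proj2 (proj2 HF) m (k + Z.of_nat (S i))%Z).
replace (k + Z.of_nat (S i) - 1)%Z with (k + Z.of_nat i)%Z in E by lia.
set (r := s _) in E; assert (Hr : / B <= r <= B) by apply Hb.
assert (HBr : 1 <= B * r).
{ apply (Rmult_le_reg_l (/ B)); [apply Rinv_0_lt_compat; lra|].
  rewrite <- Rmult_assoc, Rinv_l by lra; lra. }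
assert (0 < tile F m (k + Z.of_nat i)) by (eapply adapted_pos; eauto).
assert (0 < B ^ i) by (apply pow_lt; lra).
rewrite E; simpl; split.
- apply Rle_trans with (B * tile F m (k + Z.of_nat i)); [nra|].
  rewrite Rmult_assoc; apply Rmult_le_compat_l; lra.
- apply Rle_trans with (1 := IH2).
  replace (B * B ^ i * (r * tile F m (k + Z.of_nat i)))
    with (B * r * (B ^ i * tile F m (k + Z.of_nat i))) by ring.
  assert (0 < B ^ i * tile F m (k + Z.of_nat i)) by (apply Rmult_lt_0_compat; auto); nra.
Qed.

(** Two adjacent segments of equal length h contain tiles of size about h / 4
    and are covered by a bounded number of them. *)
Lemma adapted_quasisymmetric s : dyadic_solution s -> exists k0, 1 < k0 /\
  forall a F t h, adapted s a F -> 0 < h <= 1 ->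
  F (t + h) - F t <= k0 * (F t - F (t - h)) /\ F t - F (t - h) <= k0 * (F (t + h) - F t).
Proof.
intros Hs; destruct (solution_bounds s Hs) as [B [_ [_ [HB [_ [_ [Hb _]]]]]]].
assert (HBp : forall i j, (i <= j)%nat -> 1 <= B ^ i <= B ^ j).
{ intros i j Hij; split; [apply pow_R1_Rle; lra|apply Rle_pow; [lra|auto]]. }
exists (5 * B ^ 5); split; [generalize (HBp 0%nat 5%nat ltac:(lia)); lra|].
intros a F t h HF Hh; destruct (dyadic_scale h Hh) as [n Hn].
set (m := S (S n)); destruct (dy_floor m t) as [k Hk].
assert (Hm : (/ 2) ^ S n = 2 * (/ 2) ^ m /\ (/ 2) ^ n = 4 * (/ 2) ^ m) by (unfold m; simpl; lra).
assert (Hdy : forall i, dy m (k + i) = dy m k + IZR i * (/ 2) ^ m).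
{ intros i; unfold dy; rewrite plus_IZR; ring. }
assert (Hle : forall x y, x <= y -> F x <= F y).
{ intros x y [L|L]; [left; now apply (proj1 HF)|rewrite L; lra]. }
set (T := fun i : Z => tile F m (k + i)).
assert (HT : forall i, F (dy m (k + (i + 1))) = F (dy m (k + i)) + T i).
{ intros i; unfold T, tile; rewrite Z.add_assoc; ring. }
assert (Tc : forall i j, (-5 <= i <= 5)%Z -> (Z.abs (i - j) <= 5)%Z -> T i <= B ^ 5 * T j).
{ intros i j Hi Hij; unfold T.
  assert (P1 : 0 < tile F m (k + j)) by (eapply adapted_pos; eauto).
  destruct (Z_le_gt_dec j i) as [Hji|Hji].
  - destruct (tile_ratio_iter s a F B m (k + j) (Z.to_nat (i - j)) Hb HB HF) as [H _].
    replace (k + j + Z.of_nat (Z.to_nat (i - j)))%Z with (k + i)%Z in H by lia.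
    apply Rle_trans with (1 := H); apply Rmult_le_compat_r; [lra|]; apply HBp; lia.
  - destruct (tile_ratio_iter s a F B m (k + i) (Z.to_nat (j - i)) Hb HB HF) as [_ H].
    replace (k + i + Z.of_nat (Z.to_nat (j - i)))%Z with (k + j)%Z in H by lia.
    apply Rle_trans with (1 := H); apply Rmult_le_compat_r; [lra|]; apply HBp; lia. }
rewrite dy_succ in Hk.
split.
- assert (U : F (t + h) - F t <= T 0%Z + T 1%Z + T 2%Z + T 3%Z + T 4%Z).
  { assert (F (t + h) <= F (dy m (k + 5))) by (apply Hle; rewrite Hdy; lra).
    assert (F (dy m (k + 0)) <= F t) by (apply Hle; rewrite Hdy; lra).
    generalize (HT 0%Z) (HT 1%Z) (HT 2%Z) (HT 3%Z) (HT 4%Z); simpl Z.add; lra. }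
  assert (L : T (-1)%Z <= F t - F (t - h)).
  { assert (F (dy m (k + 0)) <= F t) by (apply Hle; rewrite Hdy; lra).
    assert (F (t - h) <= F (dy m (k + -1))) by (apply Hle; rewrite Hdy; lra).
    generalize (HT (-1)%Z); simpl Z.add; lra. }
  assert (0 < B ^ 5) by (apply pow_lt; lra).
  generalize (Tc 0%Z (-1)%Z) (Tc 1%Z (-1)%Z) (Tc 2%Z (-1)%Z) (Tc 3%Z (-1)%Z) (Tc 4%Z (-1)%Z); intros.
  apply Rle_trans with (1 := U); apply Rle_trans with (5 * B ^ 5 * T (-1)%Z).
  + generalize (H0 ltac:(lia) ltac:(lia)) (H1 ltac:(lia) ltac:(lia)) (H2 ltac:(lia) ltac:(lia))
      (H3 ltac:(lia) ltac:(lia)) (H4 ltac:(lia) ltac:(lia)); lra.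
  + apply Rmult_le_compat_l; lra.
- assert (U : F t - F (t - h) <= T (-4)%Z + T (-3)%Z + T (-2)%Z + T (-1)%Z + T 0%Z).
  { assert (F t <= F (dy m (k + 1))) by (apply Hle; rewrite Hdy; lra).
    assert (F (dy m (k + -4)) <= F (t - h)) by (apply Hle; rewrite Hdy; lra).
    generalize (HT (-4)%Z) (HT (-3)%Z) (HT (-2)%Z) (HT (-1)%Z) (HT 0%Z); simpl Z.add; lra. }
  assert (L : T 1%Z <= F (t + h) - F t).
  { assert (F t <= F (dy m (k + 1))) by (apply Hle; rewrite Hdy; lra).
    assert (F (dy m (k + 2)) <= F (t + h)) by (apply Hle; rewrite Hdy; lra).
    generalize (HT 1%Z); simpl Z.add; lra. }
  assert (0 < B ^ 5) by (apply pow_lt; lra).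
  generalize (Tc 0%Z 1%Z) (Tc (-1)%Z 1%Z) (Tc (-2)%Z 1%Z) (Tc (-3)%Z 1%Z) (Tc (-4)%Z 1%Z); intros.
  apply Rle_trans with (1 := U); apply Rle_trans with (5 * B ^ 5 * T 1%Z).
  + generalize (H0 ltac:(lia) ltac:(lia)) (H1 ltac:(lia) ltac:(lia)) (H2 ltac:(lia) ltac:(lia))
      (H3 ltac:(lia) ltac:(lia)) (H4 ltac:(lia) ltac:(lia)); lra.
  + apply Rmult_le_compat_l; lra.
Qed.

(** * Tilings *)

(** The dividing points of a tiling, numbered so that the tile b lies between
    v b and v (b + 1), from left to right when sg = 1 and from right to left
    when sg = -1. *)
Definition vertices (I : tiles) (v : Z -> R) (sg : R) :=
  (sg = 1 \/ sg = -1) /\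
  forall b, 0 < sg * (v (b + 1)%Z - v b) /\
    ((sg = 1 /\ I b = (v b, v (b + 1)%Z)) \/ (sg = -1 /\ I b = (v (b + 1)%Z, v b))).

(** Adjacent tiles abut; if the direction changed at the tile b + 1, then the tiles b and
    b + 2 would lie on the same side of it and overlap. *)
Lemma tiling_vertices B I : tiling_with B I -> exists v sg, vertices I v sg.
Proof.
intros [Hlt [Hdisj [_ [Hadj _]]]].
assert (Hdir : forall b, snd (I b) = fst (I (b + 1)%Z) \/ fst (I b) = snd (I (b + 1)%Z)).
{ intros b; destruct (Hadj b) as [p [[E|E] [[E'|E'] Hp]]]; [exfalso|right; lra|left; lra|exfalso];
    unfold in_tile in Hp; assert (L := Hlt b); assert (L' := Hlt (b + 1)%Z).
  - assert (M : Rmin (snd (I b)) (snd (I (b + 1)%Z)) = p)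
      by (apply Hp; apply Rmin_case_strong; lra).
    revert M; apply Rmin_case_strong; lra.
  - assert (M : Rmax (fst (I b)) (fst (I (b + 1)%Z)) = p)
      by (apply Hp; apply Rmax_case_strong; lra).
    revert M; apply Rmax_case_strong; lra. }
assert (Hstep : forall b, (snd (I b) = fst (I (b + 1)%Z) <-> snd (I (b + 1)%Z) = fst (I (b + 1 + 1)%Z))).
{ intros b; assert (L := Hlt b); assert (L' := Hlt (b + 1)%Z); assert (L'' := Hlt (b + 1 + 1)%Z); split; intros E.
  - destruct (Hdir (b + 1)%Z) as [E'|E']; auto; exfalso.
    apply (Hdisj b (b + 1 + 1)%Z ltac:(lia) ((Rmax (fst (I b)) (fst (I (b + 1 + 1)%Z)) + snd (I b)) / 2)).
    apply Rmax_case_strong; lra.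
  - destruct (Hdir b) as [E'|E']; auto; exfalso.
    apply (Hdisj b (b + 1 + 1)%Z ltac:(lia) ((Rmin (snd (I b)) (snd (I (b + 1 + 1)%Z)) + fst (I b)) / 2)).
    apply Rmin_case_strong; lra. }
destruct (classic (snd (I 0%Z) = fst (I 1%Z))) as [E|E].
- exists (fun b => fst (I b)), 1; split; [now left|].
  assert (A : forall b, snd (I b) = fst (I (b + 1)%Z)) by (apply Z_two_sided; auto).
  intros b; rewrite <- A; specialize (Hlt b); split; [lra|]; left; split; auto.
  now destruct (I b).
- exists (fun b => snd (I b)), (-1); split; [now right|].
  assert (A : forall b, snd (I b) <> fst (I (b + 1)%Z)).
  { apply Z_two_sided; auto; intros b; specialize (Hstep b); tauto. }
  intros b; assert (A' : fst (I b) = snd (I (b + 1)%Z)) by (destruct (Hdir b); auto; now destruct (A b)).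
  rewrite <- A'; specialize (Hlt b); split; [lra|]; right; split; auto.
  now destruct (I b).
Qed.

Lemma vertices_length I v sg b : vertices I v sg -> tile_length (I b) = sg * (v (b + 1)%Z - v b).
Proof.
intros [_ H]; destruct (H b) as [_ [[-> ->]|[-> ->]]]; unfold tile_length; simpl; ring.
Qed.

Lemma vertices_in I v sg b x : vertices I v sg ->
  in_tile (I b) x <-> 0 <= sg * (x - v b) <= sg * (v (b + 1)%Z - v b).
Proof.
intros [_ H]; destruct (H b) as [_ [[-> ->]|[-> ->]]]; unfold in_tile; simpl; split; lra.
Qed.

Lemma tiling_ratio I v sg b : vertices I v sg ->
  0 < tiling_sequence I b /\ tile_length (I (b + 1)%Z) = tiling_sequence I b * tile_length (I b).
Proof.
intros Hv; unfold tiling_sequence; rewrite !(vertices_length I v sg) by auto.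
destruct Hv as [_ Hv]; destruct (Hv b) as [P _], (Hv (b + 1)%Z) as [P' _].
split; [now apply Rdiv_lt_0_compat|]; field.
split; intros E; rewrite E in P; lra.
Qed.

(** The lengths of both tilings satisfy the same recursion, hence are proportional.  So
    the dividing points differ by an affine map, which reverses orientation if
    the two tilings are numbered in opposite directions. *)
Lemma same_sequence_affine B B' I J : tiling_with B I -> tiling_with B' J ->
  ext_eq (tiling_sequence I) (tiling_sequence J) -> tiling_eq I J.
Proof.
intros HI HJ E; apply tiling_vertices in HI; apply tiling_vertices in HJ.
destruct HI as [v [sg HI]], HJ as [w [sg' HJ]].
assert (LI : forall b, 0 < tile_length (I b)).
{ intros b; rewrite (vertices_length I v sg) by auto; apply HI. }
assert (LJ : forall b, 0 < tile_length (J b)).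
{ intros b; rewrite (vertices_length J w sg') by auto; apply HJ. }
assert (Hprop : forall b, tile_length (J b) * tile_length (I 0%Z) = tile_length (J 0%Z) * tile_length (I b)).
{ intros b; apply (geometric_unique (tiling_sequence I) (fun b => tile_length (I b)) (fun b => tile_length (J b))).
  - intros k; apply Rgt_not_eq, (tiling_ratio I v sg); auto.
  - intros k; now apply (tiling_ratio I v sg).
  - intros k; rewrite E; now apply (tiling_ratio J w sg'). }
assert (Hs : sg * sg = 1) by (destruct HI as [[->| ->] _]; ring).
assert (Hs' : sg' * sg' = 1) by (destruct HJ as [[->| ->] _]; ring).
set (a := sg * sg' * (tile_length (J 0%Z) / tile_length (I 0%Z))).
assert (Ha : forall b, w (b + 1)%Z - w b = a * (v (b + 1)%Z - v b)).
{ intros b; specialize (Hprop b).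
  rewrite !(vertices_length I v sg), (vertices_length J w sg' b) in Hprop by auto.
  unfold a; assert (L := LI 0%Z); rewrite (vertices_length I v sg 0) by auto.
  rewrite (vertices_length I v sg 0) in L by auto.
  replace (w (b + 1)%Z - w b) with (sg' * sg' * (w (b + 1)%Z - w b)) by (rewrite Hs'; ring).
  apply (Rmult_eq_reg_r (sg * (v (0 + 1)%Z - v 0%Z))); [|lra].
  replace (sg' * sg' * (w (b + 1)%Z - w b) * (sg * (v (0 + 1)%Z - v 0%Z)))
    with (sg' * (sg' * (w (b + 1)%Z - w b) * (sg * (v (0 + 1)%Z - v 0%Z)))) by ring.
  rewrite Hprop; field; split; intros Eq; rewrite Eq in L; lra. }
assert (Hane : a <> 0).
{ specialize (Ha 0%Z); intros H0; rewrite H0 in Ha.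
  specialize (LJ 0%Z); rewrite (vertices_length J w sg') in LJ by auto; rewrite Ha in LJ; lra. }
exists a, (w 0%Z - a * v 0%Z); split; auto.
assert (Hw : forall b, w b = a * v b + (w 0%Z - a * v 0%Z)).
{ apply Z_two_sided; [ring|]; intros b; specialize (Ha b); split; intros; lra. }
intros b y; set (c := w 0%Z - a * v 0%Z) in *.
rewrite (vertices_in J w sg') by auto; rewrite Ha, Hw.
assert (Hsa : 0 < sg * sg' * a).
{ unfold a; replace (sg * sg' * (sg * sg' * (tile_length (J 0%Z) / tile_length (I 0%Z))))
    with (sg * sg * (sg' * sg') * (tile_length (J 0%Z) / tile_length (I 0%Z))) by ring.
  rewrite Hs, Hs'; rewrite !Rmult_1_l; now apply Rdiv_lt_0_compat. }
split.
- intros Hy; exists ((y - c) / a); split; [|field; auto].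
  rewrite (vertices_in I v sg) by auto.
  assert (E1 : sg' * (y - (a * v b + c)) = sg * sg' * a * (sg * ((y - c) / a - v b))).
  { replace (sg * sg' * a * (sg * ((y - c) / a - v b))) with (sg * sg * (sg' * (a * ((y - c) / a - v b)))) by ring.
    rewrite Hs; field; auto. }
  assert (E2 : sg' * (a * (v (b + 1)%Z - v b)) = sg * sg' * a * (sg * (v (b + 1)%Z - v b))).
  { replace (sg * sg' * a * (sg * (v (b + 1)%Z - v b))) with (sg * sg * (sg' * (a * (v (b + 1)%Z - v b)))) by ring.
    rewrite Hs; ring. }
  rewrite E1, E2 in Hy; split; [|now apply Rmult_le_reg_l with (sg * sg' * a)].
  apply Rmult_le_reg_l with (sg * sg' * a); lra.
- intros [x [Hx ->]]; rewrite (vertices_in I v sg) in Hx by auto.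
  replace (sg' * (a * x + c - (a * v b + c))) with (sg * sg * (sg' * a * (x - v b))) by (rewrite Hs; ring).
  replace (sg' * (a * (v (b + 1)%Z - v b))) with (sg * sg * (sg' * a * (v (b + 1)%Z - v b))) by (rewrite Hs; ring).
  nra.
Qed.

Lemma tile_image_length a b I J : fst I <= snd I -> fst J <= snd J -> tile_image a b I J ->
  tile_length J = Rabs a * tile_length I.
Proof.
unfold tile_image, in_tile, tile_length; intros HI HJ H.
assert (H1 := proj1 (H (fst J)) ltac:(lra)); assert (H2 := proj1 (H (snd J)) ltac:(lra)).
assert (H3 := proj2 (H (a * fst I + b)) ltac:(exists (fst I); split; [lra|auto])).
assert (H4 := proj2 (H (a * snd I + b)) ltac:(exists (snd I); split; [lra|auto])).
destruct H1 as [x [Hx Ex]], H2 as [y [Hy Ey]].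
rewrite Ex, Ey in *; unfold Rabs; destruct Rcase_abs; nra.
Qed.

Lemma tiling_eq_sequence B B' I J : tiling_with B I -> tiling_with B' J -> tiling_eq I J ->
  ext_eq (tiling_sequence I) (tiling_sequence J).
Proof.
intros [HI _] [HJ _] [a [b [Ha H]]] m; unfold tiling_sequence.
rewrite (tile_image_length a b (I m) (J m)), (tile_image_length a b (I (m + 1)%Z) (J (m + 1)%Z));
  auto; try (left; auto).
assert (0 < tile_length (I m)) by (specialize (HI m); unfold tile_length; lra).
apply Rabs_no_R0 in Ha; field; lra.
Qed.

Lemma affine_of_0 m k : dyadic_affine (2 ^ Z.of_nat m) k (dyadic_of_Z 0) = dyadic_of_Z k.
Proof. rewrite affine_of_Z; f_equal; ring. Qed.

(** The leaf of 0 is fixed by the solenoid map, which acts on its chart as a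
    dilation; so the chart maps the line onto the line. *)
Lemma adapted_0_onto s F y : dyadic_solution s -> adapted s (dyadic_of_Z 0) F ->
  exists t, F t = y.
Proof.
intros Hs HF; assert (Hp : forall x, 0 < s x) by apply Hs.
assert (HG := adapted_rescale s _ F 1 0 HF); rewrite affine_of_0 in HG.
destruct (adapted_unique s _ _ _ Hp HG HF) as [A [B [HA E]]].
assert (HD : forall t, F (2 * t) - F 0 = A * (F t - F 0)).
{ intros t; assert (E2 := E (2 * t)); assert (E0 := E 0); cbv beta in E2, E0.
  replace ((2 * t + 0) * (/ 2) ^ 1) with t in E2 by (simpl; field).
  replace ((0 + 0) * (/ 2) ^ 1) with 0 in E0 by (simpl; field); lra. }
assert (HA1 : 1 < A).
{ assert (E1 := HD 1); assert (F 0 < F 1) by (apply HF; lra).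
  assert (F 1 < F (2 * 1)) by (apply HF; lra); nra. }
assert (HP : forall t n, F (2 ^ n * t) - F 0 = A ^ n * (F t - F 0)).
{ intros t; induction n as [|n IH]; [simpl; rewrite !Rmult_1_l; ring|].
  simpl; rewrite Rmult_assoc, HD, IH; ring. }
assert (F0 : F 0 < F 1) by (apply HF; lra).
assert (F1 : F (-1) < F 0) by (apply HF; lra).
destruct (Pow_x_infinity A ltac:(rewrite Rabs_pos_eq; lra)
  (Rabs (y - F 0) / (F 1 - F 0) + Rabs (y - F 0) / (F 0 - F (-1)))) as [n Hn].
specialize (Hn n (le_n n)); rewrite Rabs_pos_eq in Hn by (left; apply pow_lt; lra).
assert (D1 : 0 <= Rabs (y - F 0) / (F 1 - F 0)).
{ apply Rmult_le_pos; [apply Rabs_pos|left; apply Rinv_0_lt_compat; lra]. }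
assert (D2 : 0 <= Rabs (y - F 0) / (F 0 - F (-1))).
{ apply Rmult_le_pos; [apply Rabs_pos|left; apply Rinv_0_lt_compat; lra]. }
assert (U : y <= F (2 ^ n * 1)).
{ specialize (HP 1 n); assert (Rabs (y - F 0) <= A ^ n * (F 1 - F 0)).
  { replace (Rabs (y - F 0)) with (Rabs (y - F 0) / (F 1 - F 0) * (F 1 - F 0)) by (field; lra).
    apply Rmult_le_compat_r; lra. }
  generalize (Rle_abs (y - F 0)); lra. }
assert (L : F (2 ^ n * -1) <= y).
{ specialize (HP (-1) n); assert (Rabs (y - F 0) <= A ^ n * (F 0 - F (-1))).
  { replace (Rabs (y - F 0)) with (Rabs (y - F 0) / (F 0 - F (-1)) * (F 0 - F (-1))) by (field; lra).
    apply Rmult_le_compat_r; lra. }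
  generalize (Rle_abs (- (y - F 0))); rewrite Rabs_Ropp; lra. }
destruct (IVT_gen F (2 ^ n * -1) (2 ^ n * 1) y) as [t [_ Ht]]; [apply HF| |now exists t].
rewrite Rmin_left, Rmax_right by lra; auto.
Qed.

(** All tilings and grids come from the chart of the leaf of 0: by the tile law, its tiles
    of any level have the ratios s m. *)
Definition chart_tiles (F : R -> R) (m : nat) : tiles := fun b => (F (dy m (b - 1)), F (dy m b)).

Lemma chart_tiles_length F m b : tile_length (chart_tiles F m b) = tile F m (b - 1).
Proof. unfold tile_length, tile, chart_tiles; simpl; now replace (b - 1 + 1)%Z with b by ring. Qed.

Lemma chart_tiles_sequence s F m b : (forall x, 0 < s x) -> adapted s (dyadic_of_Z 0) F ->
  tiling_sequence (chart_tiles F m) b = s (dyadic_of_Z b).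
Proof.
intros Hs HF; unfold tiling_sequence; rewrite !chart_tiles_length.
replace (b + 1 - 1)%Z with b by ring; rewrite (proj2 (proj2 HF) m b), affine_of_0.
field; apply Rgt_not_eq; eapply adapted_pos; eauto.
Qed.

(** The bound does not depend on the level, as is needed for grids. *)
Lemma chart_tiles_tiling s : dyadic_solution s -> exists B, 1 <= B /\
  forall F m, adapted s (dyadic_of_Z 0) F -> tiling_with B (chart_tiles F m).
Proof.
intros Hs; destruct (solution_bounds s Hs) as [B [_ [_ [HB [_ [_ [Hb _]]]]]]].
exists B; split; [lra|]; intros F m HF.
assert (HI : forall j k, (j < k)%Z -> F (dy m j) < F (dy m k)).
{ intros j k H; apply HF; now apply dy_lt. }
assert (HI' : forall j k, (j <= k)%Z -> F (dy m j) <= F (dy m k)).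
{ intros j k H; destruct (Z.eq_dec j k) as [->|]; [lra|left; apply HI; lia]. }
split; [|split; [|split; [|split]]].
- intros b; apply HI; lia.
- assert (A : forall b b', (b < b')%Z -> F (dy m b) <= F (dy m (b' - 1))) by (intros; apply HI'; lia).
  intros b b' Hb' x [Hx Hx']; simpl in *; destruct (Z_lt_le_dec b b') as [L|L].
  + apply A in L; lra.
  + specialize (A b' b ltac:(lia)); lra.
- intros x; destruct (adapted_0_onto s F x Hs HF) as [t <-].
  destruct (dy_floor m t) as [k Hk]; exists (k + 1)%Z; unfold in_tile; simpl.
  replace (k + 1 - 1)%Z with k by ring; split.
  + destruct (proj1 Hk) as [L|L]; [left; now apply HF|rewrite L; lra].
  + left; now apply HF.
- intros b; exists (F (dy m b)); unfold is_endpoint, in_tile; simpl.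
  replace (b + 1 - 1)%Z with b by ring; repeat split; auto; intros; subst; try lra.
  + generalize (HI (b - 1)%Z b ltac:(lia)); lra.
  + generalize (HI b (b + 1)%Z ltac:(lia)); lra.
- intros b; change (/ B <= tiling_sequence (chart_tiles F m) b <= B).
  rewrite (chart_tiles_sequence s) by (auto; apply Hs); apply Hb.
Qed.

Lemma solution_quasiperiodic s : dyadic_holder s -> quasiperiodic (fun m => s (dyadic_of_Z m)).
Proof.
intros Hh; apply holder_trunc in Hh; destruct Hh as [c [mu [Hc [Hmu H]]]].
exists c, mu; repeat split; try lra; intros i j k Hd; apply H; rewrite !trunc_of_Z.
now apply congr_of_divide.
Qed.

Lemma amalgamation_clear (a b c d : R) : 0 < a -> 0 < b -> 0 < c -> 0 < d ->
  c * b * ((1 + d) / (1 + c)) = a <-> (d + 1) * b * c = a * (c + 1).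
Proof.
intros Ha Hb Hc Hd; split.
- intros <-; field; lra.
- intros H; apply (Rmult_eq_reg_r (c + 1)); [|lra]; rewrite <- H; field; lra.
Qed.

Lemma solution_amalgamation s : dyadic_solution s ->
  ext_eq (amalgamation (fun m => s (dyadic_of_Z m))) (fun m => s (dyadic_of_Z m)).
Proof.
intros [Hp [_ HE]] i; unfold amalgamation; apply amalgamation_clear; auto.
apply equation_clear; auto; specialize (HE (dyadic_of_Z i)); rewrite !affine_of_Z in HE.
replace (2 * i)%Z with (2 * i + 0)%Z at 2 by ring.
exact HE.
Qed.

(** * Functions on the 2-adic integers and tilings *)

(** A fixed tiling is a solution on the integers; quasiperiodicity extends it to the
    2-adic integers, and a solution gives back the tiling through the chart of
    the leaf of 0. *)
Lemma functions_tilings :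
  canonical_bijection dyadic_solution ext_eq fixed_tiling tiling_eq function_to_tiling.
Proof.
split; [|split].
- intros s Hs; destruct (adapted_exists s (dyadic_of_Z 0) Hs) as [F [HF _]].
  assert (E : tiling_sequence (chart_tiles F 0) = fun m => s (dyadic_of_Z m)).
  { apply functional_extensionality; intros m; apply chart_tiles_sequence; auto; apply Hs. }
  exists (chart_tiles F 0); split; [split; [|split]|].
  + destruct (chart_tiles_tiling s Hs) as [B [HB H]]; exists B; auto.
  + rewrite E; apply solution_quasiperiodic; apply Hs.
  + rewrite E; now apply solution_amalgamation.
  + intros m; now rewrite E.
- intros s s' I I' Hs Hs' [[B [_ HI]] _] [[B' [_ HI']] _] R R'; split; intros E.
  + apply same_sequence_affine with B B'; auto; intros m; rewrite (R m), (R' m); apply E.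
  + apply holder_eq; [apply Hs|apply Hs'|]; intros n; rewrite <- (R (Z.pos n)), <- (R' (Z.pos n)).
    now apply tiling_eq_sequence with B B'.
- intros I [[B [HB HI]] [[c [mu [Hc [Hmu Hq]]]] HE]].
  set (r := tiling_sequence I) in *.
  assert (Hr : forall m, / B <= r m) by (intros m; apply HI).
  assert (HBi : 0 < / B) by (apply Rinv_0_lt_compat; lra).
  assert (Hr0 : forall m, 0 < r m) by (intros m; specialize (Hr m); lra).
  destruct (extend_solution (fun n => r (Z.pos n)) (/ B) c mu) as [s [Hs E]]; auto.
  + intros n; apply equation_clear; auto.
    assert (A := HE (Z.pos n)); unfold amalgamation in A; apply amalgamation_clear in A; auto.
  + exists s; split; auto; intros m.
    assert (Hh : dyadic_holder s) by apply Hs.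
    apply holder_trunc in Hh; destruct Hh as [c' [mu' [Hc' [Hmu' Hh]]]].
    assert (L : is_lim_seq (fun n => r (Z.pos (approx (dyadic_of_Z m) n))) (r m)).
    { apply is_lim_seq_geometric with c mu 0%nat; auto; intros n _; apply Hq.
      apply divide_of_congr; now rewrite approx_mod, trunc_of_Z. }
    assert (L' : is_lim_seq (fun n => r (Z.pos (approx (dyadic_of_Z m) n))) (s (dyadic_of_Z m))).
    { apply is_lim_seq_geometric with c' mu' 0%nat; auto; intros n _; rewrite E.
      apply Hh, of_Z_close, approx_mod. }
    apply is_lim_seq_unique in L; apply is_lim_seq_unique in L'.
    rewrite L in L'; now injection L'.
Qed.

(** * Tilings and grids *)

Definition grid_level (n : positive) := pred (Pos.to_nat n).

Lemma grid_level_succ n : grid_level (n + 1) = S (grid_level n).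
Proof. unfold grid_level; lia. Qed.

(** A dividing point is the only common point of the two tiles next to it. *)
Lemma tile_image_vertices a b I J v w sg sg' : vertices I v sg -> vertices J w sg' ->
  (forall k, tile_image a b (I k) (J k)) -> forall k, w k = a * v k + b.
Proof.
intros HI HJ H k.
assert (V1 : in_tile (I k) (v k)).
{ rewrite (vertices_in I v sg) by auto; destruct (proj2 HI k) as [P _]; lra. }
assert (V2 : in_tile (I (k - 1)%Z) (v k)).
{ rewrite (vertices_in I v sg) by auto; destruct (proj2 HI (k - 1)%Z) as [P _].
  replace (k - 1 + 1)%Z with k in * by ring; lra. }
assert (W1 : in_tile (J k) (a * v k + b)) by (apply H; eauto).
assert (W2 : in_tile (J (k - 1)%Z) (a * v k + b)) by (apply H; eauto).
rewrite (vertices_in J w sg') in W1, W2 by auto.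
replace (k - 1 + 1)%Z with k in * by ring.
destruct HJ as [[->| ->] _]; lra.
Qed.

Lemma tile_image_union a b I I1 I2 J J1 J2 :
  (forall x, in_tile I x <-> in_tile I1 x \/ in_tile I2 x) ->
  (forall x, in_tile J x <-> in_tile J1 x \/ in_tile J2 x) ->
  tile_image a b I1 J1 -> tile_image a b I2 J2 -> tile_image a b I J.
Proof.
intros HI HJ H1 H2 y; rewrite HJ, (H1 y), (H2 y); split.
- intros [[x [Hx E]]|[x [Hx E]]]; exists x; split; auto; apply HI; auto.
- intros [x [Hx E]]; apply HI in Hx; destruct Hx; [left|right]; eauto.
Qed.

(** The lengths of the tiles of a level are sums of two lengths of the next level. *)
Lemma grid_amalgamation G B : (forall n, tiling_with B (G n)) -> is_grid G -> forall n,
  ext_eq (amalgamation (tiling_sequence (G (n + 1)%positive))) (tiling_sequence (G n)).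
Proof.
intros HB [_ HG] n i.
destruct (tiling_vertices B (G (n + 1)%positive) (HB _)) as [v [sg Hv]].
assert (L : forall b, tile_length (G n b)
  = tile_length (G (n + 1)%positive (2 * b - 1)%Z) + tile_length (G (n + 1)%positive (2 * b)%Z)).
{ intros b; specialize (HG n b).
  assert (P1 := proj1 (proj2 Hv (2 * b - 1)%Z)); assert (P2 := proj1 (proj2 Hv (2 * b)%Z)).
  rewrite !(vertices_length (G (n + 1)%positive) v sg) by auto.
  assert (HG' : forall x, in_tile (G n b) x <->
    0 <= sg * (x - v (2 * b - 1)%Z) <= sg * (v (2 * b + 1)%Z - v (2 * b - 1)%Z)).
  { intros x; rewrite HG, !(vertices_in (G (n + 1)%positive) v sg) by auto.
    replace (2 * b - 1 + 1)%Z with (2 * b)%Z in * by ring; destruct Hv as [[->| ->] _]; split; lra. }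
  replace (2 * b - 1 + 1)%Z with (2 * b)%Z in * by ring.
  assert (A := proj1 (HB n) b); unfold in_tile, tile_length in *.
  assert (H1 := proj1 (HG' (fst (G n b))) ltac:(lra)).
  assert (H2 := proj1 (HG' (snd (G n b))) ltac:(lra)).
  assert (H3 := proj2 (HG' (v (2 * b - 1)%Z)) ltac:(lra)).
  assert (H4 := proj2 (HG' (v (2 * b + 1)%Z)) ltac:(lra)).
  destruct Hv as [[->| ->] _]; lra. }
destruct (tiling_ratio _ v sg (2 * i - 1)%Z Hv) as [P1 E1].
destruct (tiling_ratio _ v sg (2 * i)%Z Hv) as [P2 E2].
destruct (tiling_ratio _ v sg (2 * i + 1)%Z Hv) as [P3 E3].
unfold amalgamation; unfold tiling_sequence at 5; rewrite !L.
replace (2 * (i + 1) - 1)%Z with (2 * i + 1)%Z by ring.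
replace (2 * (i + 1))%Z with (2 * i + 1 + 1)%Z by ring.
replace (2 * i - 1 + 1)%Z with (2 * i)%Z in E1 by ring.
rewrite E3, E2, E1.
assert (0 < tile_length (G (n + 1)%positive (2 * i - 1)%Z)).
{ rewrite (vertices_length (G (n + 1)%positive) v sg) by auto; apply Hv. }
field; split; nra.
Qed.

(** Level n of the grid is the image of the dyadic tiles of level n - 1, which refine each
    other.  For two grids with the same sequences each level has its own affine
    map, but the map of level n + 1 also matches the dividing points of level
    n, so all these maps coincide. *)
Lemma tilings_grids :
  canonical_bijection fixed_tiling tiling_eq fixed_grid grid_eq tiling_to_grid.
Proof.
split; [|split].
- intros I HI; destruct functions_tilings as [_ [_ Honto]].
  destruct (Honto I HI) as [s [Hs HsI]].
  destruct (adapted_exists s (dyadic_of_Z 0) Hs) as [F [HF _]].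
  assert (E : forall m, tiling_sequence (chart_tiles F m) = tiling_sequence I).
  { intros m; apply functional_extensionality; intros b; rewrite (HsI b).
    apply chart_tiles_sequence; auto; apply Hs. }
  exists (fun n => chart_tiles F (grid_level n)); split; [split; [split|split]|].
  + destruct (chart_tiles_tiling s Hs) as [B [HB H]]; exists B; auto.
  + intros n b x; rewrite grid_level_succ; unfold in_tile, chart_tiles; cbn [fst snd].
    set (m := grid_level n); replace (2 * b - 1 - 1)%Z with (2 * (b - 1))%Z by ring.
    rewrite !dy_double.
    assert (F (dy m (b - 1)) < F (dy (S m) (2 * b - 1))).
    { rewrite <- (dy_double m (b - 1)); apply HF, dy_lt; lia. }
    assert (F (dy (S m) (2 * b - 1)) < F (dy m b)).
    { rewrite <- (dy_double m b); apply HF, dy_lt; lia. }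
    lra.
  + intros n m; now rewrite !E.
  + rewrite E; apply HI.
  + intros n m; now rewrite E.
- intros I I' G G' [[B [_ HI]] _] [[B' [_ HI']] _] HG HG' R R'; split; intros E.
  + destruct HG as [[[D [_ HD]] HG] _], HG' as [[[D' [_ HD']] HG'] _].
    assert (Es : ext_eq (tiling_sequence I) (tiling_sequence I'))
      by now apply tiling_eq_sequence with B B'.
    assert (A : forall n, tiling_eq (G n) (G' n)).
    { intros n; apply same_sequence_affine with D D'; auto; intros m.
      rewrite (R n m), (R' n m); apply Es. }
    destruct (A 1%positive) as [a [b [Ha H1]]]; exists a, b; split; auto.
    intros n; pattern n; apply Pos.peano_ind; clear n; auto; intros n IH.
    rewrite <- Pos.add_1_r; destruct (A (n + 1)%positive) as [a' [b' [Ha' H']]].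
    destruct (tiling_vertices D (G n) (HD n)) as [v [sg Hv]].
    destruct (tiling_vertices D' (G' n) (HD' n)) as [w [sg' Hw]].
    assert (U1 := tile_image_vertices a b _ _ v w sg sg' Hv Hw IH).
    assert (U2 : forall k, w k = a' * v k + b').
    { apply (tile_image_vertices a' b' (G n) (G' n) v w sg sg'); auto; intros k.
      eapply tile_image_union; [apply HG|apply HG'| |]; apply H'. }
    assert (V := proj1 (proj2 Hv 0%Z)).
    assert (a' = a).
    { apply (Rmult_eq_reg_r (v (0 + 1)%Z - v 0%Z)); [|intros Eq; rewrite Eq in V; lra].
      generalize (U1 0%Z) (U1 (0 + 1)%Z) (U2 0%Z) (U2 (0 + 1)%Z); lra. }
    subst a'; assert (b' = b) by (generalize (U1 0%Z) (U2 0%Z); lra); subst b'; exact H'.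
  + apply same_sequence_affine with B B'; auto; intros m.
    rewrite <- (R 1%positive m), <- (R' 1%positive m).
    destruct HG as [[[D [_ HD]] HG] _], HG' as [[[D' [_ HD']] HG'] _].
    apply tiling_eq_sequence with D D'; auto.
    destruct E as [a [b [Ha H]]]; exists a, b; auto.
- intros G HG; exists (G 1%positive); split.
  + destruct HG as [HG1 [HG2 HG3]]; destruct HG1 as [[B [HB HD]] HG1].
    split; [exists B; auto|split; auto]; intros m.
    assert (Hgrid : is_grid G) by (split; [exists B; auto|auto]).
    rewrite <- (grid_amalgamation G B HD Hgrid 1%positive m).
    unfold amalgamation; now rewrite !(HG2 (1 + 1)%positive).
  + intros n m; apply HG.
Qed.

(** * The circle *)

Lemma continuous_on_ball {T U : UniformSpace} (D : T -> Prop) (f : T -> U) :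
  continuous_on D f <->
  forall x, D x -> forall e, 0 < e -> exists d, 0 < d /\
    forall y, D y -> ball x d y -> ball (f x) e (f y).
Proof.
split.
- intros H x Hx e He.
  destruct (H x Hx (ball (f x) e) (locally_ball (f x) (mkposreal e He))) as [d Hd].
  exists d; split; [apply cond_pos|]; intros y Hy Hxy; now apply Hd.
- intros H x Hx P [e He]; destruct (H x Hx e (cond_pos e)) as [d [Hd H']].
  exists (mkposreal d Hd); intros y Hxy Hy; apply He, H'; auto.
Qed.

Lemma cis_add s t : cis (s + t) = (cis s * cis t)%C.
Proof.
unfold cis; rewrite Rmult_plus_distr_l, cos_plus, sin_plus; unfold Cmult; simpl.
f_equal; ring.
Qed.

Lemma cis_0 : cis 0 = 1%C.
Proof. unfold cis; rewrite Rmult_0_r, cos_0, sin_0; reflexivity. Qed.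

Lemma cis_period t k : cis (t + IZR k) = cis t.
Proof.
revert k; apply Z_two_sided; [now rewrite Rplus_0_r|]; intros k.
assert (E := cis_add_bool (t + IZR k) true); simpl in E.
rewrite plus_IZR, <- Rplus_assoc, E; tauto.
Qed.

Lemma cis_eq_1 t : cis t = 1%C -> exists k : Z, t = IZR k.
Proof.
intros H; destruct (floor_ex t) as [k Hk]; exists k.
assert (E : cis (t - IZR k) = 1%C).
{ rewrite <- H, <- (cis_period (t - IZR k) k); f_equal; ring. }
set (d := t - IZR k) in *; assert (Hd : 0 <= d < 1) by (unfold d; lra).
apply (f_equal fst) in E; unfold cis in E; simpl in E.
replace (2 * PI * d) with (2 * (PI * d)) in E by ring; rewrite cos_2a_sin in E.
assert (HPI := PI_RGT_0).
destruct (Req_dec d 0) as [H0|H0]; [unfold d in H0; lra|].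
assert (0 < sin (PI * d)) by (apply sin_gt_0; nra); nra.
Qed.

Lemma cis_inj s t : cis s = cis t -> exists k : Z, s = t + IZR k.
Proof.
intros H; destruct (cis_eq_1 (s - t)) as [k Hk].
{ unfold Rminus; rewrite cis_add, H, <- cis_add, Rplus_opp_r; apply cis_0. }
exists k; lra.
Qed.

Lemma cis_inj_lt s t : cis s = cis t -> Rabs (s - t) < 1 -> s = t.
Proof.
intros H Hst; destruct (cis_inj s t H) as [k Hk].
replace (s - t) with (IZR k - IZR 0) in Hst by (rewrite Hk; simpl; ring).
apply IZR_lt_1_eq in Hst; subst k; simpl in Hk; lra.
Qed.

Lemma circle_sqr z : circle z -> fst z * fst z + snd z * snd z = 1.
Proof.
unfold circle, Cmod; intros H; simpl in H; rewrite !Rmult_1_r in H.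
rewrite <- (sqrt_sqrt (fst z * fst z + snd z * snd z)), H; [ring|nra].
Qed.

Lemma circle_param z : circle z -> exists t, 0 <= t < 1 /\ z = cis t.
Proof.
intros H; apply circle_sqr in H; assert (HPI := PI_RGT_0).
assert (Hx : -1 <= fst z <= 1) by nra.
assert (Ha := acos_bound (fst z)); set (a := acos (fst z)) in *.
assert (Hc : cos a = fst z) by now apply cos_acos.
assert (Hs : 0 <= sin a) by now apply sin_ge_0.
assert (Hs2 : sin a * sin a = snd z * snd z).
{ generalize (sin2_cos2 a); unfold Rsqr; rewrite Hc; nra. }
assert (Hr : 0 <= a / (2 * PI) <= / 2).
{ split; [apply Rmult_le_pos; [lra|left; apply Rinv_0_lt_compat; lra]|].
  apply (Rmult_le_reg_r (2 * PI)); [lra|]; replace (a / (2 * PI) * (2 * PI)) with a by (field; lra); lra. }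
destruct (Rle_lt_dec 0 (snd z)) as [Hz|Hz].
- exists (a / (2 * PI)); split; [lra|]; unfold cis.
  replace (2 * PI * (a / (2 * PI))) with a by (field; lra).
  destruct z as [x y]; simpl in *; f_equal; [auto|]; apply Rsqr_inj; auto; unfold Rsqr; lra.
- assert (E : z = cis (- (a / (2 * PI)))).
  { unfold cis; replace (2 * PI * - (a / (2 * PI))) with (- a) by (field; lra).
    rewrite cos_neg, sin_neg; destruct z as [x y]; simpl in *; f_equal; [auto|].
    assert (- y = sin a); [|lra]; apply Rsqr_inj; unfold Rsqr; lra. }
  destruct (floor_ex (- (a / (2 * PI)))) as [k Hk].
  exists (- (a / (2 * PI)) - IZR k); split; [lra|].
  rewrite E, <- (cis_period (- (a / (2 * PI)) - IZR k) k); f_equal; ring.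
Qed.

Lemma cis_continuous D : continuous_on D cis.
Proof.
apply continuous_on_ball; intros x _ e He.
assert (Hc : continuity_pt (fun t => cos (2 * PI * t)) x).
{ apply (continuity_pt_comp (fun t => 2 * PI * t) cos); [|apply continuity_cos].
  apply continuity_pt_mult; [apply continuity_pt_const; now intros u v|apply continuity_pt_id]. }
assert (Hs : continuity_pt (fun t => sin (2 * PI * t)) x).
{ apply (continuity_pt_comp (fun t => 2 * PI * t) sin); [|apply continuity_sin].
  apply continuity_pt_mult; [apply continuity_pt_const; now intros u v|apply continuity_pt_id]. }
destruct (Hc e He) as [d1 [Hd1 H1]], (Hs e He) as [d2 [Hd2 H2]].
exists (Rmin d1 d2); split; [now apply Rmin_pos|]; intros y _ Hxy.
assert (Hy : Rabs (y - x) < Rmin d1 d2) by exact Hxy.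
assert (Hy1 : Rabs (y - x) < d1) by (eapply Rlt_le_trans; [exact Hy|apply Rmin_l]).
assert (Hy2 : Rabs (y - x) < d2) by (eapply Rlt_le_trans; [exact Hy|apply Rmin_r]).
simpl in H1, H2; unfold Rdist in H1, H2.
destruct (Req_dec x y) as [->|Hne]; [apply ball_center with (e := mkposreal e He)|].
split; [apply H1|apply H2]; repeat split; auto.
Qed.

(** Openness of [cis] makes lifts of angles continuous and shows that arcs have the expected
    interior.  An angle far from t would have a cosine far from 1 after
    rotation by - t. *)
Lemma cis_open t e : 0 < e -> exists d, 0 < d /\
  forall z : C, circle z -> ball (cis t : C_UniformSpace) d z -> exists s, Rabs s < e /\ z = cis (t + s).
Proof.
intros He; assert (HPI := PI_RGT_0).
set (e' := Rmin e (/ 2)).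
assert (He' : 0 < e' <= / 2 /\ e' <= e).
{ unfold e'; repeat split; [apply Rmin_pos; lra|apply Rmin_r|apply Rmin_l]. }
assert (Hcos : cos (2 * PI * e') < 1).
{ rewrite <- cos_0; apply cos_decreasing_1; nra. }
exists ((1 - cos (2 * PI * e')) / 4); split; [lra|]; intros z Hz [B1 B2].
set (d := (1 - cos (2 * PI * e')) / 4) in *.
assert (B1' : Rabs (fst z - cos (2 * PI * t)) < d) by exact B1.
assert (B2' : Rabs (snd z - sin (2 * PI * t)) < d) by exact B2.
apply Rabs_def2 in B1'; apply Rabs_def2 in B2'.
destruct (circle_param (z * cis (- t))%C) as [s [Hs Es]].
{ apply circle_mult; auto; apply circle_cis. }
assert (Ez : z = cis (t + s)).
{ rewrite (Rplus_comm t), cis_add, <- Es, <- Cmult_assoc, <- cis_add, Rplus_opp_l, cis_0.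
  now rewrite Cmult_1_r. }
assert (Hre : cos (2 * PI * e') < cos (2 * PI * s)).
{ assert (E1 : fst z = cos (2 * PI * t) * cos (2 * PI * s) - sin (2 * PI * t) * sin (2 * PI * s)).
  { rewrite Ez; unfold cis; simpl; rewrite Rmult_plus_distr_l, cos_plus; ring. }
  assert (E2 : snd z = sin (2 * PI * t) * cos (2 * PI * s) + cos (2 * PI * t) * sin (2 * PI * s)).
  { rewrite Ez; unfold cis; simpl; rewrite Rmult_plus_distr_l, sin_plus; ring. }
  assert (Q := sin2_cos2 (2 * PI * t)); unfold Rsqr in Q.
  generalize (COS_bound (2 * PI * t)) (SIN_bound (2 * PI * t)); intros.
  set (a := cos (2 * PI * t)) in *; set (b := sin (2 * PI * t)) in *.
  assert (cos (2 * PI * s) = a * fst z + b * snd z).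
  { rewrite E1, E2; transitivity ((b * b + a * a) * cos (2 * PI * s)); [rewrite Q|]; ring. }
  assert (1 - cos (2 * PI * s) = a * (a - fst z) + b * (b - snd z)) by lra.
  assert (a * (a - fst z) <= d) by nra.
  assert (b * (b - snd z) <= d) by nra.
  unfold d in *; lra. }
destruct (Rlt_le_dec s (/ 2)) as [Hs2|Hs2].
- exists s; split; auto; rewrite Rabs_pos_eq by lra; apply Rlt_le_trans with e'; [|lra].
  apply Rnot_le_lt; intros Hle; apply (Rlt_not_le _ _ Hre), cos_decr_1; nra.
- exists (s - 1); split.
  + rewrite Rabs_left by lra; apply Rlt_le_trans with e'; [|lra].
    apply Rnot_le_lt; intros Hle; apply (Rlt_not_le _ _ Hre).
    replace (cos (2 * PI * s)) with (cos (2 * PI * (1 - s))).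
    * apply cos_decr_1; nra.
    * replace (2 * PI * (1 - s)) with (- (2 * PI * s) + 2 * PI) by ring.
      rewrite cos_plus, cos_2PI, sin_2PI, cos_neg; ring.
  + rewrite Ez, <- (cis_period (t + (s - 1)) 1); f_equal; simpl; ring.
Qed.

(** * The solenoid *)

Lemma solenoid_ext (x y : solenoid) : (forall n, x n = y n) -> x = y.
Proof.
intros H; destruct x as [f p q], y as [g p' q']; simpl in H.
assert (f = g) by (now apply functional_extensionality); subst g.
f_equal; apply proof_irrelevance.
Qed.

Lemma flow_flow x s t : flow (flow x s) t = flow x (s + t).
Proof.
apply solenoid_ext; intros n; simpl; rewrite <- Cmult_assoc, <- cis_add; do 2 f_equal.
field; apply pow_nonzero; lra.
Qed.

Lemma flow_0 x : flow x 0 = x.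
Proof.
apply solenoid_ext; intros n; simpl; unfold Rdiv; rewrite Rmult_0_l, cis_0.
apply Cmult_1_r.
Qed.

Lemma tilde_E_flow x t : tilde_E (flow x t) = flow (tilde_E x) (2 * t).
Proof.
apply solenoid_ext; intros [|n]; simpl.
- rewrite doubling_mult, doubling_cis; do 2 f_equal; field.
- do 2 f_equal; field; apply pow_nonzero; lra.
Qed.

Lemma Cmult_cis_inj z s t : circle z -> (z * cis s)%C = (z * cis t)%C -> cis s = cis t.
Proof.
intros Hz E; destruct (circle_param z Hz) as [u [_ ->]].
rewrite <- !cis_add in E.
replace s with (- u + (u + s)) by ring; rewrite cis_add, E, <- cis_add; f_equal; ring.
Qed.

Lemma flow_inj x s t : flow x s = flow x t -> s = t.
Proof.
intros E.
assert (H : forall n, exists k : Z, (s - t) / 2 ^ n = IZR k).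
{ intros n; apply (f_equal (fun y : solenoid => y n)) in E; simpl in E.
  apply Cmult_cis_inj in E; [|apply coord_circle]; apply cis_inj in E; destruct E as [k E].
  exists k; unfold Rdiv in *; rewrite Rmult_minus_distr_r; lra. }
destruct (pow_small (/ 2) (/ (Rabs (s - t) + 1))) as [n Hn]; [lra| |].
{ apply Rinv_0_lt_compat; generalize (Rabs_pos (s - t)); lra. }
destruct (H n) as [k Hk]; rewrite half_pow_inv in Hn.
assert (Hp : 0 < 2 ^ n) by (apply pow_lt; lra).
assert (Hlt : Rabs (IZR k - IZR 0) < 1).
{ replace (IZR k - IZR 0) with (IZR k) by (simpl; ring).
  rewrite <- Hk; unfold Rdiv; rewrite Rabs_mult, (Rabs_pos_eq (/ 2 ^ n))
    by (left; now apply Rinv_0_lt_compat).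
  generalize (Rabs_pos (s - t)); intros Hst.
  assert (0 < / 2 ^ n) by now apply Rinv_0_lt_compat.
  assert (E1 : (Rabs (s - t) + 1) * / (Rabs (s - t) + 1) = 1) by (field; lra); nra. }
apply IZR_lt_1_eq in Hlt; subst k; simpl in Hk.
apply (Rmult_eq_compat_r (2 ^ n)) in Hk; unfold Rdiv in Hk.
rewrite Rmult_assoc, Rinv_l in Hk; lra.
Qed.

Lemma cis_mod z n : cis (IZR (z mod 2 ^ Z.of_nat n) / 2 ^ n) = cis (IZR z / 2 ^ n).
Proof.
rewrite <- (cis_period _ (z / 2 ^ Z.of_nat n)); f_equal.
rewrite (Z.div_mod z (2 ^ Z.of_nat n)) at 3 by (generalize (pow2_pos n); lia).
rewrite plus_IZR, mult_IZR, <- pow_IZR; simpl; field; apply pow_nonzero; lra.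
Qed.

Lemma omega_shift a k : flow (tilde_omega a) (IZR k) = tilde_omega (dyadic_affine 1 k a).
Proof.
apply solenoid_ext; intros n; cbn [flow tilde_omega coord].
rewrite trunc_affine, cis_mod, <- cis_add; f_equal.
rewrite Z.mul_1_l, plus_IZR; field; apply pow_nonzero; lra.
Qed.

Lemma tilde_E_omega a : tilde_E (tilde_omega a) = tilde_omega (dyadic_affine 2 0 a).
Proof.
apply solenoid_ext; intros [|n]; cbn [coord tilde_coord tilde_omega tilde_E].
- rewrite doubling_cis, trunc_affine, cis_mod; f_equal; simpl; field.
- rewrite trunc_affine, cis_mod, Z.add_0_r, mult_IZR, trunc_S, plus_IZR, mult_IZR, <- pow_IZR.
  rewrite <- (cis_period _ (Z.b2z (a n))); f_equal.
  simpl; field; apply pow_nonzero; lra.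
Qed.

Lemma omega_coord a b n : tilde_omega a n = tilde_omega b n -> trunc a n = trunc b n.
Proof.
intros E; simpl in E.
assert (Hp : 0 < 2 ^ n) by (apply pow_lt; lra).
assert (R := trunc_range a n); assert (R' := trunc_range b n).
assert (Hlt : forall z, (0 <= z < 2 ^ Z.of_nat n)%Z -> 0 <= IZR z / 2 ^ n < 1).
{ intros z [H1 H2]; apply IZR_le in H1; apply IZR_lt in H2; rewrite <- pow_IZR in H2.
  split; [apply Rmult_le_pos; auto; left; now apply Rinv_0_lt_compat|].
  apply (Rmult_lt_reg_r (2 ^ n)); auto; unfold Rdiv; rewrite Rmult_assoc, Rinv_l; simpl in *; lra. }
apply Hlt in R; apply Hlt in R'; apply cis_inj_lt in E; [|apply Rabs_def1; lra].
apply eq_IZR, (Rmult_eq_reg_r (/ 2 ^ n)); auto; apply Rgt_not_eq, Rinv_0_lt_compat; auto.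
Qed.

Lemma omega_inj a b : tilde_omega a = tilde_omega b -> a = b.
Proof. intros E; apply trunc_inj; intros n; apply omega_coord; now rewrite E. Qed.

(** Every leaf meets the fibre over 1, which the 2-adic integers parametrize. *)
Lemma leaf_base (x : solenoid) : exists a t, 0 <= t < 1 /\ x = flow (tilde_omega a) t.
Proof.
destruct (circle_param (x 0%nat)) as [t [Ht Et]]; [apply coord_circle|].
set (y := flow x (- t)).
assert (Hy0 : y 0%nat = 1%C).
{ unfold y; simpl; rewrite Et, <- cis_add, <- cis_0; f_equal; field. }
assert (Hy : forall n, exists k : Z, y n = cis (IZR k / 2 ^ n)).
{ induction n as [|n [k Hk]].
  - exists 0%Z; rewrite Hy0, <- cis_0; f_equal; simpl; field.
  - destruct (circle_param (y (S n))) as [u [_ Hu]]; [apply coord_circle|].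
    assert (E := coord_doubling y n); rewrite Hu, Hk, doubling_cis in E.
    apply cis_inj in E; destruct E as [j E]; exists (k + j * 2 ^ Z.of_nat n)%Z.
    rewrite Hu; f_equal; replace u with ((2 * u) / 2) by field; rewrite E.
    rewrite plus_IZR, mult_IZR, <- pow_IZR; simpl; field; apply pow_nonzero; lra. }
apply ClassicalEpsilon.choice in Hy; destruct Hy as [k Hk].
assert (HS : forall n, (k (S n) mod 2 ^ Z.of_nat n = k n mod 2 ^ Z.of_nat n)%Z).
{ intros n; assert (E := coord_doubling y n); rewrite !Hk, doubling_cis in E.
  apply cis_inj in E; destruct E as [j E].
  replace (k (S n)) with (k n + j * 2 ^ Z.of_nat n)%Z; [apply Z_mod_plus_full|].
  assert (Hp : 2 ^ n <> 0) by (apply pow_nonzero; lra).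
  apply eq_IZR; rewrite plus_IZR, mult_IZR, <- pow_IZR.
  apply (Rmult_eq_compat_r (2 ^ n)) in E; rewrite Rmult_plus_distr_r in E.
  replace (IZR (k n) / 2 ^ n * 2 ^ n) with (IZR (k n)) in E by (field; auto).
  rewrite <- E; simpl; field; auto. }
set (a := fun n => Z.testbit (k (S n)) (Z.of_nat n)).
assert (Ha : forall n, trunc a n = (k n mod 2 ^ Z.of_nat n)%Z).
{ intros n; apply trunc_testbits; intros i Hi; unfold a; apply testbit_congr.
  induction Hi as [|m Hm IH]; auto.
  rewrite IH, <- (mod_pow2_le (k (S m)) (S i) m), HS, mod_pow2_le; auto. }
exists a, t; split; auto.
replace x with (flow y t) by (unfold y; rewrite flow_flow, Rplus_opp_l; apply flow_0).
f_equal; apply solenoid_ext; intros n; rewrite Hk; simpl; now rewrite Ha, cis_mod.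
Qed.

Lemma tilde_E_onto (x : solenoid) : exists y, tilde_E y = x.
Proof.
exists (Solenoid (fun n => x (S n)) (fun n => coord_circle x (S n)) (fun n => coord_doubling x (S n))).
apply solenoid_ext; intros [|n]; [apply (coord_doubling x 0)|reflexivity].
Qed.

Lemma coord_rotation (x y : solenoid) n s : x n = (y n * cis s)%C ->
  x 0%nat = (y 0%nat * cis (2 ^ n * s))%C.
Proof.
revert s; induction n as [|n IH]; intros s E.
- rewrite E; do 2 f_equal; simpl; ring.
- rewrite (IH (2 * s)); [do 2 f_equal; simpl; ring|].
  rewrite <- (coord_doubling x n), E, doubling_mult, coord_doubling, doubling_cis; reflexivity.
Qed.

Lemma coordinate_path_local (f : R -> C) D x e :
  (forall s, circle (f s)) -> continuous_on D f -> D x -> 0 < e ->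
  exists d, 0 < d /\ forall y, D y -> Rabs (y - x) < d -> exists s, Rabs s < e /\ f y = (f x * cis s)%C.
Proof.
intros Hf HC Hx He; destruct (circle_param (f x) (Hf x)) as [t [_ Et]].
destruct (cis_open t e He) as [d [Hd Ho]].
destruct (proj1 (continuous_on_ball D f) HC x Hx d Hd) as [d' [Hd' H]].
exists d'; split; auto; intros y Hy Hxy.
destruct (Ho (f y) (Hf y)) as [s [Hs Es]].
- rewrite <- Et; now apply H.
- exists s; split; auto; now rewrite Es, Et, cis_add.
Qed.

(** A path in the solenoid stays on an orbit of the flow.  Near a parameter s0,
    the coordinate 0 of the path turns by a small angle tau; the coordinate n
    turns by tau / 2^n, since this holds at s0 and continuity propagates it:
    any other rotation of the coordinate n compatible with the coordinate 0
    would differ by a multiple of 2^-n turns. *)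
Lemma path_local (gamma : R -> solenoid) s0 :
  (forall n, continuous_on (fun s => 0 <= s <= 1) (fun s => gamma s n)) -> 0 <= s0 <= 1 ->
  exists d, 0 < d /\ forall s, 0 <= s <= 1 -> Rabs (s - s0) < d ->
    exists t, gamma s = flow (gamma s0) t.
Proof.
intros HC Hs0.
destruct (coordinate_path_local (fun s => gamma s 0%nat) _ s0 (/ 8)
  (fun s => coord_circle (gamma s) 0) (HC 0%nat) Hs0 ltac:(lra)) as [d [Hd H]].
exists d; split; auto; intros s Hs Hss.
assert (Htau : forall u, exists t, 0 <= u <= 1 -> Rabs (u - s0) < d ->
  Rabs t < / 8 /\ gamma u 0%nat = (gamma s0 0%nat * cis t)%C).
{ intros u; destruct (classic (0 <= u <= 1 /\ Rabs (u - s0) < d)) as [[H1 H2]|Hn].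
  - destruct (H u H1 H2) as [t Ht]; now exists t.
  - exists 0; intros; tauto. }
apply ClassicalEpsilon.choice in Htau; destruct Htau as [tau Htau].
exists (tau s); apply solenoid_ext; intros n; simpl.
set (P := fun u => gamma u n = (gamma s0 n * cis (tau u / 2 ^ n))%C).
assert (Hp : 0 < 2 ^ n) by (apply pow_lt; lra).
assert (P0 : P s0).
{ unfold P; destruct (Htau s0 Hs0) as [H1 H2]; [rewrite Rminus_diag, Rabs_R0; auto|].
  assert (tau s0 = 0).
  { apply cis_inj_lt; [|rewrite Rminus_0_r; lra].
    apply (Cmult_cis_inj (gamma s0 0%nat)); [apply coord_circle|].
    rewrite <- H2, cis_0; symmetry; apply Cmult_1_r. }
  rewrite H0; unfold Rdiv; rewrite Rmult_0_l, cis_0; symmetry; apply Cmult_1_r. }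
assert (Hloc : forall x, 0 <= x <= 1 -> Rabs (x - s0) < d -> exists e, 0 < e /\
  forall y, 0 <= y <= 1 -> Rabs (y - s0) < d -> Rabs (y - x) < e -> (P x <-> P y)).
{ intros x Hx Hxs.
  destruct (coordinate_path_local (fun s => gamma s n) _ x (/ 8 / 2 ^ n)
    (fun s => coord_circle (gamma s) n) (HC n) Hx) as [e [He H']].
  { apply Rdiv_lt_0_compat; lra. }
  exists e; split; auto; intros y Hy Hys Hyx.
  destruct (H' y Hy Hyx) as [sg [Hsg Esg]].
  destruct (Htau x Hx Hxs) as [T1 T2], (Htau y Hy Hys) as [T3 T4].
  assert (E := coord_rotation (gamma y) (gamma x) n sg Esg).
  assert (Hsg' : Rabs (2 ^ n * sg) < / 8).
  { rewrite Rabs_mult, (Rabs_pos_eq (2 ^ n)) by lra.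
    apply (Rmult_lt_compat_l (2 ^ n)) in Hsg; auto.
    now replace (2 ^ n * (/ 8 / 2 ^ n)) with (/ 8) in Hsg by (field; lra). }
  assert (Et : tau y = tau x + 2 ^ n * sg).
  { apply cis_inj_lt.
    - apply (Cmult_cis_inj (gamma s0 0%nat)); [apply coord_circle|].
      rewrite <- T4, E, T2, cis_add; apply eq_sym, Cmult_assoc.
    - apply Rabs_def2 in T1; apply Rabs_def2 in T3; apply Rabs_def2 in Hsg'.
      apply Rabs_def1; lra. }
  assert (Es : tau y / 2 ^ n = tau x / 2 ^ n + sg) by (rewrite Et; field; lra).
  unfold P; rewrite Es, Esg, cis_add, Cmult_assoc; split; [now intros ->|].
  destruct (circle_param (gamma x n)) as [u [_ Eu]]; [apply coord_circle|].
  destruct (circle_param (gamma s0 n)) as [v [_ Ev]]; [apply coord_circle|].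
  rewrite Eu, Ev, <- !cis_add; intros Ec.
  replace u with (u + sg + - sg) by ring; rewrite cis_add, Ec, <- cis_add; f_equal; ring. }
change (P s).
assert (Seg : forall x y, 0 <= x -> x <= y -> y <= 1 ->
  (forall u, x <= u <= y -> Rabs (u - s0) < d) -> (P x <-> P y)).
{ intros x y Hx Hxy Hy Hin.
  apply (interval_induction (fun u v => P u <-> P v) x y Hxy); [intros; tauto|].
  intros u Hu; destruct (Hloc u ltac:(lra) (Hin u Hu)) as [e [He H']].
  exists e; split; auto; intros v w Hv Hw Hv' Hw'.
  assert (A1 := H' v ltac:(lra) ltac:(apply Hin; lra) ltac:(apply Rabs_def1; lra)).
  assert (A2 := H' w ltac:(lra) ltac:(apply Hin; lra) ltac:(apply Rabs_def1; lra)).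
  tauto. }
apply Rabs_def2 in Hss.
destruct (Rle_dec s0 s) as [L|L].
- apply (Seg s0 s); auto; try lra; intros u Hu; apply Rabs_def1; lra.
- apply (Seg s s0); auto; try lra; intros u Hu; apply Rabs_def1; lra.
Qed.

(** Being on the same orbit is a local property along a path, hence a global one. *)
Lemma same_leaf_flow x y : same_leaf x y <-> exists t, y = flow x t.
Proof.
split.
- intros [gamma [HC [H0 H1]]].
  assert (H : exists t, gamma 1 = flow (gamma 0) t); [|destruct H as [t Ht]; exists t; congruence].
  apply (interval_induction (fun u v => exists t, gamma v = flow (gamma u) t) 0 1); [lra| |].
  + intros u v w _ _ [t Ht] [t' Ht']; exists (t + t'); now rewrite Ht', Ht, flow_flow.
  + intros u Hu; destruct (path_local gamma u HC Hu) as [d [Hd H]]; exists d; split; auto.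
    intros v w Hv Hw Hv' Hw'.
    destruct (H v) as [t Ht]; [lra|apply Rabs_def1; lra|].
    destruct (H w) as [t' Ht']; [lra|apply Rabs_def1; lra|].
    exists (- t + t'); now rewrite Ht', Ht, flow_flow, <- Rplus_assoc, Rplus_opp_r, Rplus_0_l.
- intros [t ->]; exists (fun s => flow x (s * t)); split; [|split].
  + intros n; destruct (circle_param (x n)) as [u [_ Eu]]; [apply coord_circle|].
    apply continuous_on_ball; intros s Hs e He.
    destruct (proj1 (continuous_on_ball (fun _ => True) cis) (cis_continuous _) (u + s * t / 2 ^ n) I e He)
      as [d [Hd H]].
    assert (Ht : 0 < Rabs t + 1) by (generalize (Rabs_pos t); lra).
    assert (Hp : 1 <= 2 ^ n) by (apply pow_R1_Rle; lra).
    assert (Hp' : 0 < / 2 ^ n <= 1).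
    { split; [apply Rinv_0_lt_compat; lra|]; rewrite <- Rinv_1; apply Rinv_le_contravar; lra. }
    exists (d / (Rabs t + 1)); split; [now apply Rdiv_lt_0_compat|]; intros s' _ Hss.
    assert (Hss' : Rabs (s' - s) < d / (Rabs t + 1)) by exact Hss.
    simpl; rewrite Eu, <- !cis_add; apply H; auto.
    change (Rabs (u + s' * t / 2 ^ n - (u + s * t / 2 ^ n)) < d).
    replace (u + s' * t / 2 ^ n - (u + s * t / 2 ^ n)) with ((s' - s) * t * / 2 ^ n)
      by (field; lra).
    rewrite !Rabs_mult, (Rabs_pos_eq (/ 2 ^ n)) by lra.
    apply (Rmult_lt_compat_r (Rabs t + 1)) in Hss'; auto.
    replace (d / (Rabs t + 1) * (Rabs t + 1)) with d in Hss' by (field; lra).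
    generalize (Rabs_pos (s' - s)) (Rabs_pos t); intros; nra.
  + rewrite Rmult_0_l; apply flow_0.
  + now rewrite Rmult_1_l.
Qed.

(** * Affine structures on the leaves *)

Definition leaf_fun (phi : solenoid -> R) (x : solenoid) (t : R) := phi (flow x t).

Lemma leaf_fun_injective phi x s t : leaf_structure phi ->
  leaf_fun phi x s = leaf_fun phi x t -> s = t.
Proof.
intros [_ H] E; apply (flow_inj x), H; auto.
apply same_leaf_flow; exists (t - s); rewrite flow_flow; f_equal; ring.
Qed.

Lemma leaf_fun_continuity phi x : leaf_structure phi -> continuity (leaf_fun phi x).
Proof. intros [H _] t; apply continuity_pt_filterlim, H. Qed.

Lemma continuity_seg_cont F p q : continuity F -> seg_cont F p q.
Proof.
intros HF x _ e He; destruct (HF x e He) as [d [Hd H]]; exists d; split; auto.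
intros y _ Hy; destruct (Req_dec x y) as [->|Hne]; [rewrite Rminus_diag, Rabs_R0; auto|].
apply H; repeat split; auto.
Qed.

Lemma leaf_fun_oriented phi x : leaf_structure phi -> exists sg, (sg = 1 \/ sg = -1) /\
  forall s t, s < t -> sg * leaf_fun phi x s < sg * leaf_fun phi x t.
Proof.
intros Hphi; set (G := leaf_fun phi x).
assert (HM : forall p q, p <= q -> monotone_on G p q).
{ intros p q Hpq; apply injective_monotone; auto.
  - apply continuity_seg_cont; now apply leaf_fun_continuity.
  - intros s t _ _; now apply leaf_fun_injective. }
destruct (Rtotal_order (G 0) (G 1)) as [H|[H|H]].
- exists 1; split; auto; intros s t Hst; rewrite !Rmult_1_l.
  destruct (HM (Rmin s 0) (Rmax t 1)) as [M|M].
  + generalize (Rmin_l s 0) (Rmax_l t 1); lra.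
  + apply M; auto; [apply Rmin_l|apply Rmax_l].
  + specialize (M 0 1 ltac:(apply Rmin_r) ltac:(lra) ltac:(apply Rmax_r)); simpl in M; lra.
- apply leaf_fun_injective in H; auto; lra.
- exists (-1); split; auto; intros s t Hst.
  destruct (HM (Rmin s 0) (Rmax t 1)) as [M|M].
  + generalize (Rmin_l s 0) (Rmax_l t 1); lra.
  + specialize (M 0 1 ltac:(apply Rmin_r) ltac:(lra) ltac:(apply Rmax_r)); simpl in M; lra.
  + specialize (M s t ltac:(apply Rmin_l) Hst ltac:(apply Rmax_l)); simpl in M; lra.
Qed.

Lemma ratio_rescale phi x m t1 t2 t3 : leaf_structure phi -> tilde_E_invariant phi ->
  t1 <> t2 -> t2 <> t3 -> t1 <> t3 ->
  R3 (leaf_fun phi (Nat.iter m tilde_E x)) (2 ^ m * t1) (2 ^ m * t2) (2 ^ m * t3)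
  = R3 (leaf_fun phi x) t1 t2 t3.
Proof.
intros Hl HE H12 H23 H13; induction m as [|m IH]; [simpl; now rewrite !Rmult_1_l|].
rewrite <- IH; set (y := Nat.iter m tilde_E x); simpl Nat.iter.
assert (Hm : 0 < 2 ^ m) by (apply pow_lt; lra).
assert (E : forall t, flow (tilde_E y) (2 ^ S m * t) = tilde_E (flow y (2 ^ m * t))).
{ intros t; rewrite tilde_E_flow; f_equal; simpl; ring. }
assert (Hne : forall s t, s <> t -> flow y (2 ^ m * s) <> flow y (2 ^ m * t)).
{ intros s t Hst Eq; apply flow_inj in Eq; nra. }
assert (Hsl : forall s t, same_leaf (flow y s) (flow y t)).
{ intros s t; apply same_leaf_flow; exists (t - s); rewrite flow_flow; f_equal; ring. }
unfold R3, leaf_fun; fold y; rewrite !E.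
apply (HE (flow y (2 ^ m * t1)) (flow y (2 ^ m * t2)) (flow y (2 ^ m * t3))); auto.
Qed.

Lemma iter_omega m a : Nat.iter m tilde_E (tilde_omega a) = tilde_omega (dyadic_affine (2 ^ Z.of_nat m) 0 a).
Proof.
induction m as [|m IH]; [simpl; now rewrite affine_id|].
simpl Nat.iter; rewrite IH, tilde_E_omega, affine_comp, pow2_S; do 2 f_equal; ring.
Qed.

(** The m-th iterate of the solenoid map moves the dyadic points of level m to points of
    the fibre over 1, where the ratios are values of s. *)
Lemma leaf_fun_adapted phi s a : leaf_structure phi -> tilde_E_invariant phi ->
  leaf_to_function phi s -> exists sg, (sg = 1 \/ sg = -1) /\
  adapted s a (fun t => sg * leaf_fun phi (tilde_omega a) t).
Proof.
intros Hl HE Hs; destruct (leaf_fun_oriented phi (tilde_omega a) Hl) as [sg [Hsg HI]].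
exists sg; split; auto; split; [exact HI|split].
- apply continuity_scal; now apply leaf_fun_continuity.
- intros m k; set (F := fun t => sg * leaf_fun phi (tilde_omega a) t) in *.
  assert (Hlt : forall j, dy m (j - 1) < dy m j < dy m (j + 1)).
  { intros j; split; apply dy_lt; lia. }
  assert (HlF := HI _ _ (proj1 (Hlt k))); assert (HlF' := HI _ _ (proj2 (Hlt k))).
  assert (E : R3 F (dy m (k - 1)) (dy m k) (dy m (k + 1)) = s (dyadic_affine (2 ^ Z.of_nat m) k a)).
  { rewrite Hs.
    transitivity (R3 (leaf_fun phi (tilde_omega a)) (dy m (k - 1)) (dy m k) (dy m (k + 1))).
    - rewrite <- (R3_affine (leaf_fun phi (tilde_omega a)) sg 0) by (destruct Hsg; intros Hz; lra).
      unfold R3, F; now rewrite !Rplus_0_r.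
    - specialize (Hlt k); rewrite <- (ratio_rescale phi _ m) by (auto; lra).
      rewrite iter_omega.
      assert (Ed : forall j, 2 ^ m * dy m j = IZR j).
      { intros j; unfold dy; rewrite half_pow_inv; field; apply pow_nonzero; lra. }
      rewrite !Ed; unfold R3, leaf_fun, ratio; rewrite !omega_shift, !affine_comp.
      replace (1 * 2 ^ Z.of_nat m)%Z with (2 ^ Z.of_nat m)%Z by ring.
      replace (1 * 0 + (k - 1))%Z with (1 * k + -1)%Z by ring.
      replace (1 * 0 + k)%Z with k by ring.
      now replace (1 * 0 + (k + 1))%Z with (1 * k + 1)%Z by ring. }
  rewrite <- E; unfold tile, R3.
  replace (k - 1 + 1)%Z with k by ring.
  fold (F (dy m (k - 1))) in HlF; fold (F (dy m k)) in HlF, HlF'; fold (F (dy m (k + 1))) in HlF'.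
  rewrite !Rabs_left by lra; field; lra.
Qed.

Lemma leaf_to_function_pos phi s : leaf_structure phi -> leaf_to_function phi s -> forall a, 0 < s a.
Proof.
intros Hl Hs a; rewrite Hs; unfold ratio.
assert (E1 : tilde_omega (dyadic_affine 1 (-1) a) = flow (tilde_omega a) (-1)) by (symmetry; apply omega_shift).
assert (E2 : tilde_omega (dyadic_affine 1 1 a) = flow (tilde_omega a) 1) by (symmetry; apply omega_shift).
rewrite E1, E2; rewrite <- (flow_0 (tilde_omega a)) at 1 4.
apply Rdiv_lt_0_compat; apply Rabs_pos_lt; intros E; apply Rminus_diag_uniq in E;
  apply leaf_fun_injective in E; auto; lra.
Qed.

(** The functional equation compares the unit tiles next to a point with the four
    tiles of level 1 that they contain. *)
Lemma tile_law_equation s a F : (forall x, 0 < s x) -> (forall x y, x < y -> F x < F y) ->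
  tile_law s a F -> s (dyadic_affine 2 1 a)
    = s a / s (dyadic_affine 2 0 a) * (1 + 1 / s (dyadic_affine 2 (-1) a)) - 1.
Proof.
intros Hp HI HR; apply equation_clear; auto.
assert (R0 := HR 0%nat 0%Z); assert (R1 := HR 1%nat 1%Z); assert (R2 := HR 1%nat 0%Z);
  assert (R3 := HR 1%nat (-1)%Z).
change (2 ^ Z.of_nat 0)%Z with 1%Z in R0; rewrite affine_id in R0.
change (2 ^ Z.of_nat 1)%Z with 2%Z in *.
rewrite !(tile_split F 0) in R0; simpl Z.mul in *; simpl Z.add in *; simpl Z.sub in *.
assert (P : 0 < tile F 1 (-2)) by now apply tile_pos.
rewrite R1, R2, R3 in R0.
apply (Rmult_eq_reg_r (tile F 1 (-2))); lra.
Qed.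

Lemma leaf_to_function_solution phi s : invariant_leaf_structure phi -> leaf_to_function phi s ->
  dyadic_solution s.
Proof.
intros [Hl [HT HE]] Hs; assert (Hp := leaf_to_function_pos phi s Hl Hs).
split; [exact Hp|split].
- destruct (HT 1 ltac:(lra)) as [c [mu [Hc [Hmu H]]]].
  assert (Hln : forall n a b, trunc a n = trunc b n -> Rabs (ln (s a) - ln (s b)) <= c * mu ^ n).
  { intros n a b Hab.
    assert (E : forall a, s a = ratio phi (flow (tilde_omega a) (-1)) (flow (tilde_omega a) 0) (flow (tilde_omega a) 1)).
    { intros d; rewrite flow_0, Hs; rewrite !omega_shift; reflexivity. }
    rewrite !E; apply H; try lra; simpl; now rewrite Hab. }
  set (M := ln (s (fun _ => true)) + c).
  assert (HM : forall a, ln (s a) <= M).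
  { intros a; assert (A := Hln 0%nat a (fun _ => true) eq_refl); simpl in A.
    apply Rabs_le_between in A; unfold M; lra. }
  exists (exp M * c), mu; split; [apply Rmult_lt_0_compat; auto using exp_pos|split; auto].
  intros n a b Hab; apply agree_trunc in Hab.
  rewrite <- (exp_ln (s a)), <- (exp_ln (s b)) by auto.
  eapply Rle_trans; [apply (exp_lipschitz M); auto|].
  rewrite Rmult_assoc; apply Rmult_le_compat_l; [left; apply exp_pos|auto].
- intros a; destruct (leaf_fun_adapted phi s a Hl HE Hs) as [sg [_ [HI [_ HF]]]].
  now apply tile_law_equation with (fun t => sg * leaf_fun phi (tilde_omega a) t).
Qed.

(** On each leaf, the maps of both structures obey the same tile law. *)
Lemma leaf_structure_eq_function phi psi s s' :
  invariant_leaf_structure phi -> invariant_leaf_structure psi ->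
  leaf_to_function phi s -> leaf_to_function psi s' ->
  (leaf_structure_eq phi psi <-> ext_eq s s').
Proof.
intros Hphi Hpsi Hs Hs'; split; intros E.
- intros a; rewrite (Hs a), (Hs' a).
  destruct (E (tilde_omega a)) as [A [B [HA H]]]; unfold ratio.
  rewrite <- !omega_shift, !H.
  + assert (R := R3_affine (leaf_fun phi (tilde_omega a)) A B (-1) 0 1 HA).
    unfold R3, leaf_fun in R; rewrite flow_0 in R; symmetry; exact R.
  + apply same_leaf_flow; first [now exists 1|now exists (-1)|exists 0; now rewrite flow_0].
  + apply same_leaf_flow; first [now exists 1|now exists (-1)|exists 0; now rewrite flow_0].
  + apply same_leaf_flow; first [now exists 1|now exists (-1)|exists 0; now rewrite flow_0].
- intros x; destruct (leaf_base x) as [a [t [_ ->]]].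
  assert (Hsol := leaf_to_function_solution phi s Hphi Hs).
  assert (E' : s' = s) by (apply functional_extensionality; intros b; symmetry; apply E); subst s'.
  destruct (leaf_fun_adapted phi s a) as [sg [Hsg HF]]; try apply Hphi; auto.
  destruct (leaf_fun_adapted psi s a) as [sg' [Hsg' HG]]; try apply Hpsi; auto.
  destruct (adapted_unique s a _ _ (proj1 Hsol) HF HG) as [A [B [HA H]]].
  exists (sg' * A * sg), (sg' * B); split.
  + destruct Hsg as [->| ->], Hsg' as [->| ->]; intros E0; lra.
  + intros y Hy; apply same_leaf_flow in Hy; destruct Hy as [u ->]; rewrite flow_flow.
    specialize (H (t + u)); unfold leaf_fun in H.
    destruct Hsg' as [->| ->]; lra.
Qed.

Lemma adapted_R3 s a F G t1 t2 t3 : dyadic_solution s -> adapted s a F -> adapted s a G ->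
  R3 F t1 t2 t3 = R3 G t1 t2 t3.
Proof.
intros Hs HF HG; destruct (adapted_unique s a F G (proj1 Hs) HF HG) as [A [B [HA E]]].
rewrite <- (R3_affine F A B) by lra; unfold R3; now rewrite !E.
Qed.

Lemma coord_le (x y : solenoid) n : x n = y n -> x 0%nat = y 0%nat.
Proof.
intros E; rewrite (coord_rotation x y n 0).
- now rewrite Rmult_0_r, cis_0, Cmult_1_r.
- now rewrite cis_0, Cmult_1_r.
Qed.

(** The transverse Hölder condition compares charts of leaves with common digits.  The
    structure is invariant because the solenoid map moves the chart of a to a
    function with the tile law of 2 a, which determines it. *)
Lemma adapted_structure s phi : dyadic_solution s ->
  (forall a, adapted s a (leaf_fun phi (tilde_omega a))) ->
  invariant_leaf_structure phi /\ leaf_to_function phi s.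
Proof.
intros Hs H.
assert (HF : forall a t u, phi (flow (flow (tilde_omega a) t) u) = leaf_fun phi (tilde_omega a) (t + u)).
{ intros a t u; now rewrite flow_flow. }
split; [split; [split|split]|].
- intros x t; destruct (leaf_base x) as [a [u [_ ->]]]; apply continuity_pt_filterlim.
  apply (continuity_pt_ext (fun v => leaf_fun phi (tilde_omega a) (u + v))); [intros; now rewrite HF|].
  apply (continuity_pt_comp (fun v => u + v)); [|apply H].
  apply continuity_pt_plus; [apply continuity_pt_const; now intros v w|apply continuity_pt_id].
- intros x y Hxy E; destruct (leaf_base x) as [a [u [_ ->]]].
  apply same_leaf_flow in Hxy; destruct Hxy as [t ->]; rewrite HF in E.
  destruct (Req_dec t 0) as [->|Ht]; [now rewrite flow_0|exfalso].
  apply (adapted_neq s a (leaf_fun phi (tilde_omega a)) u (u + t)); auto; lra.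
- intros T HT; destruct (floor_ex (T + 2)) as [K HK].
  assert (HKp : (0 <= K)%Z) by (apply le_IZR; apply Rnot_lt_le; intros HH; apply lt_IZR in HH;
    assert (HH' : (K <= -1)%Z) by lia; apply IZR_le in HH'; simpl in HH'; lra).
  destruct (adapted_transverse s Hs (Z.to_nat K)) as [C [mu [HC [Hmu HT']]]].
  assert (HN : T + 1 < INR (Z.to_nat K)) by (rewrite INR_IZR_INZ, Z2Nat.id; lra || lia).
  exists C, mu; split; [auto|split; [auto|]]; intros n x x' E t1 t2 t3 H1 H2 H3 H12 H23 H13.
  destruct (leaf_base x) as [a [u [Hu ->]]], (leaf_base x') as [b [u' [Hu' ->]]].
  assert (E0 := coord_le _ _ _ E); simpl in E0.
  assert (Huu : u = u').
  { apply cis_inj_lt; [|apply Rabs_def1; lra].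
    rewrite <- (Cmult_1_l (cis u)), <- (Cmult_1_l (cis u')), <- cis_0.
    replace 0 with (0 / 1) by field; replace u with (u / 1) by field; replace u' with (u' / 1) by field.
    exact E0. }
  subst u'; change (tilde_omega a n * cis (u / 2 ^ n) = tilde_omega b n * cis (u / 2 ^ n))%C in E.
  assert (Eab : trunc a n = trunc b n).
  { apply omega_coord; rewrite <- (Cmult_1_r (tilde_omega a n)), <- (Cmult_1_r (tilde_omega b n)).
    rewrite <- cis_0; replace 0 with (u / 2 ^ n + - (u / 2 ^ n)) by ring.
    now rewrite cis_add, !Cmult_assoc, E. }
  unfold ratio; rewrite !HF.
  apply (HT' n a b (leaf_fun phi (tilde_omega a)) (leaf_fun phi (tilde_omega b)) (u + t1) (u + t2) (u + t3));
    auto; lra.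
- intros x y z Hy Hz _ _ _; destruct (leaf_base x) as [a [u [_ ->]]].
  apply same_leaf_flow in Hy; destruct Hy as [t ->].
  apply same_leaf_flow in Hz; destruct Hz as [v ->].
  rewrite !flow_flow, !tilde_E_flow, !tilde_E_omega.
  assert (HG := adapted_rescale s a _ 1 0 (H a)).
  assert (E := adapted_R3 s _ _ _ (2 * u) (2 * (u + t)) (2 * (u + v)) Hs (H (dyadic_affine 2 0 a)) HG).
  unfold ratio; unfold R3, leaf_fun in E; rewrite E.
  now replace ((2 * u + 0) * (/ 2) ^ 1) with u by (simpl; field);
  replace ((2 * (u + t) + 0) * (/ 2) ^ 1) with (u + t) by (simpl; field);
  replace ((2 * (u + v) + 0) * (/ 2) ^ 1) with (u + v) by (simpl; field).
- intros a; unfold ratio; rewrite <- !omega_shift.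
  assert (E := proj2 (proj2 (H a)) 0%nat 0%Z); assert (P : 0 < tile (leaf_fun phi (tilde_omega a)) 0 (-1)).
  { eapply adapted_pos; apply H. }
  change (2 ^ Z.of_nat 0)%Z with 1%Z in E; rewrite affine_id in E.
  assert (P' : 0 < tile (leaf_fun phi (tilde_omega a)) 0 0) by (eapply adapted_pos; apply H).
  unfold tile, leaf_fun, dy in *; simpl in *; rewrite !Rmult_1_r in *.
  rewrite flow_0 in E, P, P'; rewrite !Rabs_left by lra.
  apply (Rmult_eq_reg_r (phi (tilde_omega a) - phi (flow (tilde_omega a) (-1)))); [|lra].
  rewrite <- E; field; lra.
Qed.

(** The affine structure is built leaf by leaf, from one chosen point in each
    leaf: the choice depends on the leaf only. *)
Lemma structure_exists s : dyadic_solution s ->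
  exists phi, forall a, adapted s a (leaf_fun phi (tilde_omega a)).
Proof.
intros Hs.
assert (HF : forall a, exists F, adapted s a F).
{ intros a; destruct (adapted_exists s a Hs) as [F [HF _]]; now exists F. }
apply ClassicalEpsilon.choice in HF; destruct HF as [F HF].
set (base := fun x : solenoid => epsilon (inhabits (fun _ : nat => true)) (fun a => exists t, x = flow (tilde_omega a) t)).
set (time := fun x => epsilon (inhabits 0) (fun t => x = flow (tilde_omega (base x)) t)).
assert (Hb : forall x, exists t, x = flow (tilde_omega (base x)) t).
{ intros x; apply (epsilon_spec _ (fun a => exists t, x = flow (tilde_omega a) t)); destruct (leaf_base x) as [a [t [_ E]]]; now exists a, t. }
assert (Ht : forall x, x = flow (tilde_omega (base x)) (time x)) by (intros x; apply (epsilon_spec _ (fun t => x = flow (tilde_omega (base x)) t)), Hb).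
assert (Hbf : forall x t, base (flow x t) = base x).
{ intros x t; unfold base; f_equal; apply functional_extensionality; intros a.
  apply propositional_extensionality; split; intros [u E].
  - exists (u - t); replace x with (flow (flow x t) (- t)) by (rewrite flow_flow, Rplus_opp_r; apply flow_0).
    now rewrite E, flow_flow.
  - exists (u + t); now rewrite E, flow_flow. }
exists (fun x => F (base x) (time x)); intros a.
set (b := base (tilde_omega a)); destruct (Hb (tilde_omega a)) as [u Hu]; fold b in Hu.
assert (Hj : exists j, u = IZR j).
{ apply cis_eq_1; apply (f_equal (fun x : solenoid => x 0%nat)) in Hu; simpl in Hu.
  replace (0 / 1) with 0 in Hu by field; replace (u / 1) with u in Hu by field.
  rewrite cis_0, Cmult_1_l in Hu; now symmetry. }
destruct Hj as [j ->]; rewrite omega_shift in Hu.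
assert (Ea := omega_inj _ _ Hu); rewrite <- omega_shift in Hu.
assert (E : leaf_fun (fun x => F (base x) (time x)) (tilde_omega a)
  = fun t => F b ((t + IZR j) * (/ 2) ^ 0)).
{ apply functional_extensionality; intros t; unfold leaf_fun; rewrite Hbf; fold b; f_equal.
  apply (flow_inj (tilde_omega b)); unfold b at 1; rewrite <- (Hbf (tilde_omega a) t), <- Ht.
  rewrite Hu, flow_flow; f_equal; simpl; ring. }
rewrite E, Ea; apply (adapted_rescale s b (F b) 0 j), HF.
Qed.

Lemma leaves_functions :
  canonical_bijection invariant_leaf_structure leaf_structure_eq
                      dyadic_solution ext_eq leaf_to_function.
Proof.
split; [|split].
- intros phi Hphi.
  exists (fun a => ratio phi (tilde_omega (dyadic_affine 1 (-1) a)) (tilde_omega a) (tilde_omega (dyadic_affine 1 1 a))).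
  assert (R : leaf_to_function phi (fun a => ratio phi (tilde_omega (dyadic_affine 1 (-1) a)) (tilde_omega a)
    (tilde_omega (dyadic_affine 1 1 a)))) by (intros a; reflexivity).
  split; auto; now apply leaf_to_function_solution with phi.
- intros phi psi s s' Hphi Hpsi _ _ R R'; now apply leaf_structure_eq_function.
- intros s Hs; destruct (structure_exists s Hs) as [phi H]; exists phi.
  now apply adapted_structure.
Qed.

(** * Quasisymmetry and tangency of monotone functions *)

(** Comparing increments over adjacent segments of equal length bounds all
    increments by powers of the length, in both directions: doubling a
    segment multiplies its increment by a factor between 1 + 1/k and 1 + k. *)
Lemma weak_quasisymmetry F p q k : p < q -> 0 < k -> monotone_on F p q ->
  (forall x h, 0 < h -> p <= x - h -> x + h <= q ->
     Rabs (F (x + h) - F x) <= k * Rabs (F x - F (x - h)) /\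
     Rabs (F x - F (x - h)) <= k * Rabs (F (x + h) - F x)) ->
  forall n x y, p <= x -> x <= y -> y <= q ->
  (y - x <= 2 / 3 * (q - p) * (/ 2) ^ n -> Rabs (F y - F x) <= (k / (1 + k)) ^ n * Rabs (F q - F p)) /\
  (2 / 3 * (q - p) * (/ 2) ^ n <= y - x ->
     / (1 + 2 * k) * (/ (1 + k)) ^ n * Rabs (F q - F p) <= Rabs (F y - F x)).
Proof.
intros Hpq Hk HM HQ.
assert (Add := fun x y z => monotone_dist_add F p q x y z HM).
assert (Tot : forall x y, p <= x -> x <= y -> y <= q -> Rabs (F y - F x) <= Rabs (F q - F p)).
{ intros x y H1 H2 H3; apply (monotone_dist_incl F p q); auto; lra. }
(* a segment of length at most (q - p) / 3 can be doubled on one side *)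
assert (Dbl : forall x y, p <= x -> x < y -> y <= q -> y - x <= (q - p) / 3 -> exists x' y',
  p <= x' /\ x' <= y' /\ y' <= q /\ y' - x' = 2 * (y - x) /\
  (1 + k) * Rabs (F y - F x) <= k * Rabs (F y' - F x') /\
  Rabs (F y' - F x') <= (1 + k) * Rabs (F y - F x)).
{ intros x y H1 H2 H3 H4; destruct (Rle_dec (2 * y - x) q) as [H|H].
  - exists x, (2 * y - x); repeat split; try lra.
    + destruct (HQ y (y - x)) as [Q1 Q2]; try lra.
      rewrite (Add x y (2 * y - x)) by lra.
      replace (y + (y - x)) with (2 * y - x) in * by ring; replace (y - (y - x)) with x in * by ring; lra.
    + destruct (HQ y (y - x)) as [Q1 Q2]; try lra.
      rewrite (Add x y (2 * y - x)) by lra.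
      replace (y + (y - x)) with (2 * y - x) in * by ring; replace (y - (y - x)) with x in * by ring; lra.
  - exists (2 * x - y), y; repeat split; try lra.
    + destruct (HQ x (y - x)) as [Q1 Q2]; try lra.
      rewrite (Add (2 * x - y) x y) by lra.
      replace (x + (y - x)) with y in * by ring; replace (x - (y - x)) with (2 * x - y) in * by ring; lra.
    + destruct (HQ x (y - x)) as [Q1 Q2]; try lra.
      rewrite (Add (2 * x - y) x y) by lra.
      replace (x + (y - x)) with y in * by ring; replace (x - (y - x)) with (2 * x - y) in * by ring; lra. }
assert (Hi : 0 < / (1 + k)) by (apply Rinv_0_lt_compat; lra).
induction n as [|n IH]; intros x y Hx Hxy Hy; split; intros Hl.
- simpl; rewrite Rmult_1_l; now apply Tot.
- simpl in *; rewrite Rmult_1_r in *.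
  apply (Rmult_le_reg_l (1 + 2 * k)); [lra|].
  rewrite <- Rmult_assoc, Rinv_r by lra; rewrite Rmult_1_l.
  rewrite (Add p x q), (Add x y q) by lra.
  assert (Rabs (F x - F p) <= k * Rabs (F y - F x)).
  { destruct (Req_dec x p) as [->|Hn].
    - rewrite Rminus_diag, Rabs_R0; generalize (Rabs_pos (F y - F p)); nra.
    - destruct (HQ x (x - p)) as [_ Q]; try lra; replace (x - (x - p)) with p in Q by ring.
      apply Rle_trans with (1 := Q), Rmult_le_compat_l; [lra|].
      apply (monotone_dist_incl F p q); auto; lra. }
  assert (Rabs (F q - F y) <= k * Rabs (F y - F x)); [|lra].
  { destruct (Req_dec y q) as [->|Hn].
    - rewrite Rminus_diag, Rabs_R0; generalize (Rabs_pos (F q - F x)); nra.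
    - destruct (HQ y (q - y)) as [Q _]; try lra; replace (y + (q - y)) with q in Q by ring.
      apply Rle_trans with (1 := Q), Rmult_le_compat_l; [lra|].
      apply (monotone_dist_incl F p q); auto; lra. }
- destruct (Req_dec x y) as [<-|Hne].
  { rewrite Rminus_diag, Rabs_R0; apply Rmult_le_pos; [|apply Rabs_pos].
    apply pow_le, Rmult_le_pos; lra. }
  assert (P1 := pow_le_1 (/ 2) n ltac:(lra)); simpl in Hl.
  destruct (Dbl x y) as [x' [y' [D1 [D2 [D3 [D4 [D5 D6]]]]]]]; auto; try nra.
  destruct (IH x' y') as [A _]; auto; specialize (A ltac:(rewrite D4; lra)).
  simpl; apply (Rmult_le_reg_l (1 + k)); [lra|]; apply Rle_trans with (1 := D5).
  replace ((1 + k) * (k / (1 + k) * (k / (1 + k)) ^ n * Rabs (F q - F p)))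
    with (k * ((k / (1 + k)) ^ n * Rabs (F q - F p))) by (field; lra).
  apply Rmult_le_compat_l; lra.
- set (z := Rmin y (x + (q - p) / 3)).
  assert (Hz : z <= y /\ x < z /\ z <= x + (q - p) / 3 /\ 2 / 3 * (q - p) * (/ 2) ^ S n <= z - x).
  { assert (P1 := pow_le_1 (/ 2) n ltac:(lra)); simpl in *.
    unfold z; apply Rmin_case_strong; intros; repeat split; nra. }
  destruct Hz as [Z1 [Z2 [Z3 Z4]]]; simpl in Z4.
  destruct (Dbl x z) as [x' [y' [D1 [D2 [D3 [D4 [D5 D6]]]]]]]; auto; try lra.
  destruct (IH x' y') as [_ A]; auto; specialize (A ltac:(rewrite D4; lra)).
  apply Rle_trans with (Rabs (F z - F x)); [|apply (monotone_dist_incl F p q); auto; lra].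
  apply (Rmult_le_reg_l (1 + k)); [lra|]; apply Rle_trans with (2 := D6), Rle_trans with (2 := A).
  simpl; apply Req_le; field; lra.
Qed.

Definition log_slope (F G : R -> R) x y := ln (Rabs (F y - F x)) - ln (Rabs (G y - G x)).

Lemma log_slope_sym F G x y : log_slope F G x y = log_slope F G y x.
Proof. unfold log_slope; now rewrite (Rabs_minus_sym (F y)), (Rabs_minus_sym (G y)). Qed.

Lemma dist3_log_slope F G p q t1 t2 t3 : monotone_on F p q -> monotone_on G p q ->
  p <= t1 <= q -> p <= t2 <= q -> p <= t3 <= q -> t1 <> t2 -> t2 <> t3 ->
  dist3 F G t1 t2 t3 = Rabs (log_slope F G t2 t3 - log_slope F G t2 t1).
Proof.
intros HF HG H1 H2 H3 H12 H23; unfold dist3.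
assert (I : forall H, monotone_on H p q -> H t1 <> H t2 /\ H t2 <> H t3).
{ intros H HM; split; intros E; apply (monotone_inj H p q) in E; auto. }
destruct (I F HF), (I G HG); rewrite !ln_R3 by auto; unfold log_slope.
rewrite (Rabs_minus_sym (F t3)), (Rabs_minus_sym (G t3)); f_equal; ring.
Qed.

(** F is differentiable relative to G, with a Hölder logarithmic derivative lam,
    when distances are measured in the dyadic scale. *)
Definition tangent (F G lam : R -> R) p q N mu :=
  forall x, p <= x <= q -> Rabs (lam x) <= N /\
    forall y n, p <= y <= q -> x <> y -> Rabs (y - x) <= (/ 2) ^ n ->
      Rabs (log_slope F G x y - lam x) <= N * mu ^ n.

Lemma tangent_mono F G lam p q N N' mu mu' : tangent F G lam p q N mu ->
  0 < N <= N' -> 0 < mu <= mu' -> tangent F G lam p q N' mu'.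
Proof.
intros H HN Hmu x Hx; destruct (H x Hx) as [H1 H2]; split; [lra|].
intros y n Hy Hxy Hn; apply Rle_trans with (1 := H2 y n Hy Hxy Hn).
assert (0 < mu ^ n) by (apply pow_lt; lra).
assert (mu ^ n <= mu' ^ n) by (apply pow_incr; lra); nra.
Qed.

Lemma tangent_bound F G lam p q N mu x y : q - p <= 1 -> tangent F G lam p q N mu ->
  p <= x <= q -> p <= y <= q -> x <> y -> Rabs (log_slope F G x y) <= 2 * N.
Proof.
intros Hpq H Hx Hy Hxy; destruct (H x Hx) as [H1 H2].
specialize (H2 y 0%nat Hy Hxy); simpl in H2; rewrite Rmult_1_r in H2.
apply Rabs_le_between in H1.
assert (A := H2 ltac:(apply Rabs_le; lra)); apply Rabs_le_between in A; apply Rabs_le; lra.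
Qed.

(** Slopes over adjacent small segments that agree up to a power of their
    lengths converge; the bounds on [p, q] follow by cutting it into a
    bounded number of small segments. *)
Lemma tangent_of_dist3 F G p q C mu n0 : p < q -> q - p <= 1 -> 0 < C -> 0 < mu < 1 ->
  monotone_on F p q -> monotone_on G p q ->
  (forall n t1 t2 t3, (n0 <= n)%nat -> p <= t1 <= q -> p <= t2 <= q -> p <= t3 <= q ->
     t1 <> t2 -> t2 <> t3 -> Rabs (t1 - t2) <= (/ 2) ^ n -> Rabs (t3 - t2) <= (/ 2) ^ n ->
     dist3 F G t1 t2 t3 <= C * mu ^ n) ->
  exists lam N, 0 < N /\ tangent F G lam p q N mu.
Proof.
intros Hpq Hpq1 HC Hmu HF HG H.
assert (H' : forall n t1 t2 t3, (n0 <= n)%nat -> p <= t1 <= q -> p <= t2 <= q -> p <= t3 <= q ->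
     t1 <> t2 -> t2 <> t3 -> Rabs (t1 - t2) <= (/ 2) ^ n -> Rabs (t3 - t2) <= (/ 2) ^ n ->
     Rabs (log_slope F G t2 t3 - log_slope F G t2 t1) <= C * mu ^ n).
{ intros n t1 t2 t3 Hn H1 H2 H3 H12 H23 D1 D3.
  rewrite <- (dist3_log_slope F G p q) by auto; now apply H. }
set (C1 := C + C / (1 - mu)).
assert (HC1 : 0 < C1).
{ assert (0 < C / (1 - mu)) by (apply Rdiv_lt_0_compat; lra); unfold C1; lra. }
assert (Hlam : forall x, exists l, p <= x <= q -> forall y n, (n0 <= n)%nat -> p <= y <= q -> x <> y ->
  Rabs (y - x) <= (/ 2) ^ n -> Rabs (log_slope F G x y - l) <= C1 * mu ^ n).
{ intros x; destruct (classic (p <= x <= q)) as [Hx|Hx]; [|exists 0; tauto].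
  assert (Hd : exists d, 0 < Rabs d <= 1 /\ forall k, p <= x + d * (/ 2) ^ k <= q).
  { destruct (Rle_dec x ((p + q) / 2)) as [Hm|Hm]; [exists ((q - p) / 2)|exists (- ((q - p) / 2))];
      (split; [rewrite ?Rabs_Ropp, Rabs_pos_eq; lra|]); intros k;
      assert (P := pow_le_1 (/ 2) k ltac:(lra)); nra. }
  destruct Hd as [d [Hd Hin]]; set (y := fun k => x + d * (/ 2) ^ k).
  assert (Hy : forall k, y k <> x /\ Rabs (y k - x) <= (/ 2) ^ k).
  { intros k; assert (P := pow_le_1 (/ 2) k ltac:(lra)).
    replace (y k - x) with (d * (/ 2) ^ k) by (unfold y; ring).
    rewrite Rabs_mult, (Rabs_pos_eq ((/ 2) ^ k)) by lra; split; [|nra].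
    unfold y; intros E; assert (E0 : d * (/ 2) ^ k = 0) by lra.
    apply Rmult_integral in E0; destruct E0 as [E0|E0]; [rewrite E0, Rabs_R0 in Hd|]; lra. }
  destruct (cauchy_geometric (fun k => log_slope F G x (y k)) C mu n0) as [l [_ Hl]]; auto; try lra.
  - intros n Hn; destruct (Hy n) as [A1 A2], (Hy (S n)) as [A3 A4].
    apply H'; auto; try apply Hin.
    apply Rle_trans with (1 := A4), pow_decr; [lra|lia].
  - exists l; intros _ z n Hn Hz Hxz Hzx.
    replace (log_slope F G x z - l)
      with ((log_slope F G x z - log_slope F G x (y n)) - (l - log_slope F G x (y n))) by ring.
    eapply Rle_trans; [apply Rabs_triang|]; rewrite Rabs_Ropp.
    destruct (Hy n) as [A1 A2].
    assert (B1 := H' n (y n) x z Hn (Hin n) Hx Hz A1 Hxz A2 Hzx).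
    specialize (Hl n Hn); unfold C1; lra. }
apply ClassicalEpsilon.choice in Hlam; destruct Hlam as [lam Hlam].
set (dl := (/ 2) ^ n0); assert (Hdl : 0 < dl <= 1) by (apply pow_le_1; lra).
assert (Hmun : 0 < mu ^ n0 <= 1) by now apply pow_le_1.
assert (Hll : forall x y, p <= x <= q -> p <= y <= q -> Rabs (y - x) <= dl -> Rabs (lam y - lam x) <= 2 * C1).
{ intros x y Hx Hy Hxy; destruct (Req_dec x y) as [->|Hne]; [rewrite Rminus_diag, Rabs_R0; lra|].
  assert (A1 := Hlam x Hx y n0 (le_n _) Hy Hne Hxy).
  assert (A2 := Hlam y Hy x n0 (le_n _) Hx (not_eq_sym Hne) ltac:(rewrite Rabs_minus_sym; auto)).
  rewrite log_slope_sym in A2; apply Rabs_le_between in A1; apply Rabs_le_between in A2.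
  apply Rabs_le; nra. }
assert (Hchain : forall j x, p <= x <= q -> x - p <= INR j * dl -> Rabs (lam x) <= Rabs (lam p) + INR j * (2 * C1)).
{ induction j as [|j IH]; intros x Hx Hj.
  - simpl in *; replace x with p by lra; lra.
  - rewrite S_INR in *; destruct (Rle_dec (x - p) dl) as [Hd|Hd].
    + assert (A := Hll p x ltac:(lra) Hx ltac:(rewrite Rabs_pos_eq; lra)).
      replace (lam x) with ((lam x - lam p) + lam p) by ring.
      eapply Rle_trans; [apply Rabs_triang|]; generalize (pos_INR j); nra.
    + assert (A := Hll (x - dl) x ltac:(lra) Hx ltac:(rewrite Rabs_pos_eq; lra)).
      specialize (IH (x - dl) ltac:(lra) ltac:(lra)).
      replace (lam x) with ((lam x - lam (x - dl)) + lam (x - dl)) by ring.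
      eapply Rle_trans; [apply Rabs_triang|]; lra. }
assert (HJ : exists j, 1 <= INR j * dl).
{ exists (2 ^ n0)%nat; rewrite pow_INR; unfold dl; rewrite half_pow_inv; replace (INR 2) with 2 by (simpl; ring).
  apply Req_le; field; apply pow_nonzero; lra. }
destruct HJ as [J HJ].
set (M1 := Rabs (lam p) + INR J * (2 * C1)).
assert (HM1 : 0 <= M1).
{ unfold M1; generalize (Rabs_pos (lam p)) (pos_INR J); nra. }
assert (Hb1 : forall x, p <= x <= q -> Rabs (lam x) <= M1).
{ intros x Hx; apply Hchain; auto; lra. }
set (M0 := M1 + C1).
assert (Hsm : forall x y, p <= x -> x < y -> y <= q -> y - x <= dl -> Rabs (log_slope F G x y) <= M0).
{ intros x y Hx Hxy Hy Hd.
  assert (A := Hlam x ltac:(lra) y n0 (le_n _) ltac:(lra) ltac:(lra) ltac:(rewrite Rabs_pos_eq; auto; lra)).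
  assert (A' := Hb1 x ltac:(lra)).
  apply Rabs_le_between in A; apply Rabs_le_between in A'; unfold M0; apply Rabs_le; nra. }
assert (Hpos : forall F x y, monotone_on F p q -> p <= x -> x < y -> y <= q -> 0 < Rabs (F y - F x)).
{ intros F' x y HF' H1 H2 H3; apply (monotone_dist_pos F' p q); auto; lra. }
assert (Hbig : forall j x y, p <= x -> x < y -> y <= q -> y - x <= INR j * dl ->
  Rabs (F y - F x) <= exp M0 * Rabs (G y - G x) /\ Rabs (G y - G x) <= exp M0 * Rabs (F y - F x)).
{ assert (Hsm' : forall x y, p <= x -> x < y -> y <= q -> y - x <= dl ->
    Rabs (F y - F x) <= exp M0 * Rabs (G y - G x) /\ Rabs (G y - G x) <= exp M0 * Rabs (F y - F x)).
  { intros x y Hx Hxy Hy Hd; assert (A := Hsm x y Hx Hxy Hy Hd).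
    split; (apply ln_le_exp; [auto|auto|]); [exact A|rewrite Rabs_minus_sym; exact A]. }
  induction j as [|j IH]; intros x y Hx Hxy Hy Hj; [simpl in Hj; lra|].
  rewrite S_INR in Hj; destruct (Rle_dec (y - x) dl) as [Hd|Hd]; [now apply Hsm'|].
  destruct (IH x (y - dl)) as [I1 I2]; try lra.
  destruct (Hsm' (y - dl) y) as [S1 S2]; try lra.
  rewrite (monotone_dist_add F p q x (y - dl) y), (monotone_dist_add G p q x (y - dl) y) by (auto; lra).
  lra. }
assert (Hb0 : forall x y, p <= x -> x < y -> y <= q -> Rabs (log_slope F G x y) <= M0).
{ intros x y Hx Hxy Hy; destruct (Hbig J x y) as [B1 B2]; auto; try lra.
  apply ln_exp_le; auto. }
exists lam, ((C1 + M0 + M1) / mu ^ n0).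
assert (HN : C1 + M0 + M1 <= (C1 + M0 + M1) / mu ^ n0).
{ apply (Rmult_le_reg_r (mu ^ n0)); [lra|]; unfold Rdiv; rewrite Rmult_assoc, Rinv_l by lra.
  unfold M0; nra. }
unfold M0 in *; split; [lra|].
intros x Hx; split; [specialize (Hb1 x Hx); lra|].
intros y n Hy Hxy Hn.
destruct (le_lt_dec n0 n) as [L|L].
- eapply Rle_trans; [apply Hlam; eauto|]; apply Rmult_le_compat_r; [left; apply pow_lt; lra|lra].
- apply Rle_trans with (M1 + C1 + M1).
  + assert (A : Rabs (log_slope F G x y) <= M1 + C1).
    { destruct (Rdichotomy x y Hxy); [|rewrite log_slope_sym]; apply Hb0; lra. }
    eapply Rle_trans; [apply Rabs_triang|]; rewrite Rabs_Ropp; specialize (Hb1 x Hx); lra.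
  + assert (mu ^ n0 <= mu ^ n) by (apply pow_decr; [auto|lia]).
    apply Rle_trans with ((C1 + (M1 + C1) + M1) / mu ^ n0 * mu ^ n0).
    * replace ((C1 + (M1 + C1) + M1) / mu ^ n0 * mu ^ n0) with (C1 + (M1 + C1) + M1) by (field; lra); lra.
    * apply Rmult_le_compat_l; lra.
Qed.

(** * Derivatives on segments *)

Lemma derivative_on_eps K f g : derivative_on K f g <->
  forall x, K x -> forall e, 0 < e -> exists d, 0 < d /\
    forall y, K y -> y <> x -> Rabs (y - x) < d -> Rabs ((f y - f x) / (y - x) - g x) < e.
Proof.
split.
- intros H x Hx e He.
  destruct (H x Hx _ (locally_ball (g x : R_UniformSpace) (mkposreal e He))) as [d Hd].
  exists d; split; [apply cond_pos|]; intros y Hy Hne Hxy; apply (Hd y Hxy); auto.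
- intros H x Hx P [e He]; destruct (H x Hx e (cond_pos e)) as [d [Hd H']].
  exists (mkposreal d Hd); intros y Hxy Hne Hy; apply He, H'; auto.
Qed.

Lemma derivative_seg_cont K f g p q : derivative_on K f g -> (forall x, p <= x <= q -> K x) ->
  seg_cont f p q.
Proof.
intros H HK x Hx e He.
destruct (proj1 (derivative_on_eps K f g) H x (HK x Hx) 1 ltac:(lra)) as [d [Hd H']].
set (M := Rabs (g x) + 1); assert (HM : 0 < M) by (unfold M; generalize (Rabs_pos (g x)); lra).
exists (Rmin d (e / M)); split; [apply Rmin_pos; auto; now apply Rdiv_lt_0_compat|].
intros y Hy Hxy; destruct (Req_dec y x) as [->|Hne]; [rewrite Rminus_diag, Rabs_R0; auto|].
assert (H1 : Rabs (y - x) < d) by (eapply Rlt_le_trans; [exact Hxy|apply Rmin_l]).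
assert (H2 : Rabs (y - x) < e / M) by (eapply Rlt_le_trans; [exact Hxy|apply Rmin_r]).
specialize (H' y (HK y Hy) Hne H1).
assert (A : Rabs ((f y - f x) / (y - x)) <= M).
{ replace ((f y - f x) / (y - x)) with (((f y - f x) / (y - x) - g x) + g x) by ring.
  eapply Rle_trans; [apply Rabs_triang|]; unfold M; lra. }
replace (f y - f x) with ((f y - f x) / (y - x) * (y - x)) by (field; lra).
rewrite Rabs_mult; apply Rle_lt_trans with (M * Rabs (y - x)).
- apply Rmult_le_compat_r; [apply Rabs_pos|auto].
- apply (Rmult_lt_compat_l M) in H2; auto; now replace (M * (e / M)) with e in H2 by (field; lra).
Qed.

Lemma mean_value K f g p q : p < q -> derivative_on K f g -> (forall x, p <= x <= q -> K x) ->
  exists c, p <= c <= q /\ f q - f p = g c * (q - p).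
Proof.
intros Hpq H HK.
assert (HC := derivative_seg_cont K f g p q H HK).
destruct (MVT_gen (fun t => f (clamp p q t)) p q g) as [c [Hc E]].
- rewrite Rmin_left, Rmax_right by lra; intros x Hx.
  apply is_derive_Reals; intros e He.
  destruct (proj1 (derivative_on_eps K f g) H x (HK x ltac:(lra)) e He) as [d [Hd H']].
  assert (Hm : 0 < Rmin d (Rmin (x - p) (q - x))) by (repeat apply Rmin_pos; lra).
  exists (mkposreal _ Hm); intros h Hh Hlt; simpl in Hlt.
  assert (L1 : Rabs h < d) by (eapply Rlt_le_trans; [exact Hlt|apply Rmin_l]).
  assert (L2 : Rabs h < Rmin (x - p) (q - x)) by (eapply Rlt_le_trans; [exact Hlt|apply Rmin_r]).
  assert (L3 : Rabs h < x - p) by (eapply Rlt_le_trans; [exact L2|apply Rmin_l]).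
  assert (L4 : Rabs h < q - x) by (eapply Rlt_le_trans; [exact L2|apply Rmin_r]).
  apply Rabs_def2 in L3; apply Rabs_def2 in L4.
  rewrite !clamp_id by lra.
  assert (A := H' (x + h) (HK (x + h) ltac:(lra)) ltac:(lra)).
  replace (x + h - x) with h in A by ring; now apply A.
- intros x _; apply clamp_continuity; auto; lra.
- rewrite Rmin_left, Rmax_right in Hc by lra; exists c; split; auto.
  rewrite !clamp_id in E by lra; exact E.
Qed.

Lemma Rpower_mono_base a b e : 0 < a <= b -> 0 < e -> Rpower a e <= Rpower b e.
Proof. intros Hab He; apply Rle_Rpower_l; lra. Qed.

(** By the mean value theorem slopes are values of the derivative, whose logarithm is
    Hölder where it is bounded away from zero. *)
Lemma C1_holder_slopes K f g p q m c eps x y z :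
  derivative_on K f g -> holder_on K g eps c -> (forall t, p <= t <= q -> K t) ->
  0 < eps -> 0 < m -> (forall t, p <= t <= q -> m <= Rabs (g t)) ->
  p <= x <= q -> p <= y <= q -> p <= z <= q -> x <> y -> y <> z ->
  Rabs (log_slope f id y z - log_slope f id y x) <= Rabs c / m * Rpower (q - p) eps.
Proof.
intros Hd Hh HK He Hm Hg Hx Hy Hz Hxy Hyz.
assert (S : forall s t, p <= s <= q -> p <= t <= q -> s <> t ->
  exists w, p <= w <= q /\ log_slope f id s t = ln (Rabs (g w))).
{ assert (S' : forall s t, p <= s <= q -> p <= t <= q -> s < t ->
    exists w, p <= w <= q /\ log_slope f id s t = ln (Rabs (g w))).
  { intros s t Hs Ht Hst; destruct (mean_value K f g s t Hst Hd) as [w [Hw E]].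
    { intros; apply HK; lra. }
    exists w; split; [lra|]; assert (m <= Rabs (g w)) by (apply Hg; lra).
    unfold log_slope, id; rewrite E, Rabs_mult, ln_mult; [ring|lra|apply Rabs_pos_lt; lra]. }
  intros s t Hs Ht Hst; destruct (Rdichotomy s t Hst) as [L|L]; [now apply S'|].
  rewrite log_slope_sym; now apply S'. }
destruct (S y z) as [w [Hw Ew]]; auto; destruct (S y x) as [v [Hv Ev]]; auto.
rewrite Ew, Ev; destruct (Req_dec w v) as [->|Hne].
{ rewrite Rminus_diag, Rabs_R0; apply Rmult_le_pos; [|left; apply exp_pos].
  apply Rmult_le_pos; [apply Rabs_pos|left; now apply Rinv_0_lt_compat]. }
eapply Rle_trans; [apply (ln_lipschitz m); auto|].
unfold Rdiv; rewrite Rmult_assoc, (Rmult_comm (/ m)), <- Rmult_assoc.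
apply Rmult_le_compat_r; [left; now apply Rinv_0_lt_compat|].
eapply Rle_trans; [apply Rabs_triang_inv2|].
eapply Rle_trans; [apply Hh; auto|].
apply Rle_trans with (Rabs c * Rpower (Rabs (w - v)) eps).
- apply Rmult_le_compat_r; [left; apply exp_pos|apply Rle_abs].
- apply Rmult_le_compat_l; [apply Rabs_pos|]; apply Rpower_mono_base; auto.
  split; [apply Rabs_pos_lt; lra|apply Rabs_le; lra].
Qed.

(** * Charts of the circle *)

Definition arc_fun (u : chart) (t : R) := u (cis t).

Lemma arc_fun_period u t k : arc_fun u (t + IZR k) = arc_fun u t.
Proof. unfold arc_fun; now rewrite cis_period. Qed.

Lemma is_arc_shift J a l k : is_arc J a l -> is_arc J (a + IZR k) l.
Proof.
intros [Hl H]; split; auto; intros z; rewrite H; split; intros [t [Ht ->]].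
- exists (t + IZR k); rewrite cis_period; split; auto; lra.
- exists (t + IZR (- k)); rewrite cis_period; split; auto; rewrite opp_IZR; lra.
Qed.

Lemma is_arc_dom J a l t : is_arc J a l -> a <= t <= a + l -> J (cis t).
Proof. intros [_ H] Ht; apply H; eauto. Qed.

Lemma is_arc_lift J a l t : is_arc J a l -> J (cis t) -> exists k, a + IZR k <= t <= a + IZR k + l.
Proof.
intros [_ H] Ht; apply H in Ht; destruct Ht as [t' [Ht' E]]; apply cis_inj in E.
destruct E as [k ->]; exists k; lra.
Qed.

(** Different lifts of an arc are separated by gaps. *)
Lemma is_arc_segment J a l p q : is_arc J a l -> p <= q ->
  (forall t, p <= t <= q -> J (cis t)) -> exists k, a + IZR k <= p /\ q <= a + IZR k + l.
Proof.
intros HJ Hpq H; destruct (is_arc_lift J a l p HJ (H p ltac:(lra))) as [k Hk].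
exists k; split; [lra|]; apply Rnot_lt_le; intros Hlt; destruct HJ as [Hl HJ'].
set (r := Rmin q (a + IZR k + (1 + l) / 2)).
assert (Hr : p <= r <= q /\ a + IZR k + l < r < a + IZR k + 1)
  by (unfold r; apply Rmin_case_strong; lra).
destruct (is_arc_lift J a l r (conj Hl HJ') (H r ltac:(lra))) as [j Hj].
assert (E : j = k) by (apply IZR_lt_1_eq, Rabs_def1; lra); subst j; lra.
Qed.

Lemma chart_inv_cis u z : is_chart u -> dom u z -> chart_inv u (u z) = z.
Proof. intros [_ [p [q [_ [_ [_ [H _]]]]]]] Hz; now apply H. Qed.

Lemma chart_segment u p q : is_chart u -> p <= q -> (forall t, p <= t <= q -> dom u (cis t)) ->
  seg_cont (arc_fun u) p q /\ monotone_on (arc_fun u) p q /\ q - p < 1.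
Proof.
intros Hu Hpq H.
assert (L : q - p < 1).
{ destruct Hu as [[a [l Hal]] _]; destruct (is_arc_segment _ a l p q Hal Hpq H) as [k Hk].
  destruct Hal; lra. }
assert (HC : seg_cont (arc_fun u) p q).
{ intros x Hx e He; assert (Hc := Hu); destruct Hc as [_ [p' [q' [_ [Hc _]]]]].
  destruct (proj1 (continuous_on_ball _ _) Hc (cis x) (H x Hx) e He) as [d [Hd Hd']].
  destruct (proj1 (continuous_on_ball (fun _ => True) cis) (cis_continuous _) x I d Hd) as [d' [Hdp Hdq]].
  exists d'; split; auto; intros y Hy Hyx; apply Hd'; [now apply H|]; now apply Hdq. }
split; auto; split; auto; apply injective_monotone; auto.
intros x y Hx Hy E; apply cis_inj_lt; [|apply Rabs_def1; lra].
rewrite <- (chart_inv_cis u (cis x)), <- (chart_inv_cis u (cis y)); auto.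
unfold arc_fun in E; now rewrite E.
Qed.

(** The sign does not depend on the lift of the arc, by periodicity. *)
Lemma chart_oriented u : is_chart u -> exists sg, (sg = 1 \/ sg = -1) /\
  forall x y, x < y -> (forall t, x <= t <= y -> dom u (cis t)) -> 0 < sg * (arc_fun u y - arc_fun u x).
Proof.
intros Hu; assert (Hc := Hu); destruct Hc as [[a [l Hal]] _].
assert (Hl := proj1 Hal).
destruct (chart_segment u a (a + l) Hu ltac:(lra) (fun t => is_arc_dom _ a l t Hal)) as [_ [HM _]].
assert (A : exists sg, (sg = 1 \/ sg = -1) /\
  forall x y, a <= x -> x < y -> y <= a + l -> 0 < sg * (arc_fun u y - arc_fun u x)).
{ destruct HM as [HM|HM]; [exists 1|exists (-1)]; split; auto; intros x y H1 H2 H3;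
    specialize (HM x y H1 H2 H3); simpl in HM; lra. }
destruct A as [sg [Hsg A]]; exists sg; split; auto; intros x y Hxy H.
destruct (is_arc_segment _ a l x y Hal ltac:(lra) H) as [k [K1 K2]].
specialize (A (x + IZR (- k)) (y + IZR (- k))); rewrite !arc_fun_period in A.
rewrite opp_IZR in A; apply A; lra.
Qed.

(** All constants are expressed through one parameter X, in such a way that
    each estimate gets weaker when X grows; finitely many estimates then hold
    with a common X. *)
Definition rate X := X / (1 + X).

Lemma rate_bounds X : 0 < X -> 0 < rate X < 1.
Proof.
intros H; unfold rate; split; [apply Rdiv_lt_0_compat; lra|].
apply (Rmult_lt_reg_r (1 + X)); [lra|]; replace (X / (1 + X) * (1 + X)) with X by (field; lra); lra.
Qed.

Lemma rate_mono X Y : 0 < X <= Y -> rate X <= rate Y.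
Proof.
intros H; unfold rate; apply (Rmult_le_reg_r ((1 + X) * (1 + Y))); [nra|].
replace (X / (1 + X) * ((1 + X) * (1 + Y))) with (X * (1 + Y)) by (field; lra).
replace (Y / (1 + Y) * ((1 + X) * (1 + Y))) with (Y * (1 + X)) by (field; lra); lra.
Qed.

Lemma rate_large mu : 0 < mu < 1 -> mu = rate (mu / (1 - mu)) /\ 0 < mu / (1 - mu).
Proof. intros H; split; [unfold rate; field; lra|apply Rdiv_lt_0_compat; lra]. Qed.

Lemma rate_pow_mono X Y n : 0 < X <= Y -> X * rate X ^ n <= Y * rate Y ^ n.
Proof.
intros H; assert (P := rate_bounds X ltac:(lra)); assert (M := rate_mono X Y H).
apply Rmult_le_compat; try lra; [apply pow_le; lra|apply pow_incr; lra].
Qed.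

Lemma rate_dominates C mu : 0 < mu < 1 -> exists X, 0 < X /\ forall Y n, X <= Y -> C * mu ^ n <= Y * rate Y ^ n.
Proof.
intros Hmu; destruct (rate_large mu Hmu) as [E P].
exists (Rmax C (mu / (1 - mu))); split; [apply Rlt_le_trans with (1 := P), Rmax_r|].
intros Y n HY; assert (C <= Y) by (eapply Rle_trans; [apply Rmax_l|apply HY]).
assert (mu / (1 - mu) <= Y) by (eapply Rle_trans; [apply Rmax_r|apply HY]).
assert (M := rate_mono (mu / (1 - mu)) Y ltac:(lra)); rewrite <- E in M.
assert (0 < mu ^ n) by (apply pow_lt; lra).
apply Rle_trans with (Y * mu ^ n); [nra|]; apply Rmult_le_compat_l; [lra|]; apply pow_incr; lra.
Qed.

Lemma list_bound {A : Type} (Q : A -> R -> Prop) (L : list A) :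
  (forall x X Y, 0 < X <= Y -> Q x X -> Q x Y) ->
  (forall x, In x L -> exists X, 0 < X /\ Q x X) ->
  exists X, 0 < X /\ forall x, In x L -> Q x X.
Proof.
intros HM; induction L as [|x L IH]; intros H.
- exists 1; split; [lra|]; intros x [].
- destruct IH as [X [HX HXL]]; [intros y Hy; apply H; now right|].
  destruct (H x (or_introl eq_refl)) as [Y [HY HYx]].
  exists (X + Y); split; [lra|]; intros y [<-|Hy]; [apply (HM x Y)|apply (HM y X)]; auto; lra.
Qed.

(** The map with values H, read in the chart u, has derivative sg * exp lam.  Requiring
    the estimate at distances below 1 / X only allows P to consist of several
    segments, as when two arcs meet at both ends.  The second clause turns
    powers of the angle into powers of the length in u. *)
Definition slopes (u : chart) a l (P : R -> Prop) (H : R -> R) X :=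
  (exists sg lam, (sg = 1 \/ sg = -1) /\ forall x, P x -> Rabs (lam x) <= X /\
     forall y, P y -> x <> y -> Rabs (y - x) < / X ->
       0 < sg * ((H y - H x) / (arc_fun u y - arc_fun u x)) /\
       forall n, Rabs (y - x) <= (/ 2) ^ n ->
         Rabs (log_slope H (arc_fun u) x y - lam x) <= X * rate X ^ n) /\
  (forall x y n, a <= x <= a + l -> a <= y <= a + l -> (/ 2) ^ n <= Rabs (y - x) ->
     / X * (/ (1 + X)) ^ n <= Rabs (arc_fun u y - arc_fun u x)).

Lemma slopes_mono u a l P H X Y : 0 < X <= Y -> slopes u a l P H X -> slopes u a l P H Y.
Proof.
intros HXY [[sg [lam [Hsg H1]]] H2].
assert (Hi : / Y <= / X) by (apply Rinv_le_contravar; lra).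
assert (Hi0 : 0 < / Y) by (apply Rinv_0_lt_compat; lra).
split.
- exists sg, lam; split; auto; intros x Hx; destruct (H1 x Hx) as [A B]; split; [lra|].
  intros y Hy Hxy Hd; destruct (B y Hy Hxy ltac:(lra)) as [B1 B2]; split; auto.
  intros n Hn; apply Rle_trans with (1 := B2 n Hn); now apply rate_pow_mono.
- intros x y n Hx Hy Hn; apply Rle_trans with (2 := H2 x y n Hx Hy Hn).
  assert (0 < / (1 + Y)) by (apply Rinv_0_lt_compat; lra).
  assert (/ (1 + Y) <= / (1 + X)) by (apply Rinv_le_contravar; lra).
  apply Rmult_le_compat; auto; [lra|apply pow_le; lra|apply pow_incr; lra].
Qed.

Lemma Rpower_pow_base c r n e : 0 < c -> 0 < r -> Rpower (c * r ^ n) e = Rpower c e * Rpower r e ^ n.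
Proof.
intros Hc Hr; rewrite <- Rpower_mult_distr by (auto; apply pow_lt; auto).
f_equal; rewrite <- !Rpower_pow by (auto; apply exp_pos); rewrite !Rpower_mult; f_equal; ring.
Qed.

(** The exponent is the one that turns the rate of decay of the lengths in the chart into
    that of the errors.  At distances above 1 / X the Hölder condition holds
    since the derivative is bounded.  All constants depend on X only. *)
Lemma C1_of_slopes X : 0 < X -> exists eps b, 0 < eps /\ 1 <= b /\
  forall u a l P H h (K : R -> Prop), is_chart u -> is_arc (dom u) a l ->
  (forall x, P x -> a <= x <= a + l) ->
  (forall x, K x -> exists t, P t /\ x = arc_fun u t) ->
  (forall t, P t -> h (arc_fun u t) = H t) ->
  slopes u a l P H X -> C1_holder_bounded K h eps b.
Proof.
intros HX; assert (Hmu := rate_bounds X HX); set (mu := rate X) in *.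
set (kap := / (1 + X)).
assert (Hkap : 0 < kap < 1).
{ unfold kap; split; [apply Rinv_0_lt_compat; lra|]; rewrite <- Rinv_1; apply Rinv_lt_contravar; lra. }
assert (HXi : 0 < / X) by now apply Rinv_0_lt_compat.
assert (Hlnm : ln mu < 0) by (rewrite <- ln_1; apply ln_increasing; lra).
assert (Hlnk : ln kap < 0) by (rewrite <- ln_1; apply ln_increasing; lra).
set (eps := ln mu / ln kap).
assert (Heps : 0 < eps).
{ unfold eps; replace (ln mu / ln kap) with ((- ln mu) / (- ln kap)) by (field; lra).
  apply Rdiv_lt_0_compat; lra. }
assert (Hke : Rpower kap eps = mu).
{ unfold Rpower, eps; replace (ln mu / ln kap * ln kap) with (ln mu) by (field; lra).
  apply exp_ln; lra. }
destruct (pow_small (/ 2) (/ X)) as [n1 Hn1]; [lra|auto|].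
assert (Hmn1 : 0 < mu ^ n1) by (apply pow_lt; lra).
set (D := 2 * exp X * (X + / mu ^ n1)).
assert (HeX : 0 < exp X) by apply exp_pos.
assert (HD : 0 < D).
{ unfold D; apply Rmult_lt_0_compat; [lra|].
  apply Rplus_lt_0_compat; [lra|now apply Rinv_0_lt_compat]. }
set (Q := Rpower (/ X) eps); assert (HQ : 0 < Q) by apply exp_pos.
assert (HDQ : 0 < D / (Q * mu)) by (apply Rdiv_lt_0_compat; auto; nra).
exists eps, (exp X + 1 + D / (Q * mu)); split; auto; split; [lra|].
intros u a l P H h K Hu Harc HP HK Hh [[sg [lam [Hsg HS]]] HL].
destruct (chart_segment u a (a + l) Hu ltac:(destruct Harc; lra) (fun t => is_arc_dom _ a l t Harc))
  as [_ [HM Hl1]].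
set (U := arc_fun u) in *.
assert (Hth : forall x, exists t, K x -> P t /\ x = U t).
{ intros x; destruct (classic (K x)) as [Hx|Hx]; [|exists 0; tauto].
  destruct (HK x Hx) as [t Ht]; now exists t. }
apply ClassicalEpsilon.choice in Hth; destruct Hth as [th Hth].
set (g := fun x => sg * exp (lam (th x))).
assert (Hsga : Rabs sg = 1) by (destruct Hsg as [->| ->]; unfold Rabs; destruct Rcase_abs; lra).
assert (Hlip : forall s t, Rabs (sg * exp s - sg * exp t) = Rabs (exp s - exp t)).
{ intros s t; rewrite <- Rmult_minus_distr_l, Rabs_mult, Hsga; ring. }
assert (Hlen : forall s t, P s -> P t -> Rabs (t - s) < 1).
{ intros s t Hs Ht; apply HP in Hs; apply HP in Ht; apply Rabs_def1; lra. }
assert (Hclose : forall s t n, P s -> P t -> Rabs (U t - U s) < / X * kap ^ n -> Rabs (t - s) < (/ 2) ^ n).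
{ intros s t n Hs Ht Hlt; apply Rnot_le_lt; intros Hle.
  apply (Rlt_not_le _ _ Hlt), HL; auto. }
exists g; split; [|split].
- apply derivative_on_eps; intros x Hx e He.
  destruct (pow_small mu (e / (exp (2 * X) * X))) as [n2 Hn2]; auto.
  { apply Rdiv_lt_0_compat; auto; apply Rmult_lt_0_compat; auto using exp_pos. }
  exists (/ X * kap ^ (n1 + n2)); split; [apply Rmult_lt_0_compat; auto; apply pow_lt; lra|].
  intros y Hy Hne Hxy; unfold g.
  destruct (Hth x Hx) as [Px Ex], (Hth y Hy) as [Py Ey].
  set (s := th x) in *; set (t := th y) in *.
  rewrite Ex, Ey in Hxy; assert (Hst := Hclose s t _ Px Py Hxy).
  assert (Hst' : s <> t) by (intros E; apply Hne; rewrite Ex, Ey, E; auto).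
  destruct (HS s Px) as [B1 B2]; destruct (B2 t Py Hst') as [S1 S2].
  { apply Rlt_trans with (1 := Hst), Rle_lt_trans with (2 := Hn1), pow_decr; [lra|lia]. }
  rewrite Ex, Ey, !Hh by auto.
  assert (HU : U t - U s <> 0).
  { intros E; apply Hst'; apply (monotone_inj U a (a + l)); auto; lra. }
  set (qq := (H t - H s) / (U t - U s)) in *.
  assert (Hqq : qq = sg * exp (log_slope H U s t)).
  { assert (HHne : H t - H s <> 0).
    { intros E; unfold qq in S1; rewrite E in S1; unfold Rdiv in S1; rewrite Rmult_0_l in S1; lra. }
    unfold log_slope; rewrite <- ln_div by (apply Rabs_pos_lt; auto).
    rewrite exp_ln by (apply Rdiv_lt_0_compat; apply Rabs_pos_lt; auto).
    rewrite <- Rabs_div by auto; fold qq.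
    destruct Hsg as [->| ->]; [rewrite Rabs_pos_eq; lra|rewrite Rabs_left; lra]. }
  rewrite Hqq, Hlip.
  assert (C0 := S2 0%nat ltac:(simpl; left; now apply Hlen)); simpl in C0; rewrite Rmult_1_r in C0.
  apply Rabs_le_between in C0; apply Rabs_le_between in B1.
  eapply Rle_lt_trans; [apply (exp_lipschitz (2 * X)); lra|].
  apply Rle_lt_trans with (exp (2 * X) * (X * mu ^ n2)).
  + apply Rmult_le_compat_l; [left; apply exp_pos|]; apply S2.
    apply Rle_trans with ((/ 2) ^ (n1 + n2)); [lra|apply pow_decr; [lra|lia]].
  + apply (Rmult_lt_compat_l (exp (2 * X) * X)) in Hn2; [|apply Rmult_lt_0_compat; auto using exp_pos].
    replace (exp (2 * X) * X * (e / (exp (2 * X) * X))) with e in Hn2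
      by (field; split; [lra|apply Rgt_not_eq, exp_pos]); lra.
- intros x Hx; destruct (Hth x Hx) as [Px _]; destruct (HS _ Px) as [B1 _].
  apply Rabs_le_between in B1; unfold g; rewrite Rabs_mult, Hsga, Rmult_1_l, Rabs_pos_eq
    by (left; apply exp_pos); split.
  + apply Rle_trans with (/ exp X); [apply Rinv_le_contravar; lra|].
    rewrite <- exp_Ropp; apply exp_mono; lra.
  + apply Rle_trans with (exp X); [apply exp_mono; lra|lra].
- intros x y Hx Hy Hxy; unfold g; rewrite Hlip.
  destruct (Hth x Hx) as [Px Ex], (Hth y Hy) as [Py Ey].
  set (s := th x) in *; set (t := th y) in *.
  assert (Hst : s <> t) by (intros E; apply Hxy; rewrite Ex, Ey, E; auto).
  assert (Hpos : 0 < Rabs (t - s)) by (apply Rabs_pos_lt; lra).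
  assert (L := Hlen s t Px Py).
  destruct (dyadic_scale (Rabs (t - s)) ltac:(lra)) as [n Hn].
  destruct (HS s Px) as [B1 B2]; destruct (HS t Py) as [B1' B2'].
  assert (Bs := B1); assert (Bt := B1'); apply Rabs_le_between in Bs; apply Rabs_le_between in Bt.
  assert (HDn : Rabs (exp (lam s) - exp (lam t)) <= D * mu ^ n).
  { assert (Hmn : 0 < mu ^ n) by (apply pow_lt; lra).
    assert (0 < / mu ^ n1) by now apply Rinv_0_lt_compat.
    destruct (Rlt_le_dec (Rabs (t - s)) (/ X)) as [Hlt|Hge].
    - destruct (B2 t Py Hst Hlt) as [_ S2].
      destruct (B2' s Px (not_eq_sym Hst) ltac:(rewrite Rabs_minus_sym; auto)) as [_ S2'].
      specialize (S2 n ltac:(lra)); specialize (S2' n ltac:(rewrite Rabs_minus_sym; lra)).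
      rewrite log_slope_sym in S2'; fold U mu in S2, S2'.
      apply Rabs_le_between in S2; apply Rabs_le_between in S2'.
      assert (A : Rabs (lam s - lam t) <= 2 * X * mu ^ n) by (apply Rabs_le; lra).
      eapply Rle_trans; [apply (exp_lipschitz X); lra|].
      apply Rle_trans with (exp X * (2 * X * mu ^ n)); [apply Rmult_le_compat_l; lra|].
      unfold D; apply Rle_trans with (2 * exp X * X * mu ^ n); [lra|].
      apply Rmult_le_compat_r; [lra|]; apply Rmult_le_compat_l; lra.
    - assert (Hnn : (n <= n1)%nat).
      { destruct (le_lt_dec n n1) as [|Hlt]; auto; exfalso.
        assert ((/ 2) ^ n <= (/ 2) ^ n1) by (apply pow_decr; [lra|lia]); lra. }
      assert (mu ^ n1 <= mu ^ n) by now apply pow_decr.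
      assert (A1 : 1 <= / mu ^ n1 * mu ^ n).
      { apply (Rmult_le_reg_l (mu ^ n1)); auto; rewrite <- Rmult_assoc, Rinv_r by lra; lra. }
      assert (A2 : Rabs (exp (lam s) - exp (lam t)) <= 2 * exp X).
      { assert (exp (lam s) <= exp X) by (apply exp_mono; lra).
        assert (exp (lam t) <= exp X) by (apply exp_mono; lra).
        generalize (exp_pos (lam s)) (exp_pos (lam t)); intros; apply Rabs_le; lra. }
      apply Rle_trans with (1 := A2); unfold D.
      apply Rle_trans with (2 * exp X * (/ mu ^ n1 * mu ^ n)); [nra|].
      rewrite !Rmult_assoc; do 2 (apply Rmult_le_compat_l; [lra|]); nra. }
  apply Rle_trans with (1 := HDn).
  assert (HR : Q * mu ^ S n <= Rpower (Rabs (x - y)) eps).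
  { rewrite <- Hke; unfold Q; rewrite <- Rpower_pow_base by lra; apply Rpower_mono_base; auto.
    split; [apply Rmult_lt_0_compat; auto; apply pow_lt; lra|].
    rewrite Ex, Ey, Rabs_minus_sym; apply HL; auto; lra. }
  apply Rle_trans with (D / (Q * mu) * Rpower (Rabs (x - y)) eps).
  + replace (D * mu ^ n) with (D / (Q * mu) * (Q * mu ^ S n)) by (simpl; field; lra).
    apply Rmult_le_compat_l; lra.
  + apply Rmult_le_compat_r; [left; apply exp_pos|lra].
Qed.

(** * The charts of the circle adapted to an affine structure *)

(** [f] is an affine chart of the leaf of 0, which covers the circle.  The
    circle structure consists of the charts that are conformal with respect to
    f at small scales; by the local agreement of all affine charts, the choice
    of the leaf does not matter. *)
Definition conformal (f : R -> R) (u : chart) X :=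
  forall n t1 t2 t3 p q, X <= INR n -> p <= t1 <= q -> p <= t2 <= q -> p <= t3 <= q ->
  (forall t, p <= t <= q -> dom u (cis t)) -> t1 <> t2 -> t2 <> t3 ->
  Rabs (t1 - t2) <= (/ 2) ^ n -> Rabs (t3 - t2) <= (/ 2) ^ n ->
  dist3 (arc_fun u) f t1 t2 t3 <= X * rate X ^ n.

Definition charts_along f u := is_chart u /\ exists X, 0 < X /\ conformal f u X.

Lemma conformal_mono f u X Y : 0 < X <= Y -> conformal f u X -> conformal f u Y.
Proof.
intros HXY H n t1 t2 t3 p q Hn; intros.
apply Rle_trans with (X * rate X ^ n); [apply (H n t1 t2 t3 p q); auto; lra|now apply rate_pow_mono].
Qed.

Lemma nat_above X : exists n, X <= INR n.
Proof.
destruct (floor_ex X) as [k Hk]; exists (Z.to_nat (Z.max 0 (k + 1))).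
rewrite INR_IZR_INZ, Z2Nat.id by lia.
apply Rle_trans with (IZR (k + 1)); [rewrite plus_IZR; lra|apply IZR_le; lia].
Qed.

Lemma conformal_intro f u C mu n0 : 0 < mu < 1 ->
  (forall n t1 t2 t3 p q, (n0 <= n)%nat -> p <= t1 <= q -> p <= t2 <= q -> p <= t3 <= q ->
  (forall t, p <= t <= q -> dom u (cis t)) -> t1 <> t2 -> t2 <> t3 ->
  Rabs (t1 - t2) <= (/ 2) ^ n -> Rabs (t3 - t2) <= (/ 2) ^ n ->
  dist3 (arc_fun u) f t1 t2 t3 <= C * mu ^ n) -> exists X, 0 < X /\ conformal f u X.
Proof.
intros Hmu H; destruct (rate_dominates C mu Hmu) as [X [HX HXd]].
exists (X + INR n0); assert (P := pos_INR n0); split; [lra|].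
intros n t1 t2 t3 p q Hn; intros; eapply Rle_trans; [apply (H n t1 t2 t3 p q); auto|apply HXd; lra].
apply INR_le; lra.
Qed.

Lemma chart_tangent s f u a l : adapted s (dyadic_of_Z 0) f -> charts_along f u ->
  is_arc (dom u) a l -> exists X, 0 < X /\ exists lam, tangent (arc_fun u) f lam a (a + l) X (rate X).
Proof.
intros Hf [Hu [X [HX HC]]] Harc; destruct (nat_above X) as [n0 Hn0]; assert (Hl := proj1 Harc).
destruct (chart_segment u a (a + l) Hu ltac:(lra) (fun t => is_arc_dom _ a l t Harc)) as [_ [HM _]].
destruct (tangent_of_dist3 (arc_fun u) f a (a + l) X (rate X) n0) as [lam [N [HN HT]]]; auto; try lra.
- now apply rate_bounds.
- now apply adapted_monotone with s (dyadic_of_Z 0).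
- intros n t1 t2 t3 Hn H1 H2 H3 H12 H23 D1 D2.
  apply (HC n t1 t2 t3 a (a + l)); auto.
  + apply Rle_trans with (1 := Hn0); now apply le_INR.
  + intros t Ht; now apply is_arc_dom with a l.
- exists (X + N); split; [lra|]; exists lam; apply tangent_mono with (1 := HT); [lra|].
  split; [now apply rate_bounds|apply rate_mono; lra].
Qed.

(** Quasisymmetry is used on a segment of length 3/2, for which the scale of
    [weak_quasisymmetry] is the dyadic one. *)
Lemma adapted_holder s f a : dyadic_solution s -> adapted s (dyadic_of_Z 0) f ->
  (exists C rho, 0 < C /\ 0 < rho < 1 /\ forall x y n, a <= x <= a + 1 -> a <= y <= a + 1 ->
     Rabs (y - x) <= (/ 2) ^ n -> Rabs (f y - f x) <= C * rho ^ n) /\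
  (exists X, 0 < X /\ forall x y n, a <= x <= a + 1 -> a <= y <= a + 1 ->
     (/ 2) ^ n <= Rabs (y - x) -> / X * (/ (1 + X)) ^ n <= Rabs (f y - f x)).
Proof.
intros Hs Hf; destruct (adapted_quasisymmetric s Hs) as [k [Hk HQ]].
set (T := Rabs (f (a + 3 / 2) - f a)).
assert (HT : 0 < T) by (apply Rabs_pos_lt; assert (f a < f (a + 3 / 2)) by (apply Hf; lra); lra).
assert (W := weak_quasisymmetry f a (a + 3 / 2) k ltac:(lra) ltac:(lra)
  (adapted_monotone s _ f _ _ Hf)); fold T in W.
assert (HW : forall n x y, a <= x <= a + 1 -> a <= y <= a + 1 ->
  (Rabs (y - x) <= (/ 2) ^ n -> Rabs (f y - f x) <= rate k ^ n * T) /\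
  ((/ 2) ^ n <= Rabs (y - x) -> / (1 + 2 * k) * (/ (1 + k)) ^ n * T <= Rabs (f y - f x))).
{ assert (HWo : forall n x y, a <= x <= a + 1 -> a <= y <= a + 1 -> x <= y ->
    (Rabs (y - x) <= (/ 2) ^ n -> Rabs (f y - f x) <= rate k ^ n * T) /\
    ((/ 2) ^ n <= Rabs (y - x) -> / (1 + 2 * k) * (/ (1 + k)) ^ n * T <= Rabs (f y - f x))).
  { intros n x y Hx Hy Hxy; rewrite (Rabs_pos_eq (y - x)) by lra.
    replace ((/ 2) ^ n) with (2 / 3 * (a + 3 / 2 - a) * (/ 2) ^ n) by field.
    apply W; try lra; intros z h Hh Hz1 Hz2.
    destruct (HQ (dyadic_of_Z 0) f z h Hf) as [Q1 Q2]; [lra|].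
    assert (f z < f (z + h)) by (apply Hf; lra); assert (f (z - h) < f z) by (apply Hf; lra).
    rewrite !Rabs_pos_eq by lra; auto. }
  intros n x y Hx Hy; destruct (Rle_dec x y); [now apply HWo|].
  rewrite (Rabs_minus_sym y), (Rabs_minus_sym (f y)); apply HWo; auto; lra. }
split.
- exists T, (rate k); split; [auto|split; [apply rate_bounds; lra|]].
  intros x y n Hx Hy Hn; rewrite Rmult_comm; now apply HW.
- assert (HTi : 0 < (1 + 2 * k) / T) by (apply Rdiv_lt_0_compat; lra).
  set (X := k + (1 + 2 * k) / T); exists X; split; [unfold X; lra|].
  intros x y n Hx Hy Hn; apply Rle_trans with (2 := proj2 (HW n x y Hx Hy) Hn).
  replace (/ (1 + 2 * k) * (/ (1 + k)) ^ n * T) with (/ ((1 + 2 * k) / T) * (/ (1 + k)) ^ n) by (field; lra).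
  assert (0 < / (1 + X)) by (apply Rinv_0_lt_compat; unfold X; lra).
  apply Rmult_le_compat.
  + left; apply Rinv_0_lt_compat; unfold X; lra.
  + apply pow_le; lra.
  + apply Rinv_le_contravar; unfold X; lra.
  + apply pow_incr; split; [lra|]; apply Rinv_le_contravar; unfold X; lra.
Qed.

(** The slopes of u relative to f are bounded, and f is Hölder in both directions. *)
Lemma chart_lower_holder s f u a l : dyadic_solution s -> adapted s (dyadic_of_Z 0) f -> charts_along f u ->
  is_arc (dom u) a l -> exists X, 0 < X /\ forall Y, X <= Y -> forall x y n, a <= x <= a + l -> a <= y <= a + l ->
     (/ 2) ^ n <= Rabs (y - x) -> / Y * (/ (1 + Y)) ^ n <= Rabs (arc_fun u y - arc_fun u x).
Proof.
intros Hs Hf Hu Harc; assert (Hl := proj1 Harc).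
destruct (chart_tangent s f u a l Hf Hu Harc) as [N [HN [lam HT]]].
destruct (adapted_holder s f a Hs Hf) as [_ [X [HX HL]]].
assert (He : 1 <= exp (2 * N)) by (rewrite <- exp_0; apply exp_mono; lra).
exists (exp (2 * N) * X); split; [nra|]; intros Y HY x y n Hx Hy Hn.
assert (HXY : X <= Y) by nra.
destruct (Req_dec x y) as [->|Hne].
{ rewrite Rminus_diag, Rabs_R0 in Hn; generalize (half_pow_pos n); lra. }
assert (B := tangent_bound (arc_fun u) f lam a (a + l) N (rate N) x y ltac:(lra) HT Hx Hy Hne).
destruct (chart_segment u a (a + l) (proj1 Hu) ltac:(lra) (fun t => is_arc_dom _ a l t Harc)) as [_ [HM _]].
assert (PU := monotone_dist_pos _ _ _ y x HM Hy Hx (not_eq_sym Hne)).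
assert (PF : 0 < Rabs (f y - f x)).
{ apply Rabs_pos_lt; assert (f y <> f x) by (eapply adapted_neq; eauto); lra. }
assert (B' : Rabs (f y - f x) <= exp (2 * N) * Rabs (arc_fun u y - arc_fun u x)).
{ apply ln_le_exp; auto; rewrite Rabs_minus_sym; exact B. }
specialize (HL x y n ltac:(lra) ltac:(lra) Hn).
apply (Rmult_le_reg_l (exp (2 * N))); [lra|].
apply Rle_trans with (2 := B'), Rle_trans with (2 := HL).
assert (PX : 0 < / (1 + Y)) by (apply Rinv_0_lt_compat; lra).
assert (PY : 0 < / Y) by (apply Rinv_0_lt_compat; lra).
rewrite <- Rmult_assoc; apply Rmult_le_compat.
- apply Rmult_le_pos; lra.
- apply pow_le; lra.
- apply Rle_trans with (exp (2 * N) * / (exp (2 * N) * X)).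
  + apply Rmult_le_compat_l; [lra|]; apply Rinv_le_contravar; nra.
  + apply Req_le; field; split; lra.
- apply pow_incr; split; [lra|]; apply Rinv_le_contravar; lra.
Qed.

(** Slopes of v(d t) relative to u(t), for d = 1 (change of charts) and d = 2
    (doubling map).  The lift of the arc of v containing d t takes at most
    three values, and is constant at small distances. *)
Lemma chart_slopes s f u v d a l : dyadic_solution s -> adapted s (dyadic_of_Z 0) f ->
  charts_along f u -> charts_along f v -> d = 1 \/ d = 2 ->
  (exists A B, 0 < A /\ forall t, f (d * t) = A * f t + B) -> is_arc (dom u) a l ->
  exists X, 0 < X /\ slopes u a l (fun t => a <= t <= a + l /\ dom v (cis (d * t)))
                                  (fun t => arc_fun v (d * t)) X.
Proof.
intros Hs Hf Hu Hv Hd [A [B [HA HAf]]] Harc; assert (Hl := proj1 Harc).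
assert (HV : exists b m, d * a <= b < d * a + 1 /\ is_arc (dom v) b m).
{ destruct Hv as [[[b [m Hb]] _] _]; destruct (floor_ex (b - d * a)) as [k Hk].
  exists (b + IZR (- k)), m; split; [rewrite opp_IZR; lra|now apply is_arc_shift]. }
destruct HV as [b [m [Hb Hbm]]]; assert (Hm := proj1 Hbm).
set (P := fun t => a <= t <= a + l /\ dom v (cis (d * t))).
assert (Hk : forall t, exists k, P t -> In k [(-1)%Z; 0%Z; 1%Z] /\ b + IZR k <= d * t <= b + IZR k + m).
{ intros t; destruct (classic (P t)) as [[Ht1 Ht2]|Ht]; [|exists 0%Z; tauto].
  destruct (is_arc_lift _ b m _ Hbm Ht2) as [k Hk]; exists k; intros _; split; auto.
  assert (K1 : (k < 2)%Z) by (apply lt_IZR; destruct Hd; subst d; lra).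
  assert (K2 : (-2 < k)%Z) by (apply lt_IZR; destruct Hd; subst d; lra).
  simpl; lia. }
apply ClassicalEpsilon.choice in Hk; destruct Hk as [kk Hkk].
destruct (list_bound (fun k X => exists lam, tangent (arc_fun v) f lam (b + IZR k) (b + IZR k + m) X (rate X))
  [(-1)%Z; 0%Z; 1%Z]) as [X1 [HX1 HT1]].
{ intros k X Y HXY [lam HT]; exists lam; apply tangent_mono with (1 := HT); [lra|].
  split; [apply rate_bounds; lra|now apply rate_mono]. }
{ intros k _; apply (chart_tangent s); auto; now apply is_arc_shift. }
assert (HT1' : forall k, exists lam, In k [(-1)%Z; 0%Z; 1%Z] ->
  tangent (arc_fun v) f lam (b + IZR k) (b + IZR k + m) X1 (rate X1)).
{ intros k; destruct (classic (In k [(-1)%Z; 0%Z; 1%Z])) as [Hin|Hn]; [|exists id; tauto].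
  destruct (HT1 k Hin) as [lam HT]; now exists lam. }
apply ClassicalEpsilon.choice in HT1'; destruct HT1' as [lamv Hlamv].
destruct (chart_tangent s f u a l Hf Hu Harc) as [Xu [HXu [lamu Hlamu]]].
destruct (chart_lower_holder s f u a l Hs Hf Hu Harc) as [X3 [HX3 HL]].
destruct (chart_oriented u (proj1 Hu)) as [su [Hsu Hou]].
destruct (chart_oriented v (proj1 Hv)) as [sv [Hsv Hov]].
assert (R1 := rate_bounds X1 HX1); assert (Ru := rate_bounds Xu HXu).
set (mu := Rmax (rate X1) (rate Xu)).
assert (Hmu : 0 < mu < 1 /\ rate X1 <= mu /\ rate Xu <= mu).
{ unfold mu; generalize (Rmax_l (rate X1) (rate Xu)) (Rmax_r (rate X1) (rate Xu)).
  apply Rmax_case_strong; lra. }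
destruct (rate_dominates (X1 / rate X1 + Xu) mu ltac:(lra)) as [X2 [HX2 HX2d]].
assert (Hm1 : 0 < 2 / (1 - m)) by (apply Rdiv_lt_0_compat; lra).
set (X := X1 + Xu + Rabs (ln A) + X2 + X3 + 2 / (1 - m)).
assert (HlnA := Rabs_pos (ln A)).
assert (HX : 0 < X) by (unfold X; lra).
exists X; split; auto; split; [|intros x y n; apply HL; unfold X; lra].
exists (su * sv), (fun t => lamv (kk t) (d * t) + ln A - lamu t); split.
{ destruct Hsu as [->| ->], Hsv as [->| ->]; lra. }
intros x Hx; destruct (Hkk x Hx) as [Kx Bx]; assert (Ix := proj1 Hx).
destruct (Hlamv _ Kx (d * x) Bx) as [V1 V2]; destruct (Hlamu x Ix) as [U1 U2]; split.
{ apply Rabs_le_between in V1; apply Rabs_le_between in U1.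
  generalize (Rle_abs (ln A)) (Rle_abs (- ln A)); rewrite Rabs_Ropp; intros.
  apply Rabs_le; unfold X; lra. }
intros y Hy Hxy Hd1; destruct (Hkk y Hy) as [Ky By]; assert (Iy := proj1 Hy).
assert (Hd2 : Rabs (y - x) < (1 - m) / 2).
{ apply Rlt_le_trans with (1 := Hd1); replace ((1 - m) / 2) with (/ (2 / (1 - m))) by (field; lra).
  apply Rinv_le_contravar; auto; unfold X; lra. }
apply Rabs_def2 in Hd2.
assert (Ek : kk x = kk y).
{ apply IZR_lt_1_eq, Rabs_def1; destruct Hd; subst d; lra. }
rewrite <- Ek in By; set (k := kk x) in *.
assert (Hdom : forall t, b + IZR k <= t <= b + IZR k + m -> dom v (cis t)).
{ intros t Ht; apply is_arc_dom with (b + IZR k) m; auto; now apply is_arc_shift. }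
assert (HUp : forall x y, a <= x <= a + l -> a <= y <= a + l -> x < y -> 0 < su * (arc_fun u y - arc_fun u x)).
{ intros p q Hp Hq Hpq; apply Hou; auto; intros t Ht; apply is_arc_dom with a l; auto; lra. }
assert (HVp : forall x y, b + IZR k <= x -> x < y -> y <= b + IZR k + m -> 0 < sv * (arc_fun v y - arc_fun v x)).
{ intros p q Hp Hq Hpq; apply Hov; auto; intros t Ht; apply Hdom; lra. }
split.
- assert (Hq : forall p q, 0 < su * p -> 0 < sv * q -> 0 < su * sv * (q / p)).
  { intros p q Hp Hq; replace (su * sv * (q / p)) with ((sv * q) * (/ (su * p))).
    - apply Rmult_lt_0_compat; auto; now apply Rinv_0_lt_compat.
    - destruct Hsu as [->| ->]; field; lra. }
  destruct (Rdichotomy x y Hxy) as [L|L].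
  + apply Hq; [apply HUp; auto|apply HVp; destruct Hd; subst d; lra].
  + replace ((arc_fun v (d * y) - arc_fun v (d * x)) / (arc_fun u y - arc_fun u x))
      with ((arc_fun v (d * x) - arc_fun v (d * y)) / (arc_fun u x - arc_fun u y)).
    * apply Hq; [apply HUp; auto|apply HVp; destruct Hd; subst d; lra].
    * assert (Pu := HUp y x Iy Ix L); field.
      destruct Hsu as [->| ->]; lra.
- intros n Hn.
  assert (Hdxy : d * x <> d * y) by (destruct Hd; subst d; lra).
  assert (E : log_slope (fun t => arc_fun v (d * t)) (arc_fun u) x y
    = log_slope (arc_fun v) f (d * x) (d * y) + ln A - log_slope (arc_fun u) f x y).
  { assert (PF : 0 < Rabs (f y - f x)).
    { apply Rabs_pos_lt; assert (f y <> f x) by (eapply adapted_neq; eauto); lra. }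
    unfold log_slope; rewrite !HAf.
    replace (A * f y + B - (A * f x + B)) with (A * (f y - f x)) by ring.
    rewrite Rabs_mult, (Rabs_pos_eq A), ln_mult by lra; ring. }
  rewrite E.
  assert (B1 : Rabs (log_slope (arc_fun v) f (d * x) (d * y) - lamv k (d * x)) <= X1 / rate X1 * rate X1 ^ n).
  { destruct n as [|n].
    - apply Rle_trans with (X1 * rate X1 ^ 0); [apply V2; auto|].
      + simpl; apply Rabs_le; lra.
      + simpl; rewrite !Rmult_1_r; apply (Rmult_le_reg_r (rate X1)); [lra|].
        unfold Rdiv; rewrite Rmult_assoc, Rinv_l by lra; nra.
    - replace (X1 / rate X1 * rate X1 ^ S n) with (X1 * rate X1 ^ n) by (simpl; field; lra).
      apply V2; auto; rewrite <- Rmult_minus_distr_l, Rabs_mult; simpl in Hn.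
      generalize (Rabs_pos (y - x)); rewrite (Rabs_pos_eq d) by (destruct Hd; lra).
      destruct Hd; subst d; lra. }
  assert (B2 := U2 y n Iy Hxy Hn).
  assert (P1 : 0 < X1 / rate X1) by (apply Rdiv_lt_0_compat; lra).
  assert (M1 : rate X1 ^ n <= mu ^ n) by (apply pow_incr; lra).
  assert (M2 : rate Xu ^ n <= mu ^ n) by (apply pow_incr; lra).
  apply Rle_trans with ((X1 / rate X1 + Xu) * mu ^ n); [|apply HX2d; unfold X; lra].
  replace (_ - _) with ((log_slope (arc_fun v) f (d * x) (d * y) - lamv k (d * x))
    + - (log_slope (arc_fun u) f x y - lamu x)) by ring.
  eapply Rle_trans; [apply Rabs_triang|]; rewrite Rabs_Ropp; nra.
Qed.

Lemma charts_compatible s f u v : dyadic_solution s -> adapted s (dyadic_of_Z 0) f ->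
  charts_along f u -> charts_along f v -> compatible u v.
Proof.
intros Hs Hf Hu Hv; assert (Hc := Hu); destruct Hc as [[[a [l Harc]] _] _].
destruct (chart_slopes s f u v 1 a l Hs Hf Hu Hv) as [X [HX HS]]; auto.
{ exists 1, 0; split; [lra|]; intros t; rewrite !Rmult_1_l; ring. }
destruct (C1_of_slopes X HX) as [eps [b [He [Hb HC]]]].
destruct (HC u a l (fun t => a <= t <= a + l /\ dom v (cis (1 * t))) (fun t => arc_fun v (1 * t))
  (fun t => v (chart_inv u t)) (image u (fun z => dom u z /\ dom v z)) (proj1 Hu) Harc)
  as [g [G1 [G2 G3]]]; try exact HS.
- tauto.
- intros x [z [[Hz1 Hz2] <-]]; apply Harc in Hz1; destruct Hz1 as [t [Ht ->]].
  exists t; rewrite Rmult_1_l; auto.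
- intros t [Ht _]; unfold arc_fun; rewrite chart_inv_cis, Rmult_1_l; auto; [apply Hu|].
  now apply is_arc_dom with a l.
- exists eps; split; auto; exists g, b; split; [auto|split; auto].
  intros x Hx E; specialize (G2 x Hx); rewrite E, Rabs_R0 in G2.
  assert (0 < / b) by (apply Rinv_0_lt_compat; lra); lra.
Qed.

(** The solenoid map preserves the leaf of 0, so it acts on its chart by an affine map. *)
Lemma adapted_0_double s f : dyadic_solution s -> adapted s (dyadic_of_Z 0) f ->
  exists A B, 0 < A /\ forall t, f (2 * t) = A * f t + B.
Proof.
intros Hs Hf; assert (HG := adapted_rescale s _ f 1 0 Hf); rewrite affine_of_0 in HG.
destruct (adapted_unique s _ _ _ (proj1 Hs) HG Hf) as [A [B [HA E]]].
exists A, B; split; auto; intros t; rewrite E; simpl; do 3 f_equal; field.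
Qed.

(** Adjacent segments with comparable increments have comparable lengths: by
    quasisymmetry, increments decay geometrically when a segment is halved. *)
Lemma adapted_comparable s f D : dyadic_solution s -> adapted s (dyadic_of_Z 0) f -> 0 < D ->
  exists n : nat, forall x A B, 0 < A <= 1 -> 0 < B <= 1 ->
    (f x - f (x - B) <= D * (f (x + A) - f x) -> B <= 2 ^ n * A) /\
    (f (x + A) - f x <= D * (f x - f (x - B)) -> A <= 2 ^ n * B).
Proof.
intros Hs Hf HD; destruct (adapted_quasisymmetric s Hs) as [k [Hk HQ]].
assert (HQ' := fun t h => HQ (dyadic_of_Z 0) f t h Hf); clear HQ.
assert (HI := proj1 Hf); set (rho := k / (1 + k)).
assert (Hrho : 0 < rho < 1) by (apply (rate_bounds k); lra).
destruct (pow_small rho (/ (k * D))) as [n Hn]; auto.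
{ apply Rinv_0_lt_compat; nra. }
exists n.
assert (Hhalf : forall x h i, 0 < h <= 1 ->
  f (x + h * (/ 2) ^ i) - f x <= rho ^ i * (f (x + h) - f x) /\
  f x - f (x - h * (/ 2) ^ i) <= rho ^ i * (f x - f (x - h))).
{ intros x h i Hh; induction i as [|i [IH1 IH2]]; [simpl; rewrite !Rmult_1_r; lra|].
  assert (Pi := pow_le_1 (/ 2) i ltac:(lra)); set (h' := h * (/ 2) ^ S i).
  assert (Hh' : 0 < h' <= 1 /\ h * (/ 2) ^ i = h' + h') by (unfold h'; simpl; repeat split; nra).
  rewrite (proj2 Hh') in IH1, IH2; simpl pow; rewrite !Rmult_assoc; split.
  - apply Rle_trans with (rho * (f (x + (h' + h')) - f x)); [|apply Rmult_le_compat_l; lra].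
    destruct (HQ' (x + h') h') as [_ Q]; [lra|].
    replace (x + h' + h') with (x + (h' + h')) in Q by ring; replace (x + h' - h') with x in Q by ring.
    apply (Rmult_le_reg_r (1 + k)); [lra|]; unfold rho.
    replace (k / (1 + k) * (f (x + (h' + h')) - f x) * (1 + k)) with (k * (f (x + (h' + h')) - f x)) by (field; lra).
    lra.
  - apply Rle_trans with (rho * (f x - f (x - (h' + h')))); [|apply Rmult_le_compat_l; lra].
    destruct (HQ' (x - h') h') as [Q _]; [lra|].
    replace (x - h' - h') with (x - (h' + h')) in Q by ring; replace (x - h' + h') with x in Q by ring.
    apply (Rmult_le_reg_r (1 + k)); [lra|]; unfold rho.
    replace (k / (1 + k) * (f x - f (x - (h' + h'))) * (1 + k)) with (k * (f x - f (x - (h' + h')))) by (field; lra).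
    lra. }
assert (Hsm : rho ^ n * k * D < 1).
{ apply (Rmult_lt_compat_r (k * D)) in Hn; [|nra]; rewrite Rinv_l in Hn by nra; lra. }
assert (Hrn : 0 < rho ^ n) by (apply pow_lt; lra).
assert (Hp : 0 < 2 ^ n) by (apply pow_lt; lra).
intros x A B HA HB.
assert (P1 : f x < f (x + A)) by (apply HI; lra); assert (P2 : f (x - B) < f x) by (apply HI; lra).
split; intros H; apply Rnot_lt_le; intros Hlt.
- destruct (Hhalf x B n HB) as [S _]; destruct (HQ' x B) as [Q _]; [lra|].
  assert (f (x + A) < f (x + B * (/ 2) ^ n)).
  { apply HI; rewrite half_pow_inv; assert (A < B * / 2 ^ n); [|lra].
    apply (Rmult_lt_reg_l (2 ^ n)); auto; rewrite (Rmult_comm B), <- Rmult_assoc, Rinv_r; lra. }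
  assert (rho ^ n * (f (x + B) - f x) <= rho ^ n * (k * (f x - f (x - B)))) by (apply Rmult_le_compat_l; lra).
  assert (D * (f (x + A) - f x) <= rho ^ n * k * D * (f x - f (x - B))); nra.
- destruct (Hhalf x A n HA) as [_ S]; destruct (HQ' x A) as [_ Q]; [lra|].
  assert (f (x - A * (/ 2) ^ n) < f (x - B)).
  { apply HI; rewrite half_pow_inv; assert (B < A * / 2 ^ n); [|lra].
    apply (Rmult_lt_reg_l (2 ^ n)); auto; rewrite (Rmult_comm A), <- Rmult_assoc, Rinv_r; lra. }
  assert (rho ^ n * (f x - f (x - A)) <= rho ^ n * (k * (f (x + A) - f x))) by (apply Rmult_le_compat_l; lra).
  assert (D * (f x - f (x - B)) <= rho ^ n * k * D * (f (x + A) - f x)); nra.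
Qed.

Lemma ln_abs_le y k : 0 < k -> / k <= y <= k -> Rabs (ln y) <= ln k.
Proof.
intros Hk [H1 H2]; assert (0 < / k) by now apply Rinv_0_lt_compat.
apply Rabs_le; split; [rewrite <- ln_Rinv by auto|]; apply ln_le; lra.
Qed.

(** Slopes of u relative to f are bounded, so comparable lengths in u are comparable
    increments of f, and these lie over comparable arcs. *)
Lemma charts_quasisymmetric s f u w : dyadic_solution s -> adapted s (dyadic_of_Z 0) f -> charts_along f u ->
  arc_isometry (dom u) w -> quasisymmetric (image u (dom u)) (fun t => w (chart_inv u t)).
Proof.
intros Hs Hf Hu [a [l [Harc Hw]]] d Hd; assert (Hl := proj1 Harc).
destruct (chart_tangent s f u a l Hf Hu Harc) as [N [HN [lam HT]]].
set (D := exp (4 * N) * d).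
assert (HD : 0 < D) by (apply Rmult_lt_0_compat; [apply exp_pos|lra]).
destruct (adapted_comparable s f D Hs Hf HD) as [n Hn].
assert (Hp : 1 <= 2 ^ n) by (apply pow_R1_Rle; lra).
exists (2 ^ n * d); split; [nra|].
intros x d1 d2 Hd1 Hd2 [z1 [Hz1 E1]] [z2 [Hz2 E2]] [z3 [Hz3 E3]] Hdd.
apply Harc in Hz1; destruct Hz1 as [t1 [T1 ->]].
apply Harc in Hz2; destruct Hz2 as [t2 [T2 ->]].
apply Harc in Hz3; destruct Hz3 as [t3 [T3 ->]].
cbv beta; rewrite <- E1, <- E3, <- E2.
rewrite !chart_inv_cis by (try apply Hu; now apply is_arc_dom with a l).
destruct (chart_oriented u (proj1 Hu)) as [su [Hsu Hou]].
assert (HU : forall s t, a <= s -> s < t -> t <= a + l -> 0 < su * (arc_fun u t - arc_fun u s)).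
{ intros p q H1 H2 H3; apply Hou; auto; intros t Ht; apply is_arc_dom with a l; auto; lra. }
assert (U21 : arc_fun u t2 - arc_fun u t1 = d1) by (unfold arc_fun; lra).
assert (U32 : arc_fun u t3 - arc_fun u t2 = d2) by (unfold arc_fun; lra).
assert (Hne : t1 <> t2 /\ t2 <> t3).
{ split; intros E; [rewrite E in U21|rewrite E in U32]; lra. }
destruct Hne as [N12 N23].
assert (HF : forall s t, s <> t -> 0 < Rabs (f t - f s)).
{ intros p q Hpq; apply Rabs_pos_lt; assert (f q <> f p) by (eapply adapted_neq; eauto); lra. }
assert (B12 := tangent_bound (arc_fun u) f lam a (a + l) N (rate N) t1 t2 ltac:(lra) HT T1 T2 N12).
assert (B23 := tangent_bound (arc_fun u) f lam a (a + l) N (rate N) t2 t3 ltac:(lra) HT T2 T3 N23).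
unfold log_slope in B12, B23; rewrite U21 in B12; rewrite U32 in B23.
rewrite (Rabs_pos_eq d1) in B12 by lra; rewrite (Rabs_pos_eq d2) in B23 by lra.
assert (F12 := HF t1 t2 N12); assert (F23 := HF t2 t3 N23).
assert (C1 := ln_le_exp _ _ _ Hd1 F12 B12); assert (C2 := ln_le_exp _ _ _ Hd2 F23 B23).
rewrite Rabs_minus_sym in B12, B23.
assert (C3 := ln_le_exp _ _ _ F12 Hd1 B12); assert (C4 := ln_le_exp _ _ _ F23 Hd2 B23).
assert (He : exp (4 * N) = exp (2 * N) * exp (2 * N)) by (rewrite <- exp_plus; f_equal; ring).
assert (Hep := exp_pos (2 * N)).
assert (Hdd' : d2 <= d * d1 /\ d1 <= d * d2).
{ destruct Hdd as [H1 H2]; split.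
  - apply (Rmult_le_compat_r d1) in H2; [|lra]; unfold Rdiv in H2; rewrite Rmult_assoc, Rinv_l in H2; lra.
  - apply (Rmult_le_compat_r (d * d1)) in H1; [|nra].
    replace (/ d * (d * d1)) with d1 in H1 by (field; lra).
    replace (d2 / d1 * (d * d1)) with (d * d2) in H1 by (field; lra); auto. }
assert (G1 : Rabs (f t3 - f t2) <= D * Rabs (f t2 - f t1)).
{ unfold D; rewrite He; apply Rle_trans with (1 := C4); rewrite !Rmult_assoc; apply Rmult_le_compat_l; [lra|].
  apply Rle_trans with (d * d1); [lra|]; rewrite (Rmult_comm (exp _)), Rmult_assoc, (Rmult_comm (Rabs _)).
  apply Rmult_le_compat_l; lra. }
assert (G2 : Rabs (f t2 - f t1) <= D * Rabs (f t3 - f t2)).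
{ unfold D; rewrite He; apply Rle_trans with (1 := C3); rewrite !Rmult_assoc; apply Rmult_le_compat_l; [lra|].
  apply Rle_trans with (d * d2); [lra|]; rewrite (Rmult_comm (exp _)), Rmult_assoc, (Rmult_comm (Rabs _)).
  apply Rmult_le_compat_l; lra. }
set (R := (t3 - t2) / (t2 - t1)).
assert (HR : 0 < R /\ R <= 2 ^ n /\ 1 <= 2 ^ n * R /\
  (w (cis t3) - w (cis t2)) / (w (cis t2) - w (cis t1)) = R).
{ assert (W12 := Hw t1 t2 T1 T2); assert (W23 := Hw t2 t3 T2 T3); assert (W13 := Hw t1 t3 T1 T3).
  assert (HPI := PI_RGT_0); assert (HI := proj1 Hf).
  assert (Hsort : (t1 < t2 /\ t2 < t3) \/ (t3 < t2 /\ t2 < t1)).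
  { destruct (Rdichotomy t1 t2 N12) as [L1|L1], (Rdichotomy t2 t3 N23) as [L2|L2]; auto; exfalso.
    - assert (A1 := HU t1 t2 ltac:(lra) L1 ltac:(lra)); assert (A2 := HU t3 t2 ltac:(lra) L2 ltac:(lra)).
      destruct Hsu as [->| ->]; lra.
    - assert (A1 := HU t2 t1 ltac:(lra) L1 ltac:(lra)); assert (A2 := HU t2 t3 ltac:(lra) L2 ltac:(lra)).
      destruct Hsu as [->| ->]; lra. }
  assert (Hnm : 0 < Rabs (t3 - t2) /\ 0 < Rabs (t2 - t1)) by (split; apply Rabs_pos_lt; lra).
  assert (ER : R = Rabs (t3 - t2) / Rabs (t2 - t1)).
  { unfold R; destruct Hsort; [rewrite !Rabs_pos_eq by lra; auto|rewrite !Rabs_left by lra; field; lra]. }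
  assert (EW : (w (cis t3) - w (cis t2)) / (w (cis t2) - w (cis t1)) = R).
  { set (x1 := w (cis t1)) in *; set (x2 := w (cis t2)) in *; set (x3 := w (cis t3)) in *.
    assert (EE : exists c, c <> 0 /\ x3 - x2 = c * (t3 - t2) /\ x2 - x1 = c * (t2 - t1)).
    { destruct Hsort as [[L1 L2]|[L1 L2]].
      - rewrite (Rabs_left (t1 - t2)) in W12 by lra; rewrite (Rabs_left (t2 - t3)) in W23 by lra.
        rewrite (Rabs_left (t1 - t3)) in W13 by lra.
        assert (0 < PI * (t2 - t1)) by nra; assert (0 < PI * (t3 - t2)) by nra.
        destruct (Rle_lt_dec 0 (x1 - x2)) as [S|S].
        + exists (- (2 * PI)); split; [lra|]; rewrite Rabs_pos_eq in W12 by lra.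
          revert W23 W13; unfold Rabs; repeat destruct Rcase_abs; lra.
        + exists (2 * PI); split; [lra|]; rewrite Rabs_left in W12 by lra.
          revert W23 W13; unfold Rabs; repeat destruct Rcase_abs; lra.
      - rewrite (Rabs_pos_eq (t1 - t2)) in W12 by lra; rewrite (Rabs_pos_eq (t2 - t3)) in W23 by lra.
        rewrite (Rabs_pos_eq (t1 - t3)) in W13 by lra.
        assert (0 < PI * (t1 - t2)) by nra; assert (0 < PI * (t2 - t3)) by nra.
        destruct (Rle_lt_dec 0 (x1 - x2)) as [S|S].
        + exists (2 * PI); split; [lra|]; rewrite Rabs_pos_eq in W12 by lra.
          revert W23 W13; unfold Rabs; repeat destruct Rcase_abs; lra.
        + exists (- (2 * PI)); split; [lra|]; rewrite Rabs_left in W12 by lra.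
          revert W23 W13; unfold Rabs; repeat destruct Rcase_abs; lra. }
    destruct EE as [c [Hc [-> ->]]]; unfold R; field; split; auto; lra. }
  assert (Hcmp : Rabs (t3 - t2) <= 2 ^ n * Rabs (t2 - t1) /\ Rabs (t2 - t1) <= 2 ^ n * Rabs (t3 - t2)).
  { destruct Hsort as [[L1 L2]|[L1 L2]].
    - assert (I1 := HI _ _ L1); assert (I2 := HI _ _ L2).
      rewrite (Rabs_pos_eq (f t3 - f t2)), (Rabs_pos_eq (f t2 - f t1)) in G1, G2 by lra.
      rewrite !Rabs_pos_eq by lra.
      destruct (Hn t2 (t3 - t2) (t2 - t1)) as [A1 A2]; try lra.
      replace (t2 + (t3 - t2)) with t3 in * by ring; replace (t2 - (t2 - t1)) with t1 in * by ring; auto.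
    - assert (I1 := HI _ _ L1); assert (I2 := HI _ _ L2).
      rewrite (Rabs_left (f t3 - f t2)), (Rabs_left (f t2 - f t1)) in G1, G2 by lra.
      rewrite !Rabs_left by lra.
      destruct (Hn t2 (t1 - t2) (t2 - t3)) as [A1 A2]; try lra.
      replace (t2 + (t1 - t2)) with t1 in * by ring; replace (t2 - (t2 - t3)) with t3 in * by ring.
      specialize (A1 ltac:(lra)); specialize (A2 ltac:(lra)); lra. }
  destruct Hnm as [Hnm1 Hnm2]; rewrite EW, ER; repeat split.
  - now apply Rdiv_lt_0_compat.
  - apply (Rmult_le_reg_r (Rabs (t2 - t1))); auto; unfold Rdiv; rewrite Rmult_assoc, Rinv_l; lra.
  - apply (Rmult_le_reg_r (Rabs (t2 - t1))); auto; unfold Rdiv.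
    rewrite !Rmult_assoc, Rinv_l; lra. }
destruct HR as [R0 [R1 [R2 ->]]].
apply ln_abs_le; [nra|].
assert (Hq : 0 < d1 / d2 /\ d1 / d2 <= d /\ 1 <= d * (d1 / d2)).
{ split; [now apply Rdiv_lt_0_compat|]; split.
  - apply (Rmult_le_reg_r d2); auto; unfold Rdiv; rewrite Rmult_assoc, Rinv_l; lra.
  - apply (Rmult_le_reg_r d2); auto; unfold Rdiv; rewrite !Rmult_assoc, Rinv_l; lra. }
destruct Hq as [Q0 [Q1 Q2]]; split.
- apply (Rmult_le_reg_l (2 ^ n * d)); [nra|]; rewrite Rinv_r by nra.
  replace (2 ^ n * d * (R * (d1 / d2))) with ((2 ^ n * R) * (d * (d1 / d2))) by ring; nra.
- apply Rmult_le_compat; lra.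
Qed.

Lemma charts_doubling_invariant s f : dyadic_solution s -> adapted s (dyadic_of_Z 0) f ->
  doubling_invariant (charts_along f).
Proof.
intros Hs Hf U' [HU' _]; split; [|intros u w Hu Hw; apply charts_quasisymmetric with s f; auto].
destruct (list_bound (fun (uv : chart * chart) X => exists a l, is_arc (dom (fst uv)) a l /\
  slopes (fst uv) a l (fun t => a <= t <= a + l /\ dom (snd uv) (cis (2 * t)))
                      (fun t => arc_fun (snd uv) (2 * t)) X) (list_prod U' U')) as [X [HX H]].
- intros uv X Y HXY [a [l [Harc HS]]]; exists a, l; split; auto; now apply slopes_mono with X.
- intros [u v] Huv; apply in_prod_iff in Huv; destruct Huv as [Hu Hv].
  apply HU' in Hu; apply HU' in Hv; assert (Hc := Hu); destruct Hc as [[[a [l Harc]] _] _].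
  destruct (chart_slopes s f u v 2 a l) as [X [HX HS]]; auto.
  + now apply adapted_0_double with s.
  + exists X; split; auto; exists a, l; auto.
- destruct (C1_of_slopes X HX) as [eps [b [He [Hb HC]]]]; exists eps, b; split; auto; split; auto.
  intros u v Hu Hv K _ HK1 HK2.
  destruct (H (u, v)) as [a [l [Harc HS]]]; [now apply in_prod|]; simpl fst in *; simpl snd in *.
  apply (HC u a l (fun t => a <= t <= a + l /\ dom v (cis (2 * t))) (fun t => arc_fun v (2 * t))); auto.
  + now apply HU'.
  + tauto.
  + intros x [z [Hz <-]]; assert (Hz1 := HK1 z Hz); assert (Hz2 := HK2 z Hz).
    apply Harc in Hz1; destruct Hz1 as [t [Ht ->]]; rewrite doubling_cis in Hz2; exists t; auto.
  + intros t [Ht _]; unfold arc_fun; rewrite chart_inv_cis, doubling_cis; auto; [now apply HU'|].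
    now apply is_arc_dom with a l.
Qed.

(** ** The affine charts themselves *)

Definition arc_lift a l (z : C) : R := epsilon (inhabits 0) (fun t => a <= t <= a + l /\ z = cis t).

Definition affine_chart (f : R -> R) a l : chart :=
  Chart (fun z => exists t, a <= t <= a + l /\ z = cis t) (fun z => f (arc_lift a l z)).

Lemma arc_lift_cis a l t : l < 1 -> a <= t <= a + l -> arc_lift a l (cis t) = t.
Proof.
intros Hl Ht; unfold arc_lift.
destruct (epsilon_spec (inhabits 0) (fun s => a <= s <= a + l /\ cis t = cis s)) as [H1 H2].
{ now exists t. }
symmetry; apply cis_inj_lt; auto; apply Rabs_def1; lra.
Qed.

Lemma affine_chart_is_chart s f a l : adapted s (dyadic_of_Z 0) f -> 0 < l < 1 ->
  is_chart (affine_chart f a l).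
Proof.
intros [HI [HC _]] Hl; split.
{ exists a, l; split; auto; intros z; reflexivity. }
assert (Hval : forall t, a <= t <= a + l -> affine_chart f a l (cis t) = f t).
{ intros t Ht; simpl; now rewrite arc_lift_cis. }
assert (Hmono : forall x y, f x <= f y -> x <= y).
{ intros x y H; apply Rnot_lt_le; intros L; apply HI in L; lra. }
assert (Hmono' : forall x y, x <= y -> f x <= f y).
{ intros x y [L|L]; [left; auto|rewrite L; lra]. }
assert (Hinv : forall t, a <= t <= a + l -> chart_inv (affine_chart f a l) (f t) = cis t).
{ intros t Ht; unfold chart_inv.
  destruct (epsilon_spec (inhabits (RtoC 0)) (fun z => dom (affine_chart f a l) z /\ affine_chart f a l z = f t))
    as [[t' [Ht' E]] H2].
  { exists (cis t); split; [exists t; auto|now apply Hval]. }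
  rewrite E in *; rewrite Hval in H2 by auto; f_equal; apply Rle_antisym; apply Hmono; lra. }
assert (Honto : forall y, f a <= y <= f (a + l) -> exists t, a <= t <= a + l /\ f t = y).
{ intros y Hy; apply seg_cont_ivt; [lra|now apply continuity_seg_cont|].
  rewrite Rmin_left, Rmax_right; auto; lra. }
exists (f a), (f (a + l)); split; [apply HI; lra|split; [|split; [|split]]].
- apply continuous_on_ball; intros z [t [Ht ->]] e He.
  destruct (continuity_seg_cont f a (a + l) HC t Ht e He) as [d [Hd Hcd]].
  destruct (cis_open t (Rmin d (1 - l))) as [d' [Hd' Ho]]; [apply Rmin_pos; lra|].
  exists d'; split; auto; intros w Hw Hzw; destruct Hw as [t' [Ht' ->]].
  rewrite !Hval by auto; destruct (Ho (cis t') (circle_cis t') Hzw) as [r [Hr Er]].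
  assert (L1 : Rabs r < d) by (eapply Rlt_le_trans; [exact Hr|apply Rmin_l]).
  assert (L2 : Rabs r < 1 - l) by (eapply Rlt_le_trans; [exact Hr|apply Rmin_r]).
  apply Rabs_def2 in L2.
  assert (Et : t' = t + r) by (apply cis_inj_lt; auto; apply Rabs_def1; lra).
  apply Hcd; auto; rewrite Et; now replace (t + r - t) with r by ring.
- apply continuous_on_ball; intros y Hy e He; destruct (Honto y Hy) as [t [Ht <-]].
  destruct (proj1 (continuous_on_ball (fun _ => True) cis) (cis_continuous _) t I e He) as [d [Hd Hcd]].
  assert (L1 : f (t - d / 2) < f t) by (apply HI; lra); assert (L2 : f t < f (t + d / 2)) by (apply HI; lra).
  exists (Rmin (f t - f (t - d / 2)) (f (t + d / 2) - f t)); split; [apply Rmin_pos; lra|].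
  intros y' Hy' Hyy; destruct (Honto y' Hy') as [t' [Ht' <-]]; rewrite !Hinv by auto.
  assert (Hyy' : Rabs (f t' - f t) < Rmin (f t - f (t - d / 2)) (f (t + d / 2) - f t)) by exact Hyy.
  assert (M1 := Rlt_le_trans _ _ _ Hyy' (Rmin_l _ _)); assert (M2 := Rlt_le_trans _ _ _ Hyy' (Rmin_r _ _)).
  apply Rabs_def2 in M1; apply Rabs_def2 in M2.
  apply Hcd; auto; change (Rabs (t' - t) < d).
  assert (t - d / 2 <= t') by (apply Hmono; lra); assert (t' <= t + d / 2) by (apply Hmono; lra).
  apply Rabs_def1; lra.
- intros z [t [Ht ->]]; rewrite Hval, Hinv by auto; split; auto; split; apply Hmono'; lra.
- intros y Hy; destruct (Honto y Hy) as [t [Ht <-]]; rewrite Hinv by auto; split; [|now apply Hval].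
  exists t; auto.
Qed.

(** Translating by an integer moves f to an affine chart of another leaf. *)
Lemma adapted_translate s f k : adapted s (dyadic_of_Z 0) f ->
  adapted s (dyadic_of_Z k) (fun t => f (t + IZR k)).
Proof.
intros Hf; assert (H := adapted_rescale s _ f 0 k Hf); rewrite affine_of_0 in H.
replace (fun t => f (t + IZR k)) with (fun t => f ((t + IZR k) * (/ 2) ^ 0)); auto.
apply functional_extensionality; intros t; f_equal; simpl; ring.
Qed.

(** On a lift of its arc this chart is a translate of f. *)
Lemma affine_chart_along s f a l : dyadic_solution s -> adapted s (dyadic_of_Z 0) f -> 0 < l < 1 ->
  charts_along f (affine_chart f a l).
Proof.
intros Hs Hf Hl; assert (Hu := affine_chart_is_chart s f a l Hf Hl); split; auto.
destruct (adapted_local s Hs) as [C [mu [HC [Hmu H]]]].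
apply (conformal_intro f _ C mu 0); auto.
intros n t1 t2 t3 p q _ H1 H2 H3 Hdom H12 H23 D1 D2.
assert (Harc : is_arc (dom (affine_chart f a l)) a l) by (split; auto; intros z; reflexivity).
destruct (is_arc_segment _ a l p q Harc ltac:(lra) Hdom) as [k [K1 K2]].
assert (E : forall t, p <= t <= q -> arc_fun (affine_chart f a l) t = f (t + IZR (- k))).
{ intros t Ht; rewrite <- (arc_fun_period _ t (- k)); unfold arc_fun; simpl.
  rewrite arc_lift_cis; auto; [lra|rewrite opp_IZR; lra]. }
unfold dist3, R3; rewrite !E by auto.
now apply (H n (dyadic_of_Z (- k)) (dyadic_of_Z 0) (fun t => f (t + IZR (- k))) f t1 t2 t3);
  [apply adapted_translate| | | | |].
Qed.

Lemma arc_neighbourhood t e (D : C -> Prop) : 0 < e -> (forall r, Rabs r < e -> D (cis (t + r))) ->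
  within circle (locally (cis t : C_UniformSpace)) D.
Proof.
intros He H; destruct (cis_open t e He) as [d [Hd Ho]].
exists (mkposreal d Hd); intros z Hz Hc; destruct (Ho z Hc Hz) as [r [Hr ->]]; auto.
Qed.

Lemma charts_atlas s f : dyadic_solution s -> adapted s (dyadic_of_Z 0) f -> atlas (charts_along f).
Proof.
intros Hs Hf; split; [intros u Hu; apply Hu|split].
- intros z Hz; destruct (circle_param z Hz) as [t [_ ->]].
  exists (affine_chart f (t - / 4) (/ 2)); split; [apply affine_chart_along with s; auto; lra|].
  split; [exists t; split; auto; lra|]; apply arc_neighbourhood with (/ 4); [lra|].
  intros r Hr; apply Rabs_def2 in Hr; exists (t + r); split; auto; lra.
- intros u v Hu Hv; now apply charts_compatible with s f.
Qed.

Lemma holder_bounded_below K g eps c p q : p <= q -> 0 < eps -> holder_on K g eps c ->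
  (forall x, p <= x <= q -> K x) -> (forall x, p <= x <= q -> g x <> 0) ->
  exists m, 0 < m /\ forall x, p <= x <= q -> m <= Rabs (g x).
Proof.
intros Hpq He Hh HK Hg.
apply (interval_induction (fun u v => exists m, 0 < m /\ forall x, u <= x <= v -> m <= Rabs (g x)) p q Hpq).
- intros x y z _ _ [m [Hm H]] [m' [Hm' H']]; exists (Rmin m m'); split; [now apply Rmin_pos|].
  intros t Ht; destruct (Rle_dec t y).
  + apply Rle_trans with (1 := Rmin_l m m'), H; lra.
  + apply Rle_trans with (1 := Rmin_r m m'), H'; lra.
- intros x Hx; set (m := Rabs (g x) / 2).
  assert (Hm : 0 < m) by (assert (P := Rabs_pos_lt _ (Hg x Hx)); unfold m; lra).
  set (c' := Rabs c + 1); assert (Hc' : 0 < c') by (generalize (Rabs_pos c); unfold c'; lra).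
  set (d := Rpower (m / c') (/ eps)).
  exists d; split; [apply exp_pos|]; intros u v Hu Hv Hu' Hv'; exists m; split; auto.
  intros t Ht; destruct (Req_dec x t) as [<-|Hne]; [unfold m; generalize (Rabs_pos (g x)); lra|].
  assert (A : Rabs (g x - g t) <= m).
  { eapply Rle_trans; [apply Hh; auto; apply HK; lra|].
    assert (B : Rpower (Rabs (x - t)) eps <= m / c').
    { replace (m / c') with (Rpower d eps).
      - apply Rpower_mono_base; auto; split; [apply Rabs_pos_lt; lra|apply Rabs_le; lra].
      - unfold d; rewrite Rpower_mult, Rinv_l, Rpower_1 by (try lra; now apply Rdiv_lt_0_compat); auto. }
    assert (B0 : 0 < Rpower (Rabs (x - t)) eps) by apply exp_pos.
    apply Rle_trans with (c' * Rpower (Rabs (x - t)) eps).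
    - apply Rmult_le_compat_r; [lra|]; generalize (Rle_abs c); unfold c'; lra.
    - replace m with (c' * (m / c')) by (field; lra); apply Rmult_le_compat_l; lra. }
  replace (g t) with (g x - (g x - g t)) by ring.
  assert (T := Rabs_triang_inv (g x) (g x - g t)); unfold m in *; lra.
Qed.

(** Maximality: a chart v compatible with the affine chart b on the same arc is
    conformal with respect to f, since the slopes of b relative to v differ by
    a power of the length. *)
Lemma compatible_along s f v a l : dyadic_solution s -> adapted s (dyadic_of_Z 0) f ->
  is_chart v -> is_arc (dom v) a l -> compatible v (affine_chart f a l) -> charts_along f v.
Proof.
intros Hs Hf Hv Harc [eps [He [g [c [Hd [Hg Hh]]]]]]; split; auto; assert (Hl := proj1 Harc).
set (K := image v (fun z => dom v z /\ dom (affine_chart f a l) z)) in *.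
set (h := fun t => affine_chart f a l (chart_inv v t)) in *.
destruct (chart_segment v a (a + l) Hv ltac:(lra) (fun t => is_arc_dom _ a l t Harc)) as [HC [HM _]].
set (V := arc_fun v) in *.
assert (HK : forall t, a <= t <= a + l -> K (V t)).
{ intros t Ht; exists (cis t); split; auto; split; [now apply is_arc_dom with a l|exists t; auto]. }
assert (HhV : forall t, a <= t <= a + l -> h (V t) = f t).
{ intros t Ht; unfold h, V, arc_fun; rewrite chart_inv_cis; auto; [|now apply is_arc_dom with a l].
  simpl; rewrite arc_lift_cis; auto; lra. }
assert (Hseg : forall s t x, a <= s <= a + l -> a <= t <= a + l -> Rmin (V s) (V t) <= x <= Rmax (V s) (V t) ->
  exists r, Rmin s t <= r <= Rmax s t /\ V r = x).
{ intros r t x Hr Ht Hx.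
  assert (Hin : a <= Rmin r t /\ Rmax r t <= a + l /\ Rmin r t <= Rmax r t).
  { unfold Rmin, Rmax; destruct Rle_dec; lra. }
  apply (seg_cont_ivt V (Rmin r t) (Rmax r t) x); [lra|apply seg_cont_sub with a (a + l); auto; lra|].
  destruct (Rle_dec r t) as [L|L].
  - rewrite (Rmin_left r t), (Rmax_right r t) by lra; auto.
  - rewrite (Rmin_right r t), (Rmax_left r t) by lra.
    rewrite (Rmin_comm (V t)), (Rmax_comm (V t)); auto. }
set (P := Rmin (V a) (V (a + l))); set (Q := Rmax (V a) (V (a + l))).
assert (HPQ : P <= Q) by (unfold P, Q; apply Rle_trans with (V a); [apply Rmin_l|apply Rmax_l]).
assert (HKPQ : forall x, P <= x <= Q -> K x).
{ intros x Hx; destruct (Hseg a (a + l) x ltac:(lra) ltac:(lra) Hx) as [r [Hr <-]]; apply HK.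
  rewrite Rmin_left, Rmax_right in Hr; lra. }
destruct (holder_bounded_below K g eps c P Q HPQ He Hh HKPQ) as [m [Hm Hgm]]; [auto|].
assert (HVPQ : forall t, a <= t <= a + l -> P <= V t <= Q) by (intros; now apply monotone_range).
assert (HVne : forall s t, a <= s <= a + l -> a <= t <= a + l -> s <> t -> V s <> V t).
{ intros r t Hr Ht Hrt E; apply Hrt; now apply (monotone_inj V a (a + l)). }
assert (HVf : forall s t, a <= s <= a + l -> a <= t <= a + l -> Rabs (V t - V s) <= Rabs (f t - f s) / m).
{ assert (Ho : forall s t, a <= s <= a + l -> a <= t <= a + l -> V s < V t -> Rabs (V t - V s) <= Rabs (f t - f s) / m).
  { intros r t Hr Ht Hrt; assert (A1 := HVPQ r Hr); assert (A2 := HVPQ t Ht).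
    destruct (mean_value K h g (V r) (V t) Hrt Hd) as [w [Hw E]]; [intros; apply HKPQ; lra|].
    rewrite !HhV in E by auto; rewrite E, Rabs_mult.
    assert (m <= Rabs (g w)) by (apply Hgm; lra).
    apply (Rmult_le_reg_r m); auto; unfold Rdiv; rewrite (Rmult_assoc _ (/ m)), Rinv_l by lra.
    generalize (Rabs_pos (V t - V r)); nra. }
  intros r t Hr Ht; destruct (Rtotal_order (V r) (V t)) as [L|[L|L]]; [now apply Ho| |].
  - rewrite L, Rminus_diag, Rabs_R0; apply Rmult_le_pos; [apply Rabs_pos|left; now apply Rinv_0_lt_compat].
  - rewrite Rabs_minus_sym, (Rabs_minus_sym (f t)); now apply Ho. }
destruct (adapted_holder s f a Hs Hf) as [[C [rho [HCp [Hrho Hup]]]] _].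
destruct (adapted_local s Hs) as [C' [mu' [HC' [Hmu' Hloc]]]].
set (C1 := Rabs c / m * Rpower (2 * (C / m)) eps); set (mu1 := Rpower rho eps).
assert (Hmu1 : 0 < mu1 < 1) by now apply Rpower_lt_1.
assert (HC1 : 0 <= C1).
{ apply Rmult_le_pos; [|left; apply exp_pos]; apply Rmult_le_pos; [apply Rabs_pos|left; now apply Rinv_0_lt_compat]. }
assert (Main : forall n t1 t2 t3, a <= t1 <= a + l -> a <= t2 <= a + l -> a <= t3 <= a + l ->
  t1 <> t2 -> t2 <> t3 -> Rabs (t1 - t2) <= (/ 2) ^ n -> Rabs (t3 - t2) <= (/ 2) ^ n ->
  dist3 V f t1 t2 t3 <= C1 * mu1 ^ n).
{ intros n t1 t2 t3 H1 H2 H3 H12 H23 D1 D3.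
  assert (HVn : forall t, a <= t <= a + l -> Rabs (t - t2) <= (/ 2) ^ n -> Rabs (V t - V t2) <= C / m * rho ^ n).
  { intros t Ht HD; eapply Rle_trans; [now apply HVf|].
    replace (C / m * rho ^ n) with (C * rho ^ n / m) by (field; lra).
    apply Rmult_le_compat_r; [left; now apply Rinv_0_lt_compat|]; apply Hup; auto; lra. }
  assert (A1 := HVn t1 H1 D1); assert (A3 := HVn t3 H3 D3).
  set (r := C / m * rho ^ n) in *.
  assert (Hr : 0 < r) by (apply Rmult_lt_0_compat; [now apply Rdiv_lt_0_compat|apply pow_lt; lra]).
  apply Rabs_le_between in A1; apply Rabs_le_between in A3.
  set (p := Rmax P (V t2 - r)); set (q := Rmin Q (V t2 + r)).
  assert (B1 := HVPQ t1 H1); assert (B2 := HVPQ t2 H2); assert (B3 := HVPQ t3 H3).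
  assert (Hpq : P <= p /\ q <= Q /\ p <= V t1 <= q /\ p <= V t2 <= q /\ p <= V t3 <= q /\ q - p <= 2 * r).
  { unfold p, q, Rmax, Rmin; repeat destruct Rle_dec; lra. }
  assert (S := C1_holder_slopes K h g p q m c eps (V t1) (V t2) (V t3) Hd Hh
    ltac:(intros; apply HKPQ; lra) He Hm ltac:(intros; apply Hgm; lra) ltac:(lra) ltac:(lra) ltac:(lra)
    (HVne t1 t2 H1 H2 H12) (HVne t2 t3 H2 H3 H23)).
  rewrite (dist3_log_slope V f a (a + l)) by (auto; now apply adapted_monotone with s (dyadic_of_Z 0)).
  unfold log_slope, id in S |- *; rewrite !HhV in S by auto.
  match type of S with Rabs ?Y <= _ => match goal with |- Rabs ?Z <= _ => replace Z with (- Y) by ring end end.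
  rewrite Rabs_Ropp; apply Rle_trans with (1 := S).
  unfold C1; rewrite Rmult_assoc; apply Rmult_le_compat_l.
  { apply Rmult_le_pos; [apply Rabs_pos|left; now apply Rinv_0_lt_compat]. }
  assert (Hpq0 : 0 < q - p).
  { assert (N := HVne t1 t2 H1 H2 H12); destruct (Rdichotomy _ _ N); lra. }
  apply Rle_trans with (Rpower (2 * r) eps); [apply Rpower_mono_base; lra|].
  unfold r, mu1; rewrite <- Rmult_assoc, Rpower_pow_base; [lra| |lra].
  apply Rmult_lt_0_compat; [lra|now apply Rdiv_lt_0_compat]. }
apply (conformal_intro f v (C1 + C') (Rmax mu1 mu') 0).
{ apply Rmax_case; auto. }
intros n t1 t2 t3 p q _ H1 H2 H3 Hdom H12 H23 D1 D2.
destruct (is_arc_segment _ a l p q Harc ltac:(lra) Hdom) as [k [K1 K2]].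
set (j := (- k)%Z); assert (Hj : IZR j = - IZR k) by apply opp_IZR.
assert (A := Main n (t1 + IZR j) (t2 + IZR j) (t3 + IZR j) ltac:(lra) ltac:(lra) ltac:(lra) ltac:(lra) ltac:(lra)
  ltac:(now replace (t1 + IZR j - (t2 + IZR j)) with (t1 - t2) by ring)
  ltac:(now replace (t3 + IZR j - (t2 + IZR j)) with (t3 - t2) by ring)).
assert (B := Hloc n (dyadic_of_Z j) (dyadic_of_Z 0) (fun t => f (t + IZR j)) f t1 t2 t3
  (adapted_translate s f j Hf) Hf D1 D2 H12 H23).
assert (E : dist3 V f (t1 + IZR j) (t2 + IZR j) (t3 + IZR j) = dist3 V (fun t => f (t + IZR j)) t1 t2 t3).
{ unfold dist3, R3, V; now rewrite !arc_fun_period. }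
rewrite E in A; eapply Rle_trans; [apply (dist3_trans _ (fun t => f (t + IZR j)))|].
assert (M1 : mu1 ^ n <= Rmax mu1 mu' ^ n) by (apply pow_incr; split; [lra|apply Rmax_l]).
assert (M2 : mu' ^ n <= Rmax mu1 mu' ^ n) by (apply pow_incr; split; [lra|apply Rmax_r]).
fold V; nra.
Qed.

Lemma charts_structure s f : dyadic_solution s -> adapted s (dyadic_of_Z 0) f ->
  invariant_circle_structure (charts_along f).
Proof.
intros Hs Hf; split; [split|now apply charts_doubling_invariant with s].
- now apply charts_atlas with s.
- intros V HV HUV v Hv; assert (Hc := proj1 HV v Hv); assert (Hc' := Hc).
  destruct Hc' as [[a [l Harc]] _].
  apply compatible_along with s a l; auto; apply HV; auto; apply HUV.
  apply affine_chart_along with s; auto; apply Harc.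
Qed.

(** * From circle structures to affine structures *)

Lemma iter_tilde_E_onto n (x : solenoid) : exists y, Nat.iter n tilde_E y = x.
Proof.
revert x; induction n as [|n IH]; intros x; [now exists x|].
destruct (tilde_E_onto x) as [z Hz], (IH z) as [y Hy]; exists y; simpl; now rewrite Hy.
Qed.

Lemma iter_tilde_E_flow n y t : Nat.iter n tilde_E (flow y t) = flow (Nat.iter n tilde_E y) (2 ^ n * t).
Proof.
induction n as [|n IH]; simpl; [now rewrite Rmult_1_l|].
rewrite IH, tilde_E_flow; f_equal; ring.
Qed.

Lemma iter_tilde_E_coord n y : Nat.iter n tilde_E y n = y 0%nat.
Proof. induction n as [|n IH]; simpl; auto. Qed.

(** Passing to the coordinate n of a leaf is passing to the coordinate 0 of its
    n-th preimage by the solenoid map. *)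
Lemma coordinate_angle (x : solenoid) n : exists b tau, Nat.iter n tilde_E (flow (tilde_omega b) tau) = x /\
  forall t, flow x t n = cis (tau + t / 2 ^ n).
Proof.
destruct (iter_tilde_E_onto n x) as [y Hy]; destruct (leaf_base y) as [b [tau [_ E]]]; subst y.
exists b, tau; split; auto; intros t.
assert (Hp : 2 ^ n <> 0) by (apply pow_nonzero; lra).
replace (flow x t) with (Nat.iter n tilde_E (flow (tilde_omega b) (tau + t / 2 ^ n))).
- rewrite iter_tilde_E_coord; simpl.
  replace (0 / 1) with 0 by field; rewrite cis_0, Cmult_1_l; f_equal; field; auto.
- rewrite <- Hy, !iter_tilde_E_flow, flow_flow; f_equal; field; auto.
Qed.

Lemma is_lim_seq_ln (u : nat -> R) l : 0 < l -> (forall n, 0 < u n) ->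
  is_lim_seq (fun n => ln (u n)) (ln l) -> is_lim_seq u l.
Proof.
intros Hl Hu H; apply (is_lim_seq_ext (fun n => exp (ln (u n)))).
{ intros n; now apply exp_ln. }
rewrite <- (exp_ln l) by auto; apply is_lim_seq_continuous; auto.
apply derivable_continuous_pt, derivable_pt_exp.
Qed.

Lemma hull_in t1 t2 t3 : let P := Rmin t1 (Rmin t2 t3) in let Q := Rmax t1 (Rmax t2 t3) in
  P <= t1 <= Q /\ P <= t2 <= Q /\ P <= t3 <= Q.
Proof. simpl; unfold Rmin, Rmax; repeat destruct Rle_dec; lra. Qed.

(** At coordinate n the ratios in the charts differ from those of f, and these from those
    of the n-th preimage of the leaf, by a power of 2^-n; the latter are the
    ratios of the leaf, by invariance. *)
Lemma charts_to_leaf s f phi : dyadic_solution s -> adapted s (dyadic_of_Z 0) f ->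
  invariant_leaf_structure phi -> leaf_to_function phi s -> circle_to_leaf (charts_along f) phi.
Proof.
intros Hs Hf [Hl [_ HE]] Hphi x t1 t2 t3 H12 H23 H13 U' u [HU' _] Hu [N HN].
destruct (list_bound (fun u X => conformal f u X) U') as [X [HX HXc]].
{ intros; eapply conformal_mono; eauto. }
{ intros v Hv; apply HU' in Hv; destruct Hv as [_ [X HX]]; now exists X. }
destruct (adapted_local s Hs) as [C [mu [HC [Hmu Hloc]]]].
assert (HR := rate_bounds X HX).
set (P := Rmin t1 (Rmin t2 t3)) in *; set (Q := Rmax t1 (Rmax t2 t3)) in *.
destruct (hull_in t1 t2 t3) as [I1 [I2 I3]]; fold P Q in I1, I2, I3.
destruct (nat_above (Q - P)) as [n1 Hn1].
assert (Hn1' : Q - P <= 2 ^ n1).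
{ apply Rle_trans with (1 := Hn1); clear; induction n1 as [|n IH]; [simpl; lra|].
  rewrite S_INR; simpl; assert (1 <= 2 ^ n) by (apply pow_R1_Rle; lra); lra. }
destruct (nat_above X) as [n2 Hn2].
set (F := fun n t => u n (flow x t n)).
set (g := leaf_fun phi x).
assert (Hg : 0 < R3 g t1 t2 t3).
{ apply R3_pos; intros E; apply leaf_fun_injective in E; auto. }
assert (Key : forall n, (N + n1 + n2 <= n)%nat -> F n t1 <> F n t2 /\ F n t2 <> F n t3 /\
  Rabs (ln (R3 (F n) t1 t2 t3) - ln (R3 g t1 t2 t3)) <= X * rate X ^ (n - n1) + C * mu ^ (n - n1)).
{ intros n Hn; destruct (coordinate_angle x n) as [b [tau [Hy Hco]]].
  assert (Hp : 0 < 2 ^ n) by (apply pow_lt; lra).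
  set (r := fun t => tau + t / 2 ^ n).
  assert (HF : forall t, F n t = arc_fun (u n) (r t)) by (intros t; unfold F; rewrite Hco; auto).
  assert (Hrle : forall s t, s <= t -> r s <= r t).
  { intros p q Hpq; unfold r; apply Rplus_le_compat_l, Rmult_le_compat_r; auto.
    left; now apply Rinv_0_lt_compat. }
  assert (Hrne : forall s t, s <> t -> r s <> r t).
  { intros p q Hpq E; apply Hpq; unfold r in E.
    apply (Rmult_eq_reg_r (/ 2 ^ n)); [unfold Rdiv in E; lra|apply Rgt_not_eq; now apply Rinv_0_lt_compat]. }
  assert (Hdom : forall t, r P <= t <= r Q -> dom (u n) (cis t)).
  { intros t Ht; replace t with (r ((t - tau) * 2 ^ n)) by (unfold r; field; lra).
    unfold r; rewrite <- Hco; apply HN; [lia|]; fold P Q; unfold r in Ht; split.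
    - apply (Rmult_le_reg_r (/ 2 ^ n)); [now apply Rinv_0_lt_compat|]; rewrite Rmult_assoc, Rinv_r; lra.
    - apply (Rmult_le_reg_r (/ 2 ^ n)); [now apply Rinv_0_lt_compat|]; rewrite Rmult_assoc, Rinv_r; lra. }
  destruct (chart_segment (u n) (r P) (r Q) (proj1 (HU' _ (Hu n))) ltac:(apply Hrle; lra) Hdom) as [_ [HM _]].
  assert (Hd : forall s t, P <= s <= Q -> P <= t <= Q -> Rabs (r s - r t) <= (/ 2) ^ (n - n1)).
  { intros p q Hp1 Hq1; unfold r; replace (tau + p / 2 ^ n - (tau + q / 2 ^ n)) with ((p - q) * / 2 ^ n) by (field; lra).
    rewrite Rabs_mult, (Rabs_pos_eq (/ 2 ^ n)) by (left; now apply Rinv_0_lt_compat).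
    rewrite half_pow_inv; apply Rle_trans with (2 ^ n1 * / 2 ^ n).
    - apply Rmult_le_compat_r; [left; now apply Rinv_0_lt_compat|apply Rabs_le; lra].
    - apply Req_le; replace n with (n1 + (n - n1))%nat at 1 by lia; rewrite pow_add.
      field; split; apply pow_nonzero; lra. }
  assert (Hin : forall t, P <= t <= Q -> r P <= r t <= r Q) by (intros; split; apply Hrle; lra).
  rewrite !HF; split; [|split].
  - intros E; apply (Hrne t1 t2 H12); apply (monotone_inj _ _ _ _ _ HM); auto.
  - intros E; apply (Hrne t2 t3 H23); apply (monotone_inj _ _ _ _ _ HM); auto.
  - destruct (leaf_fun_adapted phi s b Hl HE Hphi) as [sg [Hsg Hb]].
    set (G := fun t => sg * leaf_fun phi (tilde_omega b) t) in *.
    assert (E1 : R3 (F n) t1 t2 t3 = R3 (arc_fun (u n)) (r t1) (r t2) (r t3)) by (unfold R3; now rewrite !HF).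
    assert (E2 : R3 g t1 t2 t3 = R3 G (r t1) (r t2) (r t3)).
    { assert (Eg : R3 G (r t1) (r t2) (r t3) = R3 (leaf_fun phi (tilde_omega b)) (r t1) (r t2) (r t3)).
      { rewrite <- (R3_affine (leaf_fun phi (tilde_omega b)) sg 0) by (destruct Hsg; lra).
        unfold R3, G; now rewrite !Rplus_0_r. }
      rewrite Eg, <- (ratio_rescale phi (tilde_omega b) n) by auto.
      assert (Ef : forall t, leaf_fun phi (Nat.iter n tilde_E (tilde_omega b)) (2 ^ n * r t) = g t).
      { intros t; unfold leaf_fun, g; rewrite <- Hy, iter_tilde_E_flow; unfold leaf_fun; rewrite flow_flow.
        f_equal; f_equal; unfold r; field; lra. }
      unfold R3; now rewrite !Ef. }
    rewrite E1, E2.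
    change (dist3 (arc_fun (u n)) G (r t1) (r t2) (r t3) <= X * rate X ^ (n - n1) + C * mu ^ (n - n1)).
    eapply Rle_trans; [apply (dist3_trans _ f)|]; apply Rplus_le_compat.
    + apply (HXc (u n) (Hu n) (n - n1)%nat (r t1) (r t2) (r t3) (r P) (r Q)); auto.
      apply Rle_trans with (1 := Hn2); apply le_INR; lia.
    + apply (Hloc (n - n1)%nat (dyadic_of_Z 0) b f G); auto. }
assert (Hlim : is_lim_seq (fun n => R3 (F (n + (N + n1 + n2))%nat) t1 t2 t3) (R3 g t1 t2 t3)).
{ apply is_lim_seq_ln; auto.
  - intros n; destruct (Key (n + (N + n1 + n2))%nat) as [K1 [K2 _]]; [lia|now apply R3_pos].
  - apply is_lim_seq_geometric with (X + C) (Rmax (rate X) mu) 0%nat; [apply Rmax_case; auto|].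
    intros n _; destruct (Key (n + (N + n1 + n2))%nat) as [_ [_ K]]; [lia|].
    apply Rle_trans with (1 := K).
    assert (M : forall r, 0 < r < 1 -> r <= Rmax (rate X) mu -> r ^ (n + (N + n1 + n2) - n1) <= Rmax (rate X) mu ^ n).
    { intros r Hr Hrm; apply Rle_trans with (r ^ n); [apply pow_decr; [auto|lia]|apply pow_incr; lra]. }
    assert (M1 := M (rate X) HR (Rmax_l _ _)); assert (M2 := M mu Hmu (Rmax_r _ _)); nra. }
apply (is_lim_seq_incr_n (fun n => R3 (F n) t1 t2 t3) (N + n1 + n2)) in Hlim; exact Hlim.
Qed.

(** * Distortion of an invariant circle structure *)

(** Compactness of the circle, with a Lebesgue number. *)
Lemma lebesgue_cover U : atlas U -> exists W d, 0 < d /\ (forall u, In u W -> U u) /\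
  forall p q, p <= q -> q - p <= d -> exists u, In u W /\ forall t, p <= t <= q -> dom u (cis t).
Proof.
intros [_ [HU _]].
assert (H01 : exists W d, 0 < d /\ (forall u, In u W -> U u) /\
  forall p q, p <= q -> q - p <= d -> p <= 1 -> 0 <= q -> exists u, In u W /\ forall t, p <= t <= q -> dom u (cis t)).
{ apply (interval_induction (fun x y => exists W d, 0 < d /\ (forall u, In u W -> U u) /\
    forall p q, p <= q -> q - p <= d -> p <= y -> x <= q -> exists u, In u W /\ forall t, p <= t <= q -> dom u (cis t)) 0 1);
    [lra| |].
  - intros x y z _ _ [W [d [Hd [HW H]]]] [W' [d' [Hd' [HW' H']]]].
    exists (W ++ W'), (Rmin d d'); split; [now apply Rmin_pos|split].
    + intros u Hu; apply in_app_or in Hu; destruct Hu; auto.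
    + intros p q Hpq Hl Hp Hq; generalize (Rmin_l d d') (Rmin_r d d'); intros.
      destruct (Rle_dec p y).
      * destruct (H p q) as [u [Hu Hu']]; auto; try lra; exists u; split; auto; apply in_or_app; auto.
      * destruct (H' p q) as [u [Hu Hu']]; auto; try lra; exists u; split; auto; apply in_or_app; auto.
  - intros x _; destruct (HU (cis x) (circle_cis x)) as [u [Hu [_ [e He]]]].
    destruct (proj1 (continuous_on_ball (fun _ => True) cis) (cis_continuous _) x I e (cond_pos e)) as [d [Hd Hcd]].
    exists (d / 2); split; [lra|]; intros v w Hv Hw Hv' Hw'; exists [u], (d / 2); split; [lra|split].
    + intros u' [<-|[]]; auto.
    + intros p q Hpq Hl Hp Hq; exists u; split; [now left|]; intros t Ht.
      apply He; [|apply circle_cis]; apply Hcd; auto; change (Rabs (t - x) < d); apply Rabs_def1; lra. }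
destruct H01 as [W [d [Hd [HW H]]]]; exists W, d; split; auto; split; auto.
intros p q Hpq Hl; destruct (floor_ex p) as [k Hk].
destruct (H (p + IZR (- k)) (q + IZR (- k))) as [u [Hu Hdu]]; rewrite ?opp_IZR; try lra.
exists u; split; auto; intros t Ht; rewrite <- (cis_period t (- k)); apply Hdu; rewrite opp_IZR; lra.
Qed.

(** The inverse of a quasisymmetric map is Hölder: lengths in a chart are bounded
    by a power of the arc length. *)
Lemma quasisymmetric_holder u a l : is_chart u -> is_arc (dom u) a l ->
  (forall w, arc_isometry (dom u) w -> quasisymmetric (image u (dom u)) (fun t => w (chart_inv u t))) ->
  exists C rho, 0 < C /\ 0 < rho < 1 /\ forall x y n, a <= x <= a + l -> a <= y <= a + l ->
    Rabs (y - x) <= (/ 2) ^ n -> Rabs (arc_fun u y - arc_fun u x) <= C * rho ^ n.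
Proof.
intros Hu Harc HQ; assert (Hl := proj1 Harc); assert (HPI := PI_RGT_0).
destruct (HQ (fun z => 2 * PI * arc_lift a l z)) with (d := 1) as [k [Hk HQS]]; [|lra|].
{ exists a, l; split; auto; intros s t Hs Ht; rewrite !arc_lift_cis by lra.
  rewrite <- Rmult_minus_distr_l, Rabs_mult, (Rabs_pos_eq (2 * PI)); lra. }
destruct (chart_segment u a (a + l) Hu ltac:(lra) (fun t => is_arc_dom _ a l t Harc)) as [HC [HM _]].
set (V := arc_fun u) in *; set (h := fun t => 2 * PI * arc_lift a l (chart_inv u t)) in *.
assert (Hh : forall t, a <= t <= a + l -> h (V t) = 2 * PI * t).
{ intros t Ht; unfold h, V, arc_fun; rewrite chart_inv_cis, arc_lift_cis; auto; [lra|].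
  now apply is_arc_dom with a l. }
assert (HI : forall t, a <= t <= a + l -> image u (dom u) (V t)).
{ intros t Ht; exists (cis t); split; auto; now apply is_arc_dom with a l. }
set (P := Rmin (V a) (V (a + l))); set (Q := Rmax (V a) (V (a + l))).
assert (Hons : forall x, P <= x <= Q -> exists t, a <= t <= a + l /\ V t = x).
{ intros x Hx; apply seg_cont_ivt; auto; lra. }
assert (HVne : V a <> V (a + l)).
{ intros E; apply (monotone_inj V a (a + l)) in E; auto; lra. }
assert (HPQ : P < Q).
{ unfold P, Q, Rmin, Rmax; repeat destruct Rle_dec; lra. }
assert (HVPQ : forall t, a <= t <= a + l -> P <= V t <= Q) by (intros; now apply monotone_range).
assert (HhM : monotone_on h P Q).
{ assert (Hinj : forall s t, a <= s <= a + l -> a <= t <= a + l -> V s < V t -> s <> t)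
    by (intros r t _ _ Hlt ->; lra).
  destruct HM as [HM|HM]; [left|right]; intros x y Hx Hxy Hy;
    destruct (Hons x ltac:(lra)) as [r [Hr <-]]; destruct (Hons y ltac:(lra)) as [t [Ht <-]];
    rewrite !Hh by auto; assert (Hne := Hinj r t Hr Ht Hxy); destruct (Rdichotomy r t Hne) as [L|L].
  - apply Rmult_lt_compat_l; lra.
  - specialize (HM t r ltac:(lra) L ltac:(lra)); lra.
  - specialize (HM r t ltac:(lra) L ltac:(lra)); simpl in HM; lra.
  - assert (2 * PI * t < 2 * PI * r) by (apply Rmult_lt_compat_l; lra); lra. }
assert (W := weak_quasisymmetry h P Q k HPQ ltac:(lra) HhM).
assert (HW : forall x d, 0 < d -> P <= x - d -> x + d <= Q ->
  Rabs (h (x + d) - h x) <= k * Rabs (h x - h (x - d)) /\ Rabs (h x - h (x - d)) <= k * Rabs (h (x + d) - h x)).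
{ intros x d Hd Hx1 Hx2.
  assert (IX : forall z, P <= z <= Q -> image u (dom u) z).
  { intros z Hz; destruct (Hons z Hz) as [t [Ht <-]]; now apply HI. }
  assert (HH := HQS x d d Hd Hd (IX (x - d) ltac:(lra)) (IX x ltac:(lra)) (IX (x + d) ltac:(lra))).
  replace (d / d) with 1 in HH by (field; lra); rewrite Rinv_1 in HH; specialize (HH ltac:(lra)).
  rewrite Rmult_1_r in HH; fold (h (x + d)) in HH; fold (h x) in HH; fold (h (x - d)) in HH.
  assert (P1 := monotone_dist_pos h P Q (x + d) x HhM ltac:(lra) ltac:(lra) ltac:(lra)).
  assert (P2 := monotone_dist_pos h P Q x (x - d) HhM ltac:(lra) ltac:(lra) ltac:(lra)).
  assert (E : (h (x + d) - h x) / (h x - h (x - d)) = Rabs (h (x + d) - h x) / Rabs (h x - h (x - d))).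
  { destruct HhM as [HhM|HhM]; assert (A1 := HhM x (x + d) ltac:(lra) ltac:(lra) ltac:(lra));
      assert (A2 := HhM (x - d) x ltac:(lra) ltac:(lra) ltac:(lra)); simpl in A1, A2.
    - rewrite !Rabs_pos_eq; lra.
    - rewrite !Rabs_left by lra; field; lra. }
  rewrite E, ln_div in HH by auto; rewrite <- (exp_ln k) by lra.
  split; apply ln_le_exp; auto; rewrite Rabs_minus_sym; auto; now rewrite Rabs_minus_sym. }
specialize (W HW).
assert (Htot : Rabs (h Q - h P) = 2 * PI * l).
{ assert (E : Rabs (h Q - h P) = Rabs (h (V (a + l)) - h (V a))).
  { unfold P, Q, Rmin, Rmax; repeat destruct Rle_dec; auto using Rabs_minus_sym; lra. }
  rewrite E, !Hh by lra; rewrite Rabs_pos_eq; nra. }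
rewrite Htot in W.
set (kap := / (1 + k)).
assert (Hkap : 0 < kap < 1).
{ unfold kap; split; [apply Rinv_0_lt_compat; lra|]; rewrite <- Rinv_1; apply Rinv_lt_contravar; lra. }
assert (Hlnk : ln kap < 0) by (rewrite <- ln_1; apply ln_increasing; lra).
assert (Hln2 : ln (/ 2) < 0) by (rewrite <- ln_1; apply ln_increasing; lra).
set (al := ln (/ 2) / ln kap).
assert (Hal : 0 < al).
{ unfold al; replace (ln (/ 2) / ln kap) with (- ln (/ 2) / - ln kap) by (field; lra).
  apply Rdiv_lt_0_compat; lra. }
assert (Hka : Rpower kap al = / 2).
{ unfold Rpower, al; replace (ln (/ 2) / ln kap * ln kap) with (ln (/ 2)) by (field; lra).
  apply exp_ln; lra. }
set (c0 := (1 + 2 * k) / l); assert (Hc0 : 0 < c0) by (apply Rdiv_lt_0_compat; lra).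
exists (2 * (Q - P) * Rpower c0 al), (Rpower (/ 2) al).
split; [|split].
- apply Rmult_lt_0_compat; [lra|apply exp_pos].
- apply Rpower_lt_1; lra.
- assert (Main : forall x y n, a <= x <= a + l -> a <= y <= a + l -> V x < V y ->
    Rabs (y - x) <= (/ 2) ^ n -> V y - V x <= 2 * (Q - P) * Rpower c0 al * Rpower (/ 2) al ^ n).
  { intros x y n Hx Hy Hxy Hn; assert (B1 := HVPQ x Hx); assert (B2 := HVPQ y Hy).
    set (e := (V y - V x) / (Q - P)).
    assert (Ee : V y - V x = e * (Q - P)) by (unfold e; field; lra).
    assert (He : 0 < e <= 1).
    { split; [apply Rdiv_lt_0_compat; lra|]; apply (Rmult_le_reg_r (Q - P)); lra. }
    destruct (dyadic_scale e He) as [j Hj].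
    destruct (W (S j) (V x) (V y)) as [_ WL]; try lra.
    assert (Pj := half_pow_pos (S j)).
    assert (WL' : / (1 + 2 * k) * kap ^ S j * (2 * PI * l) <= Rabs (h (V y) - h (V x))) by (apply WL; nra).
    rewrite !Hh, <- Rmult_minus_distr_l, Rabs_mult, (Rabs_pos_eq (2 * PI)) in WL' by (auto; lra).
    assert (Kj : kap ^ S j <= c0 * (/ 2) ^ n).
    { apply Rle_trans with (c0 * Rabs (y - x)); [|apply Rmult_le_compat_l; lra].
      apply (Rmult_le_reg_l (2 * PI * l / (1 + 2 * k))); [apply Rdiv_lt_0_compat; nra|].
      replace (2 * PI * l / (1 + 2 * k) * (c0 * Rabs (y - x))) with (2 * PI * Rabs (y - x)) by (unfold c0; field; lra).
      unfold Rdiv; lra. }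
    rewrite Ee; replace (2 * (Q - P) * Rpower c0 al * Rpower (/ 2) al ^ n)
      with (2 * (Rpower c0 al * Rpower (/ 2) al ^ n) * (Q - P)) by ring.
    apply Rmult_le_compat_r; [lra|]; rewrite <- Rpower_pow_base by lra.
    apply Rle_trans with (2 * (/ 2) ^ S j); [simpl; lra|]; apply Rmult_le_compat_l; [lra|].
    replace ((/ 2) ^ S j) with (Rpower (kap ^ S j) al).
    - apply Rpower_mono_base; auto; split; auto; apply pow_lt; lra.
    - rewrite <- (Rmult_1_l (kap ^ S j)), Rpower_pow_base, Hka by lra.
      unfold Rpower; rewrite ln_1, Rmult_0_r, exp_0; ring. }
  intros x y n Hx Hy Hn; destruct (Rtotal_order (V x) (V y)) as [L|[L|L]].
  + rewrite Rabs_pos_eq by lra; now apply Main.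
  + rewrite L, Rminus_diag, Rabs_R0; apply Rmult_le_pos; [|apply pow_le; left; apply exp_pos].
    left; apply Rmult_lt_0_compat; [lra|apply exp_pos].
  + rewrite Rabs_left by lra; replace (- (V y - V x)) with (V x - V y) by ring.
    apply Main; auto; now rewrite Rabs_minus_sym.
Qed.

Definition level (u : chart) (x : solenoid) (n : nat) (t : R) := u (flow x t n).

(** Going down one coordinate is applying the doubling map, whose expression in
    charts has a derivative that is Hölder and bounded away from zero. *)
Lemma one_step U W : invariant_circle_structure U -> finite_cover U W ->
  exists C mu, 0 < C /\ 0 < mu < 1 /\ forall x n k u v T1 T2 t1 t2 t3, In u W -> In v W ->
  (T2 - T1) * (/ 2) ^ S n <= (/ 2) ^ k -> T1 <= t1 <= T2 -> T1 <= t2 <= T2 -> T1 <= t3 <= T2 ->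
  t1 <> t2 -> t2 <> t3 -> (forall t, T1 <= t <= T2 -> dom u (flow x t (S n))) ->
  (forall t, T1 <= t <= T2 -> dom v (flow x t n)) ->
  dist3 (level v x n) (level u x (S n)) t1 t2 t3 <= C * mu ^ k.
Proof.
intros [[[HUc _] _] HD] HW; destruct (HD W HW) as [[eps [b [He [Hb H1]]]] H2].
destruct (list_bound (fun u X => forall x y n, x <= y -> (forall t, x <= t <= y -> dom u (cis t)) ->
  y - x <= (/ 2) ^ n -> Rabs (arc_fun u y - arc_fun u x) <= X * rate X ^ n) W) as [X [HX HXW]].
{ intros u X Y HXY H x y n Hxy Hdom Hn; apply Rle_trans with (X * rate X ^ n); [now apply H|now apply rate_pow_mono]. }
{ intros u Hu; assert (Hc : is_chart u) by (apply HUc, HW, Hu); assert (Hc' := Hc).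
  destruct Hc' as [[a [l Harc]] _].
  destruct (quasisymmetric_holder u a l Hc Harc (fun w => H2 u w Hu)) as [C [rho [HC [Hrho H]]]].
  destruct (rate_dominates C rho Hrho) as [X [HX HXd]]; exists X; split; auto.
  intros x y n Hxy Hdom Hn; destruct (is_arc_segment _ a l x y Harc Hxy Hdom) as [k [K1 K2]].
  rewrite <- (arc_fun_period u x (- k)), <- (arc_fun_period u y (- k)).
  apply Rle_trans with (C * rho ^ n); [|apply HXd; lra].
  apply H; rewrite ?opp_IZR; try lra; rewrite Rabs_pos_eq; lra. }
assert (HR := rate_bounds X HX).
set (mu := Rpower (rate X) eps).
assert (Hmu : 0 < mu < 1) by now apply Rpower_lt_1.
assert (Hbi : 0 < / b) by (apply Rinv_0_lt_compat; lra).
exists (Rabs b / / b * Rpower X eps), mu; split; [|split; auto].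
{ apply Rmult_lt_0_compat; [|apply exp_pos]; apply Rdiv_lt_0_compat; auto; rewrite Rabs_pos_eq; lra. }
intros x n k u v T1 T2 t1 t2 t3 Hu Hv HT I1 I2 I3 H12 H23 Du Dv.
destruct (coordinate_angle x (S n)) as [_ [tau [_ Hco]]].
assert (Hp : 0 < 2 ^ S n) by (apply pow_lt; lra).
assert (Hpi : 0 < / 2 ^ S n) by now apply Rinv_0_lt_compat.
set (r := fun t => tau + t / 2 ^ S n).
assert (Hr : forall s t, s < t -> r s < r t).
{ intros s t H; apply Rplus_lt_compat_l, Rmult_lt_compat_r; auto. }
assert (Hrle : forall s t, s <= t -> r s <= r t).
{ intros s t [L|L]; [left; now apply Hr|rewrite L; lra]. }
assert (Hrs : forall t, r T1 <= t <= r T2 -> exists t', T1 <= t' <= T2 /\ t = r t').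
{ intros t Ht; exists ((t - tau) * 2 ^ S n); split; [|unfold r; field; lra].
  split; apply Rnot_lt_le; intros L; apply Hr in L; unfold r at 1 2 in L;
  replace (tau + (t - tau) * 2 ^ S n / 2 ^ S n) with t in L by (field; lra); fold (r T1) (r T2) in L; lra. }
assert (HT12 : T1 < T2) by (destruct (Rdichotomy _ _ H12); lra).
assert (Fu : forall t, level u x (S n) t = arc_fun u (r t)) by (intros t; unfold level; now rewrite Hco).
assert (Fv : forall t, level v x n t = v (doubling (cis (r t)))).
{ intros t; unfold level; now rewrite <- (coord_doubling (flow x t) n), Hco. }
assert (Du' : forall t, r T1 <= t <= r T2 -> dom u (cis t)).
{ intros t Ht; destruct (Hrs t Ht) as [t' [Ht' ->]]; unfold r; rewrite <- Hco; now apply Du. }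
assert (Hcu : is_chart u) by (apply HUc, HW, Hu).
destruct (chart_segment u (r T1) (r T2) Hcu ltac:(left; now apply Hr) Du') as [HC [HM _]].
set (K := fun z => exists t, r T1 <= t <= r T2 /\ z = cis t).
destruct (H1 u v Hu Hv K) as [g [G1 [G2 G3]]].
{ exists (fun t => r T1 <= t <= r T2); split; [intros s t q Hs Ht Hq; lra|intros z; reflexivity]. }
{ intros z [t [Ht ->]]; now apply Du'. }
{ intros z [t [Ht ->]]; destruct (Hrs t Ht) as [t' [Ht' ->]]; unfold r; rewrite <- Hco, coord_doubling; now apply Dv. }
set (h := fun t => v (doubling (chart_inv u t))) in *.
set (V := arc_fun u) in *.
assert (Hh : forall t, T1 <= t <= T2 -> h (V (r t)) = level v x n t).
{ intros t Ht; rewrite Fv; unfold h, V, arc_fun; rewrite chart_inv_cis; auto; apply Du'; split; apply Hrle; lra. }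
set (P := Rmin (V (r T1)) (V (r T2))); set (Q := Rmax (V (r T1)) (V (r T2))).
assert (HK : forall z, P <= z <= Q -> image u K z).
{ intros z Hz; destruct (seg_cont_ivt V (r T1) (r T2) z) as [t [Ht <-]]; auto; [left; now apply Hr|].
  exists (cis t); split; auto; exists t; auto. }
assert (HVPQ : forall t, T1 <= t <= T2 -> P <= V (r t) <= Q).
{ intros t Ht; apply monotone_range; auto; split; apply Hrle; lra. }
assert (HVne : forall s t, T1 <= s <= T2 -> T1 <= t <= T2 -> s <> t -> V (r s) <> V (r t)).
{ intros s t Hs Ht Hst E; apply (monotone_inj V (r T1) (r T2)) in E; auto; try (split; apply Hrle; lra).
  destruct (Rdichotomy _ _ Hst) as [L|L]; apply Hr in L; lra. }
assert (S := C1_holder_slopes (image u K) h g P Q (/ b) b eps (V (r t1)) (V (r t2)) (V (r t3)) G1 G3 HK He Hbi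
  ltac:(intros t Ht; apply G2, HK, Ht) (HVPQ t1 I1) (HVPQ t2 I2) (HVPQ t3 I3)
  (HVne t1 t2 I1 I2 H12) (HVne t2 t3 I2 I3 H23)).
unfold log_slope, id in S; rewrite !Hh in S by auto.
assert (HPQ : 0 < Q - P <= X * rate X ^ k).
{ assert (E : Q - P = Rabs (V (r T2) - V (r T1))).
  { unfold P, Q, Rmin, Rmax, Rabs; repeat destruct Rle_dec; destruct Rcase_abs; lra. }
  rewrite E; split; [apply Rabs_pos_lt; assert (Hne := HVne T2 T1 ltac:(lra) ltac:(lra) ltac:(lra)); lra|].
  apply (HXW u Hu); [left; now apply Hr|auto|].
  apply Rle_trans with (2 := HT); rewrite half_pow_inv; apply Req_le; unfold r; field; lra. }
assert (B : Rabs b / / b * Rpower (Q - P) eps <= Rabs b / / b * Rpower X eps * mu ^ k).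
{ rewrite Rmult_assoc; apply Rmult_le_compat_l.
  - apply Rmult_le_pos; [apply Rabs_pos|left; now apply Rinv_0_lt_compat].
  - unfold mu; rewrite <- Rpower_pow_base by lra; now apply Rpower_mono_base. }
apply Rle_trans with (2 := B).
assert (HLne : forall s t, T1 <= s <= T2 -> T1 <= t <= T2 -> s <> t -> level v x n s <> level v x n t).
{ intros s t Hs Ht Hst E.
  assert (Hcv : is_chart v) by (apply HUc, HW, Hv).
  assert (Dv' : forall t, r T1 + r T1 <= t <= r T2 + r T2 -> dom v (cis t)).
  { intros z Hz; destruct (Hrs (z / 2) ltac:(lra)) as [t' [Ht' Et]].
    replace z with (2 * r t') by lra; rewrite <- doubling_cis; unfold r; rewrite <- Hco, coord_doubling; now apply Dv. }
  assert (Hr12 : r T1 < r T2) by now apply Hr.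
  destruct (chart_segment v (r T1 + r T1) (r T2 + r T2) Hcv ltac:(lra) Dv') as [_ [HMv _]].
  rewrite !Fv, !doubling_cis in E; apply (monotone_inj (arc_fun v) _ _ _ _ HMv) in E.
  - destruct (Rdichotomy _ _ Hst) as [L|L]; apply Hr in L; lra.
  - assert (A1 := Hrle T1 s ltac:(lra)); assert (A2 := Hrle s T2 ltac:(lra)); lra.
  - assert (A1 := Hrle T1 t ltac:(lra)); assert (A2 := Hrle t T2 ltac:(lra)); lra. }
unfold dist3; rewrite !ln_R3, !Fu; auto;
  try (rewrite !Fu; apply HVne; auto); fold V.
apply Rle_trans with (2 := S); apply Req_le.
rewrite (Rabs_minus_sym (level v x n t3)), (Rabs_minus_sym (V (r t3))); f_equal; ring.
Qed.

(** * The affine structure of an invariant circle structure *)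

Lemma level_monotone u x n T1 T2 : is_chart u -> T1 <= T2 ->
  (forall t, T1 <= t <= T2 -> dom u (flow x t n)) -> monotone_on (level u x n) T1 T2.
Proof.
intros Hu HT Hd; destruct (coordinate_angle x n) as [_ [tau [_ Hco]]].
assert (Hp : 0 < 2 ^ n) by (apply pow_lt; lra); assert (Hpi := Rinv_0_lt_compat _ Hp).
assert (Hr : forall s t, s < t -> tau + s / 2 ^ n < tau + t / 2 ^ n).
{ intros s t H; apply Rplus_lt_compat_l, Rmult_lt_compat_r; auto. }
destruct (chart_segment u (tau + T1 / 2 ^ n) (tau + T2 / 2 ^ n) Hu) as [_ [HM _]].
{ destruct HT as [L|L]; [left; now apply Hr|rewrite L; lra]. }
{ intros t Ht; replace t with (tau + ((t - tau) * 2 ^ n) / 2 ^ n) by (field; lra).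
  rewrite <- Hco; apply Hd; split; apply Rnot_lt_le; intros L; apply Hr in L;
  replace (tau + (t - tau) * 2 ^ n / 2 ^ n) with t in L by (field; lra); lra. }
assert (Hr' : forall s t, s <= t -> tau + s / 2 ^ n <= tau + t / 2 ^ n).
{ intros s t [L|L]; [left; now apply Hr|rewrite L; lra]. }
destruct HM as [HM|HM]; [left|right]; intros s t Hs Hst Ht; unfold level; rewrite !Hco;
  apply (HM (tau + s / 2 ^ n) (tau + t / 2 ^ n)); auto; apply Hr'; lra.
Qed.

Definition fine_cover (W : list chart) d := 0 < d /\
  forall p q, p <= q -> q - p <= d -> exists u, In u W /\ forall t, p <= t <= q -> dom u (cis t).

Lemma fine_level W d x n T1 T2 : fine_cover W d -> T1 <= T2 -> (T2 - T1) * (/ 2) ^ n <= d ->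
  exists u, In u W /\ forall t, T1 <= t <= T2 -> dom u (flow x t n).
Proof.
intros [_ H] HT Hd; destruct (coordinate_angle x n) as [_ [tau [_ Hco]]].
assert (Hp : 0 < 2 ^ n) by (apply pow_lt; lra); assert (Hpi := Rinv_0_lt_compat _ Hp).
assert (Hr' : forall s t, s <= t -> tau + s / 2 ^ n <= tau + t / 2 ^ n).
{ intros s t L; apply Rplus_le_compat_l, Rmult_le_compat_r; lra. }
rewrite half_pow_inv in Hd.
destruct (H (tau + T1 / 2 ^ n) (tau + T2 / 2 ^ n)) as [u [Hu Hdu]]; [now apply Hr'|unfold Rdiv; lra|].
exists u; split; auto; intros t Ht; rewrite Hco; apply Hdu; split; apply Hr'; lra.
Qed.

Lemma fine_is_cover U W d : (forall u, In u W -> U u) -> fine_cover W d -> finite_cover U W.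
Proof.
intros HU [Hd H]; split; auto; intros z Hz; destruct (circle_param z Hz) as [t [_ ->]].
destruct (H t t) as [u [Hu Hdu]]; try lra; exists u; split; auto; apply Hdu; lra.
Qed.

Lemma fine_sequence W d x T1 T2 : fine_cover W d -> T1 <= T2 -> exists w : nat -> chart,
  (forall n, In (w n) W) /\ exists N, forall n, (N <= n)%nat -> forall t, T1 <= t <= T2 -> dom (w n) (flow x t n).
Proof.
intros HW HT; assert (Hd := proj1 HW).
destruct (pow_small (/ 2) (d / (T2 - T1 + 1))) as [N HN]; [lra|apply Rdiv_lt_0_compat; lra|].
assert (H : forall n, exists u, In u W /\ ((N <= n)%nat -> forall t, T1 <= t <= T2 -> dom u (flow x t n))).
{ intros n; destruct (le_lt_dec N n) as [L|L].
  - destruct (fine_level W d x n T1 T2 HW HT) as [u [Hu Hdu]]; [|exists u; auto].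
    apply Rle_trans with ((T2 - T1 + 1) * (/ 2) ^ N).
    + assert (P := half_pow_pos n); assert ((/ 2) ^ n <= (/ 2) ^ N) by (apply pow_decr; [lra|auto]).
      apply Rmult_le_compat; lra.
    + apply (Rmult_lt_compat_l (T2 - T1 + 1)) in HN; [|lra].
      replace ((T2 - T1 + 1) * (d / (T2 - T1 + 1))) with d in HN by (field; lra); lra.
  - destruct (proj2 HW 0 0) as [u [Hu _]]; try lra; exists u; split; auto; intros; lia. }
apply ClassicalEpsilon.choice in H; destruct H as [w Hw]; exists w; split; [apply Hw|].
exists N; intros n Hn; now apply Hw.
Qed.

(** The errors made in going from each coordinate to the next one form a geometric
    series, so that ratios converge, at a rate independent of the leaf and of
    the charts.  The index n0 is a coordinate from which the segment is short. *)
Lemma leaf_estimate U W d : invariant_circle_structure U -> (forall u, In u W -> U u) -> fine_cover W d ->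
  exists C mu, 0 < C /\ 0 < mu < 1 /\ forall x n0 k T1 T2 t1 t2 t3,
  (T2 - T1) * (/ 2) ^ n0 <= d -> (T2 - T1) * (/ 2) ^ n0 <= (/ 2) ^ k ->
  T1 <= t1 <= T2 -> T1 <= t2 <= T2 -> T1 <= t3 <= T2 -> t1 <> t2 -> t2 <> t3 ->
  exists l, forall i u, In u W -> (forall t, T1 <= t <= T2 -> dom u (flow x t (n0 + i)%nat)) ->
    Rabs (ln (R3 (level u x (n0 + i)) t1 t2 t3) - l) <= C * mu ^ (i + k).
Proof.
intros HU HWU HW; destruct (one_step U W HU (fine_is_cover U W d HWU HW)) as [C [mu [HC [Hmu H]]]].
assert (Hi : 0 < / (1 - mu)) by (apply Rinv_0_lt_compat; lra).
exists (C * (1 + / (1 - mu))), mu; split; [apply Rmult_lt_0_compat; lra|split; auto].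
intros x n0 k T1 T2 t1 t2 t3 HTd HTk I1 I2 I3 H12 H23.
assert (HT : T1 <= T2) by lra.
assert (Hw : forall i, exists u, In u W /\ forall t, T1 <= t <= T2 -> dom u (flow x t (n0 + i)%nat)).
{ intros i; apply fine_level with d; auto; apply Rle_trans with (2 := HTd); apply Rmult_le_compat_l; [lra|].
  apply pow_decr; [lra|lia]. }
apply ClassicalEpsilon.choice in Hw; destruct Hw as [w Hw].
assert (Hst : forall i u v, In u W -> In v W -> (forall t, T1 <= t <= T2 -> dom u (flow x t (S (n0 + i)%nat))) ->
  (forall t, T1 <= t <= T2 -> dom v (flow x t (n0 + i)%nat)) ->
  Rabs (ln (R3 (level v x (n0 + i)) t1 t2 t3) - ln (R3 (level u x (S (n0 + i))) t1 t2 t3)) <= C * mu ^ k * mu ^ i).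
{ intros i u v Hu Hv Hdu Hdv; replace (C * mu ^ k * mu ^ i) with (C * mu ^ (i + k)) by (rewrite pow_add; ring).
  apply (H x (n0 + i)%nat (i + k)%nat u v T1 T2 t1 t2 t3); auto.
  apply Rle_trans with ((T2 - T1) * (/ 2) ^ n0 * (/ 2) ^ i).
  - rewrite Rmult_assoc, <- pow_add; apply Rmult_le_compat_l; [lra|apply pow_decr; [lra|lia]].
  - rewrite pow_add, Rmult_comm; apply Rmult_le_compat_l; [left; apply half_pow_pos|auto]. }
set (e := fun i => ln (R3 (level (w i) x (n0 + i)) t1 t2 t3)).
assert (Pk : 0 < mu ^ k) by (apply pow_lt; lra).
destruct (cauchy_geometric e (C * mu ^ k) mu 0 Hmu) as [l [_ Hl]]; [nra| |].
{ intros i _; unfold e; replace (n0 + S i)%nat with (S (n0 + i)) by lia; rewrite Rabs_minus_sym.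
  apply Hst; try apply Hw; replace (S (n0 + i)) with (n0 + S i)%nat by lia; apply Hw. }
exists l; intros i u Hu Hdu; specialize (Hl (S i) ltac:(lia)).
assert (A : Rabs (ln (R3 (level u x (n0 + i)) t1 t2 t3) - e (S i)) <= C * mu ^ k * mu ^ i).
{ unfold e; replace (n0 + S i)%nat with (S (n0 + i)) by lia.
  apply Hst; auto; [apply Hw|]; replace (S (n0 + i)) with (n0 + S i)%nat by lia; apply Hw. }
replace (ln (R3 (level u x (n0 + i)) t1 t2 t3) - l)
  with ((ln (R3 (level u x (n0 + i)) t1 t2 t3) - e (S i)) + - (l - e (S i))) by ring.
eapply Rle_trans; [apply Rabs_triang|]; rewrite Rabs_Ropp.
rewrite pow_add; simpl in Hl.
assert (Pi : 0 < mu ^ i) by (apply pow_lt; lra).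
apply Rle_trans with (C * mu ^ k * mu ^ i + C * mu ^ k / (1 - mu) * mu ^ i); [|apply Req_le; field; lra].
apply Rplus_le_compat; auto; apply Rle_trans with (1 := Hl).
apply Rmult_le_compat_l; [|nra]; apply Rmult_le_pos; [nra|lra].
Qed.

Definition hull_dom (u : chart) x n t1 t2 t3 :=
  forall t, Rmin t1 (Rmin t2 t3) <= t <= Rmax t1 (Rmax t2 t3) -> dom u (flow x t n).

(** The limit r_U of the ratios of three points of a leaf, as a relation. *)
Definition leaf_limit (U : chart -> Prop) (x : solenoid) t1 t2 t3 (rho : R) :=
  forall U' (u : nat -> chart), finite_cover U U' -> (forall n, In (u n) U') ->
  eventually (fun n => hull_dom (u n) x n t1 t2 t3) ->
  is_lim_seq (fun n => R3 (level (u n) x n) t1 t2 t3) rho.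

Lemma hull_sub T1 T2 t1 t2 t3 t : T1 <= t1 <= T2 -> T1 <= t2 <= T2 -> T1 <= t3 <= T2 ->
  Rmin t1 (Rmin t2 t3) <= t <= Rmax t1 (Rmax t2 t3) -> T1 <= t <= T2.
Proof. unfold Rmin, Rmax; repeat destruct Rle_dec; lra. Qed.

Lemma structure_fine_cover U : invariant_circle_structure U ->
  exists W d, (forall u, In u W -> U u) /\ fine_cover W d.
Proof.
intros [[HA _] _]; destruct (lebesgue_cover U HA) as [W [d [Hd [HW H]]]]; exists W, d; repeat split; auto.
Qed.

Lemma leaf_limit_unique U x t1 t2 t3 rho rho' : invariant_circle_structure U ->
  leaf_limit U x t1 t2 t3 rho -> leaf_limit U x t1 t2 t3 rho' -> rho = rho'.
Proof.
intros HU H H'; destruct (structure_fine_cover U HU) as [W [d [HW Hf]]].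
destruct (hull_in t1 t2 t3) as [[I1 I2] _].
destruct (fine_sequence W d x (Rmin t1 (Rmin t2 t3)) (Rmax t1 (Rmax t2 t3)) Hf ltac:(lra)) as [w [Hw [N HN]]].
assert (Hc := fine_is_cover U W d HW Hf).
assert (L := H W w Hc Hw (ex_intro _ N HN)); assert (L' := H' W w Hc Hw (ex_intro _ N HN)).
apply is_lim_seq_unique in L; apply is_lim_seq_unique in L'; rewrite L in L'; now injection L'.
Qed.

(** The limit is the same for all covers: two covers are compared inside their union. *)
Lemma leaf_limit_exists U x t1 t2 t3 : invariant_circle_structure U -> t1 <> t2 -> t2 <> t3 ->
  exists rho, 0 < rho /\ leaf_limit U x t1 t2 t3 rho.
Proof.
intros HU H12 H23; destruct (structure_fine_cover U HU) as [W [d [HW Hf]]].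
set (P := Rmin t1 (Rmin t2 t3)); set (Q := Rmax t1 (Rmax t2 t3)).
destruct (hull_in t1 t2 t3) as [I1 [I2 I3]]; fold P Q in I1, I2, I3.
destruct (pow_small (/ 2) (Rmin d 1 / (Q - P + 1))) as [n0 Hn0]; [lra| |].
{ apply Rdiv_lt_0_compat; [apply Rmin_pos; [apply Hf|lra]|lra]. }
assert (Hsm : (Q - P) * (/ 2) ^ n0 <= d /\ (Q - P) * (/ 2) ^ n0 <= (/ 2) ^ 0).
{ apply (Rmult_lt_compat_l (Q - P + 1)) in Hn0; [|lra].
  replace ((Q - P + 1) * (Rmin d 1 / (Q - P + 1))) with (Rmin d 1) in Hn0 by (field; lra).
  assert (Pn := half_pow_pos n0); generalize (Rmin_l d 1) (Rmin_r d 1); simpl; intros; nra. }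
assert (Est : forall W', (forall u, In u W' -> U u) -> (forall u, In u W -> In u W') ->
  exists C mu, 0 < mu < 1 /\ exists l, forall i u, In u W' -> (forall t, P <= t <= Q -> dom u (flow x t (n0 + i)%nat)) ->
    Rabs (ln (R3 (level u x (n0 + i)) t1 t2 t3) - l) <= C * mu ^ i).
{ intros W' HW' HWW'; assert (Hf' : fine_cover W' d).
  { split; [apply Hf|]; intros p q Hpq Hl; destruct (proj2 Hf p q Hpq Hl) as [u [Hu Hdu]]; exists u; auto. }
  destruct (leaf_estimate U W' d HU HW' Hf') as [C [mu [_ [Hmu H]]]]; exists C, mu; split; auto.
  destruct (H x n0 0%nat P Q t1 t2 t3) as [l Hl]; try tauto.
  exists l; intros i u Hu Hdu; specialize (Hl i u Hu Hdu); now rewrite Nat.add_0_r in Hl. }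
assert (Conv : forall (u : nat -> chart) l N C mu, 0 < mu < 1 ->
  (forall n, (N <= n)%nat -> forall t, P <= t <= Q -> dom (u n) (flow x t n)) -> (forall n, is_chart (u n)) ->
  (forall i, (N <= n0 + i)%nat -> Rabs (ln (R3 (level (u (n0 + i)%nat) x (n0 + i)) t1 t2 t3) - l) <= C * mu ^ i) ->
  is_lim_seq (fun n => R3 (level (u n) x n) t1 t2 t3) (exp l)).
{ intros u l N C mu Hmu Hdu Huc Hl.
  assert (Hlim : is_lim_seq (fun n => R3 (level (u (n + (n0 + N))%nat) x (n + (n0 + N))%nat) t1 t2 t3) (exp l)).
  { apply is_lim_seq_ln; [apply exp_pos| |].
    - intros n; assert (HM := level_monotone (u (n + (n0 + N))%nat) x (n + (n0 + N)) P Q (Huc _) ltac:(lra) (Hdu (n + (n0 + N))%nat ltac:(lia))).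
      apply R3_pos; intros E; apply (monotone_inj _ P Q _ _ HM) in E; auto.
    - rewrite ln_exp; apply is_lim_seq_geometric with (Rabs C) mu 0%nat; auto; intros n _.
      assert (A := Hl (n + N)%nat ltac:(lia)); replace (n0 + (n + N))%nat with (n + (n0 + N))%nat in A by lia.
      apply Rle_trans with (1 := A); assert (0 < mu ^ (n + N)) by (apply pow_lt; lra).
      assert (mu ^ (n + N) <= mu ^ n) by (apply pow_decr; [auto|lia]).
      generalize (Rle_abs C) (Rabs_pos C); intros; nra. }
  now apply (is_lim_seq_incr_n (fun n => R3 (level (u n) x n) t1 t2 t3) (n0 + N)) in Hlim. }
destruct (Est W HW (fun u Hu => Hu)) as [C [mu [Hmu [l Hl]]]].
exists (exp l); split; [apply exp_pos|]; intros U' u HU' Hu [N HN].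
destruct (fine_sequence W d x P Q Hf ltac:(lra)) as [w [Hw [Nw HNw]]].
destruct (Est (U' ++ W)) as [C' [mu' [Hmu' [l' Hl']]]].
{ intros v Hv; apply in_app_or in Hv; destruct Hv; [now apply HU'|auto]. }
{ intros v Hv; apply in_or_app; auto. }
assert (Hch : forall v, U v -> is_chart v) by apply HU.
assert (L1 : is_lim_seq (fun n => R3 (level (w n) x n) t1 t2 t3) (exp l)).
{ apply Conv with Nw C mu; auto; intros i Hi; apply Hl; auto. }
assert (L2 : is_lim_seq (fun n => R3 (level (w n) x n) t1 t2 t3) (exp l')).
{ apply Conv with Nw C' mu'; auto; intros i Hi; apply Hl'; auto; apply in_or_app; auto. }
assert (L3 : is_lim_seq (fun n => R3 (level (u n) x n) t1 t2 t3) (exp l')).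
{ apply Conv with N C' mu'; auto; [intros n; apply Hch, HU', Hu|].
  intros i Hi; apply Hl'; [apply in_or_app; auto|]; apply HN; lia. }
apply is_lim_seq_unique in L1; apply is_lim_seq_unique in L2; rewrite L1 in L2; injection L2 as E.
now rewrite E.
Qed.

Lemma iter_tilde_E_coord_add m y n : Nat.iter m tilde_E y (n + m)%nat = y n.
Proof.
induction m as [|m IH]; [now rewrite Nat.add_0_r|].
rewrite Nat.add_succ_r; simpl; exact IH.
Qed.

Lemma rescaled_coordinate a m k n t :
  flow (tilde_omega (dyadic_affine (2 ^ Z.of_nat m) k a)) t (n + m)%nat
  = flow (tilde_omega a) ((IZR k + t) * (/ 2) ^ m) n.
Proof.
assert (E : flow (tilde_omega (dyadic_affine (2 ^ Z.of_nat m) k a)) t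
  = Nat.iter m tilde_E (flow (tilde_omega a) ((IZR k + t) * (/ 2) ^ m))).
{ rewrite iter_tilde_E_flow, iter_omega.
  replace (2 ^ m * ((IZR k + t) * (/ 2) ^ m)) with (IZR k + t)
    by (rewrite half_pow_inv; field; apply pow_nonzero; lra).
  rewrite <- flow_flow, omega_shift, affine_comp; do 3 f_equal; ring. }
rewrite E; apply iter_tilde_E_coord_add.
Qed.

(** By invariance, the ratios at the dyadic points of a leaf are ratios at integer
    points of its images. *)
Lemma leaf_limit_dyadic U a m k rho :
  leaf_limit U (tilde_omega (dyadic_affine (2 ^ Z.of_nat m) k a)) (-1) 0 1 rho ->
  leaf_limit U (tilde_omega a) (dy m (k - 1)) (dy m k) (dy m (k + 1)) rho.
Proof.
intros H U' u HU' Hu [N HN].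
set (b := dyadic_affine (2 ^ Z.of_nat m) k a) in *.
assert (L : is_lim_seq (fun n => R3 (level (u (n - m)%nat) (tilde_omega b) n) (-1) 0 1) rho).
{ apply (H U' (fun n => u (n - m)%nat)); auto; exists (N + m)%nat; intros n Hn t Ht.
  assert (Ht1 : -1 <= t <= 1) by (apply (hull_sub (-1) 1 (-1) 0 1); auto; lra).
  replace n with (n - m + m)%nat at 2 by lia; unfold b; rewrite rescaled_coordinate.
  apply HN; [lia|].
  assert (Pm := half_pow_pos m).
  destruct (hull_in (dy m (k - 1)) (dy m k) (dy m (k + 1))) as [[I1 _] [_ [_ I2]]].
  split; [apply Rle_trans with (1 := I1)|apply Rle_trans with (2 := I2)];
    unfold dy; rewrite ?minus_IZR, ?plus_IZR; apply Rmult_le_compat_r; lra. }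
apply (is_lim_seq_incr_n _ m) in L.
apply (is_lim_seq_ext (fun n => R3 (level (u (n + m - m)%nat) (tilde_omega b) (n + m)) (-1) 0 1)); auto.
intros n; replace (n + m - m)%nat with n by lia; unfold R3, level, b; rewrite !rescaled_coordinate.
now replace ((IZR k + 0) * (/ 2) ^ m) with (dy m k) by (unfold dy; ring);
  replace ((IZR k + -1) * (/ 2) ^ m) with (dy m (k - 1)) by (unfold dy; rewrite minus_IZR; ring);
  replace ((IZR k + 1) * (/ 2) ^ m) with (dy m (k + 1)) by (unfold dy; rewrite plus_IZR; ring).
Qed.

(** The limits of the ratios are the ratios of an increasing function g: the limit
    of the coordinates in charts, normalized by g 0 = 0 and g 1 = 1. *)
Lemma limit_chart U x : invariant_circle_structure U -> exists g : R -> R,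
  (forall s t, s < t -> g s < g t) /\
  forall t1 t2 t3, t1 <> t2 -> t2 <> t3 -> leaf_limit U x t1 t2 t3 (R3 g t1 t2 t3).
Proof.
intros HU; destruct (structure_fine_cover U HU) as [W [d [HW Hf]]].
assert (Hch : forall u, In u W -> is_chart u) by (intros u Hu; apply HU, HW, Hu).
assert (Hrho : forall t : R * R * R, exists rho, fst (fst t) <> snd (fst t) -> snd (fst t) <> snd t ->
  0 < rho /\ leaf_limit U x (fst (fst t)) (snd (fst t)) (snd t) rho).
{ intros [[t1 t2] t3]; simpl; destruct (classic (t1 <> t2 /\ t2 <> t3)) as [[H1 H2]|Hn].
  - destruct (leaf_limit_exists U x t1 t2 t3 HU H1 H2) as [rho Hr]; exists rho; auto.
  - exists 0; tauto. }
apply ClassicalEpsilon.choice in Hrho; destruct Hrho as [rr Hrr].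
assert (Hr : forall t1 t2 t3, t1 <> t2 -> t2 <> t3 -> 0 < rr (t1, t2, t3) /\ leaf_limit U x t1 t2 t3 (rr (t1, t2, t3))).
{ intros t1 t2 t3 H12 H23; apply (Hrr (t1, t2, t3)); auto. }
set (g := fun t => if Req_EM_T t 0 then 0 else if Rlt_dec t 0 then - rr (1, 0, t) else rr (1, 0, t)).
assert (Hg0 : g 0 = 0) by (unfold g; destruct Req_EM_T; lra).
assert (Hseq : forall M, 1 <= M -> exists Phi : nat -> R -> R,
  (forall n, Phi n 0 = 0) /\
  (exists N, forall n, (N <= n)%nat -> increasing_on (Phi n) (- M) M) /\
  (forall t, - M <= t <= M -> is_lim_seq (fun n => Phi n t) (g t)) /\
  (forall t1 t2 t3, - M <= t1 <= M -> - M <= t2 <= M -> - M <= t3 <= M -> t1 <> t2 -> t2 <> t3 ->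
     is_lim_seq (fun n => R3 (Phi n) t1 t2 t3) (rr (t1, t2, t3)))).
{ intros M HM; destruct (fine_sequence W d x (- M) M Hf ltac:(lra)) as [w [Hw [N HN]]].
  set (F := fun n => level (w n) x n).
  assert (HFM : forall n, (N <= n)%nat -> monotone_on (F n) (- M) M).
  { intros n Hn; apply level_monotone; auto; lra. }
  set (Phi := fun n t => (F n t - F n 0) / (F n 1 - F n 0)).
  assert (H10 : forall n, (N <= n)%nat -> F n 1 - F n 0 <> 0).
  { intros n Hn E; assert (E' : 1 = 0) by (apply (monotone_inj _ _ _ _ _ (HFM n Hn)); lra); lra. }
  assert (HPR : forall n t1 t2 t3, (N <= n)%nat -> R3 (Phi n) t1 t2 t3 = R3 (F n) t1 t2 t3).
  { intros n t1 t2 t3 Hn; specialize (H10 n Hn).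
    rewrite <- (R3_affine (F n) (/ (F n 1 - F n 0)) (- (F n 0 / (F n 1 - F n 0)))).
    - unfold R3, Phi; do 2 f_equal; f_equal; field; auto.
    - now apply Rinv_neq_0_compat. }
  assert (HPI : forall n, (N <= n)%nat -> increasing_on (Phi n) (- M) M).
  { intros n Hn s t Hs Hst Ht; unfold Phi; destruct (HFM n Hn) as [HI|HI].
    - assert (A1 := HI 0 1 ltac:(lra) ltac:(lra) ltac:(lra)); assert (A2 := HI s t Hs Hst Ht).
      apply Rmult_lt_compat_r; [apply Rinv_0_lt_compat|]; lra.
    - assert (A1 := HI 0 1 ltac:(lra) ltac:(lra) ltac:(lra)); assert (A2 := HI s t Hs Hst Ht); simpl in A1, A2.
      replace ((F n s - F n 0) / (F n 1 - F n 0)) with ((F n 0 - F n s) / (F n 0 - F n 1)) by (field; lra).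
      replace ((F n t - F n 0) / (F n 1 - F n 0)) with ((F n 0 - F n t) / (F n 0 - F n 1)) by (field; lra).
      apply Rmult_lt_compat_r; [apply Rinv_0_lt_compat|]; lra. }
  assert (HP0 : forall n, Phi n 0 = 0) by (intros n; unfold Phi; rewrite Rminus_diag; unfold Rdiv; ring).
  assert (HR3 : forall t1 t2 t3, - M <= t1 <= M -> - M <= t2 <= M -> - M <= t3 <= M -> t1 <> t2 -> t2 <> t3 ->
     is_lim_seq (fun n => R3 (Phi n) t1 t2 t3) (rr (t1, t2, t3))).
  { intros t1 t2 t3 I1 I2 I3 H12 H23; apply (is_lim_seq_ext_loc (fun n => R3 (level (w n) x n) t1 t2 t3)).
    - exists N; intros n Hn; now rewrite HPR.
    - apply (proj2 (Hr t1 t2 t3 H12 H23) W w); auto; [now apply fine_is_cover with d|].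
      exists N; intros n Hn t Ht; apply HN; auto; now apply (hull_sub (- M) M t1 t2 t3). }
  exists Phi; split; auto; split; [now exists N|split; auto].
  intros t Ht; unfold g; destruct Req_EM_T as [->|Hne].
  { apply (is_lim_seq_ext (fun _ => 0)); [intros n; now rewrite HP0|apply is_lim_seq_const]. }
  assert (L := HR3 1 0 t ltac:(lra) ltac:(lra) Ht ltac:(lra) (not_eq_sym Hne)).
  assert (HP1 : forall n, (N <= n)%nat -> Phi n 1 = 1).
  { intros n Hn; unfold Phi; field; auto. }
  destruct Rlt_dec as [L0|L0].
  - apply (is_lim_seq_ext_loc (fun n => - R3 (Phi n) 1 0 t)); [|now apply (is_lim_seq_opp _ (rr (1, 0, t)))].
    exists N; intros n Hn; assert (A := HPI n Hn t 0 ltac:(lra) ltac:(lra) ltac:(lra)); rewrite HP0 in A.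
    unfold R3; rewrite HP0, HP1 by auto; rewrite (Rabs_pos_eq (0 - Phi n t)), (Rabs_pos_eq (1 - 0)) by lra; field.
  - apply (is_lim_seq_ext_loc (fun n => R3 (Phi n) 1 0 t)); auto.
    exists N; intros n Hn; assert (A := HPI n Hn 0 t ltac:(lra) ltac:(lra) ltac:(lra)); rewrite HP0 in A.
    unfold R3; rewrite HP0, HP1 by auto; rewrite (Rabs_left (0 - Phi n t)), (Rabs_pos_eq (1 - 0)) by lra; field. }
assert (Habs : forall s t, s <> t -> exists rho, 0 < rho /\ Rabs (g t - g s) = rho * Rabs (g s) \/
  s = 0 /\ g t <> 0).
{ intros s t Hst; destruct (Req_dec s 0) as [->|Hs].
  - exists 1; right; split; auto; unfold g; destruct Req_EM_T; [lra|].
    destruct (Hr 1 0 t) as [P _]; try lra; destruct Rlt_dec; lra.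
  - destruct (Hr 0 s t) as [P _]; auto; exists (rr (0, s, t)); left; split; auto.
    set (M := 1 + Rabs s + Rabs t).
    assert (HM : 1 <= M /\ - M <= s <= M /\ - M <= t <= M).
    { assert (A1 := Rle_abs s); assert (A2 := Rle_abs (- s)); assert (A3 := Rle_abs t); assert (A4 := Rle_abs (- t)).
      rewrite Rabs_Ropp in A2, A4; assert (A5 := Rabs_pos s); assert (A6 := Rabs_pos t); unfold M; lra. }
    destruct (Hseq M ltac:(lra)) as [Phi [P0 [[N PI] [PL PR]]]].
    assert (L1 : is_lim_seq (fun n => Rabs (Phi n t - Phi n s)) (Rabs (g t - g s))).
    { apply (is_lim_seq_abs _ (g t - g s)); apply is_lim_seq_minus'; apply PL; lra. }
    assert (L2 : is_lim_seq (fun n => R3 (Phi n) 0 s t * Rabs (Phi n s)) (rr (0, s, t) * Rabs (g s))).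
    { apply is_lim_seq_mult'; [apply PR; auto; lra|]; apply (is_lim_seq_abs _ (g s)); apply PL; lra. }
    apply (is_lim_seq_ext_loc _ (fun n => Rabs (Phi n t - Phi n s))) in L2.
    + apply is_lim_seq_unique in L1; apply is_lim_seq_unique in L2; rewrite L1 in L2; now injection L2.
    + exists N; intros n Hn; unfold R3; rewrite P0, (Rabs_minus_sym 0 (Phi n s)), Rminus_0_r, (Rabs_minus_sym (Phi n s)).
      field; assert (A : 0 < Rabs (Phi n s - Phi n 0)).
      { apply (monotone_dist_pos (Phi n) (- M) M); auto; try lra; left; now apply PI. }
      rewrite P0, Rminus_0_r in A; lra. }
assert (Hgne : forall t, t <> 0 -> g t <> 0).
{ intros t Ht; destruct (Habs 0 t (not_eq_sym Ht)) as [rho [[_ E]|[_ E]]]; auto.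
  rewrite Hg0, Rabs_R0, Rminus_0_r, Rmult_0_r in E; intros Eg.
  unfold g in Eg; destruct Req_EM_T; [lra|]; destruct (Hr 1 0 t) as [P _]; try lra; destruct Rlt_dec; lra. }
assert (Hinj : forall s t, s <> t -> g s <> g t).
{ intros s t Hst; destruct (Habs s t Hst) as [rho [[P E]|[-> E]]]; [|rewrite Hg0; auto].
  destruct (Req_dec s 0) as [->|Hs]; [rewrite Hg0; apply not_eq_sym, Hgne; auto|].
  intros Eg; rewrite Eg, Rminus_diag, Rabs_R0 in E.
  assert (0 < Rabs (g t)) by (rewrite <- Eg; apply Rabs_pos_lt, Hgne; auto); nra. }
exists g; split.
- intros s t Hst; assert (Hne := Hinj s t ltac:(lra)).
  set (M := 1 + Rabs s + Rabs t).
  assert (HM : 1 <= M /\ - M <= s <= M /\ - M <= t <= M).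
  { assert (A1 := Rle_abs s); assert (A2 := Rle_abs (- s)); assert (A3 := Rle_abs t); assert (A4 := Rle_abs (- t)).
    rewrite Rabs_Ropp in A2, A4; assert (A5 := Rabs_pos s); assert (A6 := Rabs_pos t); unfold M; lra. }
  destruct (Hseq M ltac:(lra)) as [Phi [P0 [[N PI] [PL PR]]]].
  assert (L : g s <= g t); [|lra].
  apply (is_lim_seq_le_loc (fun n => Phi n s) (fun n => Phi n t) (g s) (g t)); try (apply PL; lra).
  exists N; intros n Hn; left; apply PI; auto; lra.
- intros t1 t2 t3 H12 H23; replace (R3 g t1 t2 t3) with (rr (t1, t2, t3)); [now apply Hr|].
  set (M := 1 + Rabs t1 + Rabs t2 + Rabs t3).
  assert (HM : 1 <= M /\ - M <= t1 <= M /\ - M <= t2 <= M /\ - M <= t3 <= M).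
  { assert (A1 := Rle_abs t1); assert (A2 := Rle_abs (- t1)); assert (A3 := Rle_abs t2); assert (A4 := Rle_abs (- t2)).
    assert (A7 := Rle_abs t3); assert (A8 := Rle_abs (- t3)).
    rewrite Rabs_Ropp in A2, A4, A8; assert (A5 := Rabs_pos t1); assert (A6 := Rabs_pos t2); assert (A9 := Rabs_pos t3).
    unfold M; lra. }
  destruct (Hseq M ltac:(lra)) as [Phi [P0 [_ [PL PR]]]].
  assert (L1 := PR t1 t2 t3 ltac:(lra) ltac:(lra) ltac:(lra) H12 H23).
  assert (L2 : is_lim_seq (fun n => R3 (Phi n) t1 t2 t3) (R3 g t1 t2 t3)).
  { unfold R3; apply is_lim_seq_div'.
    - apply (is_lim_seq_abs _ (g t2 - g t3)); apply is_lim_seq_minus'; apply PL; lra.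
    - apply (is_lim_seq_abs _ (g t1 - g t2)); apply is_lim_seq_minus'; apply PL; lra.
    - apply Rabs_no_R0; assert (E := Hinj t1 t2 H12); lra. }
  apply is_lim_seq_unique in L1; apply is_lim_seq_unique in L2; rewrite L1 in L2; now injection L2.
Qed.

(** The ratio function of an invariant structure is Hölder: points with the same
    first n digits have the same coordinate n, hence the same ratios there. *)
Lemma limit_function_holder U s : invariant_circle_structure U -> (forall a, 0 < s a) ->
  (forall a, leaf_limit U (tilde_omega a) (-1) 0 1 (s a)) -> dyadic_holder s.
Proof.
intros HU Hp Hs; destruct (structure_fine_cover U HU) as [W [d [HW Hf]]].
destruct (leaf_estimate U W d HU HW Hf) as [C [mu [HC [Hmu H]]]].
destruct (pow_small (/ 2) (Rmin d 1 / 2)) as [n0 Hn0]; [lra| |].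
{ apply Rdiv_lt_0_compat; [apply Rmin_pos; [apply Hf|lra]|lra]. }
assert (Hsm : (1 - -1) * (/ 2) ^ n0 <= d /\ (1 - -1) * (/ 2) ^ n0 <= (/ 2) ^ 0).
{ generalize (Rmin_l d 1) (Rmin_r d 1); simpl; intros; lra. }
assert (Est : forall a i u, In u W -> (forall t, -1 <= t <= 1 -> dom u (flow (tilde_omega a) t (n0 + i)%nat)) ->
  Rabs (ln (R3 (level u (tilde_omega a) (n0 + i)) (-1) 0 1) - ln (s a)) <= C * mu ^ i).
{ intros a; destruct (H (tilde_omega a) n0 0%nat (-1) 1 (-1) 0 1) as [l Hl]; try lra; try tauto.
  assert (E : l = ln (s a)).
  { destruct (fine_sequence W d (tilde_omega a) (-1) 1 Hf ltac:(lra)) as [w [Hw [N HN]]].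
    assert (L := Hs a W w (fine_is_cover U W d HW Hf) Hw).
    assert (L1 : is_lim_seq (fun n => R3 (level (w n) (tilde_omega a) n) (-1) 0 1) (s a)).
    { apply L; exists N; intros n Hn t Ht; apply HN; auto; apply (hull_sub (-1) 1 (-1) 0 1); auto; lra. }
    assert (L2 : is_lim_seq (fun n => ln (R3 (level (w n) (tilde_omega a) n) (-1) 0 1)) (ln (s a))).
    { apply (is_lim_seq_continuous ln); auto; apply derivable_continuous_pt.
      exists (/ s a); apply derivable_pt_lim_ln; auto. }
    assert (L3 : is_lim_seq (fun i => ln (R3 (level (w (i + (n0 + N))%nat) (tilde_omega a) (i + (n0 + N))) (-1) 0 1)) l).
    { apply is_lim_seq_geometric with C mu 0%nat; auto; intros i _.
      assert (A := Hl (i + N)%nat (w (i + (n0 + N))%nat) (Hw _)).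
      replace (n0 + (i + N))%nat with (i + (n0 + N))%nat in A by lia.
      apply Rle_trans with (1 := A ltac:(apply HN; lia)); rewrite Nat.add_0_r; apply Rmult_le_compat_l; [lra|].
      apply pow_decr; [auto|lia]. }
    apply (is_lim_seq_incr_n _ (n0 + N)) in L2.
    apply is_lim_seq_unique in L2; apply is_lim_seq_unique in L3; rewrite L2 in L3; now injection L3. }
  subst l; intros i u Hu Hdu; specialize (Hl i u Hu Hdu); now rewrite Nat.add_0_r in Hl. }
assert (Hcl : forall i a b, trunc a (n0 + i) = trunc b (n0 + i) -> Rabs (ln (s a) - ln (s b)) <= 2 * C * mu ^ i).
{ intros i a b Hab.
  assert (Ef : forall t, flow (tilde_omega a) t (n0 + i)%nat = flow (tilde_omega b) t (n0 + i)%nat).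
  { intros t; simpl; now rewrite Hab. }
  destruct (fine_level W d (tilde_omega a) (n0 + i) (-1) 1 Hf ltac:(lra)) as [u [Hu Hdu]].
  { apply Rle_trans with (2 := proj1 Hsm); apply Rmult_le_compat_l; [lra|apply pow_decr; [lra|lia]]. }
  assert (A := Est a i u Hu Hdu).
  assert (B := Est b i u Hu ltac:(intros t Ht; rewrite <- Ef; auto)).
  assert (E : R3 (level u (tilde_omega b) (n0 + i)) (-1) 0 1 = R3 (level u (tilde_omega a) (n0 + i)) (-1) 0 1).
  { unfold R3, level; now rewrite !Ef. }
  rewrite E in B; apply Rabs_le_between in A; apply Rabs_le_between in B; apply Rabs_le; lra. }
(* the first n0 digits take finitely many values, so that s is bounded *)
destruct (list_bound (fun j X => forall a, trunc a n0 = Z.of_nat j -> Rabs (ln (s a)) <= X) (seq 0 (Z.to_nat (2 ^ Z.of_nat n0))))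
  as [M [HM HMb]].
{ intros j X Y HXY HX a Ha; specialize (HX a Ha); lra. }
{ intros j _; destruct (classic (exists a, trunc a n0 = Z.of_nat j)) as [[a0 Ha0]|Hn].
  - exists (1 + Rabs (ln (s a0)) + 2 * C); assert (A := Rabs_pos (ln (s a0))); split; [lra|]; intros a Ha.
    assert (B := Hcl 0%nat a a0); rewrite Nat.add_0_r in B; specialize (B ltac:(now rewrite Ha, Ha0)); simpl in B.
    replace (ln (s a)) with ((ln (s a) - ln (s a0)) + ln (s a0)) by ring.
    eapply Rle_trans; [apply Rabs_triang|]; lra.
  - exists 1; split; [lra|]; intros a Ha; destruct Hn; now exists a. }
assert (HMa : forall a, Rabs (ln (s a)) <= M).
{ intros a; assert (R := trunc_range a n0); apply (HMb (Z.to_nat (trunc a n0))); [apply in_seq; lia|lia]. }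
set (D := 2 * (C + M) / mu ^ n0).
assert (Pn : 0 < mu ^ n0) by (apply pow_lt; lra).
exists (exp M * D), mu; split; [|split; auto].
{ apply Rmult_lt_0_compat; [apply exp_pos|]; apply Rdiv_lt_0_compat; lra. }
intros n a b Hab; apply agree_trunc in Hab.
assert (Ba := HMa a); assert (Bb := HMa b); apply Rabs_le_between in Ba; apply Rabs_le_between in Bb.
rewrite <- (exp_ln (s a)), <- (exp_ln (s b)) by auto.
eapply Rle_trans; [apply (exp_lipschitz M); lra|].
rewrite Rmult_assoc; apply Rmult_le_compat_l; [left; apply exp_pos|].
assert (HD : D * mu ^ n0 = 2 * (C + M)) by (unfold D; field; lra).
assert (HDp : 0 < D) by (apply Rdiv_lt_0_compat; lra).
destruct (le_lt_dec n0 n) as [L|L].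
- replace n with (n0 + (n - n0))%nat in Hab by lia; apply Rle_trans with (1 := Hcl _ a b Hab).
  replace n with (n0 + (n - n0))%nat at 2 by lia; rewrite pow_add, <- Rmult_assoc, HD.
  apply Rmult_le_compat_r; [left; apply pow_lt; lra|lra].
- apply Rle_trans with (2 * M); [apply Rabs_le; lra|].
  assert (mu ^ n0 <= mu ^ n) by (apply pow_decr; [auto|lia]).
  apply Rle_trans with (D * mu ^ n0); [lra|apply Rmult_le_compat_l; lra].
Qed.

(** The ratios at integer points make up a solution s; its affine structure has the ratios
    of U at dyadic points, hence everywhere. *)
Lemma circle_to_leaf_exists U : invariant_circle_structure U ->
  exists phi, invariant_leaf_structure phi /\ circle_to_leaf U phi.
Proof.
intros HU.
assert (Hg : forall a, exists g : R -> R, (forall s t, s < t -> g s < g t) /\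
  forall t1 t2 t3, t1 <> t2 -> t2 <> t3 -> leaf_limit U (tilde_omega a) t1 t2 t3 (R3 g t1 t2 t3))
  by (intros a; now apply limit_chart).
apply ClassicalEpsilon.choice in Hg; destruct Hg as [g Hg].
set (s := fun a => R3 (g a) (-1) 0 1).
assert (Hsl : forall a, leaf_limit U (tilde_omega a) (-1) 0 1 (s a)) by (intros a; apply Hg; lra).
assert (Hp : forall a, 0 < s a).
{ intros a; destruct (Hg a) as [HI _]; assert (A1 := HI (-1) 0 ltac:(lra)); assert (A2 := HI 0 1 ltac:(lra)).
  apply R3_pos; lra. }
assert (HT : forall a, tile_law s a (g a)).
{ intros a m k; destruct (Hg a) as [HI HL].
  assert (L1 : dy m (k - 1) < dy m k) by (apply dy_lt; lia); assert (L2 : dy m k < dy m (k + 1)) by (apply dy_lt; lia).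
  assert (E : s (dyadic_affine (2 ^ Z.of_nat m) k a) = R3 (g a) (dy m (k - 1)) (dy m k) (dy m (k + 1))).
  { apply (leaf_limit_unique U (tilde_omega a) (dy m (k - 1)) (dy m k) (dy m (k + 1))); auto.
    - now apply leaf_limit_dyadic.
    - apply HL; lra. }
  rewrite E; unfold tile, R3; replace (k - 1 + 1)%Z with k by ring.
  assert (A1 := HI _ _ L1); assert (A2 := HI _ _ L2); rewrite !Rabs_left by lra; field; lra. }
assert (Hs : dyadic_solution s).
{ split; auto; split; [now apply limit_function_holder with U|].
  intros a; apply tile_law_equation with (g a); auto; apply Hg. }
destruct (structure_exists s Hs) as [phi Hphi]; exists phi.
split; [now apply adapted_structure with s|].
intros x t1 t2 t3 H12 H23 H13 U' u HU' Hu Hd.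
destruct (leaf_base x) as [a [tau [_ ->]]].
destruct (tile_law_unique s a _ (g a) Hp (Hphi a) (proj1 (Hg a)) (HT a)) as [A [B [HA E]]].
assert (L := proj2 (Hg a) (tau + t1) (tau + t2) (tau + t3) ltac:(lra) ltac:(lra) U' u HU' Hu).
assert (Ef : forall t n, flow (flow (tilde_omega a) tau) t n = flow (tilde_omega a) (tau + t) n)
  by (intros; now rewrite flow_flow).
assert (ER : R3 (g a) (tau + t1) (tau + t2) (tau + t3)
  = ratio phi (flow (flow (tilde_omega a) tau) t1) (flow (flow (tilde_omega a) tau) t2) (flow (flow (tilde_omega a) tau) t3)).
{ assert (EA := R3_affine (leaf_fun phi (tilde_omega a)) A B (tau + t1) (tau + t2) (tau + t3) ltac:(lra)).
  unfold ratio; rewrite !flow_flow; transitivity (R3 (fun t => A * leaf_fun phi (tilde_omega a) t + B) (tau + t1) (tau + t2) (tau + t3)).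
  - unfold R3; now rewrite !E.
  - exact EA. }
rewrite ER in L; apply (is_lim_seq_ext (fun n => R3 (level (u n) (tilde_omega a) n) (tau + t1) (tau + t2) (tau + t3))).
- intros n; unfold R3, level; now rewrite !Ef.
- apply L; destruct Hd as [N HN]; exists N; intros n Hn t Ht.
  replace t with (tau + (t - tau)) by ring; rewrite <- Ef; apply HN; auto.
  revert Ht; unfold Rmin, Rmax; repeat destruct Rle_dec; lra.
Qed.

(** Conversely, an invariant structure with affine structure phi is contained in the
    structure of the charts conformal to phi: the distortion between the
    coordinate 0 and the limit is a power of the length. *)
Lemma structure_along U s f phi : dyadic_solution s -> adapted s (dyadic_of_Z 0) f ->
  invariant_circle_structure U -> invariant_leaf_structure phi -> leaf_to_function phi s ->
  circle_to_leaf U phi -> forall u, U u -> charts_along f u.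
Proof.
intros Hs Hf HU Hphi Hphis HUphi u Hu.
assert (Hcu : is_chart u) by apply HU, Hu; split; auto.
destruct (structure_fine_cover U HU) as [W0 [d [HW0 Hf0]]].
set (W := u :: W0).
assert (HW : forall v, In v W -> U v) by (intros v [<-|Hv]; auto).
assert (HfW : fine_cover W d).
{ split; [apply Hf0|]; intros p q Hpq Hl; destruct (proj2 Hf0 p q Hpq Hl) as [v [Hv Hdv]]; exists v; split; auto; now right. }
destruct (leaf_estimate U W d HU HW HfW) as [C [mu [HC [Hmu H]]]].
set (x := tilde_omega (dyadic_of_Z 0)).
assert (Hx0 : forall t, flow x t 0%nat = cis t).
{ intros t; simpl; replace (0 / 1) with 0 by field; rewrite cis_0, Cmult_1_l; f_equal; field. }
destruct (leaf_fun_adapted phi s (dyadic_of_Z 0)) as [sg [Hsg Hfs]]; try apply Hphi; auto.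
destruct (pow_small (/ 2) d) as [n1 Hn1]; [lra|apply Hf0|].
apply (conformal_intro f u (C / mu) mu (S n1) Hmu).
intros n t1 t2 t3 p q Hn I1 I2 I3 Hdom H12 H23 D1 D3.
destruct n as [|n]; [lia|].
assert (Hn' : (/ 2) ^ n <= (/ 2) ^ n1) by (apply pow_decr; [lra|lia]).
destruct (Req_dec t1 t3) as [E13|H13].
{ subst t3; unfold dist3, R3; rewrite (Rabs_minus_sym (arc_fun u t2)), (Rabs_minus_sym (f t2)).
  unfold Rdiv at 1 2; rewrite !Rinv_r.
  - rewrite Rminus_diag, Rabs_R0; apply Rmult_le_pos; [left; apply Rdiv_lt_0_compat; lra|apply pow_le; lra].
  - apply Rabs_no_R0; assert (f t1 <> f t2) by (eapply adapted_neq; eauto); lra.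
  - destruct (chart_segment u p q Hcu ltac:(lra) Hdom) as [_ [HM _]].
    apply Rgt_not_eq, (monotone_dist_pos _ p q t1 t2 HM); auto. }
set (P := Rmin t1 (Rmin t2 t3)); set (Q := Rmax t1 (Rmax t2 t3)).
destruct (hull_in t1 t2 t3) as [J1 [J2 J3]]; fold P Q in J1, J2, J3.
assert (HPQ : Q - P <= (/ 2) ^ n /\ p <= P /\ Q <= q).
{ apply Rabs_le_between in D1; apply Rabs_le_between in D3; simpl in D1, D3.
  unfold P, Q, Rmin, Rmax; repeat destruct Rle_dec; lra. }
destruct (H x 0%nat n P Q t1 t2 t3) as [l Hl]; auto; try (simpl; lra).
assert (B := Hl 0%nat u (or_introl eq_refl) ltac:(intros t Ht; rewrite Hx0; apply Hdom; lra)).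
assert (El : l = ln (R3 (leaf_fun phi x) t1 t2 t3)).
{ destruct (fine_sequence W d x P Q HfW ltac:(lra)) as [w [Hw [N HN]]].
  assert (L := HUphi x t1 t2 t3 H12 H23 H13 W w (fine_is_cover U W d HW HfW) Hw (ex_intro _ N HN)).
  assert (Hpos : 0 < R3 (leaf_fun phi x) t1 t2 t3).
  { apply R3_pos; intros E; apply leaf_fun_injective in E; auto; apply Hphi. }
  assert (L2 : is_lim_seq (fun n => ln (R3 (level (w n) x n) t1 t2 t3)) (ln (R3 (leaf_fun phi x) t1 t2 t3))).
  { apply (is_lim_seq_continuous ln); auto; apply derivable_continuous_pt.
    exists (/ R3 (leaf_fun phi x) t1 t2 t3); now apply derivable_pt_lim_ln. }
  assert (L3 : is_lim_seq (fun i => ln (R3 (level (w (i + N)%nat) x (i + N)) t1 t2 t3)) l).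
  { apply is_lim_seq_geometric with C mu 0%nat; auto; intros i _.
    apply Rle_trans with (1 := Hl (i + N)%nat (w (i + N)%nat) (Hw _) (HN (i + N)%nat ltac:(lia))).
    apply Rmult_le_compat_l; [lra|apply pow_decr; [auto|lia]]. }
  apply (is_lim_seq_incr_n _ N) in L2.
  apply is_lim_seq_unique in L2; apply is_lim_seq_unique in L3; rewrite L2 in L3; now injection L3. }
assert (E1 : R3 (level u x 0) t1 t2 t3 = R3 (arc_fun u) t1 t2 t3) by (unfold R3, level; now rewrite !Hx0).
assert (E2 : R3 (leaf_fun phi x) t1 t2 t3 = R3 f t1 t2 t3).
{ rewrite <- (adapted_R3 s _ _ f t1 t2 t3 Hs Hfs Hf).
  rewrite <- (R3_affine (leaf_fun phi x) sg 0) by (destruct Hsg; lra).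
  unfold R3; now rewrite !Rplus_0_r. }
change (0 + 0)%nat with 0%nat in B; rewrite E1, El, E2 in B; simpl Nat.add in B.
unfold dist3; apply Rle_trans with (1 := B); apply Req_le; simpl; field; lra.
Qed.

(** Two invariant structures with the same affine structure are both contained in the
    structure of charts along f, hence equal to it by maximality. *)
Lemma circles_leaves :
  canonical_bijection invariant_circle_structure structure_eq
                      invariant_leaf_structure leaf_structure_eq circle_to_leaf.
Proof.
assert (Hfun : forall phi, invariant_leaf_structure phi -> exists s, dyadic_solution s /\ leaf_to_function phi s)
  by apply leaves_functions.
assert (Hmax : forall U s f phi, dyadic_solution s -> adapted s (dyadic_of_Z 0) f ->
  invariant_circle_structure U -> invariant_leaf_structure phi -> leaf_to_function phi s ->
  circle_to_leaf U phi -> structure_eq U (charts_along f)).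
{ intros U s f phi Hs Hf HU Hphi Hphis HUphi u.
  assert (Hsub := structure_along U s f phi Hs Hf HU Hphi Hphis HUphi); split; [apply Hsub|].
  apply (proj2 (proj1 HU)); auto; now apply charts_atlas with s. }
split; [|split].
- apply circle_to_leaf_exists.
- intros U V phi psi HU HV Hphi Hpsi RU RV.
  destruct (Hfun phi Hphi) as [s [Hs Hphis]], (Hfun psi Hpsi) as [s' [Hs' Hpsis]].
  rewrite (leaf_structure_eq_function phi psi s s' Hphi Hpsi Hphis Hpsis); split; intros E.
  + assert (EUV : U = V).
    { apply functional_extensionality; intros u; apply propositional_extensionality, E. }
    subst V; destruct (structure_fine_cover U HU) as [W [d [HW Hf]]]; intros a.
    assert (L : forall chi r, circle_to_leaf U chi -> leaf_to_function chi r ->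
      leaf_limit U (tilde_omega a) (-1) 0 1 (r a)).
    { intros chi r Hchi Hr U' u HU' Hu Hd.
      assert (L := Hchi (tilde_omega a) (-1) 0 1 ltac:(lra) ltac:(lra) ltac:(lra) U' u HU' Hu Hd).
      assert (E' : ratio chi (flow (tilde_omega a) (-1)) (flow (tilde_omega a) 0) (flow (tilde_omega a) 1) = r a)
        by (rewrite flow_0, !omega_shift; symmetry; apply Hr).
      rewrite E' in L; exact L. }
    apply (leaf_limit_unique U (tilde_omega a) (-1) 0 1); eauto.
  + assert (Es : s' = s) by (apply functional_extensionality; intros a; symmetry; apply E); subst s'.
    destruct (adapted_exists s (dyadic_of_Z 0) Hs) as [f [Hf _]].
    intros u; rewrite (Hmax U s f phi Hs Hf HU Hphi Hphis RU u).
    symmetry; apply (Hmax V s f psi Hs Hf HV Hpsi Hpsis RV).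
- intros phi Hphi; destruct (Hfun phi Hphi) as [s [Hs Hphis]].
  destruct (adapted_exists s (dyadic_of_Z 0) Hs) as [f [Hf _]].
  exists (charts_along f); split; [now apply charts_structure with s|now apply charts_to_leaf with s].
Qed.

(** * The theorem *)

Theorem theorem1 :
  canonical_bijection dyadic_solution ext_eq inA2 ext_eq function_to_sequence /\
  canonical_bijection invariant_leaf_structure leaf_structure_eq
                      dyadic_solution ext_eq leaf_to_function /\
  canonical_bijection invariant_circle_structure structure_eq
                      invariant_leaf_structure leaf_structure_eq circle_to_leaf /\
  canonical_bijection dyadic_solution ext_eq fixed_tiling tiling_eq
                      function_to_tiling /\
  canonical_bijection fixed_tiling tiling_eq fixed_grid grid_eq tiling_to_grid.
Proof.
exact (conj functions_sequences (conj leaves_functions (conj circles_leaves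
  (conj functions_tilings tilings_grids)))).
Qed.
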